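(* Let $A$ be a finite alphabet with an involution without fixed points. The following problem can be decided in $\mathsf{DEXPTIME}$. Input: a finite system $\mathcal S$ of typed equations over $\mathrm{FIM}(A)$ with idempotent variables from a set $\Omega$ and at most one reduced variable $x$ (with $\overline x$), i.e. each equation $(U,V)$ satisfies $UV\in(A\cup\Omega\cup\{x,\overline x\})^*$, such that at least one equation $(U,V)\in\mathcal S$ is strongly unbalanced. Question: does $\mathcal S$ have a solution in $\mathrm{FIM}(A)$?
   Context: $\mathrm{FG}(C)=C^*/\{c\overline c=1\}$ identified with reduced words; $\mathrm{FIM}(A)$ is the free inverse monoid (pairs $(P,g)$, $P$ finite prefix-closed set of reduced words, $g\in P$, product $(P,g)(Q,h)=(P\cup gQ,gh)$), and $\psi:A^*\to\mathrm{FIM}(A)$, $\psi(a)=(\{1,a\},a)$. Idempotent variables $Z\in\Omega$ satisfy $\overline Z=Z$; the reduced variable satisfies $x\neq\overline x$. A solution of a typed system is an involution-respecting map $\sigma$ from $\Omega\cup\{x,\overline x\}$ to $A^*$ (extended to a morphism fixing $A$) such that $\psi(\sigma(Z))$ is idempotent for every $Z\in\Omega$, $\sigma(x)$ is a reduced word, and $\psi(\sigma(U))=\psi(\sigma(V))$ for all equations. Let $\pi_{A,\Gamma}$ be the morphism from $(A\cup\Omega\cup\{x,\overline x\})^*$ to $\mathrm{FG}(A\cup\{x,\overline x\})$ that erases symbols of $\Omega$. For a word $W$ let $\delta_x(W)$ (resp. $\delta_{\overline x}(W)$) be the number of occurrences of $x$ minus that of $\overline x$ (resp. of $\overline x$ minus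 $x$) in $W$. An equation $(U,V)$ is strongly unbalanced if $\pi_{A,\Gamma}(U)\neq\pi_{A,\Gamma}(V)$ and at least one of: (SU1) $\delta_x(U)\neq\delta_x(V)$; (SU2) for all $z\in\Omega\cup\{1\}$ and all prefixes $V'z$ of $V$ there is a prefix $U'z$ of $U$ with $\delta_x(U')>\delta_x(V')$; (SU3) for all $z\in\Omega\cup\{1\}$ and all prefixes $V'z$ of $V$ there is a prefix $U'z$ of $U$ with $\delta_{\overline x}(U')>\delta_{\overline x}(V')$. *)

(* Defs.v *)
From HB Require Import structures.
From Corelib Require Import PosDef.
From mathcomp Require Import all_boot all_order all_algebra finmap.

Set Implicit Arguments.
Unset Strict Implicit.
Unset Printing Implicit Defensive.

Definition bar_word (C : Type) (bar : C -> C) (w : seq C) : seq C :=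
  rev (map bar w).

Definition reduced (C : eqType) (bar : C -> C) (w : seq C) : bool :=
  sorted (fun c d => d != bar c) w.

Definition cons_red (C : eqType) (bar : C -> C) (c : C) (w : seq C) : seq C :=
  if w is d :: w' then if d == bar c then w' else c :: w else [:: c].

(* The reduced word representing the class of [w] in FG(C); elements of FG(C)
   are identified with reduced words. *)
Definition reduce (C : eqType) (bar : C -> C) (w : seq C) : seq C :=
  foldr (cons_red bar) [::] w.

Definition fg_mul (C : eqType) (bar : C -> C) (g h : seq C) : seq C :=
  reduce bar (g ++ h).

Lemma reduced_reduce (C : eqType) (bar : C -> C) w : reduced bar (reduce bar w).
Proof.
elim: w => //= c w; rewrite /reduced; case: (reduce bar w) => //= d v pv.
by case: ifP => [_|/negbT dc /=]; [exact: path_sorted pv | rewrite dc].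
Qed.

Lemma reduce_id (C : eqType) (bar : C -> C) w : reduced bar w -> reduce bar w = w.
Proof.
rewrite /reduced; elim: w => //= c w IH pw; rewrite IH; last exact: path_sorted pw.
by case: w pw {IH} => //= d w /andP[/negbTE -> _].
Qed.

Lemma reduced_take (C : eqType) (bar : C -> C) i w :
  reduced bar w -> reduced bar (take i w).
Proof. exact: take_sorted. Qed.

Lemma take_fg_mul (C : eqType) (bar : C -> C) g h i :
    reduced bar g -> reduced bar h ->
  (exists j, take i (fg_mul bar g h) = take j g) \/
  (exists j, take i (fg_mul bar g h) = fg_mul bar g (take j h)).
Proof.
rewrite /fg_mul => rg rh; elim: g i rg => [|a g IH] i rg /=.
  by right; exists i; rewrite !reduce_id // reduced_take.
have {}IH j := IH j (path_sorted rg).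
case E: (reduce bar (g ++ h)) IH => [|d v] IH /=.
  case: i => [|i]; first by left; exists 0.
  case: (IH 0) => /= -[j Ej]; first by left; exists 1; rewrite /= take0.
  by right; exists j; rewrite -Ej.
case: eqP => [da|/eqP da].
  case: (IH i.+1) => /= -[j Ej].
    case: j g rg Ej {IH E} => [|j] [|b g] //= /andP[ba _] [bd _].
    by rewrite -bd da eqxx in ba.
  by right; exists j; rewrite -Ej /= da eqxx.
case: i => [|i]; first by left; exists 0.
case: (IH i) => -[j Ej]; first by left; exists j.+1; rewrite /= -Ej.
by right; exists j; rewrite -Ej; case: i {Ej} => //= i; rewrite (negbTE da).
Qed.

Local Open Scope fset_scope.

Definition prefix_closed (A : choiceType) (P : {fset seq A}) : bool :=
  [forall w : P, forall i : 'I_(size (val w)), take i (val w) \in P].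

Definition fim_axiom (A : choiceType) (bar : A -> A)
    (e : {fset seq A} * seq A) : bool :=
  [&& [forall w : e.1, reduced bar (val w)], prefix_closed e.1 & e.2 \in e.1].

Record fim (A : choiceType) (bar : A -> A) :=
  FIM { fim_val : {fset seq A} * seq A; fim_valP : fim_axiom bar fim_val }.

HB.instance Definition _ (A : choiceType) (bar : A -> A) :=
  [isSub for @fim_val A bar].

Lemma prefix_closedP (A : choiceType) (P : {fset seq A}) :
  reflect (forall w i, w \in P -> take i w \in P) (prefix_closed P).
Proof.
apply: (iffP forallP) => [H w i wP | H w]; last first.
  by apply/forallP => i; apply: H; apply: valP.
case: (ltnP i (size w)) => [iw|?]; last by rewrite take_oversize.
by have /forallP/(_ (Ordinal iw)) := H [` wP].
Qed.

Lemma fim_axiomP (A : choiceType) (bar : A -> A) (e : {fset seq A} * seq A) :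
  reflect [/\ forall w, w \in e.1 -> reduced bar w,
              forall w i, w \in e.1 -> take i w \in e.1 & e.2 \in e.1]
          (fim_axiom bar e).
Proof.
apply: (iffP and3P) => -[H1 H2 H3]; split=> //; first 1 last.
- exact/prefix_closedP.
- by apply/forallP => w; apply: H1; apply: valP.
- exact/prefix_closedP.
- by move=> w we; have /forallP/(_ [` we]) := H1.
Qed.

Fact fim_one_subproof (A : choiceType) (bar : A -> A) :
  fim_axiom bar ([fset [::]], [::]).
Proof.
apply/fim_axiomP; split=> /= [w|w i|]; rewrite ?inE //.
  by move/eqP->.
by move/eqP->.
Qed.

Definition fim_one (A : choiceType) (bar : A -> A) : fim bar :=
  FIM (fim_one_subproof bar).

Definition fim_mul_val (A : choiceType) (bar : A -> A)
    (e f : {fset seq A} * seq A) : {fset seq A} * seq A :=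
  (e.1 `|` [fset fg_mul bar e.2 h | h in f.1], fg_mul bar e.2 f.2).

Fact fim_mul_subproof (A : choiceType) (bar : A -> A) (e f : fim bar) :
  fim_axiom bar (fim_mul_val bar (fim_val e) (fim_val f)).
Proof.
case: e f => [[P g] /= /fim_axiomP/=[rP cP gP]] [[Q h] /= /fim_axiomP/=[rQ cQ hQ]].
apply/fim_axiomP; split=> /= [w|w i|].
- by rewrite inE => /orP[/rP //|/imfsetP[q _ ->]]; apply: reduced_reduce.
- rewrite !inE => /orP[/cP-> //|/imfsetP[q /= qQ ->]].
  case: (take_fg_mul i (rP _ gP) (rQ _ qQ)) => -[j ->]; first by rewrite cP.
  by apply/orP; right; apply/imfsetP; exists (take j q) => //=; apply: cQ.
- by rewrite !inE; apply/orP; right; apply/imfsetP; exists h.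
Qed.

Definition fim_mul (A : choiceType) (bar : A -> A) (e f : fim bar) : fim bar :=
  FIM (fim_mul_subproof e f).

Fact fim_gen_subproof (A : choiceType) (bar : A -> A) (a : A) :
  fim_axiom bar ([fset [::]; [:: a]], [:: a]).
Proof.
apply/fim_axiomP; split=> /= [w|w i|]; rewrite ?inE ?eqxx ?orbT //.
  by case/orP=> /eqP->.
by case/orP=> /eqP-> //=; case: i => //= i; rewrite eqxx orbT.
Qed.

Definition fim_gen (A : choiceType) (bar : A -> A) (a : A) : fim bar :=
  FIM (fim_gen_subproof bar a).

Definition psi (A : choiceType) (bar : A -> A) (w : seq A) : fim bar :=
  foldr (fun a => fim_mul (fim_gen bar a)) (fim_one bar) w.

(* [inl Z] is the idempotent variable Z, [inr true] is the reduced variable x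
   and [inr false] is its formal inverse. *)
Definition var (Omega : Type) : Type := (Omega + bool)%type.

HB.instance Definition _ (Omega : eqType) :=
  Equality.copy (var Omega) (Omega + bool)%type.

Definition var_bar (Omega : Type) (v : var Omega) : var Omega :=
  match v with inl Z => inl Z | inr b => inr (~~ b) end.

Definition symb (A Omega : Type) : Type := (A + var Omega)%type.

HB.instance Definition _ (A Omega : eqType) :=
  Equality.copy (symb A Omega) (A + var Omega)%type.

Definition idem (A Omega : Type) (Z : Omega) : symb A Omega := inr (inl Z).
Definition rvar (A Omega : Type) (b : bool) : symb A Omega := inr (inr b).

Definition equation (A Omega : Type) : Type :=
  (seq (symb A Omega) * seq (symb A Omega))%type.

Definition subst_symb (A Omega : Type) (sigma : var Omega -> seq A)
    (s : symb A Omega) : seq A :=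
  match s with inl a => [:: a] | inr v => sigma v end.

Definition subst_word (A Omega : Type) (sigma : var Omega -> seq A)
    (W : seq (symb A Omega)) : seq A :=
  flatten (map (subst_symb sigma) W).

Definition is_solution (A : choiceType) (bar : A -> A) (Omega : eqType)
    (S : seq (equation A Omega)) (sigma : var Omega -> seq A) : Prop :=
  [/\ forall v, sigma (var_bar v) = bar_word bar (sigma v),
      forall Z, fim_mul (psi bar (sigma (inl Z))) (psi bar (sigma (inl Z)))
                = psi bar (sigma (inl Z)),
      reduced bar (sigma (inr true))
    & forall U V, (U, V) \in S ->
        psi bar (subst_word sigma U) = psi bar (subst_word sigma V)].

Definition solvable (A : choiceType) (bar : A -> A) (Omega : eqType)
    (S : seq (equation A Omega)) : Prop :=
  exists sigma, is_solution bar S sigma.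

Definition barx (A : Type) (bar : A -> A) (c : A + bool) : A + bool :=
  match c with inl a => inl (bar a) | inr b => inr (~~ b) end.

Definition erase_idem (A Omega : Type) (s : symb A Omega) : option (A + bool) :=
  match s with
  | inl a => Some (inl a)
  | inr (inl _) => None
  | inr (inr b) => Some (inr b)
  end.

Definition pi_A_Gamma (A : eqType) (bar : A -> A) (Omega : Type)
    (W : seq (symb A Omega)) : seq (A + bool) :=
  reduce (barx bar) (pmap (@erase_idem A Omega) W).

(* [delta true] is delta_x and [delta false] is delta for the inverse of x. *)
Definition delta (A Omega : eqType) (b : bool) (W : seq (symb A Omega)) : int :=
  ((count_mem (rvar A Omega b) W)%:Z - (count_mem (rvar A Omega (~~ b)) W)%:Z)%R.

(* Elements of Omega + {1}, viewed as words of length at most one. *)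
Definition opt_idem (A Omega : Type) (z : option Omega) : seq (symb A Omega) :=
  if z is Some Z then [:: idem A Z] else [::].

Definition delta_dominates (A Omega : eqType) (b : bool)
    (U V : seq (symb A Omega)) : Prop :=
  forall (z : option Omega) (V' : seq (symb A Omega)),
    prefix (V' ++ opt_idem A z) V ->
    exists2 U' : seq (symb A Omega),
      prefix (U' ++ opt_idem A z) U & (delta b V' < delta b U')%R.

Definition strongly_unbalanced (A : eqType) (bar : A -> A) (Omega : eqType)
    (E : equation A Omega) : Prop :=
  let: (U, V) := E in
  pi_A_Gamma bar U <> pi_A_Gamma bar V /\
  [\/ delta true U <> delta true V,
      delta_dominates true U V
    | delta_dominates false U V].

Inductive move := MoveL | Stay | MoveR.

(* A two-way infinite tape with finitely many visited cells: [tape_left] lists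
   the cells to the left of the head, nearest first; cells that are not listed
   are blank. *)
Record tape (T : Type) := Tape {
  tape_left : seq T;
  tape_head : T;
  tape_right : seq T }.

Definition tape_write (T : Type) (t : tape T) (s : T) : tape T :=
  Tape (tape_left t) s (tape_right t).

Definition tape_move (T : Type) (blank : T) (t : tape T) (m : move) : tape T :=
  let: Tape l h r := t in
  match m with
  | MoveL => Tape (behead l) (head blank l) (h :: r)
  | Stay => t
  | MoveR => Tape (h :: l) (head blank r) (behead r)
  end.

(* The tape alphabet is the input alphabet [I] together with finitely many work
   symbols and the blank [None]; there is at least one tape.  [tm_halt q] is
   [Some true] in accepting, [Some false] in rejecting and [None] in
   non-halting states. *)
Record tm (I : finType) := TM {
  tm_tapes : nat;
  tm_work : finType;
  tm_state : finType;
  tm_start : tm_state;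
  tm_halt : tm_state -> option bool;
  tm_delta : tm_state -> {ffun 'I_tm_tapes.+1 -> option (I + tm_work)} ->
    tm_state * {ffun 'I_tm_tapes.+1 -> option (I + tm_work) * move} }.

Definition tm_config (I : finType) (M : tm I) : Type :=
  (tm_state M * ('I_(tm_tapes M).+1 -> tape (option (I + tm_work M))))%type.

Definition tm_step (I : finType) (M : tm I) (c : tm_config M) : tm_config M :=
  let: (q, ts) := c in
  if tm_halt q is Some _ then c
  else let: (q', act) := tm_delta q [ffun i => tape_head (ts i)] in
       (q', fun i => tape_move None (tape_write (ts i) (act i).1) (act i).2).

Definition tm_init (I : finType) (M : tm I) (w : seq I) : tm_config M :=
  let inp : seq (option (I + tm_work M)) := [seq Some (inl a) | a <- w] in
  (tm_start M,
   fun i => if i == ord0 then Tape [::] (head None inp) (behead inp)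
            else Tape [::] None [::]).

Definition tm_answers (I : finType) (M : tm I) (w : seq I) (t : nat) (b : bool)
    : Prop :=
  tm_halt (iter t (@tm_step I M) (tm_init M w)).1 = Some b.

(* DEXPTIME is the union of the classes DTIME(2^p(n)) over all polynomials p. *)
Definition dexptime (I : finType) (L : seq I -> Prop) : Prop :=
  exists (M : tm I) (c d : nat), forall w : seq I,
    exists2 b : bool,
      tm_answers M w (2 ^ (c * size w ^ d + c))%N b & (b = true <-> L w).

Inductive code (A : Type) :=
  Letter of A | RedVar of bool | IdemVar | Bit of bool | EqSign | EqEnd.

Arguments RedVar {A}.
Arguments IdemVar {A}.
Arguments Bit {A}.
Arguments EqSign {A}.
Arguments EqEnd {A}.

Definition code_to_sum (A : Type) (c : code A) :
    option (option (option (A + bool + bool))) :=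
  match c with
  | Letter a => Some (Some (Some (inl (inl a))))
  | RedVar b => Some (Some (Some (inl (inr b))))
  | Bit b => Some (Some (Some (inr b)))
  | IdemVar => Some (Some None)
  | EqSign => Some None
  | EqEnd => None
  end.

Definition sum_to_code (A : Type)
    (s : option (option (option (A + bool + bool)))) : code A :=
  match s with
  | Some (Some (Some (inl (inl a)))) => Letter a
  | Some (Some (Some (inl (inr b)))) => RedVar b
  | Some (Some (Some (inr b))) => Bit b
  | Some (Some None) => IdemVar
  | Some None => EqSign
  | None => EqEnd
  end.

Lemma code_to_sumK (A : Type) : cancel (@code_to_sum A) (@sum_to_code A).
Proof. by case. Qed.

HB.instance Definition _ (A : finType) :=
  Finite.copy (code A) (can_type (@code_to_sumK A)).

Fixpoint pos_bits (p : positive) : seq bool :=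
  match p with
  | xH => [:: true]
  | xO p => false :: pos_bits p
  | xI p => true :: pos_bits p
  end.

Definition nat_bits (n : nat) : seq bool :=
  if bin_of_nat n is Npos p then pos_bits p else [::].

(* The names of idempotent variables in an input are natural numbers, written
   in binary with the least significant bit first and without trailing 0s. *)
Definition encode_symb (A : Type) (s : symb A nat) : seq (code A) :=
  match s with
  | inl a => [:: Letter a]
  | inr (inl i) => IdemVar :: map Bit (nat_bits i)
  | inr (inr b) => [:: RedVar b]
  end.

Definition encode_word (A : Type) (W : seq (symb A nat)) : seq (code A) :=
  flatten (map (@encode_symb A) W).

Definition encode (A : Type) (S : seq (equation A nat)) : seq (code A) :=
  flatten [seq encode_word E.1 ++ EqSign :: encode_word E.2 ++ [:: EqEnd] | E <- S].

Fact nat_bits_inj : injective nat_bits.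
Proof.
have pbI : injective pos_bits.
  by elim=> [p IH|p IH|] [q|q|] //= [E]; rewrite ?(IH _ E) //;
     [case: p {IH} E | case: q E].
move=> m n; rewrite /nat_bits => E; apply: (can_inj bin_of_natK).
case: (bin_of_nat m) (bin_of_nat n) E => [|p] [|q] //.
- by case: q.
- by case: p.
- by move/pbI->.
Qed.

Fact encode_inj (A : eqType) : injective (@encode A).
Proof.
pose nobit (s : seq (code A)) := if s is Bit _ :: _ then false else true.
have bitI (u v : seq bool) (s t : seq (code A)) :
    nobit s -> nobit t ->
    map Bit u ++ s = map Bit v ++ t -> u = v /\ s = t.
  move=> hs ht; elim: u v => [|b u IH] [|c v] //=.
  - by move=> E; rewrite E in hs.
  - by move=> E; rewrite -E in ht.
  - by case=> -> /IH[-> ->].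
have hW (W : seq (symb A nat)) (s : seq (code A)) :
    nobit s -> nobit (encode_word W ++ s).
  by case: W => [|[a|[i|b]] W].
have wI (e : code A) (W X : seq (symb A nat)) (s t : seq (code A)) :
    (e = EqSign \/ e = EqEnd) ->
    encode_word W ++ e :: s = encode_word X ++ e :: t -> W = X /\ s = t.
  move=> he; have hb r : nobit (e :: r) by case: he => ->.
  elim: W X => [|w W IH] [|x X] /=.
  - by case=> ->.
  - by case: he => ->; case: x => [a|[i|b]].
  - by case: he => ->; case: w => [a|[i|b]].
  rewrite /encode_word /= -!catA -!/(encode_word _).
  case: w x => [a|[i|b]] [c|[j|d]] //=.
  - by case=> -> /IH[-> ->].
  - case=> /bitI[||]; try exact/hW/hb.
    by move=> /nat_bits_inj -> /IH[-> ->].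
  - by case=> -> /IH[-> ->].
elim=> [|[U V] S IH] [|[U' V'] S'] //=; rewrite /encode /=.
- by case: U' => [|[a|[i|b]] ?].
- by case: U => [|[a|[i|b]] ?].
rewrite -!catA /= => /(wI _ _ _ _ _ (or_introl erefl))[->].
by rewrite -!catA /= => /(wI _ _ _ _ _ (or_intror erefl))[-> /IH ->].
Qed.

(* Main.v *)
(** A satisfied strongly unbalanced equation bounds the value of the reduced variable.  Its image in
    the free group is a nontrivial one-variable equation, so a long value of [x] is, up to bounded
    pieces, a power of a cyclically reduced word; counting the occurrences of a long subword, with
    sign, along both sides (a Brooks counting quasimorphism) then contradicts (SU1), and comparing
    the extremal vertices of the two Munn trees in the direction of that power contradicts (SU2) and
    (SU3).  Hence [x] has length at most a polynomial in the input size.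

    With [x] of polynomial length, the remaining unknowns are the finite trees of the idempotent
    variables.  A solution is a labelling of a finite subtree of the Cayley graph that records, for
    every position of the input, which vertices belong to the Munn tree of the suffix read from
    there; the local constraints form a tree automaton with exponentially many states.  Nonemptiness
    of that automaton is a least fixpoint on a table of exponential size, which a Turing machine
    obtained by compiling a small imperative language computes in exponential time. *)

From HB Require Import structures.
From Corelib Require Import PosDef.
From mathcomp Require Import all_boot zify.
From mathcomp Require all_order all_algebra finmap.
From Stdlib Require Classical_Prop List FunctionalExtensionality ClassicalEpsilon.
Require Import Defs.

Set Implicit Arguments.
Unset Strict Implicit.
Unset Printing Implicit Defensive.

(** An equation in the free group alone bounds nothing: [x a = a x] has arbitrarily long solutions.
    What a nontrivial one-variable equation does give is a short word [p] for which [phi p] is large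
    on a long [x]. The obstacle is a value close to [V e V^-1] with [V] a long power, where
    occurrences of [p] and of its inverse balance; excluding it ([no_conj_power]) is the reason for
    Nielsen's theorem on pairs and the theory of roots. Unbalancedness enters only after that,
    through [height]. On the side of automata, the labels at a vertex [h] interact with those at
    [a h], since reading a letter translates the tree from the left. Being closed under prefixes
    compares [h] with [h b] instead and is not local in this sense. The automaton therefore does not
    demand it: prefix closures are taken only when words are rebuilt. A state is a number below
    [N = 2 ^ M] with [M] polynomial in the input size; the same [N] is the length of the table and
    the capacity of all unary registers, so time polynomial in [N] is what has to be shown. *)

Module FreeGroup.

(** * Free groups as groups of reduced words *)

Section BarWord.
Variables (C : Type) (bar : C -> C).

Lemma bar_word_cat u v : bar_word bar (u ++ v) = bar_word bar v ++ bar_word bar u.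
Proof. by rewrite /bar_word map_cat rev_cat. Qed.

Lemma bar_word_rcons u a : bar_word bar (rcons u a) = bar a :: bar_word bar u.
Proof. by rewrite /bar_word map_rcons rev_rcons. Qed.

Lemma bar_word_cons u a : bar_word bar (a :: u) = rcons (bar_word bar u) (bar a).
Proof. by rewrite /bar_word /= rev_cons. Qed.

Lemma size_bar_word u : size (bar_word bar u) = size u.
Proof. by rewrite size_rev size_map. Qed.

Lemma bar_wordK : involutive bar -> involutive (bar_word bar).
Proof.
by move=> barK u; rewrite /bar_word map_rev revK mapK.
Qed.

Lemma bar_word_take i u : bar_word bar (take i u) = drop (size u - i) (bar_word bar u).
Proof. by rewrite /bar_word map_take drop_rev size_map; congr rev; case: (leqP i (size u)) => h;
  [rewrite subKn | rewrite !take_oversize ?size_map //; lia]. Qed.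

Lemma bar_word_drop i u : bar_word bar (drop i u) = take (size u - i) (bar_word bar u).
Proof. by rewrite /bar_word map_drop take_rev size_map; congr rev; case: (leqP i (size u)) => h;
  [rewrite subKn | rewrite !drop_oversize ?size_map //; lia]. Qed.

End BarWord.

Section FreeGroup.
Variables (C : choiceType) (bar : C -> C) (barK : involutive bar).
Hypothesis bar_free : forall a, bar a <> a.

Local Notation reduce := (reduce bar).
Local Notation reduced := (reduced bar).
Local Notation cons_red := (cons_red bar).
Local Notation bw := (bar_word bar).
Implicit Types u v w : seq C.

Lemma cons_redK a w : reduced w -> cons_red a (cons_red (bar a) w) = w.
Proof.
case: w => [|d w] /=; first by rewrite eqxx.
rewrite barK; case: eqP => [->|_ _ /=]; last by rewrite eqxx.
by case: w => //= e w /andP[/negbTE -> _].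
Qed.

Lemma reduce_cat_foldr u v : reduce (u ++ v) = foldr cons_red (reduce v) u.
Proof. exact: foldr_cat. Qed.

Lemma reduced_foldr u g : reduced g -> reduced (foldr cons_red g u).
Proof.
move=> rg; rewrite -(reduce_id rg) -reduce_cat_foldr; exact: reduced_reduce.
Qed.

Lemma reduce_catr u v : reduce (u ++ reduce v) = reduce (u ++ v).
Proof. by rewrite !reduce_cat_foldr reduce_id ?reduced_reduce. Qed.

Lemma foldr_cons_red a w g : reduced g ->
  foldr cons_red g (cons_red a w) = cons_red a (foldr cons_red g w).
Proof.
case: w => //= d w rg; case: eqP => //= ->.
by rewrite cons_redK // reduced_foldr.
Qed.

Lemma reduce_catl u v : reduce (reduce u ++ v) = reduce (u ++ v).
Proof.
rewrite !reduce_cat_foldr; elim: u => //= a u IH.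
by rewrite foldr_cons_red ?reduced_reduce // IH.
Qed.

Lemma reduce_barr u : reduce (u ++ bw u) = [::].
Proof.
elim/last_ind: u => // u a IH.
rewrite bar_word_rcons -cats1 -catA /= reduce_cat_foldr /=.
by rewrite cons_redK ?reduced_reduce // -reduce_cat_foldr.
Qed.

Lemma reduced_bw u : reduced (bw u) = reduced u.
Proof.
rewrite /reduced /bar_word rev_sorted sorted_map; apply: eq_sorted => a b /=.
by rewrite barK eq_sym -(inj_eq (inv_inj barK)) barK.
Qed.

Definition fg of involutive bar := {w : seq C | reduced w}.
Local Notation G := (fg barK).
HB.instance Definition _ := Choice.on G.

Definition cl (w : seq C) : G := exist (fun w => is_true (reduced w)) (reduce w) (reduced_reduce bar w).
Definition fg_mulg (g h : G) : G := cl (val g ++ val h).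
Definition fg_inv (g : G) : G := cl (bw (val g)).

Lemma val_cl w : val (cl w) = reduce w. Proof. by []. Qed.
Lemma cl_val (g : G) : cl (val g) = g.
Proof. by apply: val_inj; rewrite val_cl reduce_id //; exact: (valP g). Qed.
Lemma clE u v : (cl u = cl v) <-> (reduce u = reduce v).
Proof. by split=> [/(congr1 val)|h]; [|apply: val_inj]. Qed.
Lemma val_clK w : reduced w -> val (cl w) = w.
Proof. by move=> rw; rewrite val_cl reduce_id. Qed.
Lemma cl_inj u v : reduced u -> reduced v -> cl u = cl v -> u = v.
Proof. by move=> ru rv /clE; rewrite !reduce_id. Qed.

Fact fg_mulA : associative fg_mulg.
Proof. by move=> x y z; apply/clE; rewrite reduce_catr reduce_catl catA. Qed.
Fact fg_mul1 : left_id (cl [::]) fg_mulg.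
Proof. by move=> x; rewrite /fg_mulg cl_val. Qed.
Fact fg_mulr1 : right_id (cl [::]) fg_mulg.
Proof. by move=> x; rewrite /fg_mulg cats0 cl_val. Qed.
Fact fg_mulV : left_inverse (cl [::]) fg_inv fg_mulg.
Proof.
move=> x; apply/clE; rewrite reduce_catl.
by rewrite -{2}[val x](bar_wordK barK) reduce_barr.
Qed.
Fact fg_mulrV : right_inverse (cl [::]) fg_inv fg_mulg.
Proof. by move=> x; apply/clE; rewrite reduce_catr reduce_barr. Qed.

HB.instance Definition _ := isGroup.Build G fg_mulA fg_mul1 fg_mulr1 fg_mulV fg_mulrV.

Local Open Scope group_scope.

Lemma cl_cat u v : cl (u ++ v) = cl u * cl v.
Proof. by apply/clE; rewrite reduce_catr reduce_catl. Qed.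
Lemma cl_nil : cl [::] = 1. Proof. by []. Qed.
Lemma cl_bw u : cl (bw u) = (cl u)^-1.
Proof. by symmetry; apply: mulg1_eq; rewrite -cl_cat; apply/clE; rewrite reduce_barr. Qed.

Definition len (g : G) := size (val g).

Lemma val_inv (g : G) : val g^-1 = bw (val g).
Proof. by rewrite -{1}[g]cl_val -cl_bw val_clK // reduced_bw; exact: (valP g). Qed.
Lemma lenV g : len g^-1 = len g.
Proof. by rewrite /len val_inv size_bar_word. Qed.
Lemma len1 : len 1 = 0. Proof. by []. Qed.
Lemma len_eq0 g : len g = 0 -> g = 1.
Proof. by move/size0nil => h; rewrite -[g]cl_val h. Qed.

Lemma size_reduce w : size (reduce w) <= size w.
Proof.
elim: w => //= a w; rewrite /Defs.cons_red; case: (reduce w) => //= d v h.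
by case: ifP => _ /=; lia.
Qed.
Lemma len_cl w : len (cl w) <= size w. Proof. exact: size_reduce. Qed.
Lemma len_cl_reduced w : reduced w -> len (cl w) = size w.
Proof. by move=> rw; rewrite /len val_clK. Qed.
Lemma lenM g h : len (g * h) <= len g + len h.
Proof. by rewrite /len -size_cat size_reduce. Qed.

Lemma reduced_catl u v : reduced (u ++ v) -> reduced u.
Proof. by rewrite /reduced; case: u => //= a u; rewrite cat_path => /andP[]. Qed.
Lemma reduced_catr u v : reduced (u ++ v) -> reduced v.
Proof. by move=> h; rewrite -reduced_bw; apply: (@reduced_catl _ (bw u)); rewrite -bar_word_cat reduced_bw. Qed.
Lemma reduced_cat u v : reduced u -> reduced v ->
  (forall u' a v' b, u = rcons u' a -> v = b :: v' -> b != bar a) -> reduced (u ++ v).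
Proof.
move=> ru rv h; case/lastP: u ru h => // u a ru h; case: v rv h => [|b v] rv h; first by rewrite cats0.
have := h _ _ _ _ erefl erefl; rewrite /reduced cat_rcons => hb.
case: u ru {h} => [|c u] /=; first by rewrite hb.
by rewrite /reduced /= rcons_path cat_path /= => /andP[-> ->]; rewrite hb.
Qed.
Lemma reduced_cat3 u v w : v <> [::] -> reduced (u ++ v) -> reduced (v ++ w) -> reduced (u ++ v ++ w).
Proof.
move=> hv h1 h2; rewrite catA; apply: reduced_cat => //; first exact: reduced_catr h2.
move=> u' a w' b; case/lastP: v hv h1 h2 => // v c _ h1 h2.
rewrite -rcons_cat => /rcons_inj[_ ec] ew; move: h2; rewrite ew ec cat_rcons.
by move/reduced_catr; rewrite /reduced /= => /andP[].
Qed.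

Lemma reduce_cat_split u v : reduced u -> reduced v ->
  exists u' c v' : seq C, [/\ u = u' ++ c, v = bw c ++ v', reduced (u' ++ v') & reduce (u ++ v) = u' ++ v'].
Proof.
elim/last_ind: u v => [|u a IH] v ru rv.
  by exists [::], [::], v; rewrite /= reduce_id.
have ru' : reduced u by move: ru; rewrite -cats1 => /reduced_catl.
case: v rv => [|b v] rv.
  by exists (rcons u a), [::], [::]; rewrite !cats0 reduce_id.
have [eb|nb] := eqVneq b (bar a).
  have [u' [c [v' [e1 e2 e3 e4]]]] := IH v ru' (reduced_catr (rv : reduced ([:: b] ++ v))).
  exists u', (rcons c a), v'; split=> //.
  - by rewrite e1 rcons_cat.
  - by rewrite bar_word_rcons eb e2.
  - by rewrite -e4 cat_rcons eb reduce_cat_foldr /= cons_redK ?reduced_reduce // -reduce_cat_foldr.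
exists (rcons u a), [::], (b :: v); have h : reduced (rcons u a ++ b :: v).
  apply: reduced_cat => // u' a' v' b' /rcons_inj[_ <-] [<- _]; exact: nb.
by rewrite cats0 /= reduce_id.
Qed.

(** The outer letters of a self-inverse word are mutually inverse; peeling off such pairs ends in a
    letter fixed by [bar], excluded by [bar_free], or in two adjacent inverse letters. This is the
    absence of elements of order two. *)
Lemma bw_self w : reduced w -> bw w = w -> w = [::].
Proof.
have [k] := ubnP (size w); elim: k w => // k IH [|a w] // hk rw.
case/lastP: w hk rw => [|w b] hk rw.
  by case=> /bar_free.
rewrite bar_word_cons bar_word_rcons /= => -[ea /rcons_inj[ew eb]].
have rw' : reduced w by move: rw; rewrite -rcons_cons -cats1 => /reduced_catl; move/(@reduced_catr [:: a]).
have {}IH : w = [::] by apply: IH => //; move: hk; rewrite /= size_rcons; lia.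
by move: rw; rewrite IH /= /reduced /= andbT eb eqxx.
Qed.

End FreeGroup.

End FreeGroup.
Import FreeGroup.

(** * Relations between two elements of a free group; Nielsen reduction *)

Module FreeGroupWords.

Local Open Scope group_scope.

(** Letters of the free group of rank two: the first component names the generator, the second its
    sign. *)
Definition flip2 (l : bool * bool) := (l.1, ~~ l.2).
Lemma flip2K : involutive flip2. Proof. by case=> a b; rewrite /flip2 /= negbK. Qed.
Local Notation F2 := (fg flip2K).

Section Evaluation.
Variable G : groupType.
Implicit Types a b : G.

Definition gen2 a b (l : bool * bool) : G :=
  let x := if l.1 then a else b in if l.2 then x else x^-1.
Definition evalw2 a b (w : seq (bool * bool)) : G := foldr (fun l g => gen2 a b l * g) 1 w.
Definition eval2 a b (o : F2) : G := evalw2 a b (val o).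

Lemma gen2V a b l : gen2 a b (flip2 l) = (gen2 a b l)^-1.
Proof. by case: l => [[] []] //=; rewrite /gen2 /= invgK. Qed.

Lemma evalw2_reduce a b w : evalw2 a b (reduce flip2 w) = evalw2 a b w.
Proof.
elim: w => //= l w <-; case: (reduce flip2 w) => //= d v.
by case: eqP => // ->; rewrite gen2V mulVKg.
Qed.
Lemma evalw2_cat a b u v : evalw2 a b (u ++ v) = evalw2 a b u * evalw2 a b v.
Proof. by elim: u => [|l u IH] /=; rewrite ?mul1g // IH mulgA. Qed.
Lemma eval2M a b : {morph eval2 a b : x y / x * y}.
Proof. by move=> x y; rewrite /eval2 evalw2_reduce evalw2_cat. Qed.
Lemma eval21 a b : eval2 a b 1 = 1. Proof. by []. Qed.
Lemma eval2V a b : {morph eval2 a b : x / x^-1}.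
Proof. by move=> x; symmetry; apply: mulg1_eq; rewrite -eval2M mulgV. Qed.
End Evaluation.

Definition x2 : F2 := cl flip2K [:: (true, true)].
Definition y2 : F2 := cl flip2K [:: (false, true)].

Lemma eval2x (G : groupType) (a b : G) : eval2 a b x2 = a.
Proof. by rewrite /eval2 /= mulg1. Qed.
Lemma eval2y (G : groupType) (a b : G) : eval2 a b y2 = b.
Proof. by rewrite /eval2 /= mulg1. Qed.

Lemma cl_gen2 w : cl flip2K w = evalw2 x2 y2 w.
Proof.
elim: w => //= l w <-; rewrite -cat1s cl_cat; congr (_ * _).
by case: l => [[] []] //; rewrite /gen2 /= -cl_bw.
Qed.

Lemma eval2_comp (G : groupType) (a b : G) u v o :
  eval2 a b (eval2 u v o) = eval2 (eval2 a b u) (eval2 a b v) o.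
Proof.
rewrite [in RHS]/eval2 {2}/eval2; elim: (val o) => //= l w IH; rewrite eval2M IH; congr (_ * _).
by case: l => [[] []]; rewrite /gen2 /= ?eval2V.
Qed.
Lemma eval2_id o : eval2 x2 y2 o = o.
Proof. by rewrite /eval2 -cl_gen2 cl_val. Qed.

Section Relations.
Variable G : groupType.
Implicit Types a b : G.

Definition related a b := exists2 o : F2, o <> 1 & eval2 a b o = 1.

(** Relations travel along an injective endomorphism of the free group of rank two: [u], [v] express
    the old pair in the new one, and substituting [u'], [v'] undoes this, so a nontrivial word stays
    nontrivial. *)
Lemma related_subst a b a' b' u v u' v' :
  eval2 a' b' u = a -> eval2 a' b' v = b -> eval2 u' v' u = x2 -> eval2 u' v' v = y2 ->
  related a b -> related a' b'.
Proof.
move=> <- <- eu ev [o no]; rewrite -eval2_comp => e; exists (eval2 u v o) => // h.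
by apply: no; rewrite -(eval2_id o) -eu -ev -eval2_comp h.
Qed.
Lemma related_sym a b : related a b -> related b a.
Proof. by apply: (@related_subst _ _ _ _ y2 x2 y2 x2); rewrite ?eval2x ?eval2y. Qed.
Lemma related_invl a b : related a b -> related a^-1 b.
Proof.
by apply: (@related_subst _ _ _ _ x2^-1 y2 x2^-1 y2); rewrite ?eval2V ?eval2x ?eval2y ?invgK.
Qed.
Lemma related_mul a b : related a b -> related a (a * b).
Proof.
apply: (@related_subst _ _ _ _ x2 (x2^-1 * y2) x2 (x2 * y2));
  by rewrite ?eval2M ?eval2V ?eval2x ?eval2y ?mulKg.
Qed.
Lemma related_conj a b g : related a b -> related (a ^ g) (b ^ g).
Proof.
case=> o no e; exists o => //; rewrite -(conj1g g) -e /eval2.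
elim: (val o) => //= [|l w ->]; first by rewrite conj1g.
by rewrite conjMg; congr (_ * _); case: l => [[] []]; rewrite /gen2 /= ?conjVg.
Qed.
Lemma related_invr a b : related a b -> related a b^-1.
Proof. by move/related_sym/related_invl/related_sym. Qed.
Lemma related_mulr a b : related a b -> related a (b * a).
Proof.
by move/related_invl/related_invr/related_mul/related_invl/related_invr; rewrite !invgK invgM !invgK.
Qed.
End Relations.

Section Nielsen.
Variables (C : choiceType) (bar : C -> C) (barK : involutive bar).
Hypothesis bar_free : forall a, bar a <> a.
Local Notation G := (fg barK).
Local Notation bw := (bar_word bar).
Local Notation cl := (cl barK).
Implicit Types g h k : G.

(** The length of the cancelled part in [g * h] (a Gromov product); every cancelled pair lowers the
    total length by two. *)
Definition can g h := (len g + len h - len (g * h))./2.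

Lemma canP g h : exists u c v : seq C,
  [/\ val g = u ++ c, val h = bw c ++ v, val (g * h) = u ++ v & size c = can g h].
Proof.
have [u [c [v [e1 e2 _ e4]]]] := reduce_cat_split barK (valP g) (valP h).
exists u, c, v; split=> //; rewrite /can /len e1 e2 [val (g * h)]e4 !size_cat size_bar_word.
have -> : size u + size c + (size c + size v) - (size u + size v) = (size c).*2 by lia.
by rewrite doubleK.
Qed.

Lemma len_mulE g h : len (g * h) = len g + len h - (can g h).*2 /\ (can g h).*2 <= len g + len h.
Proof.
have [u [c [v [e1 e2 e3 <-]]]] := canP g h.
rewrite /len e1 e2 e3 !size_cat size_bar_word. split; lia.
Qed.

(** How much of [g] cancels is decided by the first [can g h + 1] letters of [h]; any [k] that
    shares them cancels in the same way. *)
Lemma can_prefix g h k p q q' : val h = p ++ q -> val k = p ++ q' -> can g h < size p ->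
  val (g * k) = take (len g - can g h) (val g) ++ drop (can g h) (val k).
Proof.
have [u [c [v [e1 e2 e3 <-]]]] := canP g h => ep ek sc.
have ec : bw c = take (size c) p.
  have := congr1 (take (size c)) ep; rewrite e2 take_size_cat ?size_bar_word //.
  by move=> ->; rewrite takel_cat // ltnW.
move: ep ek; rewrite -(cat_take_drop (size c) p) -ec -!catA => ep ek.
rewrite ek drop_size_cat ?size_bar_word // /len e1 size_cat addnK take_size_cat //.
set p' := drop _ p in ep ek *.
have np' : p' <> [::] by move/(congr1 size); rewrite size_drop /=; lia.
have ev : v = p' ++ q by move: ep; rewrite e2 => /eqP; rewrite eqseq_cat // eqxx /= => /eqP.
have r1 : reduced bar (u ++ p').
  have := valP (g * h); rewrite e3 ev catA; exact: reduced_catl.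
have r2 : reduced bar (p' ++ q').
  have := valP k; rewrite ek; exact: (reduced_catr barK).
have r3 := reduced_cat3 barK np' r1 r2.
apply: (@cl_inj _ _ barK) => //; first exact: (valP (g * k)).
by rewrite cl_val -(cl_val g) -(cl_val k) e1 ek !cl_cat cl_bw -!mulgA mulVKg.
Qed.

(** Each inner factor keeps a letter between the cancellations on its two sides, so these never
    meet: by induction and [can_prefix], [x] cancels against the whole remaining product exactly as
    against its first factor. *)
Lemma prod_nocancel (x : G) (s : seq G) : x <> 1 ->
  (forall i, i < size s -> can (nth 1 (x :: s) i) (nth 1 (x :: s) i.+1) < len (nth 1 s i)) ->
  (forall i, i.+1 < size s -> can (nth 1 (x :: s) i) (nth 1 (x :: s) i.+1)
     + can (nth 1 (x :: s) i.+1) (nth 1 (x :: s) i.+2) < len (nth 1 (x :: s) i.+1)) ->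
  exists z, val (foldr (fun a b : G => a * b) 1 (x :: s)) =
    take (if s is y :: _ then len x - can x y else len x) (val x) ++ z.
Proof.
elim: s x => [|y s IH] x nx h1 h3; first by exists [::]; rewrite cats0 take_size [foldr _ _ _](mulg1 x).
have h10 : can x y < len y := h1 0 isT; have ny : y <> 1 by move=> e; move: h10; rewrite e.
have [] := IH y ny.
- by move=> i hi; apply: (h1 i.+1).
- by move=> i hi; apply: (h3 i.+1).
move=> z; set P := foldr _ _ _; set m := (if s is _ :: _ then _ else _) => eP.
have hm : can x y < m /\ m <= len y.
  rewrite /m; case: s h3 {IH eP m z P h1} => [|y' s] h3 //.
  by have := h3 0 isT; rewrite /=; lia.
exists (drop (can x y) (val P)); rewrite -[foldr _ _ _]/(x * P).
apply: (@can_prefix x y P (take m (val y)) (drop m (val y)) z) => //.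
  by rewrite cat_take_drop.
by rewrite size_take -/(len y); case: ifP; lia.
Qed.

(** Cancellation of at least half of [g] in [g * g] would mean [g = u e u^-1] with [e] equal to its
    own inverse, hence [e] empty and [g] trivial. *)
Lemma can_self g : g <> 1 -> (can g g).*2 < len g.
Proof.
move=> ng; rewrite ltnNge; apply/negP => h.
have [u [c [v [e1 e2 e3 ec]]]] := canP g g.
have hs : size (val g) = size u + size c by rewrite e1 size_cat.
move: h; rewrite -ec /len hs => h.
have rg := valP g.
have ecb : bw c = u ++ drop (size u) (bw c).
  have : take (size u) (val g) = u by rewrite e1 take_size_cat.
  rewrite e2 takel_cat ?size_bar_word; last by lia.
  by move=> h1; rewrite -{1}(cat_take_drop (size u) (bw c)) h1.
set e := drop _ _ in ecb.
have ec' : c = bw e ++ bw u by rewrite -[LHS](bar_wordK barK) ecb bar_word_cat.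
have ee : bw e = e.
  have : take (size e) (drop (size u) (val g)) = e.
    by rewrite e2 ecb -!catA drop_size_cat // take_size_cat.
  by rewrite e1 drop_size_cat // ec' take_size_cat // size_bar_word.
have re : reduced bar e by move: rg; rewrite e2 ecb -!catA => /(reduced_catr barK) /reduced_catl.
move: (bw_self barK bar_free re ee) => e0; apply: ng.
by rewrite -(cl_val g) e1 ec' e0 /= cl_cat cl_bw mulgV.
Qed.

Lemma commute_mull (x y : G) : commute x (x * y) -> commute x y.
Proof. by rewrite /commute -mulgA => /mulgI. Qed.
Lemma commute_invl (x y : G) : commute x^-1 y -> commute x y.
Proof. by move=> h; apply/commute_sym; rewrite -[x]invgK; apply: commuteV; apply: commute_sym. Qed.
Lemma commute_invr (x y : G) : commute x y^-1 -> commute x y.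
Proof. by move=> h; rewrite -[y]invgK; apply: commuteV. Qed.

(* Nielsen reduction: two elements of a free group that satisfy a nontrivial
   relation commute. *)
Lemma related_commute (a b : G) : related a b -> commute a b.
Proof.
have [n] := ubnP (len a + len b); elim: n a b => // n IH a b hn rel.
apply/eqP/negPn/negP => nc.
pose ok (x y : G) := [/\ related x y, x * y != y * x & len x + len y < n.+1].
have okS x y : ok x y -> ok y x.
  by case=> h1 h2 h3; split; [exact: related_sym | rewrite eq_sym | rewrite addnC].
have okI x y : ok x y -> ok x^-1 y.
  case=> h1 h2 h3; split; [exact: related_invl | | by rewrite lenV].
  by apply: contra h2 => /eqP/commute_invl/eqP.
have okI' x y : ok x y -> ok x y^-1 by move/okS/okI/okS.
(* If more than half of a factor cancelled, replacing the other factor by the product would shorten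
   the pair and keep it related, so the induction hypothesis would apply. *)
have half x y : ok x y -> (can x y).*2 <= len x /\ (can x y).*2 <= len y.
  case=> h1 h2 h3; have [e1 e2] := len_mulE x y; split; rewrite leqNgt; apply/negP => h.
    case/negP: h2; apply/eqP/commute_mull/IH; last exact: related_mul.
    by rewrite e1; lia.
  case/negP: h2; apply/eqP/commute_sym.
  have : commute y (x * y).
    apply: IH; last by apply: related_mulr; apply: related_sym.
    by rewrite e1; lia.
  by rewrite /commute mulgA => /mulIg.
have n1 x y : ok x y -> x <> 1.
  by case=> _ h _ e; case/negP: h; rewrite e mulg1 mul1g.
(* The critical case: [x] is consumed entirely by its two neighbours, one half each, so
   [x = c^-1 c']. If [z = y^-1], then [c = c'] and [x] is trivial. If [z = y], then
   [y = c'^-1 b' c], and conjugation by [c'] turns the pair into [w] and [b' w^-1], where [w] and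
   [b'] together are no longer than [y]. *)
have tie x y z : ok x y -> z = y \/ z = y^-1 -> can y x + can x z < len x.
  move=> oxy hz; rewrite ltnNge; apply/negP => h.
  have oxz : ok x z by case: hz => -> //; exact: okI'.
  have [h1 h2] := half _ _ (okS _ _ oxy); have [h3 h4] := half _ _ oxz.
  have [u [c [v [e1 e2 e3 ec]]]] := canP y x.
  have [u' [c' [v' [e1' e2' e3' ec']]]] := canP x z.
  have ev : v = c' /\ u' = bw c.
    have sz : size v = size c'.
      by have := congr1 size e2; rewrite -/(len x) size_cat size_bar_word; lia.
    have : bw c ++ v = u' ++ c' by rewrite -e2.
    move/eqP; rewrite -(inj_eq (can_inj revK)) !rev_cat eqseq_cat ?size_rev //.
    by case/andP=> /eqP/(can_inj revK)-> /eqP/(can_inj revK)->.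
  case: ev => ev eu'; rewrite ev in e2.
  have ex : x = (cl c)^-1 * cl c' by rewrite -[LHS]cl_val e2 cl_cat cl_bw.
  case: hz => ez; last first.
    have : bw c = bw c'.
      have : take (size c) (val z) = bw c.
        by rewrite ez val_inv e1 bar_word_cat take_size_cat ?size_bar_word.
      by rewrite e2' take_size_cat ?size_bar_word //; lia.
    move/(congr1 bw); rewrite !(bar_wordK barK) => ecc.
    by apply: (n1 _ _ oxy); rewrite ex ecc mulVg.
  rewrite ez in e2' h4.
  have [b' ey] : exists b', val y = bw c' ++ b' ++ c.
    exists (drop (size c') u); rewrite catA e1; congr (_ ++ _).
    have : take (size c') u = bw c'.
      have <- : take (size c') (val y) = bw c' by rewrite e2' take_size_cat ?size_bar_word.
      rewrite e1 takel_cat //.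
      by have := congr1 size e1; rewrite -/(len y) size_cat; move: oxz; rewrite ez; lia.
    by move=> <-; rewrite cat_take_drop.
  have ey' : y = (cl c')^-1 * cl b' * cl c by rewrite -[LHS]cl_val ey !cl_cat cl_bw mulgA.
  set q := cl c'; set p := (cl c)^-1; set w := q * p.
  have exq : x ^ q^-1 = w by rewrite conjgE invgK ex -/p -/q !mulgA mulgK.
  have eyq : y ^ q^-1 = cl b' * w^-1.
    by rewrite conjgE invgK ey' -/q !mulgA mulgV mul1g /w invgM /p invgK !mulgA.
  have [rxy nxy sxy] := oxy.
  have r2 : related w (cl b').
    have := related_mulr (related_conj q^-1 rxy); rewrite exq eyq -mulgA mulVg mulg1; exact.
  case/negP: nxy; apply/eqP.
  have {}r2 : commute w (cl b').
    apply: IH r2; have := lenM q p; have := len_cl barK c'; have := len_cl barK c; have := len_cl barK b'.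
    have hp := lenV (cl c); have := congr1 size ey; rewrite !size_cat size_bar_word -/(len y).
    have : 0 < len x by case: (posnP (len x)) => // /len_eq0 /(n1 _ _ oxy).
    rewrite -/p in hp; rewrite -/q -/w; lia.
  have : commute (x ^ q^-1) (y ^ q^-1).
    by rewrite exq eyq; apply: commuteM => //; apply: commuteV; apply: commute_refl.
  by move=> hxy; apply: (@conjg_inj _ q^-1); rewrite !conjMg; exact: hxy.
have oab : ok a b by split=> //.
(* The pair is now Nielsen reduced, so [prod_nocancel] shows that the product spelled by [o] keeps a
   letter of its first factor and is not trivial. *)
case: rel => o no; rewrite /eval2.
have ro : reduced flip2 (val o) := valP o.
have {no} : val o <> [::] by move=> e; apply: no; rewrite -(cl_val o) e.
case: (val o) ro => // l w rw _ e.
have okg l1 l2 : l1.1 != l2.1 -> ok (gen2 a b l1) (gen2 a b l2).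
  case: l1 l2 => [[] []] [[] []] //= _; rewrite /gen2 /=; try exact: oab;
  by [exact: okI|exact: okI'|apply: okI; exact: okI'|exact: okS|apply: okI; exact: okS
     |apply: okI'; exact: okS|apply: okI; apply: okI'; exact: okS].
have g1 l1 : gen2 a b l1 <> 1 by apply: (n1 _ (gen2 a b (~~ l1.1, true))); apply: okg; case: l1 => [[]].
have canl l1 l2 : l2 != flip2 l1 -> (can (gen2 a b l1) (gen2 a b l2)).*2 <= len (gen2 a b l2)
   /\ ((can (gen2 a b l1) (gen2 a b l2)).*2 = len (gen2 a b l2) -> l1.1 != l2.1).
  move=> h; have [ne|/negPn/eqP eq] := boolP (l1.1 != l2.1).
    by split=> //; have [] := half _ _ (okg _ _ ne).
  have -> : l2 = l1.
    by case: l1 l2 eq h => [x []] [y []] //= ->; rewrite ?eqxx // /flip2 /= eqxx.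
  have := can_self (g1 l1); split; lia.
have pos l1 : 0 < len (gen2 a b l1) by case: (posnP (len (gen2 a b l1))) => // /len_eq0 /g1.
have [] := @prod_nocancel (gen2 a b l) (map (gen2 a b) w) (g1 l).
- move=> i; rewrite size_map => hi.
  have := pathP l rw i hi => hl.
  rewrite (nth_map l) // -(map_cons (gen2 a b)) (nth_map l) /=; last by lia.
  rewrite (nth_map l) //.
  by have [] := canl _ _ hl; have := pos (nth l w i); rewrite /=; lia.
- move=> i; rewrite size_map => hi.
  have hl := pathP l rw i (ltnW hi); have hl' := pathP l rw i.+1 hi.
  rewrite -!(map_cons (gen2 a b)) !(nth_map l) /=; try lia.
  move: hl hl'; rewrite /=; set l1 := nth l (l :: w) i; set l2 := nth l w i; set l3 := nth l w i.+1.
  move=> hl hl'; have [h1 h2] := canl _ _ hl.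
  have hl2 : flip2 l2 != flip2 (flip2 l3).
    by rewrite flip2K eq_sym.
  have csym x y : can x y = can y^-1 x^-1.
    by rewrite /can -invgM !lenV (addnC (len x)).
  have [h3 h4] := canl _ _ hl2; move: h3 h4; rewrite !gen2V -csym lenV => h3 h4.
  have [] := ltnP (can (gen2 a b l1) (gen2 a b l2) + can (gen2 a b l2) (gen2 a b l3)) (len (gen2 a b l2)) => // hge.
  have t1 : l1.1 != l2.1 by apply: h2; lia.
  have t2 : l3.1 != l2.1 by apply: h4; lia.
  move: (hge); rewrite leqNgt => /negP; case; apply: (tie (gen2 a b l2) (gen2 a b l1)); first by apply: okg; rewrite eq_sym.
  case: l1 l2 l3 t1 t2 {h1 h2 h3 h4 hge hl hl' hl2} => [x1 s1] [x2 s2] [x3 s3] /= t1 t2.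
  have -> : x3 = x1 by case: x1 x2 x3 t1 t2 => [] [] [].
  case: (eqVneq s3 s1) => [->|ns]; first by left.
  by right; rewrite -gen2V; congr (gen2 a b (_, _)); case: s1 s3 ns => [] [].
move=> z; rewrite -(map_cons (gen2 a b)) foldr_map [foldr _ _ _]e => h.
have : size (take (if [seq gen2 a b i | i <- w] is y :: _ then
   len (gen2 a b l) - can (gen2 a b l) y else len (gen2 a b l)) (val (gen2 a b l))) = 0.
  by move/(congr1 size)/esym/eqP: h; rewrite size_cat addn_eq0 => /andP[/eqP].
rewrite size_take -/(len _); case: w rw {h e z} => [|l' w] rw /=; first by rewrite ltnn; have := pos l; lia.
have hl : flip2 l != flip2 (flip2 l') by move: rw; rewrite /reduced /= => /andP[h _]; rewrite flip2K eq_sym.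
have := canl _ _ hl; rewrite !gen2V lenV => -[].
have -> : can (gen2 a b l')^-1 (gen2 a b l)^-1 = can (gen2 a b l) (gen2 a b l').
  by rewrite /can -invgM !lenV addnC.
by have := pos l; case: ifP; lia.
Qed.
End Nielsen.

End FreeGroupWords.
Import FreeGroupWords.

(** * Roots, commutation, and cancellation between high powers *)

Module FreeGroupPowers.

Local Open Scope group_scope.

Definition ipow (G : groupType) (c a : G) := exists n, a = c ^+ n \/ a = c ^- n.

Section Powers.
Variable G : groupType.
Implicit Types a b c d : G.
Lemma ipow_id a : ipow a a. Proof. by exists 1%N; left. Qed.
Lemma ipow1 c : ipow c 1. Proof. by exists 0; left. Qed.
Lemma ipowV c a : ipow c a -> ipow c a^-1.
Proof. by case=> n [->|->]; exists n; [right|left]; rewrite ?invgK. Qed.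
Lemma ipowM c a b : ipow c a -> ipow c b -> ipow c (a * b).
Proof.
have aux n m : ipow c (c ^+ n * c ^- m).
  case: (leqP m n) => h; first by exists (n - m); left; rewrite expgnFr.
  exists (m - n); right; rewrite expgnFr; last exact: ltnW.
  by rewrite invgM invgK.
have cc n m : c ^- m * c ^+ n = c ^+ n * c ^- m.
  by apply/esym/commuteV/commuteX2/commute_refl.
case=> n [->|->] [m [->|->]].
- by exists (n + m); left; rewrite expgnDr.
- exact: aux.
- by rewrite cc; exact: aux.
- by exists (m + n); right; rewrite expgnDr invgM.
Qed.
Lemma ipowX c a n : ipow c a -> ipow c (a ^+ n).
Proof.
move=> h; elim: n => [|n IH]; first exact: ipow1.
by rewrite expgS; apply: ipowM.
Qed.
Lemma ipow_trans d c a : ipow d c -> ipow c a -> ipow d a.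
Proof. by move=> h [n [->|->]]; [|apply: ipowV]; apply: ipowX. Qed.
Lemma evalw2_nseq a b s n l : evalw2 a b (nseq n (s, l)) =
  (if l then (if s then a else b) ^+ n else (if s then a else b) ^- n).
Proof.
elim: n => [|n IH] /=; first by case: l; rewrite ?invg1.
rewrite IH /gen2 /=; case: l {IH}; first by rewrite expgS.
by rewrite expgSr invgM.
Qed.
End Powers.

Section FG.
Variables (C : choiceType) (bar : C -> C) (barK : involutive bar).
Hypothesis bar_free : forall a, bar a <> a.
Local Notation G := (fg barK).
Local Notation bw := (bar_word bar).
Local Notation cl := (cl barK).
Implicit Types a b c e g h v : G.

Lemma no_relation a b w : ~ commute a b -> reduced flip2 w -> w <> [::] -> evalw2 a b w <> 1.
Proof.
move=> nc rw nw h; apply: nc; apply: (related_commute bar_free).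
exists (FreeGroup.cl flip2K w).
  by move/(congr1 (fun x : fg flip2K => val x)); rewrite val_clK.
by rewrite /eval2 val_clK.
Qed.

Lemma reduced_nseq (D : eqType) (f : D -> D) n x : x != f x -> reduced f (nseq n x).
Proof. by move=> h; rewrite /reduced; case: n => //=; elim=> //= n ->; rewrite h. Qed.

Lemma flip2_neq l : l != flip2 l.
Proof. by case: l => x []; rewrite /flip2 /= xpair_eqE eqxx. Qed.

Lemma reduced_nseq2 n l : reduced flip2 (nseq n l).
Proof. exact/reduced_nseq/flip2_neq. Qed.

Lemma reduced_cat_ne (u v : seq (bool * bool)) : reduced flip2 u -> reduced flip2 v ->
  (last (true, true) u).1 != (head (true, true) v).1 -> reduced flip2 (u ++ v).
Proof.
move=> ru rv h; apply: reduced_cat => // u' x v' y eu ev; move: h; rewrite eu ev last_rcons /=.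
by apply: contra => /eqP->.
Qed.

(** The commutator of [c ^+ n] and [h] is a nontrivial word in [c] and [h] that evaluates to 1, and
    related elements commute. *)
Lemma commute_root c v h : ipow c v -> v <> 1 -> commute v h -> commute c h.
Proof.
move=> [n ev] nv cvh; apply: (related_commute bar_free).
have hc : commute (c ^+ n) h.
  by case: ev cvh => -> // /commute_invl.
have n0 : n != 0 by apply/eqP => e; apply: nv; case: ev => ->; rewrite e // invg1.
pose w := nseq n (true, true) ++ (false, true) :: nseq n (true, false) ++ [:: (false, false)].
have rw : reduced flip2 w.
  have hl m l : m != 0 -> last (true, true) (nseq m l) = l by case: m => // m _; rewrite -[m.+1]addn1 nseqD cats1 last_rcons.
  apply: reduced_cat_ne; rewrite ?reduced_nseq2 ?hl //.
  rewrite -cat1s; apply: reduced_cat_ne => //; last by case: (n) n0.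
  by apply: reduced_cat_ne; rewrite ?reduced_nseq2 ?hl //.
exists (FreeGroup.cl flip2K w).
  move/(congr1 (fun x : fg flip2K => val x)); rewrite val_clK //.
  by rewrite /w; case: (n) n0.
rewrite /eval2 val_clK // /w !evalw2_cat /= evalw2_cat !evalw2_nseq /gen2 /= mulg1.
by rewrite !mulgA hc mulgK mulgV.
Qed.

Lemma can_sym g h : can g h = can h^-1 g^-1.
Proof. by rewrite /can -invgM !lenV addnC. Qed.

(** If the two cancellations covered [x], its halves would be [c^-1] and the same word [c], so [x]
    would be trivial. *)
Lemma tieV x y : x <> 1 :> G -> (can y x).*2 <= len x -> (can x y^-1).*2 <= len x ->
  can y x + can x y^-1 < len x.
Proof.
move=> nx h1 h2; rewrite ltnNge; apply/negP => h.
have [u [c [v [e1 e2 e3 ec]]]] := canP y x.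
have [u' [c' [v' [e1' e2' e3' ec']]]] := canP x y^-1.
have ecc : bw c = bw c'.
  have : take (size c) (val y^-1) = bw c.
    by rewrite val_inv e1 bar_word_cat take_size_cat ?size_bar_word.
  by rewrite e2' take_size_cat ?size_bar_word //; lia.
move/(congr1 bw): ecc; rewrite !(bar_wordK barK) => ecc.
have ev : v = c'.
  have sz : size v = size c' by have := congr1 size e2; rewrite -/(len x) size_cat size_bar_word; lia.
  have : bw c ++ v = u' ++ c' by rewrite -e2.
  move/eqP; rewrite -(inj_eq (can_inj revK)) !rev_cat eqseq_cat ?size_rev //.
  by case/andP=> /eqP/(can_inj revK)->.
by apply: nx; rewrite -[LHS]cl_val e2 cl_cat cl_bw ev ecc mulVg.
Qed.

(** One step of Euclid's algorithm. If neither [a * b] nor [a * b^-1] were shorter than [a] or [b],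
    at most half of each factor of [a b a^-1 b^-1] would cancel on either side, [tieV] would exclude
    complete cancellation, and this commutator could not be trivial. *)
Lemma commute_shrink a b : a <> 1 -> b <> 1 -> commute a b ->
  exists2 y, y = b \/ y = b^-1 & len (a * y) < len a \/ len (a * y) < len b.
Proof.
move=> na nb cab.
case: (ltnP (len (a * b)) (len a)) => h1; first by exists b; [left | left].
case: (ltnP (len (a * b)) (len b)) => h2; first by exists b; [left | right].
case: (ltnP (len (a * b^-1)) (len a)) => h3; first by exists b^-1; [right | left].
case: (ltnP (len (a * b^-1)) (len b)) => h4; first by exists b^-1; [right | right].
have e1 : len (b * a^-1) = len (a * b^-1) by rewrite -lenV invgM invgK.
have e2 : len (a^-1 * b^-1) = len (a * b) by rewrite -lenV invgM !invgK cab.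
have [c1 c1'] := len_mulE a b; have [c2 c2'] := len_mulE b a^-1; have [c3 c3'] := len_mulE a^-1 b^-1.
rewrite !lenV in c2 c3 c2' c3'; rewrite c3 in e2; rewrite c2 in e1.
have t1 : can a b + can b a^-1 < len b by apply: tieV => //; lia.
have t2 : can b a^-1 + can a^-1 b^-1 < len a^-1.
  apply: tieV; rewrite ?lenV; [|lia|lia].
  by move=> e; apply: na; rewrite -[a]invgK e invg1.
have pa : 0 < len a by case: (posnP (len a)) => // /len_eq0.
have pb : 0 < len b by case: (posnP (len b)) => // /len_eq0.
have [||z] := @prod_nocancel _ _ barK a [:: b; a^-1; b^-1] na.
- move=> [|[|[|i]]] h //; [rewrite -[len _]/(len b) | rewrite -[len _]/(len a^-1) | rewrite -[len _]/(len b^-1)];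
  rewrite ?lenV /=; lia.
- by move=> [|[|i]] // _.
rewrite [foldr _ _ _](_ : _ = 1); last first.
  by rewrite -[LHS]/(a * (b * (a^-1 * (b^-1 * 1)))) mulg1 !mulgA cab mulgK mulgV.
move/(congr1 size)/esym/eqP; rewrite size_cat addn_eq0 size_take -/(len a) => /andP[/eqP].
by case: ifP; lia.
Qed.

(** Euclid's algorithm with [commute_shrink] as division step: a common root of the shortened pair
    is one of the original pair. *)
Lemma root2 a b : commute a b -> exists2 c, ipow c a & ipow c b.
Proof.
have [n] := ubnP (len a + len b); elim: n a b => // n IH a b hn cab.
case: (eqVneq a 1) => [->|/eqP na]; first by exists b; [exact: ipow1 | exact: ipow_id].
case: (eqVneq b 1) => [->|/eqP nb]; first by exists a; [exact: ipow_id | exact: ipow1].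
have [y ey hy] := commute_shrink na nb cab.
have cay : commute a y by case: ey => -> //; apply: commuteV.
have ly : len y = len b by case: ey => ->; rewrite ?lenV.
have fin c : ipow c (a * y) -> ipow c a \/ ipow c y -> ipow c a /\ ipow c b.
  move=> h1 h2; have hay : ipow c a /\ ipow c y.
    case: h2 => h2; split=> //; first by rewrite -(mulKg a y); apply: ipowM => //; apply: ipowV.
    by rewrite -(mulgK y a); apply: ipowM => //; apply: ipowV.
  by case: hay => h3 h4; split=> //; case: ey h4 => -> // /ipowV; rewrite invgK.
case: hy => hy.
  have [||c h1 h2] := IH (a * y) y; first by lia.
    by apply: commute_sym; apply: commuteM => //; apply: commute_sym.
  by exists c; have [] := fin c h1 (or_intror h2).
have [||c h1 h2] := IH a (a * y); first by lia.
  by apply: commuteM.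
by exists c; have [] := fin c h2 (or_introl h1).
Qed.

Lemma root_list v (s : seq G) : v <> 1 -> (forall g, g \in s -> commute v g) ->
  exists2 c, ipow c v & forall g, g \in s -> ipow c g.
Proof.
move=> nv; elim: s => [|g s IH] hs; first by exists v => //; exact: ipow_id.
have [|c h1 h2] := IH; first by move=> k hk; apply: hs; rewrite inE hk orbT.
have cg : commute c g by apply: (commute_root h1 nv); apply: hs; rewrite mem_head.
have [d h3 h4] := root2 cg; exists d; first exact: ipow_trans h3 h1.
move=> k; rewrite inE => /orP[/eqP->//|/h2]; exact: ipow_trans.
Qed.

(* A word in [e] (letters [(true, _)]) and [c] that begins and ends with [e]. *)
Definition alternating (w : seq (bool * bool)) (eps : bool) :=
  [&& reduced flip2 w, (head (false, true) w).1 & last (false, true) w == (true, eps)].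

(** Take the commutator of the value of [w] with [c ^+ n]. As [w] begins and ends with an
    [e]-letter, it is spelled by a nonempty reduced word in [e] and [c], so it is trivial only if
    [e] commutes with [c], and then with [v]. *)
Lemma alternating_ncommute e c v w eps : ipow c v -> v <> 1 -> ~ commute e v ->
  alternating w eps -> ~ commute (evalw2 e c w) v.
Proof.
move=> [n ev] nv nev /and3P[rw hw /eqP lw] cwv.
have hc : commute (evalw2 e c w) (c ^+ n) by case: ev cwv => -> // /commute_invr.
have n0 : n != 0 by apply/eqP => e0; apply: nv; case: ev => ->; rewrite e0 // invg1.
have nec : ~ commute e c.
  by move=> h; apply: nev; case: ev => ->; [|apply: commuteV]; apply: commuteX.
have w0 : w <> [::] by move=> e0; move: lw; rewrite e0.
pose w1 := w ++ nseq n (false, true) ++ bar_word flip2 w ++ nseq n (false, false).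
apply: (@no_relation e c w1 nec); last 1 first.
- rewrite /w1 !evalw2_cat !evalw2_nseq /=.
  have -> : evalw2 e c (bar_word flip2 w) = (evalw2 e c w)^-1.
    symmetry; apply: mulg1_eq; rewrite -evalw2_cat -evalw2_reduce reduce_barr //; exact: flip2K.
  by rewrite !mulgA hc mulgK mulgV.
- have hl m l x : m != 0 -> last x (nseq m l) = l by case: m => // m _; rewrite -[m.+1]addn1 nseqD cats1 last_rcons.
  have hh m l x : m != 0 -> head x (nseq m l) = l by case: m.
  have lw' x : last x w = (true, eps) by case: (w) w0 lw.
  have hw' x : (head x w).1 = true by case: (w) w0 hw.
  have [y [w' ew]] : exists y w', w = y :: w' by case: (w) w0 => // y w' _; exists y, w'.
  apply: reduced_cat_ne => //; last by rewrite lw'; case: (n) n0.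
  apply: reduced_cat_ne; rewrite ?reduced_nseq2 ?hl //; last first.
    move: lw; case/lastP: (w) => // u z; rewrite last_rcons bar_word_rcons /= => ->; by [].
  apply: reduced_cat_ne; rewrite ?reduced_nseq2 ?hh //.
    by rewrite reduced_bw //; exact: flip2K.
  by move: hw; rewrite ew bar_word_cons last_rcons /= => ->.
- by move: w0; rewrite /w1; case: (w).
Qed.

Definition wpow (v : seq C) i := flatten (nseq i v).
Lemma wpowS (v : seq C) i : wpow v i.+1 = v ++ wpow v i. Proof. by []. Qed.
Lemma wpowD (v : seq C) i j : wpow v (i + j) = wpow v i ++ wpow v j.
Proof. by rewrite /wpow nseqD flatten_cat. Qed.
Lemma wpowSr (v : seq C) i : wpow v i.+1 = wpow v i ++ v.
Proof. by rewrite -[i.+1]addn1 wpowD /wpow /= cats0. Qed.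
Lemma size_wpow (v : seq C) i : size (wpow v i) = (i * size v)%N.
Proof. by elim: i => // i IH; rewrite wpowS size_cat IH mulSn. Qed.
Lemma bw_wpow (v : seq C) i : bw (wpow v i) = wpow (bw v) i.
Proof. by elim: i => // i IH; rewrite wpowS bar_word_cat IH -wpowSr. Qed.
Lemma cl_wpow (v : seq C) i : cl (wpow v i) = (cl v) ^+ i.
Proof. by elim: i => // i IH; rewrite wpowS cl_cat IH expgS. Qed.

Lemma catsI (u v u' v' : seq C) : size v = size v' -> u ++ v = u' ++ v' -> u = u' /\ v = v'.
Proof.
move=> sv /eqP; rewrite -(inj_eq (can_inj revK)) !rev_cat eqseq_cat ?size_rev //.
by case/andP=> /eqP/(can_inj revK)-> /eqP/(can_inj revK)->.
Qed.
Lemma catIs (u v u' v' : seq C) : size u = size u' -> u ++ v = u' ++ v' -> u = u' /\ v = v'.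
Proof. by move=> su /eqP; rewrite eqseq_cat // => /andP[/eqP-> /eqP->]. Qed.
Lemma suffix_split (u v u' v' : seq C) : u ++ v = u' ++ v' -> size v <= size v' ->
  exists2 m, v' = m ++ v & u = u' ++ m.
Proof.
move=> e h; have hs := congr1 size e; rewrite !size_cat in hs.
exists (take (size v' - size v) v').
  rewrite -{1}(cat_take_drop (size v' - size v) v'); congr (_ ++ _).
  have [] // := @catsI u v (u' ++ take (size v' - size v) v') (drop (size v' - size v) v').
    by rewrite size_drop; lia.
  by rewrite -catA cat_take_drop.
have [] // := @catsI u v (u' ++ take (size v' - size v) v') (drop (size v' - size v) v').
  by rewrite size_drop; lia.
by rewrite -catA cat_take_drop.
Qed.

Lemma drop_wpow (v : seq C) i k : size v <= size (drop k (wpow v i)) ->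
  take (size v) (drop k (wpow v i)) ++ drop k (wpow v i) = drop k (wpow v i) ++ v.
Proof.
case: (posnP (size v)) => [/size0nil ->|v0]; first by rewrite take0 cats0.
set u := drop _ _ => h.
have hk : k <= size (wpow v i) by move: h; rewrite /u size_drop; lia.
have e : u ++ v = drop k (v ++ wpow v i).
  by rewrite -wpowS wpowSr drop_cat; case: ltngtP hk => // ek _; rewrite /u ek subnn drop0 drop_size.
have e2 : drop (size v) (u ++ v) = u.
  by rewrite e drop_drop addnC -drop_drop drop_size_cat.
by rewrite -{2}e2 -{2}(cat_take_drop (size v) (u ++ v)) e2 takel_cat.
Qed.

(** An argument in the style of Fine and Wilf. Write [w = x u] with [x] short. Since [w] and [u]
    agree on a long prefix, [x] is also a prefix of [u] and commutes as a word with the first period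
    [v1] of [u]; conjugation by [u] carries [x] to [h] and [v1] to [v]. *)
Lemma commute_suffix1 (v : seq C) i k l (h : G) Q :
  reduced bar (wpow v i) -> len h <= Q -> let u := drop k (wpow v i) in let w := drop l (wpow v i) in
  cl u * h = cl w -> size u <= size w -> Q.*2 + size v <= size u -> commute h (cl v).
Proof.
move=> rV hQ u w e huw hu.
have ru : reduced bar u by apply: (reduced_catr barK (u := take k (wpow v i))); rewrite cat_take_drop.
have rw : reduced bar w by apply: (reduced_catr barK (u := take l (wpow v i))); rewrite cat_take_drop.
have [u' [c [h' [e1 e2 e3 ec]]]] := canP (cl u) h.
rewrite val_clK // in e1; rewrite e val_clK // in e3.
have sc : size c <= Q by move: hQ; rewrite /len e2 size_cat size_bar_word; lia.
have sh : size h' <= Q by move: hQ; rewrite /len e2 size_cat size_bar_word; lia.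
have su : size u = size u' + size c by rewrite e1 size_cat.
have sw : size w = size u' + size h' by rewrite e3 size_cat.
have [x ewx] : exists x, w = x ++ u.
  have [] := @suffix_split (take k (wpow v i)) u (take l (wpow v i)) w; rewrite ?cat_take_drop //.
  by move=> m -> _; exists m.
have sx : size x <= Q by move: (congr1 size ewx); rewrite size_cat; lia.
set v1 := take (size v) u.
have hv1 : v1 ++ u = u ++ v by apply: drop_wpow; rewrite -/u; lia.
have sv1 : size v1 = size v by rewrite size_takel //; lia.
pose u1 := drop (size v) u.
have eu1 : u = v1 ++ u1 by rewrite cat_take_drop.
have eu2 : u = u1 ++ v.
  by move: hv1; rewrite {2}eu1 -catA => /(catIs erefl)[].
have ex : x = take (size x) u.
  have : take (size x) w = x by rewrite ewx take_size_cat.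
  rewrite e3 takel_cat; last by lia.
  by move=> {1}<-; rewrite e1 takel_cat //; lia.
have exv : x ++ v1 = v1 ++ x.
  have h1 : take (size x + size v) w = x ++ v1.
    by rewrite ewx take_cat ltnNge leq_addr /= addKn.
  have h2 : take (size x + size v) u = v1 ++ x.
    rewrite {1}eu1 take_cat ltnNge sv1 leq_addl /= addnK; congr (_ ++ _).
    have : size x <= size u1 by rewrite size_drop; lia.
    by move=> h3; rewrite ex {2}eu2 takel_cat // size_takel //; lia.
  rewrite -h1 -h2 e3 e1 !takel_cat //; lia.
have eh : h = (cl u)^-1 * cl x * cl u.
  by rewrite -mulgA; apply: (mulgI (cl u)); rewrite mulVKg e ewx cl_cat.
have ev : cl v = (cl u)^-1 * cl v1 * cl u.
  by rewrite -mulgA; apply: (mulgI (cl u)); rewrite mulVKg -!cl_cat hv1.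
rewrite /commute eh ev !mulgA; congr (_ * _).
rewrite -(mulgA _ (cl u)) mulgV mulg1 -(mulgA _ (cl u)) mulgV mulg1.
by move/(congr1 cl): exv; rewrite !cl_cat -!mulgA => ->.
Qed.

Lemma commute_suffix (v : seq C) i k l (h : G) Q :
  reduced bar (wpow v i) -> len h <= Q -> let u := drop k (wpow v i) in let w := drop l (wpow v i) in
  cl u * h = cl w -> 3 * Q + size v <= size u -> commute h (cl v).
Proof.
move=> rV hQ u w e hu; case: (leqP (size u) (size w)) => h1.
  by apply: (commute_suffix1 rV hQ e h1); rewrite -/u; lia.
have e' : cl w * h^-1 = cl u by rewrite -e mulgK.
have ru : reduced bar u by apply: (reduced_catr barK (u := take k (wpow v i))); rewrite cat_take_drop.
have hw : size u <= size w + Q.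
  have := lenM (cl w) h^-1; rewrite e' lenV len_cl_reduced // => hh.
  by have := len_cl barK w; lia.
apply: commute_invl; apply: (commute_suffix1 rV _ e' (ltnW h1) (Q := Q)); rewrite -/w ?lenV //; lia.
Qed.

(* If [h] does not commute with [v], little of a high power of [v] cancels
   against [h v^-1 v^-1 ...]. *)
Lemma power_nocancel (v : seq C) i k (z : seq C) (h : G) Q :
  reduced bar (wpow v i) -> let s := drop k (wpow v i) in reduced bar (z ++ s) ->
  len h <= Q -> ~ commute h (cl v) -> 4 * Q + 3 * size v <= size s ->
  exists z' l, val (cl (z ++ s) * h * cl (bw (wpow v i))) = z' ++ drop l (bw (wpow v i))
     /\ l <= 4 * Q + 3 * size v.
Proof.
move=> rV s rzs hQ nc hs.
have [u1 [c [h' [e1 e2 e3 ec]]]] := canP (cl (z ++ s)) h.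
rewrite val_clK // in e1.
have sc : size c <= Q by move: hQ; rewrite /len e2 size_cat size_bar_word; lia.
have sh : size h' <= Q by move: hQ; rewrite /len e2 size_cat size_bar_word; lia.
have [s1 es eu1] : exists2 s1, s = s1 ++ c & u1 = z ++ s1.
  by have [|m h1 h2] := @suffix_split u1 c z s (esym e1); [lia | exists m].
have ss1 : size s = size s1 + size c by rewrite es size_cat.
have rbV : reduced bar (bw (wpow v i)) by rewrite reduced_bw.
have [u2 [c2 [v2 [f1 f2 f3 fc]]]] := canP (cl (z ++ s) * h) (cl (bw (wpow v i))).
rewrite val_clK // in f2; rewrite e3 eu1 in f1.
exists u2, (size c2); split; first by rewrite f3 f2 drop_size_cat ?size_bar_word.
rewrite leqNgt; apply/negP => hc2; apply: nc.
(* The overlap that [commute_suffix] asks for, up to the piece [c]. If more cancelled, the window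
   [s3] followed by [h'] would lie inside the power of [v], where [s3 c] lies already, and
   [h = c^-1 h']. *)
pose kk := (3 * Q + size v)%N.
pose s3 := drop (size s1 - kk) s1.
have ss3 : size s3 = kk by rewrite size_drop /kk; lia.
have ec3 : exists m, c2 = m ++ s3 ++ h'.
  have [] := @suffix_split (z ++ take (size s1 - kk) s1) (s3 ++ h') u2 c2.
  - by rewrite -f1 -!catA [RHS]catA -[s1 in RHS](cat_take_drop (size s1 - kk)) -!catA.
  - by rewrite size_cat ss3 /kk; lia.
  by move=> m -> _; exists m.
case: ec3 => m ec3.
have sV : wpow v i = bw v2 ++ m ++ s3 ++ h'.
  by rewrite -ec3 -[LHS](bar_wordK barK) f2 bar_word_cat (bar_wordK barK).
have hu : s3 ++ c = drop (k + (size s1 - kk)) (wpow v i).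
  rewrite addnC -drop_drop -/s es drop_cat /s3; case: ltngtP => // hlt; try lia.
  by rewrite hlt subnn drop0 drop_size.
have hw : s3 ++ h' = drop (size (bw v2 ++ m)) (wpow v i).
  by rewrite sV catA drop_size_cat.
apply: (@commute_suffix v i (k + (size s1 - kk)) (size (bw v2 ++ m)) h Q) => //.
- by rewrite -hu -hw !cl_cat -mulgA -{1}(cl_val h) e2 cl_cat cl_bw mulVKg.
- by rewrite -hu size_cat ss3 /kk; lia.
Qed.

Definition sgn (X : G) (eps : bool) := if eps then X else X^-1.
Definition prodb (X : G) (bl : seq (bool * G)) := foldr (fun (b : bool * G) g => sgn X b.1 * b.2 * g) 1 bl.
(** Reducedness of the block form: the unknown never meets its inverse across a trivial
    coefficient. *)
Definition alt (bl : seq (bool * G)) := sorted (fun b b' : bool * G => (b.1 == b'.1) || (b.2 != 1)) bl.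

Lemma prodb_cat X s t : prodb X (s ++ t) = prodb X s * prodb X t.
Proof. by elim: s => [|b s IH] /=; rewrite ?mul1g // IH !mulgA. Qed.

(* The block data of an equation [X^e1 g1 X^e2 g2 ... = h] in one unknown. *)
Definition sys (X : G) M bl h :=
  [/\ bl <> [::], alt bl, all (fun b : bool * G => len b.2 <= M) bl, len h <= M & prodb X bl = h].

Lemma sys_split X M bl h pre (b b' : bool * G) post : sys X M bl h -> bl = pre ++ b :: b' :: post ->
  [/\ len b.2 <= M, len b'.2 <= M & b.1 <> b'.1 -> b.2 <> 1].
Proof.
case=> _ ha hl _ _ e; move: ha hl; rewrite e /alt /sorted all_cat /= => ha /and4P[_ -> -> _]; split=> //.
have : (b.1 == b'.1) || (b.2 != 1).
  by case: pre ha {e} => [|x pre] /=; rewrite ?cat_path /= => /andP[] //= _ /and3P[].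
by case: eqP => //= _ /eqP.
Qed.

Lemma len_gen2 e c w : all (fun l => l.1) w -> len (evalw2 e c w) <= size w * len e.
Proof.
elim: w => //= -[[] s] w IH //= /IH h; apply: leq_trans (lenM _ _) _.
by rewrite mulSn leq_add //; rewrite /gen2 /=; case: s; rewrite ?lenV.
Qed.

(** This excludes the shape on which every counting function can stay small. A coefficient that
    commutes with [v] passes through [V^-1 _ V] and only lengthens an alternating word in [e] and
    the common root [c]; any other coefficient stops the cancellation of the two powers after
    boundedly many letters. Either way the product ends in nearly all of [V^-1], too long for
    [h]. *)
Lemma no_conj_power (v : seq C) i (e : G) M bl h :
  reduced bar (wpow v i) -> ~ commute e (cl v) ->
  sys (cl (wpow v i) * e * (cl (wpow v i))^-1) M bl h ->
  8 * ((size bl).+1 * (len e + M)) + 6 * size v + 2 * M < size (wpow v i) -> False.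
Proof.
set V := wpow v i; set X := _ * _ * _ => rV nec hsys hbig.
set Q := ((size bl).+1 * (len e + M))%N in hbig; set K := (4 * Q + 3 * size v)%N.
have nv : cl v <> 1 by move=> e0; apply: nec; rewrite e0; apply: commute1.
have [c hcv hcg] : exists2 c, ipow c (cl v) & forall g, g \in [seq b.2 | b : bool * G <- bl & b.2 * cl v == cl v * b.2] -> ipow c g.
  by apply: root_list => // g /mapP[b]; rewrite mem_filter => /andP[/eqP hb _] ->; apply: commute_sym.
have nec' : ~ commute e (cl (bw v)) by rewrite cl_bw => /commute_invr.
have sgnX eps : sgn X eps = cl V * sgn e eps * (cl V)^-1.
  by rewrite /X; case: eps => //=; rewrite !invgM invgK mulgA.
(* The invariant: a partial product is [z], almost all of [V], an alternating word whose value has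
   length linear in the number of blocks read, and [V^-1]. *)
have claim pre eps g post : bl = pre ++ (eps, g) :: post ->
  exists z k w, [/\ reduced bar (z ++ drop k V), k <= K, alternating w eps,
    len (evalw2 e c w) <= (size pre).+1 * (len e + M) &
    prodb X pre * sgn X eps = cl (z ++ drop k V) * evalw2 e c w * (cl V)^-1].
  elim/last_ind: pre eps g post => [|pre [eps1 g1] IH] eps g post ebl.
    exists [::], 0, [:: (true, eps)]; split => //=; rewrite ?drop0 //.
    - by rewrite /alternating /= eqxx.
    - by rewrite mulg1 mul1n /gen2 /=; case: eps {ebl}; rewrite ?lenV; lia.
    by rewrite mul1g mulg1 sgnX.
  rewrite cat_rcons in ebl; have [z [k [w [h1 h2 h3 h4 h5]]]] := IH _ _ _ ebl.
  have [lg1 lg ng] := sys_split hsys ebl; rewrite /= in lg1 lg ng.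
  have eprod : prodb X (rcons pre (eps1, g1)) * sgn X eps =
     cl (z ++ drop k V) * evalw2 e c w * (cl V)^-1 * g1 * (cl V * sgn e eps * (cl V)^-1).
    by rewrite -cats1 prodb_cat /= mulg1 !mulgA h5 sgnX !mulgA.
  have spre : (size pre).+2 <= (size bl) by rewrite ebl size_cat /=; lia.
  have sQ : (size pre).+1 * (len e + M) <= Q by rewrite /Q leq_mul2r; apply/orP; right; lia.
  have ls : len (sgn e eps) = len e by case: (eps); rewrite /= ?lenV.
  have sdk : size (drop k V) = size V - k by rewrite size_drop.
  have [hc|hc] := boolP (g1 * cl v == cl v * g1).
    have hg1 : ipow c g1.
      by apply: hcg; apply/mapP; exists (eps1, g1) => //; rewrite mem_filter /= hc ebl mem_cat inE eqxx orbT.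
    have [n [s eg1]] : exists n s, g1 = if s then c ^+ n else c ^- n.
      by case: hg1 => n [->|->]; exists n; [exists true | exists false].
    exists z, k, (w ++ nseq n (false, s) ++ [:: (true, eps)]); split=> //.
    - move: h3; rewrite /alternating => /and3P[rw hw /eqP lw].
      have w0 : w <> [::] by move=> e0; move: lw; rewrite e0.
      apply/and3P; split; last by rewrite !last_cat.
      + case: (posnP n) => n0.
          rewrite n0 /=; apply: reduced_cat => // u' x v' y eu [<- _].
          move: lw; rewrite eu last_rcons => ->; rewrite /flip2 /= xpair_eqE /=.
          have -> : eps = eps1 by apply/eqP/negPn/negP => /eqP ne; apply: ng; [apply/nesym | rewrite eg1 n0; case: (s); rewrite ?invg1].
          by case: (eps1).
        have n0' : n != 0 by rewrite -lt0n.
        have hl x l : last x (nseq n l) = l by case: (n) n0' => // m _; rewrite -[m.+1]addn1 nseqD cats1 last_rcons.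
        apply: reduced_cat_ne => //; last by case: (w) w0 lw => // a w' _ /= ->; case: (n) n0'.
        by apply: reduced_cat_ne; rewrite ?reduced_nseq2 ?hl.
      + by case: (w) w0 hw.
    - rewrite !evalw2_cat evalw2_nseq -eg1 size_rcons.
      apply: leq_trans (lenM _ _) _; have := lenM g1 (evalw2 e c [:: (true, eps)]).
      have -> : evalw2 e c [:: (true, eps)] = sgn e eps by rewrite /= mulg1.
      rewrite ls mulSn => hh; apply: leq_trans (leq_add h4 hh) _; rewrite addnC leq_add2r addnC leq_add2l; exact: lg1.
    - rewrite eprod !evalw2_cat evalw2_nseq -eg1 /= mulg1 !mulgA; congr (_ * _).
      have -> : gen2 e c (true, eps) = sgn e eps by [].
      congr (_ * _); rewrite -!mulgA; do 2 congr (_ * _).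
      have : commute (cl V) g1 by rewrite cl_wpow; apply/commute_sym/commuteX/eqP.
      by move=> hV; rewrite -hV mulKg.
  have nH := alternating_ncommute hcv nv nec h3.
  have lH : len (evalw2 e c w) <= Q by apply: leq_trans h4 sQ.
  have hsz : K <= size (drop k V) by rewrite sdk /K; lia.
  have [z1 [l1 [p1 q1]]] := power_nocancel rV h1 lH nH hsz.
  have rbV : reduced bar (wpow (bw v) i) by rewrite -bw_wpow reduced_bw.
  have r1 : reduced bar (z1 ++ drop l1 (bw V)) by rewrite -p1; exact: (valP (_ : G)).
  have lgQ : len g1 <= Q by rewrite /Q; lia.
  have ng1 : ~ commute g1 (cl (bw v)) by rewrite cl_bw => /commute_invr /eqP; apply/negP.
  rewrite /V bw_wpow in r1.
  have hsz1 : 4 * Q + 3 * size (bw v) <= size (drop l1 (wpow (bw v) i)).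
    by rewrite size_bar_word size_drop -bw_wpow size_bar_word -/V; lia.
  have [z2 [l2 [p2 q2]]] := power_nocancel rbV r1 lgQ ng1 hsz1.
  rewrite -bw_wpow (bar_wordK barK) -/V in p2.
  exists z2, l2, [:: (true, eps)]; split.
  - by rewrite -p2; exact: (valP (_ : G)).
  - by move: q2; rewrite size_bar_word.
  - by rewrite /alternating /= eqxx.
  - by rewrite /= mulg1 mulSn /gen2 /= size_rcons; case: (eps); rewrite ?lenV; lia.
  - rewrite eprod -p2 cl_val -p1 cl_val cl_bw /= mulg1 !mulgA.
    by have -> : gen2 e c (true, eps) = sgn e eps by [].
have [nb _ hl hh hp] := hsys.
case/lastP ebl : bl nb => // [pre [eps g]] _.
have [z [k [w [h1 h2 h3 h4 h5]]]] := claim pre eps g [::] (etrans ebl (esym (cats1 _ _))).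
have lH : len (evalw2 e c w) <= Q.
  by apply: leq_trans h4 _; rewrite /Q leq_mul2r ebl size_rcons; apply/orP; right; lia.
have nH := alternating_ncommute hcv nv nec h3.
have hsz : K <= size (drop k V) by rewrite size_drop /K; lia.
have [z1 [l1 [p1 q1]]] := power_nocancel rV h1 lH nH hsz.
have e1 : cl (z ++ drop k V) * evalw2 e c w * cl (bw V) = h * g^-1.
  by rewrite cl_bw -h5 -hp ebl -cats1 prodb_cat /= mulg1 !mulgA mulgK.
have := lenM h g^-1; rewrite -e1 /len p1 size_cat size_drop size_bar_word -!/(len _) lenV.
by move: hl; rewrite ebl all_rcons /= => /andP[lg _]; rewrite -/V; lia.
Qed.
End FG.

End FreeGroupPowers.
Import FreeGroupPowers.

(** * Long solutions of one-variable equations are made of two periodic words *)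

Module OneVariable.

Local Open Scope group_scope.

Section OneVar.
Variables (C : choiceType) (bar : C -> C) (barK : involutive bar) (c0 : C).
Hypothesis bar_free : forall a, bar a <> a.
Local Notation G := (fg barK).
Local Notation bw := (bar_word bar).
Local Notation cl := (cl barK).
Implicit Types g h : G.

(* [w] has period [p] on the positions [x, ..., y - 1]. *)
Definition per (x y p : nat) (w : seq C) :=
  forall k, x <= k -> k + p < y -> nth c0 w k = nth c0 w (k + p).

Lemma per_sub x y x' y' p w : per x y p w -> x <= x' -> y' <= y -> per x' y' p w.
Proof. by move=> h hx hy k h1 h2; apply: h; lia. Qed.

Lemma nth_bw w k : k < size w -> nth c0 (bw w) k = bar (nth c0 w (size w - k.+1)).
Proof. by move=> h; rewrite /bar_word nth_rev ?size_map // (nth_map c0) //; lia. Qed.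

Lemma per_bw x y p w : y <= size w -> per x y p (bw w) -> per (size w - y) (size w - x) p w.
Proof.
move=> hy h k h1 h2; apply: (inv_inj barK).
have hs : size w - x <= size w by lia.
have := h (size w - (k + p).+1); rewrite !nth_bw; try lia.
have -> : size w - (size w - (k + p).+1).+1 = k + p by lia.
have -> : size w - (size w - (k + p).+1 + p).+1 = k by lia.
by move=> ->//; lia.
Qed.

Lemma sgnP (X : G) eps : sgn X (~~ eps) = (sgn X eps)^-1.
Proof. by case: eps; rewrite /= ?invgK. Qed.
Lemma len_sgn (X : G) eps : len (sgn X eps) = len X.
Proof. by case: eps; rewrite /= ?lenV. Qed.

(** The first [i] letters of this occurrence are cancelled exactly, across the coefficient, by a
    suffix of the preceding occurrence; [right_info] is the mirror image. *)
Definition left_info (X : G) pre eps i := exists pre' eps1 g1 a,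
  pre = rcons pre' (eps1, g1) /\
  cl (drop a (val (sgn X eps1))) * g1 * cl (take i (val (sgn X eps))) = 1.
Definition right_info (X : G) post eps g i := exists (eps3 : bool) g3 post' k,
  post = (eps3, g3) :: post' /\
  cl (drop (len X - i) (val (sgn X eps))) * g * cl (take k (val (sgn X eps3))) = 1.

(* Some occurrence of the unknown is cancelled, up to [3 * M] letters, by its
   two neighbours. *)
Lemma cancelled_block X M bl h : sys X M bl h -> 3 * M < len X ->
  exists pre eps g post i i', [/\ bl = pre ++ (eps, g) :: post, i <= len X, i' <= len X,
    len X <= i + i' + 3 * M & (i = 0 \/ left_info X pre eps i) /\ (i' = 0 \/ right_info X post eps g i')].
Proof.
move=> hsys hL; match goal with |- ?T => set goal := T end.
(* Reading from the left, either a cancelled occurrence has been met or more than [2 * M] letters of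
   the current one survive. The latter cannot hold at the end, where the product is [h * g^-1], of
   length at most [2 * M]. *)
have claim pre eps g post : bl = pre ++ (eps, g) :: post -> goal \/
  exists z i, [/\ val (prodb X pre * sgn X eps) = z ++ drop i (val (sgn X eps)),
    i + 2 * M < len X & i <= M \/ left_info X pre eps i].
  elim/last_ind: pre eps g post => [|pre [eps1 g1] IH] eps g post ebl.
    right; exists [::], 0; rewrite mul1g drop0; split=> //; first by lia.
    by left.
  rewrite cat_rcons in ebl; have [|[z [i1 [h1 h2 h3]]]] := IH _ _ _ ebl; first by left.
  have [lg1 _ _] := sys_split hsys ebl; rewrite /= in lg1.
  set P := prodb X pre * sgn X eps1 in h1; set s := drop i1 _ in h1.
  have ss : size s = len X - i1 by rewrite size_drop -/(len _) len_sgn.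
  have eP : prodb X (rcons pre (eps1, g1)) * sgn X eps = P * g1 * sgn X eps.
    by rewrite -cats1 prodb_cat /= mulg1 !mulgA.
  have [u [c [g' [e1 e2 e3 ec]]]] := canP P g1.
  have sc : size c <= M by move: lg1; rewrite /len e2 size_cat size_bar_word; lia.
  have sg : size g' <= M by move: lg1; rewrite /len e2 size_cat size_bar_word; lia.
  have [s1 es eu] : exists2 s1, s = s1 ++ c & u = z ++ s1.
    rewrite h1 in e1.
    by have [|m m1 m2] := @suffix_split _ u c z s (esym e1); [lia | exists m].
  have ss1 : size s = size s1 + size c by rewrite es size_cat.
  rewrite eu in e3.
  have [u2 [c2 [v2 [f1 f2 f3 fc]]]] := canP (P * g1) (sgn X eps).
  rewrite e3 in f1; rewrite -eP in f3.
  have lX : size (val (sgn X eps)) = size c2 + size v2 by rewrite f2 size_cat size_bar_word.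
  have lX' : size c2 + size v2 = len X by rewrite -lX -(len_sgn X eps).
  have dv : drop (size c2) (val (sgn X eps)) = v2 by rewrite f2 drop_size_cat ?size_bar_word.
  have tv : take (size c2) (val (sgn X eps)) = bw c2 by rewrite f2 take_size_cat ?size_bar_word.
  case: (leqP (size c2) (size g')) => hc2.
    right; exists u2, (size c2); rewrite dv; split=> //; first by lia.
    by left; lia.
  have [d ed ed'] : exists2 d, c2 = d ++ g' & z ++ s1 = u2 ++ d.
    by have [m m1 m2] := suffix_split f1 (ltnW hc2); exists m.
  have cg1 : cl c * g1 = cl g' by rewrite -{1}(cl_val g1) e2 cl_cat cl_bw mulVKg.
  have sd : size c2 = size d + size g' by rewrite ed size_cat.
  case: (leqP (size d) (size s1)) => hd.
    have [m em _] := @suffix_split _ u2 d z s1 (esym ed') hd.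
    have li : left_info X (rcons pre (eps1, g1)) eps (size c2).
      exists pre, eps1, g1, (i1 + size m); split=> //; rewrite tv.
      have -> : drop (i1 + size m) (val (sgn X eps1)) = d ++ c.
        by rewrite addnC -drop_drop -/s es em -catA drop_size_cat.
      by rewrite cl_cat -(mulgA (cl d)) cg1 ed cl_bw cl_cat mulgV.
    case: (ltnP (size c2 + 2 * M) (len X)) => hl.
      by right; exists u2, (size c2); rewrite dv; split=> //; right.
    left; exists (rcons pre (eps1, g1)), eps, g, post, (size c2), 0.
    by rewrite cat_rcons; split=> //; [lia | lia | split; [right | left]].
  have [m em _] := @suffix_split _ z s1 u2 d ed' (ltnW hd).
  left; exists pre, eps1, g1, ((eps, g) :: post), (if i1 <= M then 0 else i1), (size s).
  split=> //; first by case: ifP => _ //; lia.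
  - by rewrite ss; lia.
  - by rewrite ss; case: ifP; lia.
  split; first by case: h3 => [->|h3]; [left | case: ifP => _; [left | right]].
  right; exists eps, g, post, (size s1 + size g'); split=> //.
  have -> : drop (len X - size s) (val (sgn X eps1)) = s by rewrite ss; congr drop; lia.
  have -> : take (size s1 + size g') (val (sgn X eps)) = bw (s1 ++ g').
    by rewrite f2 ed em -catA bar_word_cat -catA take_size_cat // size_bar_word size_cat.
  by rewrite es cl_cat -(mulgA (cl s1)) cg1 cl_bw cl_cat mulgV.
have [nb _ hl hh hp] := hsys.
case/lastP ebl : bl nb => // [pre [eps g]] _.
have [//|[z [i [h1 h2 _]]]] := claim pre eps g [::] (etrans ebl (esym (cats1 _ _))).
have e1 : prodb X pre * sgn X eps = h * g^-1 by rewrite -hp ebl -cats1 prodb_cat /= mulg1 !mulgA mulgK.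
have := lenM h g^-1; rewrite -e1 /len h1 size_cat size_drop -!/(len _) len_sgn lenV.
by move: hl; rewrite ebl all_rcons /= => /andP[lg _]; lia.
Qed.

(** Apart from the few letters that [g] cancels or adds, the two prefixes of [R] are the same word
    shifted by the difference of their lengths; this shift is the period, and it is nonzero because
    [g <> 1]. *)
Lemma prefix_period (R : seq C) a i g M : reduced bar R -> a <= size R -> i <= size R -> g <> 1 -> len g <= M ->
  cl (take a R) = g * cl (take i R) -> exists2 p, 0 < p <= M & per M i p R.
Proof.
have main a' i' g' : reduced bar R -> i' <= a' -> a' <= size R -> g' <> 1 -> len g' <= M ->
    cl (take a' R) = g' * cl (take i' R) -> 0 < a' - i' <= M /\ (forall k, M <= k < i' -> nth c0 R k = nth c0 R (k + (a' - i'))).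
  move=> rR hia ha ng lg e.
  have [g1 [c [v [e1 e2 e3 ec]]]] := canP g' (cl (take i' R)).
  rewrite -e !val_clK ?reduced_take // in e2 e3.
  have sc : size c + size g1 <= M by move: lg; rewrite /len e1 size_cat; lia.
  have si : i' = size c + size v by have := congr1 (@size C) e2; rewrite size_take size_cat size_bar_word; case: ifP; lia.
  have sa : a' = size g1 + size v by have := congr1 (@size C) e3; rewrite size_take size_cat; case: ifP; lia.
  split.
    have : a' != i'.
      apply/eqP => eai; apply: ng; apply: (mulIg (cl (take i' R))).
      by rewrite -e mul1g eai.
    by lia.
  move=> k /andP[hk1 hk2].
  have -> : nth c0 R k = nth c0 v (k - size c).
    by rewrite -(nth_take c0 hk2) e2 nth_cat size_bar_word ifN //; lia.
  rewrite -(nth_take c0 (_ : k + (a' - i') < a')); last by lia.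
  rewrite e3 nth_cat ifN; last by lia.
  by congr nth; lia.
move=> rR ha hi ng lg e; case: (leqP i a) => hia.
  have [hp hk] := main _ _ _ rR hia ha ng lg e; exists (a - i) => // k h1 h2.
  by rewrite hk //; lia.
have e' : cl (take i R) = g^-1 * cl (take a R) by rewrite e mulKg.
have [|| hp hk] := main _ _ _ rR (ltnW hia) hi _ _ e'; rewrite ?lenV //.
  by move=> e1; apply: ng; rewrite -[g]invgK e1 invg1.
by exists (i - a) => // k h1 h2; rewrite hk //; lia.
Qed.

Definition flipb (bl : seq (bool * G)) := [seq (~~ b.1, b.2) | b : bool * G <- bl].
Lemma sys_flip X M bl h : sys X M bl h -> sys X^-1 M (flipb bl) h.
Proof.
case=> nb ha hl hh hp; split=> //.
- by move: nb; case: (bl).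
- rewrite /alt /flipb sorted_map; apply: sub_sorted ha => b b' /=.
  by rewrite (inj_eq negb_inj).
- by rewrite all_map; apply: sub_all hl => b.
- rewrite -hp /prodb /flipb foldr_map; elim: (bl) => //= b s ->.
  by congr (_ * _ * _); case: (b.1); rewrite /= ?invgK.
Qed.

(* Substituting [X = y * X'] shifts [y] into the constants. *)
Lemma sys_change (y X : G) M bl h : sys X M bl h ->
  exists bl' h', [/\ sys (y^-1 * X) (M + 2 * len y) bl' h' & size bl' = size bl].
Proof.
case=> nb ha hl hh hp.
pose lft (eps : bool) : G := if eps then y else 1.
pose rgt (eps : bool) : G := if eps then 1 else y^-1.
have lft_len eps : len (lft eps) <= len y by case: eps; rewrite // len1.
have rgt_len eps : len (rgt eps) <= len y by case: eps; rewrite ?lenV // len1.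
have sX eps : sgn X eps = lft eps * sgn (y^-1 * X) eps * rgt eps.
  by case: eps; rewrite /= ?mulg1 ?mul1g ?mulVKg // invgM invgK mulgK.
pose nxt (s : seq (bool * G)) : G := if s is b :: _ then lft b.1 else 1.
pose fix tr (s : seq (bool * G)) : seq (bool * G) := if s is b :: s' then (b.1, rgt b.1 * b.2 * nxt s') :: tr s' else [::].
have nxt_len s : len (nxt s) <= len y by case: s => [|b s] //; exact: lft_len.
have tr_size s : size (tr s) = size s by elim: s => //= b s ->.
have tr_prod s : prodb X s = nxt s * prodb (y^-1 * X) (tr s).
  elim: s => [|b s IH] /=; first by rewrite mulg1.
  by rewrite sX IH !mulgA.
exists (tr bl), ((nxt bl)^-1 * h); split; last exact: tr_size.
split.
- by move: nb; case: (bl).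
- move: ha; rewrite /alt; elim: (bl) => //= b s IH hp'.
  have /IH : sorted (fun b b' : bool * G => (b.1 == b'.1) || (b.2 != 1)) s by apply: path_sorted hp'.
  case: s hp' {IH} => //= b' s /andP[hb _] ->; rewrite andbT.
  case/orP: hb => [->//|hb]; apply/orP; case: (eqVneq b.1 b'.1) => [->|ne]; first by left.
  right; apply: contra hb => /eqP; case: (b.1) (b'.1) ne => [] [] //= _; rewrite /lft /rgt /=.
    by rewrite mul1g mulg1 => ->.
  by move/eqP; rewrite -mulgA -conjgE conjg_eq1.
- move: hl; elim: (bl) => //= b s IH /andP[lb /IH ->]; rewrite andbT.
  have := lenM (rgt b.1 * b.2) (nxt s); have := lenM (rgt b.1) b.2.
  by have := rgt_len b.1; have := nxt_len s; lia.
- apply: leq_trans (lenM _ _) _; rewrite lenV; have := nxt_len bl; lia.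
- by rewrite -hp tr_prod mulKg.
Qed.

Lemma core_decomp (Y : seq C) : reduced bar Y -> Y <> [::] ->
  exists t d, [/\ Y = bw t ++ d ++ t, d <> [::] & reduced bar (d ++ d)].
Proof.
have [k] := ubnP (size Y); elim: k Y => // k IH [|a Y] // hk rY _.
case/lastP: Y hk rY => [|Y b] hk rY.
  exists [::], [:: a]; split=> //; rewrite /reduced /= andbT.
  by apply/eqP => e; apply: (bar_free (a := a)).
have [eb|nb] := eqVneq b (bar a).
  have rY' : reduced bar Y.
    by move: rY; rewrite -rcons_cons -cats1 => /reduced_catl /(@reduced_catr _ _ barK [:: a]).
  have Y0 : Y <> [::] by move=> e; move: rY; rewrite e eb /reduced /= eqxx.
  have [|t [d [e1 e2 e3]]] := IH Y _ rY' Y0; first by move: hk; rewrite /= size_rcons; lia.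
  exists (rcons t b), d; split=> //.
  by rewrite bar_word_rcons eb barK e1 -!cats1 /= -!catA.
exists [::], (a :: rcons Y b); rewrite cats0; split=> //.
apply: reduced_cat => // u' x v' y; rewrite -rcons_cons => /rcons_inj[_ <-] [<- _].
by apply: contra nb => /eqP ->; rewrite barK.
Qed.

(* If [X] is a conjugate [t^-1 d t] with a long [t], then [t] is periodic:
   otherwise no two neighbouring tails cancel completely. *)
Lemma tail_periodic (X : G) M bl h t d : sys X M bl h -> val X = bw t ++ d ++ t -> d <> [::] ->
  reduced bar (d ++ d) -> 2 * M < size t -> exists2 p, 0 < p <= M & per M (size t) p (bw t).
Proof.
move=> hsys eX nd rdd ht; apply: Classical_Prop.NNPP => np.
have rX : reduced bar (bw t ++ d ++ t) by rewrite -eX; exact: (valP X).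
have rt : reduced bar t by apply: (reduced_catr barK (u := bw t ++ d)); rewrite -catA.
have rbt : reduced bar (bw t) by rewrite reduced_bw.
have ng g a : g <> 1 -> len g <= M -> cl (take a (bw t)) = g * cl (bw t) -> False.
  move=> g1 lg e; apply: np.
  have [||p] := @prefix_period (bw t) (minn a (size (bw t))) (size (bw t)) g M rbt _ (leqnn _) g1 lg; last 1 first.
  - by rewrite size_bar_word => h1 h2; exists p.
  - exact: geq_minr.
  - by rewrite take_size -e; congr (cl _); case: (leqP a (size (bw t))) => ha; [|rewrite take_size take_oversize // ltnW].
pose xd (eps : bool) := if eps then d else bw d.
have exs eps : val (sgn X eps) = bw t ++ xd eps ++ t.
  by case: eps => //; rewrite -[sgn X false]/(X^-1) val_inv eX !bar_word_cat (bar_wordK barK) -catA.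
have nxd eps : xd eps <> [::] by case: eps => //= /(congr1 size); rewrite size_bar_word => /size0nil.
have rxx eps : reduced bar (xd eps ++ xd eps) by case: eps => //=; rewrite -bar_word_cat reduced_bw.
(* Without a period no tail is consumed completely, so every partial product still ends in the core
   and the tail, a word longer than [h * g^-1]. *)
have claim pre eps g post : bl = pre ++ (eps, g) :: post ->
  exists z, val (prodb X pre * sgn X eps) = z ++ xd eps ++ t.
  elim/last_ind: pre eps g post => [|pre [eps1 g1] IH] eps g post ebl.
    by exists (bw t); rewrite mul1g exs.
  rewrite cat_rcons in ebl; have [z h1] := IH _ _ _ ebl.
  have [lg1 _ nalt] := sys_split hsys ebl; rewrite /= in lg1 nalt.
  set P := prodb X pre * sgn X eps1 in h1.
  have eP : prodb X (rcons pre (eps1, g1)) * sgn X eps = P * g1 * sgn X eps.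
    by rewrite -cats1 prodb_cat /= mulg1 !mulgA.
  have rP : reduced bar (z ++ xd eps1 ++ t) by rewrite -h1; exact: (valP P).
  have rxs : reduced bar (bw t ++ xd eps ++ t) by rewrite -exs; exact: (valP (sgn X eps)).
  have [g10|/eqP g1n] := eqVneq g1 1.
    have ee : eps1 = eps by apply/eqP/negPn/negP => /eqP /nalt; rewrite g10.
    exists (z ++ xd eps); rewrite -catA eP g10 mulg1.
    have -> : P * sgn X eps = cl (z ++ xd eps ++ xd eps ++ t).
      by rewrite -(cl_val P) -(cl_val (sgn X eps)) h1 exs ee !cl_cat cl_bw !mulgA mulgK.
    rewrite val_clK //; apply: reduced_cat3 => //; first by rewrite ee catA in rP; exact: reduced_catl rP.
    by apply: reduced_cat3 => //; exact: (reduced_catr barK rxs).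
  have [u [c [g' [e1 e2 e3 ec]]]] := canP P g1.
  have sc : size c <= M by move: lg1; rewrite /len e2 size_cat size_bar_word; lia.
  have sg : size g' <= M by move: lg1; rewrite /len e2 size_cat size_bar_word; lia.
  have [t1 et eu] : exists2 t1, t = t1 ++ c & u = (z ++ xd eps1) ++ t1.
    rewrite h1 catA in e1.
    by have [|m m1 m2] := @suffix_split _ u c (z ++ xd eps1) t (esym e1); [lia | exists m].
  have st : size t = size t1 + size c by rewrite et size_cat.
  rewrite eu in e3; set y := z ++ xd eps1 in e3 eu.
  have [u2 [c2 [v2 [f1 f2 f3 fc]]]] := canP (P * g1) (sgn X eps).
  rewrite e3 -catA in f1; rewrite exs in f2; rewrite -eP in f3.
  have cg1 : cl c * g1 = cl g' by rewrite -{1}(cl_val g1) e2 cl_cat cl_bw mulVKg.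
  have tg1 : cl t * g1 = cl (t1 ++ g') by rewrite et !cl_cat -mulgA cg1.
  case: (ltnP (size c2) (minn (size t1 + size g') (size t))) => hc2.
    have [m em1 em2] : exists2 m, bw t = bw c2 ++ m & v2 = m ++ xd eps ++ t.
      exists (drop (size c2) (bw t)).
        have : take (size c2) (bw t) = bw c2.
          have <- : take (size c2) (bw t ++ xd eps ++ t) = take (size c2) (bw t).
            by rewrite takel_cat // size_bar_word; lia.
          by rewrite f2 take_size_cat ?size_bar_word.
        by move=> <-; rewrite cat_take_drop.
      have <- : drop (size c2) (bw t ++ xd eps ++ t) = v2 by rewrite f2 drop_size_cat ?size_bar_word.
      by rewrite drop_cat size_bar_word ifT //; lia.
    by exists (u2 ++ m); rewrite f3 em2 catA.
  exfalso; case: (leqP (size t1 + size g') (size t)) => hm.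
    have [m em _] : exists2 m, c2 = m ++ t1 ++ g' & y = u2 ++ m.
      by apply: suffix_split f1 _; rewrite size_cat; lia.
    apply: (@ng g1^-1 (size (t1 ++ g'))); rewrite ?lenV //.
      by move=> e; apply: g1n; rewrite -[g1]invgK e invg1.
    have -> : take (size (t1 ++ g')) (bw t) = bw (t1 ++ g').
      have <- : take (size (t1 ++ g')) (bw t ++ xd eps ++ t) = take (size (t1 ++ g')) (bw t).
        by rewrite takel_cat // size_bar_word size_cat.
      by rewrite f2 em bar_word_cat -catA take_size_cat // size_bar_word.
    by rewrite cl_bw -tg1 invgM cl_bw.
  have [c3 ec3] : exists c3, c2 = c3 ++ t.
    have h2 : size t <= size c2 by lia.
    exists (take (size c2 - size t) c2); rewrite -{1}(cat_take_drop (size c2 - size t) c2); congr (_ ++ _).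
    have : bw (drop (size c2 - size t) c2) = bw t.
      rewrite bar_word_drop subKn //.
      have <- : take (size t) (bw c2 ++ v2) = take (size t) (bw c2) by rewrite takel_cat // size_bar_word.
      by rewrite -f2 take_size_cat // size_bar_word.
    by move/(congr1 bw); rewrite !(bar_wordK barK).
  have [y1 ey1 _] : exists2 y1, t1 ++ g' = y1 ++ t & u2 ++ c3 = y ++ y1.
    apply: suffix_split; first by rewrite f1 ec3 -catA.
    by rewrite size_cat; lia.
  have sy1 : size y1 = size t1 + size g' - size t by have := congr1 size ey1; rewrite !size_cat; lia.
  have [t2 et2] : exists t2, t1 = y1 ++ t2.
    exists (drop (size y1) t1); rewrite -{1}(cat_take_drop (size y1) t1); congr (_ ++ _).
    have := congr1 (take (size y1)) ey1; rewrite takel_cat; last by lia.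
    by rewrite take_size_cat.
  have et3 : t = t2 ++ g' by move: ey1; rewrite et2 -catA => /(catIs erefl)[_ <-].
  apply: (@ng g1 (size (bw (t2 ++ c)))) => //.
  have -> : take (size (bw (t2 ++ c))) (bw t) = bw (t2 ++ c).
    have -> : t = y1 ++ (t2 ++ c) by rewrite et et2 catA.
    by rewrite [bw (y1 ++ _)]bar_word_cat take_size_cat.
  have e4 : cl (t2 ++ c) * g1 = cl t by rewrite cl_cat -mulgA cg1 {1}et3 cl_cat.
  by rewrite !cl_bw -e4 invgM mulVKg.
have [nb _ hl hh hp] := hsys.
case/lastP ebl : bl nb => // [pre [eps g]] _.
have [z h1] := claim pre eps g [::] (etrans ebl (esym (cats1 _ _))).
have e1 : prodb X pre * sgn X eps = h * g^-1 by rewrite -hp ebl -cats1 prodb_cat /= mulg1 !mulgA mulgK.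
have := lenM h g^-1; rewrite -e1 /len h1 !size_cat -!/(len _) lenV.
by move: hl; rewrite ebl all_rcons /= => /andP[lg _]; lia.
Qed.

(** The end of [X] is cancelled by the beginning of another copy with the same sign. Then [g * X]
    begins with the inverse of its own long suffix [u1], so it is a conjugate with a long tail, and
    [tail_periodic] applies to the equation rewritten for [g * X]. The rewriting enlarges the
    coefficients to at most [3 * M], hence the bound on the period. *)
Lemma reflection (X : G) M bl h b i g k : sys X M bl h -> 0 < M -> len g <= M ->
  cl (drop (len X - b) (val X)) * g * cl (take i (val X)) = 1 -> b <= len X -> i <= len X ->
  k <= i -> 2 * k + 2 * M <= len X -> 10 * M < k ->
  exists2 p, 0 < p <= 3 * M & per (4 * M) k p (val X) /\ per (3 * M) (k - M) p (bw (val X)).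
Proof.
set R := val X => hsys hM0 lg e hb hi hki hkL hk.
have sR : size R = len X by [].
have rR : reduced bar R := valP X.
pose u := drop (len X - b) R.
have ru : reduced bar u by apply: (reduced_catr barK (u := take (len X - b) R)); rewrite cat_take_drop.
have su : size u = b by rewrite size_drop sR; lia.
have [g' [c [v2 [e1 e2 e3 ec]]]] := canP g (cl (take i R)).
have e4 : g * cl (take i R) = cl (bw u).
  by rewrite cl_bw; apply/esym/mulg1_eq; rewrite mulgA.
rewrite e4 !val_clK ?reduced_bw ?reduced_take // in e2 e3.
have sc : size c + size g' <= M by move: lg; rewrite /len e1 size_cat; lia.
have si : i = size c + size v2 by have := congr1 (@size C) e2; rewrite size_takel ?size_cat ?size_bar_word ?sR //; lia.
have sb : b = size g' + size v2 by have := congr1 size e3; rewrite size_bar_word size_cat su.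
pose ev := take (k - size c) v2.
have sev : size ev = k - size c by rewrite size_takel //; lia.
have etk : take k R = bw c ++ ev.
  have -> : take k R = take k (take i R) by rewrite take_takel.
  by rewrite e2 take_cat size_bar_word ifN //; lia.
pose b1 := size g' + size ev.
have eu1 : bw (drop (len X - b1) R) = g' ++ ev.
  have -> : drop (len X - b1) R = drop (b - b1) u.
    by rewrite /u drop_drop; congr drop; rewrite /b1; lia.
  rewrite bar_word_drop su; have -> : b - (b - b1) = b1 by rewrite /b1; lia.
  by rewrite e3 take_cat ifN /b1; [congr (_ ++ _); rewrite addKn sev | lia].
set u1 := drop (len X - b1) R in eu1.
have ru1 : reduced bar u1 by apply: (reduced_catr barK (u := take (len X - b1) R)); rewrite cat_take_drop.
have su1 : size u1 = b1 by rewrite size_drop sR /b1; lia.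
pose R2 := drop k (take (len X - b1) R).
have eR : drop k R = R2 ++ u1.
  rewrite /R2 /u1 -{1}(cat_take_drop (len X - b1) R) drop_cat size_takel ?sR; last by lia.
  by rewrite ifT // /b1; lia.
have rgX : reduced bar (bw u1 ++ R2 ++ u1).
  rewrite eu1 -eR -catA; apply: reduced_cat3 => //.
  - by move/(congr1 size); rewrite sev /=; lia.
  - by rewrite -eu1 reduced_bw.
  - by apply: (reduced_catr barK (u := bw c)); rewrite catA -etk cat_take_drop.
have egX : g * X = cl (bw u1 ++ R2 ++ u1).
  rewrite -(cl_val X) -/R -{1}(cat_take_drop k R) etk eR eu1 -(cl_val g) e1 !cl_cat !cl_bw !mulgA.
  by rewrite mulgK.
have vgX : val (g * X) = bw u1 ++ R2 ++ u1 by rewrite egX val_clK.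
have R20 : R2 <> [::].
  move=> e0; have : size (drop k R) = b1 by rewrite eR e0 /= su1.
  by rewrite size_drop sR /b1; lia.
have rR2 : reduced bar R2 by apply: (@reduced_catl _ bar _ u1); apply: (reduced_catr barK rgX).
have [t0 [d [et0 nd rdd]]] := core_decomp rR2 R20.
have [bl' [h' [hsys' _]]] := sys_change g^-1 hsys; rewrite invgK lenV in hsys'.
have vgX' : val (g * X) = bw (t0 ++ u1) ++ d ++ (t0 ++ u1).
  by rewrite vgX et0 bar_word_cat -!catA.
have [|p hp hper] := tail_periodic hsys' vgX' nd rdd; first by rewrite size_cat su1 /b1; lia.
have hM : M + 2 * len g <= 3 * M by lia.
exists p; first by lia.
have sbt : size (bw (t0 ++ u1)) = size t0 + b1 by rewrite size_bar_word size_cat su1.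
have nthu j : j < b1 -> nth c0 (bw (t0 ++ u1)) j = nth c0 (g' ++ ev) j.
  by move=> hj; rewrite bar_word_cat -eu1 nth_cat size_bar_word su1 hj.
split.
  move=> j h1 h2.
  have nR q : M <= q -> q < k -> nth c0 R q = nth c0 (bw (t0 ++ u1)) (q - size c + size g').
    move=> q1 q2; rewrite nthu; last by rewrite /b1 sev; lia.
    rewrite -(nth_take c0 q2) etk !nth_cat size_bar_word !ifN; try lia.
    by congr nth; lia.
  rewrite !nR; try lia.
  rewrite hper; [congr nth; lia | lia | rewrite size_cat su1 /b1 sev; lia].
have ebR : bw R = bw (t0 ++ u1) ++ bw (take (k + (size (bw t0 ++ d))) R).
  rewrite -bar_word_cat; congr bw.
  rewrite -{1}(cat_take_drop (k + size (bw t0 ++ d)) R); congr (_ ++ _).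
  by rewrite addnC -drop_drop eR et0 -!catA catA drop_size_cat.
move=> j h1 h2; rewrite ebR !nth_cat sbt !ifT /b1 ?sev; try lia.
by apply: hper; rewrite ?size_cat ?su1 /b1 ?sev; lia.
Qed.

(* Up to short pieces, a long solution is a product of two periodic words. *)
Lemma two_periodic (X : G) M bl h : sys X M bl h -> 0 < M -> 100 * M < len X ->
  exists eps x p1 p2, [/\ 0 < p1 <= 3 * M, 0 < p2 <= 3 * M, x <= len X,
    per (20 * M) x p1 (val (sgn X eps)) &
    per (x + 20 * M) (len X - 20 * M) p2 (val (sgn X eps))].
Proof.
move=> hsys hM hL.
have hL3 : 3 * M < len X by lia.
have [pre [eps [g [post [i [i' [ebl hi hi' hii [hl hr]]]]]]]] := cancelled_block hsys hL3.
have [bl' hsysY] : exists bl', sys (sgn X eps) M bl' h.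
  by case: (eps); [exists bl | exists (flipb bl); exact: sys_flip].
match goal with |- ?T => set goal := T end.
set Y := sgn X eps in hsysY; set R := val Y.
have lY : len Y = len X by rewrite len_sgn.
have rR : reduced bar R := valP Y.
have sR : size R = len X by rewrite -lY.
have sR' : size (bw R) = len X by rewrite size_bar_word.
(* Slightly below half the length: two mirror pieces of this size do not overlap, yet the gap
   between their periodic parts stays below [20 * M]. *)
pose k0 := (len X)./2 - 4 * M.
have hk0 : 2 * k0 + 8 * M <= len X <= 2 * k0 + 8 * M + 1 by rewrite /k0; lia.
have part b j (g' : G) k : len g' <= M -> cl (drop (len X - b) R) * g' * cl (take j R) = 1 -> b <= len X ->
    j <= len X -> k <= j -> k <= k0 -> 10 * M < k -> exists p, [/\ 0 < p <= 3 * M, per (4 * M) k p R & per (len X - k + M) (len X - 3 * M) p R].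
  move=> lg' er hb hj hkj hk hk10.
  have er' : cl (drop (len Y - b) (val Y)) * g' * cl (take j (val Y)) = 1 by rewrite lY.
  have hb' : b <= len Y by rewrite lY.
  have hj' : j <= len Y by rewrite lY.
  have hk2 : 2 * k + 2 * M <= len Y by rewrite lY; lia.
  have [p hp [q1 q2]] := reflection hsysY hM lg' er' hb' hj' hkj hk2 hk10.
  exists p; split=> //; apply: per_sub (per_bw _ q2) _ _; rewrite -/R sR; lia.
have full b j (g' : G) : len g' <= M -> cl (drop (len X - b) R) * g' * cl (take j R) = 1 -> b <= len X ->
    j <= len X -> k0 <= j -> goal.
  move=> lg' er hb hj hkj; have h10 : 10 * M < k0 by lia.
  have [p [hp q1 q2]] := part b j g' k0 lg' er hb hj hkj (leqnn _) h10.
  exists eps, k0, p, p; split=> //; first by lia.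
  - by apply: per_sub q1 _ _; lia.
  - by apply: per_sub q2 _ _; lia.
(* A neighbour of the same sign gives a reflection; one of opposite sign gives two prefixes of [R]
   that differ by the short factor [g1 <> 1], hence a period. *)
have lres : goal \/ (i <= 10 * M \/ exists2 p, 0 < p <= 3 * M & per (4 * M) i p R).
  case: hl => [->|[pre' [eps1 [g1 [a [epre er]]]]]]; first by right; left.
  rewrite epre cat_rcons in ebl; have [lg1 _ ng1] := sys_split hsys ebl; rewrite /= in lg1 ng1.
  rewrite -/Y -/R in er.
  have [ee|/eqP ne] := eqVneq eps1 eps.
    rewrite ee -/Y -/R in er.
    have er' : cl (drop (len X - (len X - a)) R) * g1 * cl (take i R) = 1.
      rewrite -er; congr (cl _ * _ * _); case: (leqP a (len X)) => ha; first by rewrite subKn.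
      by rewrite !drop_oversize // sR; lia.
    case: (leqP k0 i) => hik; first by left; apply: (full _ _ _ lg1 er'); lia.
    right; case: (leqP i (10 * M)) => h10; [by left | right].
    by have [p [h1 h2 h3]] := part _ _ _ i lg1 er' (leq_subr _ _) hi (leqnn _) (ltnW hik) h10; exists p.
  right; right.
  have es1 : val (sgn X eps1) = bw R.
    by rewrite -val_inv /Y -sgnP; congr (val (sgn X _)); case: (eps1) (eps) ne => [] [].
  rewrite es1 in er.
  have [||p hp hper] := @prefix_period R (size R - a) i g1 M rR (leq_subr _ _) _ (ng1 ne) lg1.
  - by rewrite sR.
  - have e1 : drop a (bw R) = bw (take (size R - a) R).
      rewrite bar_word_take; case: (leqP a (size R)) => ha; first by rewrite subKn.
      by rewrite !drop_oversize // size_bar_word; lia.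
    rewrite e1 cl_bw in er; apply/esym/(mulgI (cl (take (size R - a) R))^-1).
    by rewrite mulgA er mulVg.
  by exists p; [lia | apply: per_sub hper _ _; lia].
have rres : goal \/ (i' <= 11 * M \/ exists2 p, 0 < p <= 3 * M & per (len X - i' + 2 * M) (len X - 3 * M) p R).
  case: hr => [->|[eps3 [g3 [post' [k [epost er]]]]]]; first by right; left; lia.
  rewrite epost in ebl; have [lg _ ng] := sys_split hsys ebl; rewrite /= in lg ng.
  rewrite -/Y -/R in er.
  have [ee|/eqP ne] := eqVneq eps3 eps.
    rewrite ee -/Y -/R in er.
    pose j := minn k (len X).
    have er' : cl (drop (len X - i') R) * g * cl (take j R) = 1.
      rewrite -er; congr (_ * cl _); rewrite /j; case: (leqP k (len X)) => // hk.
      by rewrite !take_oversize // sR; lia.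
    have hj : i' <= j + M.
      have rd : reduced bar (drop (len X - i') R).
        by apply: (reduced_catr barK (u := take (len X - i') R)); rewrite cat_take_drop.
      have e1 : cl (drop (len X - i') R) = (g * cl (take j R))^-1.
        by rewrite -[LHS]invgK; congr (_^-1); apply: mulg1_eq; rewrite mulgA.
      have := lenM g (cl (take j R)); rewrite -lenV -e1 len_cl_reduced // size_drop sR.
      have := len_cl barK (take j R); rewrite size_take sR; case: ifP; rewrite /j; lia.
    have hjX : j <= len X by rewrite /j; lia.
    case: (leqP k0 j) => hik; first by left; apply: (full _ _ _ lg er').
    right; case: (leqP j (10 * M)) => h10; [by left; lia | right].
    have [p [h1 h2 h3]] := part _ _ _ j lg er' hi' hjX (leqnn _) (ltnW hik) h10.
    by exists p => //; apply: per_sub h3 _ _; lia.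
  right; right.
  have es1 : val (sgn X eps3) = bw R.
    by rewrite -val_inv /Y -sgnP; congr (val (sgn X _)); case: (eps3) (eps) ne => [] [].
  rewrite es1 in er.
  have rR' : reduced bar (bw R) by rewrite reduced_bw.
  pose j := minn k (len X).
  have e2 : take k (bw R) = take j (bw R).
    by rewrite /j; case: (leqP k (len X)) => // hk; rewrite !take_oversize // sR'; lia.
  have [|||||p hp hper] := @prefix_period (bw R) j i' g^-1 M rR' _ _ _ _.
  - by rewrite sR' /j; lia.
  - by rewrite sR'.
  - by move=> e1; apply: (ng (nesym ne)); rewrite -[g]invgK e1 invg1.
  - by rewrite lenV.
  - have e1 : drop (len X - i') R = bw (take i' (bw R)) by rewrite bar_word_take (bar_wordK barK) sR'.
    rewrite e1 cl_bw e2 in er.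
    have e3 : g * cl (take j (bw R)) = cl (take i' (bw R)).
      by apply: (mulgI (cl (take i' (bw R)))^-1); rewrite mulgA er mulVg.
    by rewrite -e3 mulKg.
  exists p; first by lia.
  by apply: per_sub (per_bw _ hper) _ _; rewrite sR; lia.
case: lres => // hl'; case: rres => // hr'.
have [p1 hp1 q1] : exists2 p, 0 < p <= 3 * M & per (20 * M) i p R.
  case: hl' => [h10|[p hp q]]; first by exists 1%N; [lia | move=> k; lia].
  by exists p => //; apply: per_sub q _ _; lia.
have [p2 hp2 q2] : exists2 p, 0 < p <= 3 * M & per (i + 20 * M) (len X - 20 * M) p R.
  case: hr' => [h10|[p hp q]]; first by exists 1%N; [lia | move=> k; lia].
  by exists p => //; apply: per_sub q _ _; lia.
by exists eps, i, p1, p2.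
Qed.
End OneVar.

End OneVariable.
Import OneVariable.

(** * Counting quasimorphisms on solutions of one-variable equations *)

Module Counting.
Import all_order all_algebra.

Section Occ.
Variable C : choiceType.
Implicit Types p u v w : seq C.
Local Arguments prefix : simpl never.

Fixpoint occ p w := if w is a :: w' then prefix p w + occ p w' else 0.

Lemma prefix_catE p u v : size p <= size u -> prefix p (u ++ v) = prefix p u.
Proof. by move=> h; rewrite !prefixE takel_cat. Qed.

Lemma occ_size p w : occ p w <= size w.
Proof. by elim: w => //= a w IH; case: (prefix p _); lia. Qed.

Lemma occ_cat_ge p u v : occ p u + occ p v <= occ p (u ++ v).
Proof.
elim: u => //= a u IH.
have : prefix p (a :: u) -> prefix p (a :: u ++ v).
  by rewrite -cat_cons => h; rewrite prefix_catE // size_prefix.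
by case: (prefix p (a :: u)) => [-> //|_]; lia.
Qed.

Lemma occ_cat_le p u v : occ p (u ++ v) <= occ p u + occ p v + size p.
Proof.
suff : occ p (u ++ v) <= occ p u + occ p v + minn (size p) (size u) by lia.
elim: u => [|a u IH] /=; first by lia.
rewrite -cat_cons.
case: (leqP (size p) (size (a :: u))) => h; first by rewrite prefix_catE //; move: h => /=; lia.
by have := leq_b1 (prefix p ((a :: u) ++ v)); move: h; rewrite [size (a :: u)]/=; lia.
Qed.

Lemma occ_rcons p w a : p <> [::] -> occ p (rcons w a) = occ p w + suffix p (rcons w a).
Proof.
move=> np; elim: w => [|b w IH].
  rewrite /= addn0 add0n; congr nat_of_bool.
  by rewrite prefixE suffixE; case: p np => // x [|y p] _.
rewrite rcons_cons /= IH.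
case: (leqP (size p) (size w).+1) => h.
  rewrite -rcons_cons -cats1 prefix_catE //.
  have -> : suffix p ((b :: w) ++ [:: a]) = suffix p (rcons w a).
    by rewrite !suffixE cat_cons cats1 /= size_rcons subSn // size_rcons.
  by lia.
have -> : prefix p (b :: w) = false by apply/negP => /size_prefix /=; lia.
have -> : suffix p (rcons w a) = false by apply/negP => hs; have : size p <= size (rcons w a) := size_suffix hs; rewrite size_rcons; lia.
have -> : prefix p (b :: rcons w a) = suffix p (b :: rcons w a).
  case: (eqVneq (size p) (size w).+2) => hp.
    by rewrite prefixE suffixE /= size_rcons hp subnn drop0 take_oversize //= size_rcons.
  by apply/idP/idP => [/size_prefix|/size_suffix] /=; rewrite size_rcons; lia.
by lia.
Qed.

Variables (bar : C -> C).
Hypothesis barK : involutive bar.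
Local Notation bw := (bar_word bar).

Lemma suffix_bw p w : suffix (bw p) (bw w) = prefix p w.
Proof.
rewrite /suffix /bar_word !revK !prefixE size_map -map_take.
by rewrite (inj_eq (inj_map (inv_inj barK))).
Qed.

Lemma occ_bw p w : p <> [::] -> occ (bw p) (bw w) = occ p w.
Proof.
move=> np; elim: w => // a w IH.
rewrite bar_word_cons occ_rcons; last by move/(congr1 size); rewrite size_bar_word; case: (p) np.
by rewrite IH -bar_word_cons suffix_bw addnC.
Qed.

Lemma bw_nil p : p <> [::] -> bw p <> [::].
Proof. by case/lastP: p => // p a _; rewrite bar_word_rcons. Qed.

Lemma occ_split p w : 0 < occ p w -> exists u v, w = u ++ p ++ v.
Proof.
elim: w => //= a w IH; case: (boolP (prefix p (a :: w))) => [/prefixP[v ->] _|_].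
  by exists [::], v.
by rewrite add0n => /IH[u [v ->]]; exists (a :: u), v.
Qed.
End Occ.

Section Brooks.
Variables (C : choiceType) (bar : C -> C) (barK : involutive bar) (c0 : C).
Hypothesis bar_free : forall a, bar a <> a.
Local Notation G := (fg barK).
Local Notation bw := (bar_word bar).
Local Notation cl := (cl barK).
Local Notation per := (per c0).
Local Arguments prefix : simpl never.

(* The Brooks counting quasimorphism of the word [p]. *)
Definition phiw (p w : seq C) : int := (Posz (occ p w) - Posz (occ (bw p) w))%R.
Definition phi (p : seq C) (g : G) : int := phiw p (val g).

Lemma phiw_cat p u v : p <> [::] ->
  (- Posz (size p) <= phiw p (u ++ v) - phiw p u - phiw p v <= Posz (size p))%R.
Proof.
move=> np; have := occ_cat_ge p u v; have := occ_cat_le p u v.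
have := occ_cat_ge (bw p) u v; have := occ_cat_le (bw p) u v; rewrite size_bar_word /phiw; lia.
Qed.
Lemma phiw_bw p w : p <> [::] -> phiw p (bw w) = (- phiw p w)%R.
Proof.
move=> np; rewrite /phiw (occ_bw barK) // -{1}(bar_wordK barK p) (occ_bw barK); last exact: bw_nil.
lia.
Qed.
Lemma phiV p g : p <> [::] -> phi p (g^-1)%g = (- phi p g)%R.
Proof. by move=> np; rewrite /phi val_inv phiw_bw. Qed.
Lemma phi1 p : phi p (1 : G)%g = 0%R. Proof. by []. Qed.
(** The cancelled part counts once with each sign, and each of the three cuts costs at most
    [size p]. *)
Lemma phiM p g h : p <> [::] ->
  (- Posz (3 * size p) <= phi p (g * h)%g - phi p g - phi p h <= Posz (3 * size p))%R.
Proof.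
move=> np; rewrite /phi; have [u [c [v [-> -> -> _]]]] := canP g h.
have := phiw_cat u v np; have := phiw_cat u c np; have := phiw_cat (bw c) v np.
by rewrite phiw_bw //; lia.
Qed.
Lemma phi_letter p a : p <> [::] -> (- Posz (size p) <= phi p (cl [:: a]) <= Posz (size p))%R.
Proof.
move=> np; rewrite /phi /phiw val_clK //.
have := occ_size p [:: a]; have := occ_size (bw p) [:: a].
by have : 0 < size p by [case: (p) np]; rewrite /=; lia.
Qed.

Lemma per_drop k p s : per 0 (size s) p s -> per 0 (size (drop k s)) p (drop k s).
Proof.
move=> h j _; rewrite size_drop => hj; rewrite !nth_drop addnA; apply: h; lia.
Qed.

Lemma per_take p q s : per 0 (size s) p s -> p + q <= size s -> take q (drop p s) = take q s.
Proof.
move=> h hs; apply: (@eq_from_nth _ c0).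
  by rewrite !size_take size_drop; do 2 case: ifP; lia.
move=> i; rewrite size_take size_drop => hi.
have hiq : i < q by move: hi; case: ifP; lia.
by rewrite !nth_take // nth_drop addnC -h //; lia.
Qed.

Lemma occ_per p q s k : 0 < p -> 0 < q -> per 0 (size s) p s -> k * p + q <= size s -> k < occ (take q s) s.
Proof.
move=> hp hq; elim: k s => [|k IH] s hs hk.
  have hqs : q <= size s by lia.
  have : prefix (take q s) s by rewrite prefixE size_takel ?eqxx.
  by case: s hk {hs hqs} => [|a s] /=; [lia | move=> _ ->].
rewrite mulSn in hk; have hd : take q (drop p s) = take q s by apply: per_take => //; lia.
have := IH (drop p s) (per_drop hs); rewrite hd size_drop => h.
have {}h : k < occ (take q s) (drop p s) by apply: h; lia.
have hqs : q <= size s by lia.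
have hpre : prefix (take q s) s by rewrite prefixE size_takel ?eqxx.
case: s hk hpre h {hs hd IH hqs} => [|a s] hk hpre h; first by move: hk; rewrite /=; lia.
rewrite [occ _ (a :: s)]/= hpre; case: p hp h {hk} => // p _ /=.
have := occ_cat_ge (take q (a :: s)) (take p s) (drop p s); rewrite cat_take_drop; lia.
Qed.

Lemma per_wpow p s : 0 < p -> per 0 (size s) p s -> p <= size s ->
  exists2 f, s = wpow (take p s) (size s %/ p) ++ f & size f < p.
Proof.
move=> hp; have [n] := ubnP (size s); elim: n s => // n IH s hn hs hps.
case: (leqP (p + p) (size s)) => h.
  have h1 : size (drop p s) < n by rewrite size_drop; lia.
  have h2 : p <= size (drop p s) by rewrite size_drop; lia.
  have [f ef sf] := IH _ h1 (per_drop hs) h2.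
  exists f => //; rewrite -{1}(cat_take_drop p s) ef per_take // size_drop.
  have -> : size s %/ p = ((size s - p) %/ p).+1 by rewrite -{1}(subnKC hps) divnDl // divnn hp.
  by rewrite wpowS -catA.
exists (drop p s); last by rewrite size_drop; lia.
have -> : size s %/ p = 1.
  by rewrite -{1}(subnKC hps) divnDl // divnn hp divn_small //; lia.
by rewrite /wpow /= cats0 cat_take_drop.
Qed.

Lemma occ_wpow (v : seq C) a : v <> [::] -> a <= occ v (wpow v a).
Proof.
move=> nv; elim: a => // a IH; rewrite wpowS; have := occ_cat_ge v v (wpow v a).
have : 0 < occ v v by case: (v) nv => // x u _ /=; rewrite prefix_refl.
by lia.
Qed.
Lemma occ_wpow_le (v : seq C) a b : v <> [::] -> b <= a -> occ v (wpow v b) + (a - b) <= occ v (wpow v a).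
Proof.
move=> nv h; rewrite -{2}(subnKC h) wpowD; have := occ_cat_ge v (wpow v b) (wpow v (a - b)).
by have := occ_wpow (a - b) nv; lia.
Qed.

Lemma nth_per p s i k : per 0 (size s) p s -> i + k * p < size s -> nth c0 s (i + k * p) = nth c0 s i.
Proof.
move=> h; elim: k => [|k IH] hi; first by rewrite addn0.
have -> : i + k.+1 * p = (i + k * p) + p by rewrite mulSn; lia.
by rewrite -h ?IH //; move: hi; rewrite mulSn; lia.
Qed.

(* A word and its inverse are not conjugate as words, so the inverse of a
   period does not occur in a periodic word. *)
Lemma no_inverse_factor p s : 0 < p -> per 0 (size s) p s -> p <= size s -> reduced bar s ->
  occ (bw (take p s)) s = 0.
Proof.
move=> hp hs hps rs; apply/eqP/negPn/negP; rewrite -lt0n => /occ_split[u [v es]].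
set t := take p s in es.
have st : size t = p by rewrite size_takel.
have rt : reduced bar t by apply: reduced_take.
pose k := size u %% p.
have hk : k < p by rewrite ltn_mod.
have hku : k <= size u by apply: leq_mod.
have su : size u + p <= size s by rewrite es !size_cat size_bar_word st; lia.
have rot : bw t = drop k t ++ take k t.
  apply: (@eq_from_nth _ c0); first by rewrite size_cat size_drop size_take size_bar_word st hk; lia.
  move=> i; rewrite size_bar_word st => hi.
  have -> : nth c0 (bw t) i = nth c0 s (size u + i).
    by rewrite es nth_cat ifN ?addKn ?nth_cat ?size_bar_word ?st ?hi //; lia.
  have eu : size u = size u %/ p * p + k by rewrite /k -divn_eq.
  have -> : nth c0 s (size u + i) = nth c0 s (k + i).
    have -> : size u + i = (k + i) + (size u %/ p) * p by rewrite {1}eu; lia.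
    by apply: nth_per => //; rewrite (_ : _ + _ = size u + i); lia.
  rewrite nth_cat size_drop st; case: ltnP => hi2.
    by rewrite nth_drop nth_take //; lia.
  rewrite nth_take; last by lia.
  rewrite nth_take; last by lia.
  have -> : k + i = (i - (p - k)) + 1 * p by lia.
  by apply: nth_per => //; lia.
have tkd : t = take k t ++ drop k t by rewrite cat_take_drop.
have : bw (drop k t) ++ bw (take k t) = drop k t ++ take k t by rewrite -bar_word_cat -tkd.
case/catIs; first by rewrite size_bar_word.
move=> e1 e2.
have rd : reduced bar (drop k t) by apply: (reduced_catr barK (u := take k t)); rewrite -tkd.
have d0 := bw_self barK bar_free rd e1.
have t0 := bw_self barK bar_free (reduced_take k rt) e2.
by move: st; rewrite tkd d0 t0 /=; lia.
Qed.

Lemma occ_cat_size (p u v : seq C) : occ p (u ++ v) <= size u + occ p v + size p.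
Proof. by have := occ_cat_le p u v; have := occ_size p u; lia. Qed.
Lemma occ_cat_size' (p u v : seq C) : occ p (u ++ v) <= occ p u + size v + size p.
Proof. by have := occ_cat_le p u v; have := occ_size p v; lia. Qed.

Lemma sys_change_both (a b X : G) M bl h : sys (a * X * b)%g M bl h ->
  exists bl' h', sys X (M + 2 * len a + 2 * len b) bl' h' /\ size bl' = size bl.
Proof.
case/(sys_change a) => bl1 [h1 [s1 e1]]; rewrite -!mulgA mulKg in s1.
have [bl2 [h2 [s2 e2]]] := sys_change (b^-1)%g (sys_flip s1).
rewrite invgM invgK mulgA mulgV mul1g lenV in s2.
have s3 := sys_flip s2; rewrite invgK in s3.
by exists (flipb bl2), h2; split=> //; rewrite size_map e2 size_map e1.
Qed.

(** If the inverse of the window [p] of [s1] does not occur in [s2], the many occurrences of [p] in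
    [s1] are not compensated. Otherwise [s2] is essentially a power of the inverse of the period [v]
    of [s1], so [Y] is about [v^a be' v^-b]. Either [a - b] is large and [v] itself is counted, or
    [Y] is nearly a conjugate of a short [e] by [v^b], which [no_conj_power] forbids. *)
Lemma large_phi_word (Y : G) M T bl h al s1 be s2 ga p1 p2 : sys Y M bl h -> 0 < M -> size bl <= M ->
  val Y = al ++ s1 ++ be ++ s2 ++ ga -> size al + size be + size ga <= 60 * M ->
  0 < p1 <= 3 * M -> 0 < p2 <= 3 * M -> per 0 (size s1) p1 s1 -> per 0 (size s2) p2 s2 ->
  size s2 <= size s1 -> 60 * M * M * T + 13 * 1000 * M * M * M <= size s1 ->
  exists p, [/\ p <> [::], size p <= 6 * M & (Posz T < phi p Y)%R \/ (phi p Y < - Posz T)%R].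
Proof.
move=> hsys hM hbl eY hsz hp1 hp2 per1 per2 h12 hbig.
have rY : reduced bar (val Y) := valP Y.
have rs1 : reduced bar s1.
  by move: rY; rewrite eY => /(reduced_catr barK) /reduced_catl.
have M2 : M <= M * M by rewrite leq_pmulr.
have M3 : M * M <= M * M * M by rewrite leq_pmulr.
have MT : M * T <= M * M * T by rewrite leq_mul2r M2 orbT.
have TT : T <= M * T by rewrite leq_pmull.
rewrite -!mulnA in hbig; rewrite -?mulnA in M2 M3 MT TT.
(* At least the sum of the two periods: an inverse copy of [p] inside [s2] then transfers the period
   [p1] to all of [s2]. *)
pose q := 6 * M; pose p := take q s1.
have hq : q <= size s1 by rewrite /q; lia.
have sp : size p = q by rewrite size_takel.
have np : p <> [::] by move=> e; move: sp; rewrite e /q /=; lia.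
have sYw r : occ (bw r) (val Y) <= 60 * M + 4 * size r + occ (bw r) s1 + occ (bw r) s2.
  rewrite eY; have := occ_cat_size (bw r) al (s1 ++ be ++ s2 ++ ga).
  have := occ_cat_le (bw r) s1 (be ++ s2 ++ ga); have := occ_cat_size (bw r) be (s2 ++ ga).
  by have := occ_cat_size' (bw r) s2 ga; rewrite !size_bar_word; lia.
have sYw' r : occ r (val Y) <= 60 * M + 4 * size r + occ r s1 + occ r s2.
  by have := sYw (bw r); rewrite (bar_wordK barK) size_bar_word.
have gYw r : occ r s1 + occ r s2 <= occ r (val Y).
  rewrite eY; have := occ_cat_ge r al (s1 ++ be ++ s2 ++ ga).
  have := occ_cat_ge r s1 (be ++ s2 ++ ga); have := occ_cat_ge r be (s2 ++ ga).
  by have := occ_cat_ge r s2 ga; lia.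
pose v := take p1 s1.
have sv : size v = p1 by rewrite size_takel //; lia.
have nv : v <> [::] by move=> e; move: sv; rewrite e /=; lia.
have inv1 : occ (bw v) s1 = 0 by apply: no_inverse_factor => //; lia.
have ep : p = v ++ drop p1 p.
  have -> : v = take p1 p by rewrite /v /p take_takel //; rewrite /q; lia.
  by rewrite cat_take_drop.
have inv1p : occ (bw p) s1 = 0.
  apply/eqP/negPn/negP; rewrite -lt0n => /occ_split[u [w es]].
  have : 0 < occ (bw v) s1.
    rewrite es ep bar_word_cat -!catA.
    have := occ_cat_ge (bw v) u (bw (drop p1 p) ++ bw v ++ w).
    have := occ_cat_ge (bw v) (bw (drop p1 p)) (bw v ++ w).
    have := occ_cat_ge (bw v) (bw v) w.
    have : 0 < occ (bw v) (bw v) by case: (bw v) (bw_nil (bar := bar) nv) => // x y _ /=; rewrite prefix_refl.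
    by lia.
  by rewrite inv1.
have [hB|hA] := posnP (occ (bw p) s2).
  exists p; split=> //; [by rewrite sp | left; rewrite /phi /phiw].
  have hk : T + 90 * M < occ p s1.
    apply: (@occ_per p1 q s1 (T + 90 * M)) => //; try lia.
    have : (T + 90 * M) * p1 <= (T + 90 * M) * (3 * M) by rewrite leq_mul2l; lia.
    have : (T + 90 * M) * (3 * M) = 3 * (M * T) + 270 * (M * M) by lia.
    by rewrite /q; lia.
  by have := sYw p; have := gYw p; rewrite inv1p hB sp /q; lia.
have [e1 [e2 es2]] := occ_split hA.
have ss2 : size e1 + q + size e2 = size s2 by rewrite es2 !size_cat size_bar_word sp; lia.
have pp : per 0 (size p) p1 p.
  move=> j _; rewrite sp => hj; rewrite /p !nth_take; try lia.
  by apply: per1; lia.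
have pbp : per 0 (size (bw p)) p1 (bw p).
  have := @per_bw _ _ barK c0 0 (size p) p1 (bw p).
  rewrite !size_bar_word (bar_wordK barK) subnn subn0; apply => //.
have wnd j : size e1 <= j -> j < size e1 + q -> nth c0 s2 j = nth c0 (bw p) (j - size e1).
  by move=> j1 j2; rewrite es2 nth_cat ifN ?nth_cat ?size_bar_word ?sp ?ifT //; lia.
have per21 : per 0 (size s2) p1 s2.
  have wp j : size e1 <= j -> j + p1 < size e1 + q -> nth c0 s2 j = nth c0 s2 (j + p1).
    move=> j1 j2; rewrite !wnd; try lia.
    by rewrite pbp ?size_bar_word ?sp; [congr nth; lia | lia | lia].
  move=> j _ hj.
  have [j' [h1 h2 h3 h4]] : exists j', [/\ size e1 <= j', j' + p1 < size e1 + q, nth c0 s2 j' = nth c0 s2 j &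
      nth c0 s2 (j' + p1) = nth c0 s2 (j + p1)].
    have hm : (j + size e1 * p2 - size e1) %% p2 < p2 by rewrite ltn_mod; lia.
    have hge : size e1 <= size e1 * p2 by rewrite leq_pmulr; lia.
    pose d := j + size e1 * p2 - size e1.
    pose j' := size e1 + d %% p2.
    have hd : d = d %/ p2 * p2 + d %% p2 by rewrite -divn_eq.
    exists j'; split; first by rewrite /j'; lia.
    - by rewrite /j' /q; lia.
    - have e : j + size e1 * p2 = j' + (d %/ p2) * p2 by rewrite /j'; lia.
      case: (leqP (size e1) (d %/ p2)) => hh.
        have e' : j = j' + (d %/ p2 - size e1) * p2 by rewrite mulnBl; have := leq_mul hh (leqnn p2); lia.
        by rewrite e' nth_per // -e'; lia.
      have e' : j' = j + (size e1 - d %/ p2) * p2 by rewrite mulnBl; have := leq_mul (ltnW hh) (leqnn p2); lia.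
      by rewrite {1}e' nth_per // -e' /j'; lia.
    - have e : j + size e1 * p2 = j' + (d %/ p2) * p2 by rewrite /j'; lia.
      case: (leqP (size e1) (d %/ p2)) => hh.
        have e' : j + p1 = j' + p1 + (d %/ p2 - size e1) * p2 by rewrite mulnBl; have := leq_mul hh (leqnn p2); lia.
        by rewrite e' nth_per // -e'; lia.
      have e' : j' + p1 = j + p1 + (size e1 - d %/ p2) * p2 by rewrite mulnBl; have := leq_mul (ltnW hh) (leqnn p2); lia.
      by rewrite e' nth_per // -e' /j' /q; lia.
  by rewrite -h3 -h4 wp.
have hp0 : 0 < p1 by lia.
have hps1 : p1 <= size s1 by rewrite /q in hq; lia.
have [f1 ef1 sf1] := @per_wpow p1 s1 hp0 per1 hps1.
pose y0 := size e1 + (q - p1); pose y := y0 %% p1.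
have hy : y < p1 by rewrite ltn_mod; lia.
have dy : drop y0 s2 = bw v ++ e2.
  rewrite es2 ep bar_word_cat -!catA catA drop_size_cat //.
  by rewrite size_cat size_bar_word size_drop sp.
have y0y : y0 = y0 %/ p1 * p1 + y by rewrite /y -divn_eq.
have hys2 : p1 <= size (drop y s2) by rewrite size_drop; move: ss2; rewrite /q; lia.
have ty : take p1 (drop y s2) = bw v.
  apply: (@eq_from_nth _ c0); first by rewrite (size_takel hys2) size_bar_word.
  move=> i; rewrite (size_takel hys2) => hi; rewrite nth_take // nth_drop.
  have -> : nth c0 (bw v) i = nth c0 s2 (y0 + i).
    by rewrite -nth_drop dy nth_cat size_bar_word sv hi.
  have -> : y0 + i = (y + i) + y0 %/ p1 * p1 by lia.
  have e3 : y + i + y0 %/ p1 * p1 = y0 + i by lia.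
  by rewrite nth_per // e3; move: ss2; rewrite /y0 /q; lia.
have [f2 ef2 sf2] := @per_wpow p1 (drop y s2) hp0 (per_drop per21) hys2.
rewrite ty in ef2; rewrite -/v in ef1.
set a := size s1 %/ p1 in ef1; set b := size (drop y s2) %/ p1 in ef2.
have es2' : s2 = take y s2 ++ wpow (bw v) b ++ f2 by rewrite -ef2 cat_take_drop.
have sa : size s1 = a * p1 + size f1 by rewrite {1}ef1 size_cat size_wpow sv.
pose be' := f1 ++ be ++ take y s2; pose ga' := f2 ++ ga.
have eY' : val Y = al ++ wpow v a ++ be' ++ wpow (bw v) b ++ ga'.
  by rewrite eY ef1 {1}es2' /be' /ga' -!catA.
have sty : size (take y s2) < p1 by rewrite size_take; case: ifP; lia.
have sbe : size al + size be' + size ga' <= 69 * M by rewrite /be' /ga' !size_cat; lia.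
clearbody be' ga'.
have rva : reduced bar (wpow v a) by move: rs1; rewrite ef1; exact: reduced_catl.
pose T1 := T + 100 * M.
have occva : occ (bw v) (wpow v a) = 0.
  by have := occ_cat_ge (bw v) (wpow v a) f1; rewrite -ef1 inv1; lia.
have hba : b <= a by apply: leq_div2r; rewrite size_drop; lia.
have occY : occ (bw v) (val Y) <= 81 * M + occ v (wpow v b).
  rewrite eY'; have := occ_cat_size (bw v) al (wpow v a ++ be' ++ wpow (bw v) b ++ ga').
  have := occ_cat_le (bw v) (wpow v a) (be' ++ wpow (bw v) b ++ ga').
  have := occ_cat_size (bw v) be' (wpow (bw v) b ++ ga').
  have := occ_cat_size' (bw v) (wpow (bw v) b) ga'.
  by rewrite -bw_wpow (occ_bw barK) // occva !size_bar_word sv; lia.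
have occY' : occ v (wpow v a) <= occ v (val Y).
  rewrite eY'; have := occ_cat_ge v al (wpow v a ++ be' ++ wpow (bw v) b ++ ga').
  by have := occ_cat_ge v (wpow v a) (be' ++ wpow (bw v) b ++ ga'); lia.
case: (ltnP T1 (a - b)) => hT.
  exists v; split=> //; first by rewrite sv; lia.
  by left; rewrite /phi /phiw; have := occ_wpow_le nv hba; rewrite /T1 in hT; lia.
(* The two powers nearly balance, so [e] is short. It does not commute with [v], since otherwise the
   long reduced word [wpow v a ++ be' ++ wpow (bw v) b] would represent just [e]. *)
exfalso.
pose e : G := (cl (wpow v (a - b)) * cl be')%g.
pose V := wpow v b.
have ewa : wpow v a = V ++ wpow v (a - b) by rewrite /V -wpowD subnKC.
have rV : reduced bar V by move: rva; rewrite ewa; exact: reduced_catl.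
have T1p : T1 * p1 <= 3 * (M * T) + 300 * (M * M).
  have h1 : T1 * p1 <= T1 * (3 * M) by rewrite leq_mul2l; lia.
  have h2 : T1 * (3 * M) = 3 * (M * T) + 300 * (M * M) by rewrite /T1; lia.
  by lia.
have abp : (a - b) * p1 <= T1 * p1 by rewrite leq_mul2r hT orbT.
have sV : size V = b * p1 by rewrite size_wpow sv.
have hab : a * p1 = b * p1 + (a - b) * p1 by rewrite -mulnDl subnKC.
have le_e : len e <= 3 * (M * T) + 300 * (M * M) + 69 * M.
  rewrite /e; have := lenM (cl (wpow v (a - b))) (cl be').
  have := len_cl barK (wpow v (a - b)); have := len_cl barK be'.
  by rewrite size_wpow sv; lia.
have bigV : 100 * M + len e < size V by rewrite sV; lia.
have wred : reduced bar (wpow v a ++ be' ++ wpow (bw v) b).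
  by move: rY; rewrite eY' => /(reduced_catr barK) hh; apply: (@reduced_catl _ bar _ ga'); rewrite -2!catA.
have clw : cl (wpow v a ++ be' ++ wpow (bw v) b) = (cl V * e * (cl V)^-1)%g.
  by rewrite !cl_cat ewa cl_cat -bw_wpow cl_bw /e !mulgA.
have nc : ~ commute e (cl v).
  move=> ce; have cV : commute e (cl V) by rewrite cl_wpow; apply: commuteX.
  have : len (cl (wpow v a ++ be' ++ wpow (bw v) b)) = len e by rewrite clw -cV mulgK.
  by rewrite len_cl_reduced // ewa !size_cat; lia.
have eYg : Y = (cl al * (cl V * e * (cl V)^-1) * cl ga')%g.
  by rewrite -clw -[LHS]cl_val eY' !cl_cat !mulgA.
rewrite eYg in hsys; have [bl' [h' [hsys' sbl']]] := sys_change_both hsys.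
apply: (no_conj_power bar_free rV nc hsys').
have la := len_cl barK al; have lg := len_cl barK ga'.
set M4 := M + 2 * len (cl al) + 2 * len (cl ga').
have hM4 : M4 <= 139 * M by rewrite /M4; lia.
have h1 : (size bl').+1 * (len e + M4) <= (2 * M) * (3 * (M * T) + 300 * (M * M) + 208 * M).
  by apply: leq_mul; rewrite ?sbl'; lia.
have h2 : (2 * M) * (3 * (M * T) + 300 * (M * M) + 208 * M) = 6 * (M * (M * T)) + 600 * (M * (M * M)) + 416 * (M * M) by lia.
by rewrite -/V sV sv; lia.
Qed.

Lemma per_slice x y p w : per x y p w -> x <= y -> y <= size w -> 
  let s := take (y - x) (drop x w) in per 0 (size s) p s /\ size s = y - x.
Proof.
move=> h hxy hy s; have ss : size s = y - x by rewrite size_takel // size_drop; lia.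
split=> // j _; rewrite ss => hj; rewrite !nth_take ?nth_drop; try lia.
by rewrite h ?addnA //; lia.
Qed.

Lemma cat5 (w : seq C) x y z t : x <= y -> y <= z -> z <= t -> t <= size w ->
  w = take x w ++ take (y - x) (drop x w) ++ take (z - y) (drop y w) ++ take (t - z) (drop z w) ++ drop t w.
Proof.
move=> h1 h2 h3 h4.
have aux a b : a <= b -> drop a w = take (b - a) (drop a w) ++ drop b w.
  by move=> hab; rewrite -{1}(cat_take_drop (b - a) (drop a w)) drop_drop subnK.
by rewrite -(aux z t) // -(aux y z) // -(aux x y) // cat_take_drop.
Qed.

(** [large_phi_word] wants the longer periodic piece in front; passing to the inverse of the unknown
    exchanges the two pieces and only changes the sign of [phi]. *)
Lemma large_phi (X : G) M T bl h : sys X M bl h -> 0 < M -> size bl <= M ->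
  200 * M * M * T + 40 * 1000 * M * M * M <= len X ->
  exists p, [/\ p <> [::], size p <= 6 * M & (Posz T < phi p X)%R \/ (phi p X < - Posz T)%R].
Proof.
move=> hsys hM hbl hbig.
have M2 : M <= M * M by rewrite leq_pmulr.
have M3 : M * M <= M * M * M by rewrite leq_pmulr.
rewrite -!mulnA in hbig M2 M3.
have hL : 100 * M < len X by lia.
have [eps [x [p1 [p2 [hp1 hp2 hx q1 q2]]]]] := two_periodic c0 bar_free hsys hM hL.
have hsys' e : exists2 bl', sys (sgn X e) M bl' h & size bl' = size bl.
  by case: e; [exists bl | exists (flipb bl); [exact: sys_flip | rewrite size_map]].
have back e p : p <> [::] -> (Posz T < phi p (sgn X e))%R \/ (phi p (sgn X e) < - Posz T)%R ->
    (Posz T < phi p X)%R \/ (phi p X < - Posz T)%R.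
  by move=> np; case: e => //=; rewrite phiV //; lia.
pose x1 := maxn x (20 * M); pose x2 := minn (x1 + 20 * M) (len X - 20 * M); pose x3 := minn x1 x2.
have q1' : per (20 * M) x3 p1 (val (sgn X eps)) by move=> j h1 h2; apply: q1; lia.
have q2' : per x2 (len X - 20 * M) p2 (val (sgn X eps)) by move=> j h1 h2; apply: q2; lia.
have sw : size (val (sgn X eps)) = len X by rewrite -(len_sgn X eps).
have f1' : 20 * M <= x3 by lia.
have f2' : x3 <= x2 <= x3 + 20 * M by lia.
have f3' : x2 <= len X - 20 * M by lia.
clearbody x3; clearbody x2; clearbody x1.
case: (leqP (len X - 20 * M - x2) (x3 - 20 * M)) => hcmp.
  have [bl' hs sb] := hsys' eps.
  have [||r1 s1] := per_slice q1'; try lia.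
  have [||r2 s2] := per_slice q2'; try lia.
  have f1 : 20 * M <= x3 by lia.
  have f2 : x3 <= x2 by lia.
  have f3 : x2 <= len X - 20 * M by lia.
  have f4 : len X - 20 * M <= size (val (sgn X eps)) by rewrite sw; lia.
  have e5 := cat5 f1 f2 f3 f4.
  have hsb : size bl' <= M by rewrite sb.
  have hz : size (take (20 * M) (val (sgn X eps))) + size (take (x2 - x3) (drop x3 (val (sgn X eps)))) +
     size (drop (len X - 20 * M) (val (sgn X eps))) <= 60 * M.
    by rewrite !size_take !size_drop sw; do 2 case: ifP; lia.
  rewrite -s1 -s2 in hcmp.
  have hbg : 60 * M * M * T + 13 * 1000 * M * M * M <= size (take (x3 - 20 * M) (drop (20 * M) (val (sgn X eps)))).
    by rewrite s1 -!mulnA; move: hcmp; rewrite s1 s2; lia.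
  have [p [h1 h2 h3]] := large_phi_word hs hM hsb e5 hz hp1 hp2 r1 r2 hcmp hbg.
  by exists p; split=> //; apply: back h3.
have [bl' hs sb] := hsys' (~~ eps).
have ev : val (sgn X (~~ eps)) = bw (val (sgn X eps)) by rewrite sgnP val_inv.
have mir a b p : b <= len X -> per a b p (val (sgn X eps)) -> per (len X - b) (len X - a) p (val (sgn X (~~ eps))).
  move=> hb hper; rewrite ev -{1}sw -[in len X - a]sw -(size_bar_word bar); apply: per_bw => //.
    by rewrite size_bar_word sw.
  by rewrite (bar_wordK barK).
have m1 := mir _ _ _ _ q2'; have m2 := mir _ _ _ _ q1'.
have sw' : size (val (sgn X (~~ eps))) = len X by rewrite ev size_bar_word.
set wm := val (sgn X (~~ eps)) in sw' m1 m2 *.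
have k1 : len X - 20 * M <= len X by lia.
have k2 : x3 <= len X by lia.
have [||r1 s1] := per_slice (m1 k1); try lia.
have [||r2 s2] := per_slice (m2 k2); try lia.
have f1 : len X - (len X - 20 * M) <= len X - x2 by lia.
have f2 : len X - x2 <= len X - x3 by lia.
have f3 : len X - x3 <= len X - 20 * M by lia.
have f4 : len X - 20 * M <= size wm by rewrite sw'; lia.
have e5 := cat5 f1 f2 f3 f4.
have hsb : size bl' <= M by rewrite sb.
set A := take _ wm in e5; set B := take (len X - x3 - _) _ in e5; set D := drop (len X - 20 * M) wm in e5.
have hz : size A + size B + size D <= 60 * M.
  have : size D = 20 * M by rewrite /D size_drop sw'; lia.
  have : size A <= 20 * M by rewrite /A size_take; case: ifP; lia.
  have : size B <= 20 * M by rewrite /B size_take; case: ifP; lia.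
  by lia.
have hcmp' := ltnW hcmp.
have hcc : size (take (len X - 20 * M - (len X - x3)) (drop (len X - x3) wm)) <=
   size (take (len X - x2 - (len X - (len X - 20 * M))) (drop (len X - (len X - 20 * M)) wm)).
  by rewrite s1 s2; lia.
have hbg : 60 * M * M * T + 13 * 1000 * M * M * M <=
   size (take (len X - x2 - (len X - (len X - 20 * M))) (drop (len X - (len X - 20 * M)) wm)).
  by rewrite s1 -!mulnA; lia.
have [p [h1 h2 h3]] := large_phi_word hs hM hsb e5 hz hp2 hp1 r1 r2 hcc hbg.
by exists p; split=> //; apply: back h3.
Qed.
End Brooks.

End Counting.
Import Counting.

(** * Munn trees, and the bound on the reduced variable *)

Module LengthBound.
Import all_order all_algebra finmap.
Import Order.TTheory GRing.Theory Num.Theory.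

Lemma cl_reduce (C : choiceType) (bar : C -> C) (barK : involutive bar) w :
  cl barK (reduce bar w) = cl barK w.
Proof. by apply/clE; rewrite reduce_id // reduced_reduce. Qed.

Section Munn.
Variables (A : choiceType) (bar : A -> A) (barK : involutive bar).
Local Notation bw := (bar_word bar).

Lemma psi_cons a w : psi bar (a :: w) = fim_mul (fim_gen bar a) (psi bar w).
Proof. by []. Qed.

Lemma psi_snd w : (fim_val (psi bar w)).2 = reduce bar w.
Proof.
elim: w => // a w IH; rewrite psi_cons /= IH /fg_mul cat1s /=.
by rewrite reduce_id // reduced_reduce.
Qed.

Lemma psi_nil_mem w : [::] \in (fim_val (psi bar w)).1.
Proof.
elim: w => [|a w IH]; first by rewrite inE.
by rewrite psi_cons /= !inE eqxx.
Qed.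

Lemma psi_fst w h : reflect (exists i, h = reduce bar (take i w)) (h \in (fim_val (psi bar w)).1).
Proof.
apply: (iffP idP); elim: w h => [|a w IH] h.
- by rewrite inE => /eqP ->; exists 0.
- rewrite psi_cons /= !inE => /orP[/orP[/eqP->|/eqP->]|/imfsetP[k /= hk ->]].
  + by exists 0.
  + by exists 1; rewrite /= take0.
  + have [i ->] := IH _ hk; exists i.+1; rewrite /fg_mul cat1s /=.
    by rewrite (reduce_id (reduced_reduce _ _)).
- by case=> i ->; rewrite inE.
- case=> -[|i] ->; first by rewrite psi_nil_mem.
  rewrite psi_cons /= !inE; apply/orP; right; apply/imfsetP; exists (reduce bar (take i w)).
    by apply: IH; exists i.
  by rewrite /fg_mul cat1s /= (reduce_id (reduced_reduce _ _)).
Qed.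

Lemma psi_eqP u v : psi bar u = psi bar v <->
  reduce bar u = reduce bar v /\
  (forall h, (exists i, h = reduce bar (take i u)) <-> (exists i, h = reduce bar (take i v))).
Proof.
split=> [e|[e1 e2]].
  split; first by rewrite -!psi_snd e.
  by move=> h; split=> /psi_fst; [rewrite e | rewrite -e] => /psi_fst.
apply: val_inj; rewrite /= [LHS]surjective_pairing [RHS]surjective_pairing !psi_snd e1; congr pair.
by apply/fsetP => h; apply/psi_fst/psi_fst => /e2.
Qed.

Lemma idem_reduce w : fim_mul (psi bar w) (psi bar w) = psi bar w -> reduce bar w = [::].
Proof.
move/(congr1 (fun x => (fim_val x).2)); rewrite /= !psi_snd /fg_mul => e.
have : (cl barK w * cl barK w = cl barK w)%g by apply/val_inj.
by move/(congr1 (fun x => x * (cl barK w)^-1)%g); rewrite mulgK mulgV => /(congr1 val).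
Qed.
End Munn.

Section Unbalanced.
Variables (A : choiceType) (bar : A -> A) (barK : involutive bar) (Omega : eqType).
Hypothesis bar_free : forall a, bar a <> a.
Local Notation G := (fg barK).
Local Notation bw := (bar_word bar).
Local Notation cl := (cl barK).
Variable sigma : var Omega -> seq A.
Hypothesis sbar : forall v, sigma (var_bar v) = bw (sigma v).
Hypothesis sidem : forall Z, reduce bar (sigma (inl Z)) = [::].
Hypothesis sred : reduced bar (sigma (inr true)).
Local Notation sw := (subst_word sigma).
Local Notation X := (cl (sigma (inr true))).

Definition evx (w : seq (A + bool)) : G :=
  foldr (fun s g => (match s with inl a => cl [:: a] | inr b => sgn X b end * g)%g) 1%g w.

Lemma evx_cat u v : evx (u ++ v) = (evx u * evx v)%g.
Proof. by elim: u => [|s u IH] /=; rewrite ?mul1g // IH mulgA. Qed.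

Lemma barxK : involutive (barx bar).
Proof. by case=> [a|b] /=; rewrite ?barK ?negbK. Qed.

Lemma evx_bar s : evx [:: barx bar s] = (evx [:: s])^-1%g.
Proof.
by case: s => [a|[]] /=; rewrite ?mulg1 ?invgK // -cl_bw.
Qed.

Lemma evx_reduce w : evx (reduce (barx bar) w) = evx w.
Proof.
elim: w => // s w IH; rewrite -[s :: w]cat1s evx_cat -IH -[reduce _ ([:: s] ++ w)]/(cons_red (barx bar) s (reduce (barx bar) w)).
case: (reduce _ w) => [|d v]; first by rewrite mulg1.
rewrite /cons_red.
case: eqP => [->|_]; last by rewrite -[_ :: _ :: _]cat1s evx_cat.
by rewrite -[barx bar s :: v]cat1s evx_cat evx_bar mulVKg.
Qed.

Lemma sgn_sigma b : cl (sigma (inr b)) = sgn X b.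
Proof. by case: b => //=; rewrite -cl_bw -sbar. Qed.

Lemma sw_cat u v : sw (u ++ v) = sw u ++ sw v.
Proof. by rewrite /subst_word map_cat flatten_cat. Qed.
Lemma sw_cons s v : sw (s :: v) = subst_symb sigma s ++ sw v. Proof. by []. Qed.

Lemma cl_sw U : cl (sw U) = evx (pmap (@erase_idem A Omega) U).
Proof.
elim: U => // s U IH; rewrite sw_cons cl_cat IH.
case: s => [a|[Z|b]] //=; last by rewrite sgn_sigma.
by rewrite -cl_reduce sidem mul1g.
Qed.

Fixpoint blocks (w : seq (A + bool)) : seq A * seq (bool * G) :=
  match w with
  | [::] => ([::], [::])
  | inl a :: w' => let: (c, bl) := blocks w' in (a :: c, bl)
  | inr b :: w' => let: (c, bl) := blocks w' in ([::], (b, cl c) :: bl)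
  end.

Lemma blocksP w : reduced (barx bar) w ->
  [/\ evx w = (cl (blocks w).1 * prodb X (blocks w).2)%g, reduced bar (blocks w).1,
      alt (blocks w).2, size (blocks w).1 + size (blocks w).2 <= size w &
      [/\ all (fun b : bool * G => len b.2 <= size w) (blocks w).2,
      (blocks w).1 = [::] -> w = [::] \/ exists b w', w = inr b :: w' &
      (forall a c, (blocks w).1 = a :: c -> exists w', w = inl a :: w')
      /\ (forall b w', w = inr b :: w' -> exists g bl, (blocks w).2 = (b, g) :: bl)]].
Proof.
elim: w => [|s w IH] rw; first by split=> //; rewrite ?mul1g //; split=> //; left.
have /IH : reduced (barx bar) w by apply: (reduced_catr barxK (u := [:: s])).
case: s rw => [a|b] rw /=; case: (blocks w) => c bl /= [h1 h2 h3 h4 [h5 h6 [h7 h8]]].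
  split=> //.
  - by rewrite h1 -(cat1s a c) cl_cat mulgA.
  - change (is_true (reduced bar ([:: a] ++ c))); apply: reduced_cat => // u' x v' y; case: u' => [|z [|z' u']] //= [<-] ec.
    have [w' ew] := h7 _ _ ec; move: rw; rewrite ew /reduced /= => /andP[+ _].
    by apply: contra => /eqP->.
  split=> //.
  - by apply: sub_all h5 => x; lia.
  - by split=> // x y [<- _]; exists w.
split=> //.
- by rewrite h1 mul1g mulgA.
- rewrite /alt; case: bl h3 h4 h8 {h1 h5} => //= -[b' g'] bl h3 h4 h8; rewrite h3 andbT /=.
  case: c h6 h7 h2 h4 => [|x c] h6 h7 h2 h4; last first.
    apply/orP; right; apply/eqP => e.
    by have := cl_inj h2 (isT : reduced bar [::]) e.
  have [ew|[b1 [w' ew]]] := h6 erefl; first by move: h4; rewrite ew.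
  have [g1 [bl1 [e1 _ _]]] := h8 _ _ ew.
  by move: rw; rewrite ew /reduced /= => /andP[+ _]; rewrite e1 /=; case: (b) (b1) => [] [].
- by lia.
split=> //.
- by have := len_cl barK c; rewrite (sub_all _ h5) ?andbT => [|x]; lia.
- by move=> _; right; exists b, w.
- by split=> // b1 w1 [<- _]; exists (cl c), bl.
Qed.

(** The blocks come from the reduced form [W] of [U^-1 V] over [A] and [x]. It is nonempty, and it
    contains [x]: a nonempty reduced word of constants would not evaluate to 1. *)
Lemma sys_of_equation U V : pi_A_Gamma bar U <> pi_A_Gamma bar V -> cl (sw U) = cl (sw V) ->
  exists bl h, sys X (size U + size V).+1 bl h /\ size bl <= (size U + size V).+1.
Proof.
move=> npi e; pose W := reduce (barx bar) (bar_word (barx bar) (pi_A_Gamma bar U) ++ pi_A_Gamma bar V).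
have rW : reduced (barx bar) W by apply: reduced_reduce.
have nW : W <> [::].
  move=> W0; apply: npi.
  have : FreeGroup.cl barxK (bar_word (barx bar) (pi_A_Gamma bar U) ++ pi_A_Gamma bar V) = 1%g by apply: val_inj.
  rewrite cl_cat cl_bw => h; apply: (cl_inj (barK := barxK)); rewrite ?reduced_reduce //.
  by rewrite -[LHS]invgK; apply: mulg1_eq.
have eW : evx W = 1%g.
  have ebw w : evx (bar_word (barx bar) w) = (evx w)^-1%g.
    elim: w => [|s w IH]; first by rewrite invg1.
    by rewrite bar_word_cons -cats1 evx_cat IH evx_bar -invgM -evx_cat.
  by rewrite evx_reduce evx_cat ebw !evx_reduce -!cl_sw e mulVg.
have sW : size W <= size U + size V.
  apply: leq_trans (size_reduce _ _) _; rewrite size_cat size_bar_word.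
  have aux w : size (pi_A_Gamma bar w) <= size w.
    by apply: leq_trans (size_reduce _ _) _; rewrite size_pmap count_size.
  by apply: leq_add.
have [h1 h2 h3 h4 [h5 h6 [h7 h8]]] := blocksP rW.
exists (blocks W).2, (cl (blocks W).1)^-1%g; split; last by lia.
split=> //.
- move=> e0; rewrite e0 mulg1 eW in h1; have c0 := cl_inj h2 (isT : reduced bar [::]) (esym h1).
  have [//|[b [w' ew]]] := h6 c0; have [g [bl]] := h8 _ _ ew; by rewrite e0.
- by apply: sub_all h5 => x; lia.
- by rewrite lenV; have := len_cl barK (blocks W).1; lia.
- by apply/esym/mulg1_eq; rewrite -h1.
Qed.

Lemma deltaS b U s : delta b (rcons U s) = (delta b U + ((s == rvar A Omega b)%:Z - (s == rvar A Omega (~~ b))%:Z))%R.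
Proof. by rewrite /delta -cats1 !count_cat /=; lia. Qed.

Section Height.
Variables (f : G -> int) (D : nat) (b : bool).
Hypothesis f1 : f 1%g = 0%R.
Hypothesis fM : forall g h, (- D%:Z <= f (g * h)%g - f g - f h <= D%:Z)%R.
Hypothesis fV : forall g, f (g^-1)%g = (- f g)%R.
Hypothesis fl : forall a, (- D%:Z <= f (cl [:: a]) <= D%:Z)%R.
Local Notation rho := (f (sgn X b)).

(** A quasimorphism [f] of defect [D] is additive along a word up to an error of order [D] per
    symbol. Idempotent variables have trivial value in the free group, so only the signed count of
    [x] matters. *)
Lemma height U : (- (2 * D * size U)%:Z <= f (cl (sw U)) - delta b U * rho <= (2 * D * size U)%:Z)%R.
Proof.
elim/last_ind: U => [|U s IH].
  by rewrite /subst_word /= f1 /delta /=; lia.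
rewrite deltaS size_rcons -cats1 sw_cat cl_cat.
have hs : ((s == rvar A Omega b)%:Z - (s == rvar A Omega (~~ b))%:Z = 0 /\ (- D%:Z <= f (cl (sw [:: s])) <= D%:Z)
   \/ (s == rvar A Omega b)%:Z - (s == rvar A Omega (~~ b))%:Z = 1 /\ f (cl (sw [:: s])) = rho
   \/ (s == rvar A Omega b)%:Z - (s == rvar A Omega (~~ b))%:Z = -1 /\ f (cl (sw [:: s])) = - rho)%R.
  case: s => [a|[Z|c]].
  - by left; split=> //; rewrite /subst_word /=; exact: fl.
  - by left; split=> //; rewrite /subst_word /= cats0 -cl_reduce sidem f1; lia.
  - rewrite /subst_word /= cats0 sgn_sigma; right.
    have [->|nb] := eqVneq c b; first by left; split=> //; rewrite eqxx; case: (b).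
    have -> : c = ~~ b by case: c (b) nb => [] [].
    right; split; first by case: (b).
    by rewrite sgnP fV.
have := fM (cl (sw U)) (cl (sw [:: s])).
have e2 : (2 * D * (size U).+1)%N = (2 * D * size U + 2 * D)%N by lia.
rewrite e2 mulrDl.
set dU := delta b U in IH *; set ds := (_ - _)%R in hs *.
by case: hs => [[-> hh]|[[-> ->]|[-> ->]]]; lia.
Qed.

Lemma unbalanced1 U V : delta b U <> delta b V -> cl (sw U) = cl (sw V) ->
  (rho <= (2 * D * (size U + size V))%:Z)%R.
Proof.
move=> hd e; have := height U; have := height V; rewrite e.
set x := delta b U in hd *; set y := delta b V in hd *.
have e2 : (2 * D * (size U + size V))%N = (2 * D * size U + 2 * D * size V)%N by lia.
rewrite e2; set P := (2 * D * size U)%N; set Q := (2 * D * size V)%N.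
case: (lerP rho 0) => hr; first by lia.
nia.
Qed.

Lemma prefix_cases U i : exists U' s k, 
  (exists U'', U = U' ++ s ++ U'') /\ (s = [::] /\ k = 0 \/ exists c, s = [:: c]) /\ take i (sw U) = sw U' ++ take k (sw s).
Proof.
elim: U i => [|c U IH] i.
  by exists [::], [::], 0; split; [exists [::] | split; [left |]].
case: (leqP i (size (subst_symb sigma c))) => hi.
  exists [::], [:: c], i; split; first by exists U.
  by split; [right; exists c | rewrite sw_cons takel_cat // /subst_word /= cats0].
have [U' [s [k [[U'' eU] [hs e]]]]] := IH (i - size (subst_symb sigma c)).
exists (c :: U'), s, k; split; first by exists U''; rewrite eU.
split=> //; rewrite sw_cons take_cat ltnNge (ltnW hi) /= e.
by rewrite sw_cons catA.
Qed.

Lemma reach b' (m : int) (U : seq (symb A Omega)) : (delta b' (@nil (symb A Omega)) <= m)%R ->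
  (exists2 U1, prefix U1 U & (m < delta b' U1)%R) ->
  exists U' U'', U = U' ++ rvar A Omega b' :: U'' /\ delta b' U' = m.
Proof.
move=> h0 [U1 /prefixP[U2 ->]]; elim/last_ind: U1 U2 => [|U1 s IH] U2 hm; first by move: hm; rewrite ltNge h0.
rewrite cat_rcons; case: (ltrP m (delta b' U1)) => hU1; first exact: IH.
rewrite deltaS in hm.
have [es|ns] := eqVneq s (rvar A Omega b'); last first.
  by move: hm; rewrite (negbTE ns); lia.
exists U1, U2; rewrite es; split=> //; move: hm; rewrite es eqxx.
have -> : (rvar A Omega b' == rvar A Omega (~~ b')) = false by case: (b').
by rewrite /=; lia.
Qed.

(** Compare the maximum of [f] on the two Munn trees, which coincide. Dominance lets [U] start an
    occurrence of [x] at the top level [m] of [V], and so climb about [m * rho + S], where [S] is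
    the maximum of [f] on prefixes of [x]. In [V], a vertex at a letter or inside [x] or its inverse
    stays lower by about [rho], and one inside the value of some [Z] is beaten by the copy of [Z]
    that dominance provides in [U]. *)
Lemma unbalanced2 U V : delta_dominates b U V ->
  (forall h, (exists i, h = reduce bar (take i (sw U))) <-> (exists i, h = reduce bar (take i (sw V)))) ->
  (rho <= (2 * D * (size U + size V) + 4 * D)%:Z)%R.
Proof.
move=> hdom htree; rewrite leNgt; apply/negP => hrho.
have e2 : (2 * D * (size U + size V) + 4 * D)%N = (2 * D * size U + 2 * D * size V + 4 * D)%N by lia.
rewrite e2 in hrho.
have hpre W W' W'' : W = W' ++ W'' -> (- (2 * D * size W)%:Z <= f (cl (sw W')) - delta b W' * rho <= (2 * D * size W)%:Z)%R.
  move=> ->; have := height W'; rewrite size_cat.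
  have -> : (2 * D * (size W' + size W''))%N = (2 * D * size W' + 2 * D * size W'')%N by lia.
  set P := (2 * D * size W')%N; set Q := (2 * D * size W'')%N; lia.
set eU := (2 * D * size U)%N in hrho hpre *; set eV := (2 * D * size V)%N in hrho hpre *.
have max_f (w : seq A) : exists i, forall j, (f (cl (take j w)) <= f (cl (take i w)))%R.
  have [i hi] : exists i, forall j, j <= size w -> (f (cl (take j w)) <= f (cl (take i w)))%R.
    elim: (size w) => [|n [i hi]]; first by exists 0 => j; rewrite leqn0 => /eqP->.
    case: (lerP (f (cl (take n.+1 w))) (f (cl (take i w)))) => hn.
      by exists i => j; rewrite leq_eqVlt => /orP[/eqP->//|]; exact: hi.
    exists n.+1 => j; rewrite leq_eqVlt => /orP[/eqP->//|hj].
    by have := hi _ hj; lia.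
  exists i => j; case: (leqP j (size w)) => [/hi//|hj].
  by rewrite take_oversize ?(ltnW hj) // -{1}(take_size w); apply: hi.
set rb := sigma (inr b); have clrb : cl rb = sgn X b := sgn_sigma b.
have [iS hS] := max_f rb; set S := f (cl (take iS rb)) in hS.
have S0 : (0 <= S)%R by have := hS 0; rewrite take0 f1.
have Srho : (rho <= S)%R by have := hS (size rb); rewrite take_size clrb.
have [m [V1 hV1 mV1] hmax] : exists2 m, (exists2 V1, prefix V1 V & delta b V1 = m) & forall V', prefix V' V -> (delta b V' <= m)%R.
  have : exists2 m, (exists2 V1, prefix V1 V & delta b V1 = m) & forall k, k <= size V -> (delta b (take k V) <= m)%R.
    elim: (size V) => [|n [m [V1 hV1 mV1] hm]].
      by exists (delta b (take 0 V)) => [|k]; [exists (take 0 V); rewrite ?prefix_take | rewrite leqn0 => /eqP->].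
    case: (lerP (delta b (take n.+1 V)) m) => hn.
      by exists m => [|k]; [exists V1 | rewrite leq_eqVlt => /orP[/eqP->//|]; exact: hm].
    exists (delta b (take n.+1 V)) => [|k]; first by exists (take n.+1 V); rewrite ?prefix_take.
    by rewrite leq_eqVlt => /orP[/eqP->//|/hm]; lia.
  case=> m h1 h2; exists m => // V' hV'; have := size_prefix hV' => hs.
  by move: (h2 _ hs); move: hV'; rewrite prefixE => /eqP->.
have m0 : (delta b (@nil (symb A Omega)) <= m)%R by apply: hmax; exact: prefix0s.
have d0 : delta b (@nil (symb A Omega)) = 0%R by rewrite /delta /=; lia.
(* Some prefix of [U] exceeds level [m], and levels change by one; the step that leaves level [m] is
   the occurrence wanted. *)
have [U' [U'' [eUU dU']]] : exists U' U'', U = U' ++ rvar A Omega b :: U'' /\ delta b U' = m.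
  apply: reach => //; have [|U1 h1 h2] := hdom None V1; first by rewrite cats0.
  by exists U1; [move: h1; rewrite cats0 | rewrite -mV1].
have in_tree W' c W'' k : exists i, sw W' ++ take k (subst_symb sigma c) = take i (sw (W' ++ c :: W'')).
  exists (size (sw W') + minn k (size (subst_symb sigma c))).
  rewrite sw_cat sw_cons take_cat ltnNge leq_addr /= addKn takel_cat ?geq_minr //; congr (_ ++ _).
  by case: (leqP k (size (subst_symb sigma c))) => // hk; rewrite take_size take_oversize // ltnW.
have [iQ hQ] := max_f (sw U); set Q := f (cl (take iQ (sw U))) in hQ.
have hPs : (m * rho - eU%:Z + S - D%:Z <= Q)%R.
  have [i ei] := in_tree U' (rvar A Omega b) U'' iS.
  have := hQ i; rewrite {1}eUU -ei cl_cat -[subst_symb sigma (rvar A Omega b)]/rb.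
  have := fM (cl (sw U')) (cl (take iS rb)); rewrite -/S.
  have := hpre U U' _ eUU; rewrite dU' -/eU; lia.
have rho0 : (0 < rho)%R by lia.
have mul_le d : (d <= m -> d * rho <= m * rho)%R by move=> hd; rewrite ler_wpM2r // ltW.
have mul_le1 d : (d <= m - 1 -> d * rho <= m * rho - rho)%R.
  by move=> hd; have : (d * rho <= (m - 1) * rho)%R by [rewrite ler_wpM2r // ltW]; rewrite mulrBl mul1r.
have [j ej] : exists j, reduce bar (take iQ (sw U)) = reduce bar (take j (sw V)) by apply/htree; exists iQ.
have {ej} eQ : Q = f (cl (take j (sw V))) by rewrite /Q -cl_reduce ej cl_reduce.
have [V' [s [k [[V'' eVV] [hs es]]]]] := prefix_cases V j.
rewrite es cl_cat in eQ.
have hV' := hpre V V' _ eVV; rewrite -/eV in hV'; have dV' : (delta b V' <= m)%R by apply: hmax; rewrite eVV prefix_prefix.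
have := fM (cl (sw V')) (cl (take k (sw s))); rewrite -eQ => hfQ.
case: hs => [[s0 k0]|[c ec]].
  by move: hfQ; rewrite s0 k0 take0 f1; have := mul_le _ dV'; lia.
have esw : sw s = subst_symb sigma c by rewrite ec /subst_word /= cats0.
rewrite esw in hfQ eQ.
have dVs : (delta b (rcons V' c) <= m)%R.
  by apply: hmax; rewrite eVV ec -cats1; apply/prefixP; exists V''; rewrite -catA.
have eVc : V = rcons V' c ++ V'' by rewrite eVV ec cat_rcons.
rewrite deltaS in dVs; case: c ec hfQ eQ dVs eVc {esw} => [a|[Z|c]] ec hfQ eQ dVs eVc.
- have : (f (cl (take k [:: a])) <= D%:Z)%R.
    by case: k {es hfQ eQ} => [|k] /=; rewrite ?take0 ?f1 //; case/andP: (fl a).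
  by rewrite /= in hfQ; have := mul_le _ dV'; lia.
(* The value of [Z] may reach arbitrarily high, so only the same [Z] at a higher level of [U] can
   exceed it. *)
- have [|U2 hU2 dU2] := hdom (Some Z) V'; first by apply/prefixP; exists V''; rewrite eVV ec -catA.
  case/prefixP: hU2 => U3 eU3; rewrite -catA /= in eU3.
  have [i ei] := in_tree U2 (idem A Z) U3 k.
  have := hQ i; rewrite {1}eU3 -ei cl_cat -[subst_symb sigma (idem A Z)]/(sigma (inl Z)).
  have := fM (cl (sw U2)) (cl (take k (sigma (inl Z)))); rewrite /= in hfQ.
  have := hpre U U2 _ eU3; rewrite -/eU.
  have : (delta b V' * rho + rho <= delta b U2 * rho)%R.
    have : ((delta b V' + 1) * rho <= delta b U2 * rho)%R by rewrite ler_wpM2r ?(ltW rho0) // lezD1; exact: dU2.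
    by rewrite mulrDl mul1r.
  by lia.
have [ecb|ncb] := eqVneq c b.
  rewrite ecb in dVs hfQ; have hk := hS k; rewrite /= -/rb in hfQ.
  have d1 : (delta b V' <= m - 1)%R.
    have dVs' := dVs; move: dVs'; rewrite -/(rvar A Omega b) eqxx (_ : (rvar A Omega b == rvar A Omega (~~ b)) = false) ?subr0; last by rewrite /rvar; case: (b).
    by rewrite lerBrDr.
  by have := mul_le1 _ d1; lia.
have ecb : c = ~~ b by case: c (b) ncb {ec hfQ eQ dVs eVc} => [] [].
rewrite ecb in dVs eQ eVc.
have esc : sigma (inr (~~ b)) = bw rb by rewrite /rb -sbar.
(* A vertex inside the inverse of [x] is reached from the end of that occurrence along a prefix of
   [x], where [S] bounds [f]. *)
have eQ' : Q = f (cl (sw (rcons V' (rvar A Omega (~~ b)))) * cl (take (size rb - k) rb))%g.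
  rewrite eQ; congr f; rewrite -cats1 sw_cat cl_cat -!mulgA; congr (_ * _)%g.
  rewrite /subst_word /= cats0 esc.
  have -> : take k (bw rb) = bw (drop (size rb - k) rb).
    rewrite bar_word_drop; case: (leqP k (size rb)) => hk; first by rewrite subKn.
    by rewrite !take_oversize ?size_bar_word //; lia.
  have e3 : cl rb = (cl (take (size rb - k) rb) * cl (drop (size rb - k) rb))%g by rewrite -cl_cat cat_take_drop.
  by rewrite !cl_bw e3 invgM -mulgA mulVg mulg1.
have hk := hS (size rb - k).
have := fM (cl (sw (rcons V' (rvar A Omega (~~ b))))) (cl (take (size rb - k) rb)); rewrite -eQ'.
have := hpre V _ _ eVc; rewrite -/eV -!/(rvar A Omega (~~ b)) deltaS -!/(rvar A Omega (~~ b)).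
have d1 : (delta b V' + ((rvar A Omega (~~ b) == rvar A Omega b)%:Z - (rvar A Omega (~~ b) == rvar A Omega (~~ b))%:Z) <= m - 1)%R.
  rewrite eqxx (_ : (rvar A Omega (~~ b) == rvar A Omega b) = false) ?sub0r; last by rewrite /rvar; case: (b).
  by rewrite lerD2r.
move: (mul_le1 _ d1); set y := f (cl (sw _)); set dd := (_ + _)%R; set z := (dd * rho)%R => h1 h2 h3.
have h4 : (y <= m * rho - rho + eV%:Z)%R by clearbody y z; lia.
by clearbody y; clear h2; lia.
Qed.
End Height.

(** Coarse form of the threshold of [large_phi] for [T = 36 * M * (M + 1)] and [M = n.+1]: the terms
    of degree 4 and 3 add up to less than [60000 * M ^ 4]. *)
Definition xbound n := 600 * (100 * n.+1 ^ 4).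

Lemma solution_bound (S : seq (equation A Omega)) (U V : seq (symb A Omega)) : is_solution bar S sigma -> (U, V) \in S ->
  strongly_unbalanced bar (U, V) -> size (sigma (inr true)) <= xbound (size U + size V).
Proof.
case=> _ _ _ hS hUV [npi hsu]; rewrite leqNgt; apply/negP => hbig.
have /psi_eqP [ered htree] := hS _ _ hUV.
have ecl : cl (sw U) = cl (sw V) by apply/clE.
have [bl [h [hsys hbl]]] := sys_of_equation npi ecl.
set n := size U + size V in hsys hbl hbig; set M := n.+1 in hsys hbl.
(* The word [p] has at most [6 * M] letters, so [phi p] has defect [D = 18 * M]; [T] is the bound
   [2 * D * (size U + size V) + 4 * D] of [unbalanced2]. *)
pose T := 36 * M * (M + 1).
have c0 : A by case: (sigma (inr true)) hbig => [|a s _]; [rewrite ltn0 | exact: a].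
have lX : len X = size (sigma (inr true)) by rewrite len_cl_reduced.
have hT : 200 * M * M * T + 40 * 1000 * M * M * M <= len X.
  rewrite lX; apply: leq_trans (ltnW hbig); rewrite /xbound -/M /T.
  have -> : M ^ 4 = M * (M * (M * M)) by rewrite !expnS expn0 muln1.
  have h1 : M * M <= M * (M * M) by rewrite leq_pmull.
  have h2 : M * (M * M) <= M * (M * (M * M)) by rewrite leq_pmull.
  have -> : 200 * M * M * (36 * M * (M + 1)) = 72 * 100 * (M * (M * (M * M))) + 72 * 100 * (M * (M * M)) by lia.
  by rewrite -!mulnA; lia.
have [p [np sp hphi]] := large_phi c0 bar_free hsys (ltn0Sn _) hbl hT.
(* [phi p] may be very positive or very negative on [X], and the condition may concern [x] or its
   inverse; a suitable sign makes [f] very positive in all four cases. *)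
pose f b := if b then phi p else (fun g : G => - phi p g)%R.
have key b0 b : delta b U <> delta b V \/ delta_dominates b U V -> (T%:Z < f b0 (sgn X b))%R -> False.
  set D := 18 * M.
  have hf1 : f b0 1%g = 0%R by rewrite /f; case: (b0); rewrite phi1 ?oppr0.
  have hfM g1 g2 : (- D%:Z <= f b0 (g1 * g2)%g - f b0 g1 - f b0 g2 <= D%:Z)%R.
    by have := phiM g1 g2 np; rewrite /f /D; case: (b0); lia.
  have hfV g : f b0 (g^-1)%g = (- f b0 g)%R by rewrite /f; case: (b0); rewrite phiV.
  have hfl a : (- D%:Z <= f b0 (cl [:: a]) <= D%:Z)%R.
    by have := phi_letter barK a np; rewrite /f /D; case: (b0); lia.
  have eT : 2 * D * (size U + size V) + 4 * D <= T by rewrite -/n /D /T /M; lia.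
  case=> hd; first by move=> hh; have hh' := unbalanced1 hf1 hfM hfV hfl hd ecl; move: (lt_le_trans hh hh'); rewrite ltz_nat ltnNge => /negP; apply; apply: leq_trans eT; exact: leq_addr.
  by move=> hh; have hh' := unbalanced2 hf1 hfM hfV hfl hd htree; move: (lt_le_trans hh hh'); rewrite ltz_nat ltnNge => /negP; apply; exact: eT.
have fin b : delta b U <> delta b V \/ delta_dominates b U V -> False.
  move=> hd; case: b hd => hd; case: hphi => hp.
  - by apply: (key true true hd).
  - by apply: (key false true hd); rewrite /f /=; lia.
  - by apply: (key false false hd); rewrite /f /= phiV //; lia.
  - by apply: (key true false hd); rewrite /f /= phiV //; lia.
by case: hsu => hd; [apply: (fin true); left | apply: (fin true); right | apply: (fin false); right].
Qed.
End Unbalanced.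

End LengthBound.
Import LengthBound.

(** * A small imperative language and its compilation to Turing machines *)

Module Machines.
Import all_order all_algebra finmap FunctionalExtensionality.

Definition upd (T : Type) (f : nat -> T) (i : nat) (x : T) : nat -> T :=
  fun j => if j == i then x else f j.

Lemma upd_same T (f : nat -> T) i x : upd f i x i = x.
Proof. by rewrite /upd eqxx. Qed.

Lemma upd_other T (f : nat -> T) i x j : j <> i -> upd f i x j = f j.
Proof. by rewrite /upd => /eqP/negbTE ->. Qed.

Lemma upd_id T (f : nat -> T) i : upd f i (f i) = f.
Proof. by apply: functional_extensionality => j; rewrite /upd; case: eqP => // ->. Qed.

Lemma upd_upd T (f : nat -> T) i x y : upd (upd f i x) i y = upd f i y.
Proof. by apply: functional_extensionality => j; rewrite /upd; case: eqP. Qed.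

Lemma updC T (f : nat -> T) i j x y : i <> j -> upd (upd f i x) j y = upd (upd f j y) i x.
Proof.
by move=> ij; apply: functional_extensionality => k; rewrite /upd; do 2 case: eqP => //; lia.
Qed.

Section Machine.
Variable I : finType.
Notation sy := (option (I + option bool)).
Notation tp := (tape sy).

(** Tapes are addressed by number without limit, and tests look only at the symbol under one head.
    The relation [exec] carries the exact number of machine steps, which makes termination and
    running time one statement. *)
Inductive prog :=
| Skip
| Do of nat & (sy -> sy * move)
| Seq of prog & prog
| While of nat & (sy -> bool) & prog
| When of nat & (sy -> bool) & prog.

Definition act (f : sy -> sy * move) (t : tp) : tp :=
  tape_move None (tape_write t (f (tape_head t)).1) (f (tape_head t)).2.

Inductive exec : prog -> (nat -> tp) -> nat -> (nat -> tp) -> Prop :=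
| ExecSkip ts : exec Skip ts 0 ts
| ExecDo i f ts : exec (Do i f) ts 1 (upd ts i (act f (ts i)))
| ExecSeq p q ts n ts1 m ts2 : exec p ts n ts1 -> exec q ts1 m ts2 ->
    exec (Seq p q) ts (n + m) ts2
| ExecWhileF i g p ts : ~~ g (tape_head (ts i)) -> exec (While i g p) ts 1 ts
| ExecWhileT i (g : sy -> bool) p ts n ts1 m ts2 : g (tape_head (ts i)) -> exec p ts n ts1 ->
    exec (While i g p) ts1 m ts2 -> exec (While i g p) ts (n + m).+2 ts2
| ExecWhenF i g p ts : ~~ g (tape_head (ts i)) -> exec (When i g p) ts 1 ts
| ExecWhenT i (g : sy -> bool) p ts n ts1 : g (tape_head (ts i)) -> exec p ts n ts1 ->
    exec (When i g p) ts n.+1 ts1.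

Definition instr : Type := nat * (sy -> nat * (sy * move)).

Fixpoint csize (p : prog) : nat :=
  match p with
  | Skip => 0
  | Do _ _ => 1
  | Seq p q => csize p + csize q
  | While _ _ p => (csize p).+2
  | When _ _ p => (csize p).+1
  end.

(** Jumps are absolute, so the address [k] at which the code will be placed is a parameter. A loop
    is a test in front and an unconditional jump behind. *)
Fixpoint compile (p : prog) (k : nat) : seq instr :=
  match p with
  | Skip => [::]
  | Do i f => [:: (i, fun s => (k.+1, f s))]
  | Seq p q => compile p k ++ compile q (k + csize p)
  | While i g p =>
      (i, fun s => (if g s then k.+1 else k + (csize p).+2, (s, Stay)))
      :: rcons (compile p k.+1) (i, fun s => (k, (s, Stay)))
  | When i g p =>
      (i, fun s => (if g s then k.+1 else k + (csize p).+1, (s, Stay)))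
      :: compile p k.+1
  end.

Lemma size_compile p k : size (compile p k) = csize p.
Proof.
elim: p k => //= [p IHp q IHq k|i g p IH k|i g p IH k].
- by rewrite size_cat IHp IHq.
- by rewrite size_rcons IH.
- by rewrite IH.
Qed.

Lemma compile_bound p k x s : List.In x (compile p k) -> (x.2 s).1 <= k + csize p.
Proof.
elim: p k => //= [i f|p IHp q IHq|i g p IH|i g p IH] k.
- by case=> // <- /=; lia.
- by rewrite List.in_app_iff => -[/IHp|/IHq]; lia.
- case=> [<- /=|]; first by case: ifP; lia.
  rewrite -cats1 List.in_app_iff => -[/IH|[<-|]] //=; lia.
- case=> [<- /=|/IH]; last by lia.
  by case: ifP; lia.
Qed.

Definition fetch (code : seq instr) (pc : nat) : instr :=
  nth (0, fun s => (0, (s, Stay))) code pc.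

Definition istep (code : seq instr) (c : nat * (nat -> tp)) : nat * (nat -> tp) :=
  let: (pc, ts) := c in
  if pc < size code then
    let: (i, f) := fetch code pc in
    let: (pc', _) := f (tape_head (ts i)) in
    (pc', upd ts i (act (fun s => (f s).2) (ts i)))
  else c.

Arguments istep : simpl never.

Lemma act_stay (t : tp) : act (fun s => (s, Stay)) t = t.
Proof. by case: t. Qed.

Lemma istep_fetch code pc ts i f : pc < size code -> fetch code pc = (i, f) ->
  istep code (pc, ts) = ((f (tape_head (ts i))).1, upd ts i (act (fun s => (f s).2) (ts i))).
Proof. by rewrite /istep => -> ->; case: (f _). Qed.

Lemma istep_test code pc ts i (h : sy -> nat) : pc < size code ->
  fetch code pc = (i, fun s => (h s, (s, Stay))) ->
  istep code (pc, ts) = (h (tape_head (ts i)), ts).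
Proof. by move=> hp e; rewrite (istep_fetch ts hp e) /= act_stay upd_id. Qed.

Lemma fetch_cat pre x post : fetch (pre ++ x :: post) (size pre) = x.
Proof. by rewrite /fetch nth_cat ltnn subnn. Qed.

(** The code is run inside an arbitrary context so that the induction covers the parts of sequences
    and the bodies of loops. *)
Lemma compile_run p ts n ts' : exec p ts n ts' -> forall pre post,
  iter n (istep (pre ++ compile p (size pre) ++ post)) (size pre, ts)
  = (size pre + csize p, ts').
Proof.
elim=> {p ts n ts'}.
- by move=> ts pre post /=; rewrite addn0.
- move=> i f ts pre post /=; rewrite (@istep_fetch _ _ _ i (fun s => ((size pre).+1, f s))) ?addn1 //.
    by rewrite size_cat /=; lia.
  by rewrite fetch_cat.
- move=> p q ts n ts1 m ts2 _ IH1 _ IH2 pre post /=.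
  rewrite addnC iterD -catA IH1.
  have := IH2 (pre ++ compile p (size pre)) post.
  by rewrite size_cat size_compile -!catA => ->; rewrite addnA.
- move=> i g p ts hg pre post /=; rewrite (istep_test _ _ (fetch_cat _ _ _)).
    by rewrite (negbTE hg).
  by rewrite size_cat /=; lia.
- move=> i g p ts n ts1 m ts2 hg _ IH1 _ IH2 pre post.
  set code := pre ++ compile (While i g p) (size pre) ++ post.
  have ec : code = rcons pre (i, fun s => (if g s then (size pre).+1 else size pre + (csize p).+2, (s, Stay)))
     ++ compile p (size pre).+1 ++ (i, fun s => (size pre, (s, Stay))) :: post.
    by rewrite /code /= cat_rcons -cats1 -catA.
  have h0 : istep code (size pre, ts) = ((size pre).+1, ts).
    rewrite /code /= (istep_test _ _ (fetch_cat _ _ _)) ?hg //.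
    by rewrite size_cat /=; lia.
  have h1 : iter n (istep code) ((size pre).+1, ts) = ((size pre).+1 + csize p, ts1).
    rewrite ec; set y := (i, fun s => (if g s then _ else _, (s, Stay))).
    have := IH1 (rcons pre y) ((i, fun s => (size pre, (s, Stay))) :: post).
    by rewrite size_rcons => ->.
  have h2 : istep code ((size pre).+1 + csize p, ts1) = (size pre, ts1).
    rewrite (@istep_test _ _ _ i (fun=> size pre)) //.
      by rewrite ec !size_cat /= size_rcons size_compile; lia.
    by rewrite ec /fetch catA nth_cat size_cat size_rcons size_compile ltnn subnn.
  have -> : (n + m).+2 = m + (1 + (n + 1)) by lia.
  rewrite !iterD -/code -[iter 1 (istep code) (size pre, ts)]/(istep code (size pre, ts)) h0 h1.
  by rewrite -[iter 1 _ _]/(istep code (_, ts1)) h2; exact: IH2.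
- move=> i g p ts hg pre post /=; rewrite (istep_test _ _ (fetch_cat _ _ _)).
    by rewrite (negbTE hg).
  by rewrite size_cat /=; lia.
- move=> i g p ts n ts1 hg _ IH pre post.
  rewrite -addn1 iterD [iter 1 _ _]/= (istep_test _ _ (fetch_cat _ _ _)); last first.
    by rewrite size_cat /=; lia.
  have := IH (rcons pre (i, fun s => (if g s then (size pre).+1 else size pre + (csize p).+1, (s, Stay)))) post.
  by rewrite hg size_rcons cat_rcons /= => ->; rewrite addSnnS.
Qed.

Section Decider.
Variables (p : prog) (r : nat) (g : sy -> bool).
Let L := csize p.
Let code := rcons (compile p 0) (r, fun s => (if g s then L.+1 else L.+2, (s, Stay))).
Let K := foldr maxn 0 (map fst code).

(** Address [L] holds the final test; [L.+1] and [L.+2] lie behind the code and serve as accepting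
    and rejecting states. *)
Definition machine : tm I :=
  @TM I K (option bool : finType) 'I_L.+3 ord0
    (fun q => if q == L.+1 :> nat then Some true else if q == L.+2 :> nat then Some false else None)
    (fun q h => let: (i, f) := fetch code q in
       let: (pc', a) := f (h (inord i)) in
       (inord pc', [ffun j => if j == inord i :> 'I_K.+1 then a else (h j, Stay)])).

Definition input_tapes (w : seq I) : nat -> tp :=
  fun i => if i == 0 then Tape [::] (head None [seq Some (inl a) | a <- w]) (behead [seq Some (inl a) | a <- w])
           else Tape [::] None [::].

Definition restrict (c : nat * (nat -> tp)) : tm_config machine :=
  (inord c.1, fun i : 'I_K.+1 => c.2 i).

Lemma size_code : size code = L.+1.
Proof. by rewrite size_rcons size_compile. Qed.

Lemma fetch_bound pc : pc < size code -> (fetch code pc).1 <= K.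
Proof.
move=> hpc; rewrite /fetch /K; elim: code pc hpc => //= x c IH [|pc] hpc /=.
  by rewrite leq_maxl.
by apply: leq_trans (IH _ hpc) _; rewrite leq_maxr.
Qed.

Lemma fetch_target pc s : pc < size code -> ((fetch code pc).2 s).1 < L.+3.
Proof.
rewrite size_code /fetch /code nth_rcons size_compile ltnS leq_eqVlt => /orP[/eqP ->|h].
  by rewrite ltnn eqxx /=; case: ifP.
rewrite h; have : List.In (nth (0, fun s0 => (0, (s0, Stay))) (compile p 0) pc) (compile p 0).
  have : pc < size (compile p 0) by rewrite size_compile.
  elim: (compile p 0) pc {h} => //= x c IH [|pc] hpc /=; first by left.
  by right; apply: IH.
by move/compile_bound => /(_ s); rewrite add0n -/L; lia.
Qed.

Lemma restrict_step pc ts : pc < L.+3 ->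
  tm_step (restrict (pc, ts)) = restrict (istep code (pc, ts)) /\ (istep code (pc, ts)).1 < L.+3.
Proof.
move=> hpc; rewrite /tm_step /restrict /= inordK //.
case: ifP => [/eqP e|h1].
  by rewrite /istep size_code e ltnn.
case: ifP => [/eqP e|h2]; first by rewrite /istep size_code e ltnNge leqnSn.
have hL : pc < L.+1 by move/eqP: h1; move/eqP: h2; lia.
have hc : pc < size code by rewrite size_code.
rewrite /istep hc; have hb := fetch_bound hc; have ht := fun s => fetch_target s hc.
case: (fetch code pc) hb ht => i f /= hi ht.
rewrite ffunE inordK //; case ef: (f (tape_head (ts i))) => [pc' a] /=; split; last first.
  by have := ht (tape_head (ts i)); rewrite ef.
congr (_, _); apply: functional_extensionality => j; rewrite ffunE /upd.
have -> : (j == inord i) = (j == i :> nat) by rewrite -val_eqE /= inordK.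
by case: eqP => [->|_]; [rewrite /act ef | rewrite ffunE /=; case: (ts j)].
Qed.

Lemma restrict_iter n pc ts : pc < L.+3 ->
  iter n (@tm_step I machine) (restrict (pc, ts)) = restrict (iter n (istep code) (pc, ts)).
Proof.
move=> hpc; have : iter n (@tm_step I machine) (restrict (pc, ts)) = restrict (iter n (istep code) (pc, ts)) /\ (iter n (istep code) (pc, ts)).1 < L.+3.
  elim: n => //= n [-> h]; move: h; case: (iter n _ _) => pc' ts' /= h.
  exact: restrict_step.
by case.
Qed.

Lemma iter_halted t (c : tm_config machine) b : tm_halt c.1 = Some b -> iter t (@tm_step I machine) c = c.
Proof. by move=> h; elim: t => //= t ->; move: h; case: c => q ts; rewrite /tm_step /= => ->. Qed.

Lemma machine_decides w n ts' t : exec p (input_tapes w) n ts' -> n < t ->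
  tm_answers machine w t (g (tape_head (ts' r))).
Proof.
move=> he hn; rewrite /tm_answers.
have -> : tm_init machine w = restrict (0, input_tapes w).
  rewrite /tm_init /restrict /=; congr (_, _).
    by apply: val_inj; rewrite /= inordK.
have -> : t = (t - n.+1) + n.+1 by lia.
rewrite iterD restrict_iter // iterS.
have := compile_run he [::] [:: (r, fun s => (if g s then L.+1 else L.+2, (s, Stay)))].
rewrite /= cats1 add0n -/code => ->.
rewrite (@istep_test _ _ _ r (fun s => if g s then L.+1 else L.+2)) ?size_code //; last first.
  by rewrite /fetch /code nth_rcons size_compile ltnn eqxx.
have hh : tm_halt (restrict (if g (tape_head (ts' r)) then L.+1 else L.+2, ts')).1 = Some (g (tape_head (ts' r))).
  by rewrite /=; case: (g _); rewrite inordK ?eqxx // gtn_eqF.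
by rewrite (iter_halted _ hh).
Qed.
End Decider.
End Machine.
Arguments Skip {I}.

End Machines.
Import Machines.

(** * Bounded registers and a calculus of functions computable in polynomial time *)

Module Registers.
Import all_order all_algebra finmap FunctionalExtensionality.

Ltac updlia := apply: functional_extensionality; let k := fresh "k" in intro k; rewrite /upd; repeat (case: eqP; let e := fresh "e" in intro e); try lia; try congruence; try (subst; try lia; congruence).

Ltac updx := rewrite /upd; repeat (case: eqP; let e := fresh "e" in intro e); try lia; try congruence; try (subst; try lia; congruence).

Section Registers.
Variable I : finType.
Notation sy := (option (I + option bool)).
Notation tp := (tape sy).

Definition cex (p : prog I) ts T ts' : Prop := exists2 n, n <= T & exec p ts n ts'.

Lemma cex_le p ts T T' ts' : cex p ts T ts' -> T <= T' -> cex p ts T' ts'.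
Proof. by case=> n hn h hT; exists n => //; apply: leq_trans hn hT. Qed.

Lemma cex_skip ts : cex Skip ts 0 ts.
Proof. by exists 0 => //; exact: ExecSkip. Qed.

Lemma cex_seq p q ts T1 ts1 T2 ts2 : cex p ts T1 ts1 -> cex q ts1 T2 ts2 -> cex (Seq p q) ts (T1 + T2) ts2.
Proof.
case=> n hn h [m hm h']; exists (n + m); first by rewrite leq_add.
exact: ExecSeq h h'.
Qed.

Lemma cex_do i f ts : cex (Do i f) ts 1 (upd ts i (act f (ts i))).
Proof. by exists 1 => //; exact: ExecDo. Qed.

Lemma cex_when i (g : sy -> bool) p ts T ts' :
  cex p ts T ts' -> cex (When i g p) ts T.+1 (if g (tape_head (ts i)) then ts' else ts).
Proof.
case=> n hn h; case: ifP => hg; first by exists n.+1 => //; exact: ExecWhenT.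
by exists 1 => //; apply: ExecWhenF; rewrite hg.
Qed.

Lemma cex_while i (g : sy -> bool) p (S : nat -> nat -> tp) m T :
  (forall j, j < m -> g (tape_head (S j i)) /\ cex p (S j) T (S j.+1)) ->
  ~~ g (tape_head (S m i)) -> cex (While i g p) (S 0) (m * T.+2).+1 (S m).
Proof.
elim: m S => [|m IH] S h he; first by exists 1 => //; exact: ExecWhileF.
have [h0 [n hn e0]] := h 0 isT.
have [|k hk e1] := IH (fun j => S j.+1) _ he; first by move=> j hj; apply: h.
exists (n + k).+2; last exact: ExecWhileT e0 e1.
by rewrite mulSn; lia.
Qed.

(** [mF] and [mE] mark the two ends of a register tape, [mM] its interior; [mM] also stands for true
    in the table. *)
Definition mF : sy := Some (inr (Some true)).
Definition mE : sy := Some (inr (Some false)).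
Definition mM : sy := Some (inr None).

(** The contents of the tapes: the capacity of the registers, the input on tape 0 and a Boolean
    table on tape 1. All tapes from 2 on are registers. *)
Record wd := World { wN : nat; ww : seq I; wT : nat -> bool }.

Definition wok W := (0 < wN W) && (size (ww W) <= wN W).

Definition cells (W : wd) (i : nat) : seq sy :=
  if i == 0 then [seq Some (inl a) | a <- ww W] ++ nseq ((wN W).+1 - size (ww W)) None
  else if i == 1 then mkseq (fun j => if wT W j then mM else None) (wN W).+1
  else mF :: rcons (nseq (wN W).-1 mM) mE.

Definition ztape (s : seq sy) (p : nat) : tp :=
  Tape (rev (take p s)) (nth None s p) (drop p.+1 s).

(** A register holds its value as a head position; the contents of its tape never change. *)
Definition conc (W : wd) (v : nat -> nat) : nat -> tp := fun i => ztape (cells W i) (v i).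

Lemma size_cells W i : wok W -> size (cells W i) = (wN W).+1.
Proof.
case/andP => h1 h2; rewrite /cells; case: ifP => _.
  by rewrite size_cat size_map size_nseq; lia.
by case: ifP => _; rewrite ?size_mkseq //= size_rcons size_nseq; lia.
Qed.

Lemma ztape_right s p : p.+1 < size s -> tape_move None (ztape s p) MoveR = ztape s p.+1.
Proof.
move=> hp; rewrite /ztape /= (take_nth None) ?rev_rcons; last by lia.
by rewrite (drop_nth None hp).
Qed.

Lemma ztape_left s p : p.+1 < size s -> tape_move None (ztape s p.+1) MoveL = ztape s p.
Proof.
move=> hp; rewrite /ztape /= (take_nth None) ?rev_rcons /=; last by lia.
by rewrite (drop_nth None hp).
Qed.

Lemma tape_write_head (t : tp) : tape_write t (tape_head t) = t.
Proof. by case: t. Qed.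

Lemma conc_upd W v i x : upd (conc W v) i (ztape (cells W i) x) = conc W (upd v i x).
Proof. by apply: functional_extensionality => j; rewrite /conc /upd; case: eqP => // ->. Qed.

Definition MvR i : prog I := Do i (fun s => (s, MoveR)).
Definition MvL i : prog I := Do i (fun s => (s, MoveL)).
Definition Inc i : prog I := Do i (fun s => (s, if s == mE then Stay else MoveR)).
Definition nz (s : sy) := s != mF.
Definition Clear i := While i nz (MvL i).
Definition MoveTo i j := While i nz (Seq (MvL i) (Inc j)).
Definition Copy i f t := Seq (While i nz (Seq (MvL i) (Seq (Inc f) (Inc t)))) (MoveTo t i).

Section World.
Variable W : wd.
Hypothesis okW : wok W.
Notation N := (wN W).
Implicit Type v : nat -> nat.

Lemma cex_MvR v i : v i < N -> cex (MvR i) (conc W v) 1 (conc W (upd v i (v i).+1)).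
Proof.
move=> h; rewrite -conc_upd -(ztape_right (s := cells W i)) ?size_cells //.
by have := cex_do i (fun s => (s, MoveR)) (conc W v); rewrite /act /= /tape_write.
Qed.

Lemma cex_MvL v i : 0 < v i <= N -> cex (MvL i) (conc W v) 1 (conc W (upd v i (v i).-1)).
Proof.
move=> h; have e : v i = (v i).-1.+1 by lia.
rewrite -conc_upd -(ztape_left (s := cells W i)) ?size_cells //; last by lia.
rewrite -e; have := cex_do i (fun s => (s, MoveL)) (conc W v).
by rewrite /act /= /tape_write.
Qed.

Lemma reg_head v i : 1 < i -> v i <= N ->
  (tape_head (conc W v i) == mF) = (v i == 0) /\ (tape_head (conc W v i) == mE) = (v i == N).
Proof.
move=> hi hv; have [h0 _] := andP okW; rewrite /conc /ztape /= /cells.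
have [-> ->] : (i == 0) = false /\ (i == 1) = false by split; apply/eqP; lia.
case: (v i) hv => [|k] hk /=; first by rewrite eqxx; split => //; case: N h0.
rewrite nth_rcons size_nseq nth_nseq; case: ltnP => hl.
  by split=> //; rewrite [RHS](_ : _ = false) //; apply/eqP; lia.
have -> : k = N.-1 by lia.
by rewrite !eqxx; split=> //; rewrite prednK // eqxx.
Qed.

Lemma nzE v i : 1 < i -> v i <= N -> nz (tape_head (conc W v i)) = (0 < v i).
Proof. by move=> hi hv; rewrite /nz (reg_head hi hv).1 lt0n. Qed.

Lemma cex_Inc v i : 1 < i -> v i <= N -> cex (Inc i) (conc W v) 1 (conc W (upd v i (minn N (v i).+1))).
Proof.
move=> hi hv; have [_ hE] := reg_head hi hv.
have := cex_do i (fun s => (s, if s == mE then Stay else MoveR)) (conc W v).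
rewrite /act hE; case: eqP => e.
  have -> : tape_move None (tape_write (conc W v i) (tape_head (conc W v i), Stay).1) (tape_head (conc W v i), Stay).2 = conc W v i by case: (conc W v i).
  by rewrite e (minn_idPl (leqnSn _)) upd_id -e upd_id.
have -> : tape_move None (tape_write (conc W v i) (tape_head (conc W v i), MoveR).1) (tape_head (conc W v i), MoveR).2 = ztape (cells W i) (v i).+1.
  by rewrite -ztape_right // size_cells //; lia.
by rewrite conc_upd (minn_idPr _) //; lia.
Qed.

Lemma cex_Clear v i : 1 < i -> v i <= N -> cex (Clear i) (conc W v) (3 * N).+1 (conc W (upd v i 0)).
Proof.
move=> hi hv; pose S j := conc W (upd v i (v i - j)).
have := @cex_while i nz (MvL i) S (v i) 1; rewrite /S subn0 subnn upd_id => h.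
apply: (cex_le (T := (v i * 3).+1)); last by lia.
apply: h; last by rewrite nzE ?upd_same.
move=> j hj; rewrite nzE ?upd_same //; last by lia.
split; first by lia.
have -> : upd v i (v i - j.+1) = upd (upd v i (v i - j)) i (upd v i (v i - j) i).-1 by updlia.
by apply: cex_MvL; rewrite upd_same; lia.
Qed.

Lemma cex_MoveTo v i j : 1 < i -> 1 < j -> i <> j -> v i + v j <= N ->
  cex (MoveTo i j) (conc W v) (4 * N).+1 (conc W (upd (upd v j (v i + v j)) i 0)).
Proof.
move=> hi hj ij hv; pose S t := conc W (upd (upd v j (t + v j)) i (v i - t)).
have := @cex_while i nz (Seq (MvL i) (Inc j)) S (v i) 2; rewrite /S subn0 subnn.
have -> : upd (upd v j (0 + v j)) i (v i) = v by updlia.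
move=> h; apply: (cex_le (T := (v i * 4).+1)); last by lia.
apply: h; last by rewrite nzE ?upd_same.
move=> t ht; rewrite nzE ?upd_same //; last by lia.
split; first by lia.
apply: (cex_seq (T1 := 1) (T2 := 1)); first by apply: cex_MvL; rewrite upd_same; lia.
set v' := upd _ i _; have ej : v' j = t + v j by rewrite /v'; updx.
have -> : upd (upd v j (t.+1 + v j)) i (v i - t.+1) = upd v' j (minn N (v' j).+1).
  by rewrite ej /v'; updlia.
by apply: cex_Inc => //; rewrite ej; lia.
Qed.

Lemma cex_Copy v i f t : 1 < i -> 1 < f -> 1 < t -> i <> f -> i <> t -> f <> t ->
  v i <= N -> v f = 0 -> v t = 0 ->
  cex (Copy i f t) (conc W v) (10 * N + 2) (conc W (upd v f (v i))).
Proof.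
move=> hi hf ht nif nit nft hv ef et.
pose S j := conc W (upd (upd (upd v f j) t j) i (v i - j)).
have := @cex_while i nz (Seq (MvL i) (Seq (Inc f) (Inc t))) S (v i) 3; rewrite /S subn0 subnn.
have -> : upd (upd (upd v f 0) t 0) i (v i) = v by updlia.
move=> h; apply: (cex_le (T := (v i * 5).+1 + (4 * N).+1)); last by lia.
have -> : upd v f (v i) = upd (upd (upd (upd (upd v f (v i)) t (v i)) i 0) i (v i)) t 0 by updlia.
set v1 := upd (upd (upd v f (v i)) t (v i)) i 0.
have e1 : v1 t = v i by rewrite /v1; updx.
have e2 : v1 i = 0 by rewrite /v1 upd_same.
apply: (cex_seq (ts1 := conc W v1)); last first.
  have e3 : v i = v1 t + v1 i by lia.
  by rewrite e3; apply: cex_MoveTo => //; lia.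
apply: h; last by rewrite nzE ?upd_same.
move=> j hj; rewrite nzE ?upd_same //; last by lia.
split; first by lia.
apply: (cex_seq (T1 := 1) (T2 := 2)); first by apply: cex_MvL; rewrite upd_same; lia.
set v' := upd _ i _; have ej : v' f = j by rewrite /v'; updx.
apply: (cex_seq (T1 := 1) (T2 := 1)); first by apply: cex_Inc => //; rewrite ej; lia.
set v'' := upd _ f _.
have ej' : v'' t = j by rewrite /v'' /v'; updx.
have -> : upd (upd (upd v f j.+1) t j.+1) i (v i - j.+1) = upd v'' t (minn N (v'' t).+1).
  by rewrite ej' /v'' ej /v'; updlia.
by apply: cex_Inc => //; rewrite ej'; lia.
Qed.

(* Reads the cell of tape [i] whose index is in register [f] and replaces this index by the answer. *)
Definition Probe i (P : sy -> bool) f : prog I :=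
  Seq (While f nz (Seq (MvL f) (Seq (MvR i) (Inc f.+1))))
 (Seq (When i P (Inc f.+2))
 (Seq (While f.+1 nz (Seq (MvL f.+1) (MvL i))) (MoveTo f.+2 f))).

Lemma cex_Probe v i (P : sy -> bool) f : i <= 1 -> 1 < f -> v i = 0 -> v f <= N ->
  v f.+1 = 0 -> v f.+2 = 0 ->
  cex (Probe i P f) (conc W v) (20 * N + 20)
    (conc W (upd v f (nat_of_bool (P (nth None (cells W i) (v f)))))).
Proof.
move=> hi hf vi hv v1 v2; have [N0 _] := andP okW.
set b := P _; set m := v f.
pose S j := conc W (upd (upd (upd v f (m - j)) i j) f.+1 j).
have := @cex_while f nz (Seq (MvL f) (Seq (MvR i) (Inc f.+1))) S m 3; rewrite /S subn0 subnn.
have -> : upd (upd (upd v f m) i 0) f.+1 0 = v by rewrite /m; updlia.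
set va := upd (upd (upd v f 0) i m) f.+1 m => hA.
pose vb := upd va f.+2 b.
pose S2 j := conc W (upd (upd vb i (m - j)) f.+1 (m - j)).
have := @cex_while f.+1 nz (Seq (MvL f.+1) (MvL i)) S2 m 2; rewrite /S2 subn0 subnn.
have -> : upd (upd vb i m) f.+1 m = vb by rewrite /vb /va; updlia.
set vc := upd (upd vb i 0) f.+1 0 => hB.
apply: (cex_le (T := (m * 5).+1 + (2 + ((m * 4).+1 + (4 * N).+1)))); last by rewrite /m; lia.
apply: cex_seq.
  apply: hA => [j hj|]; last by rewrite nzE //; rewrite /va; updx.
  set v' := upd _ f.+1 _; have e1 : v' f = m - j by rewrite /v'; updx.
  rewrite nzE ?e1 //; last by lia.
  split; first by lia.
  apply: (cex_seq (T1 := 1) (T2 := 2)); first by apply: cex_MvL; rewrite e1; lia.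
  set v'' := upd v' f _; have e2 : v'' i = j by rewrite /v'' /v'; updx.
  apply: (cex_seq (T1 := 1) (T2 := 1)); first by apply: cex_MvR; rewrite e2; lia.
  set v3 := upd v'' i _; have e3 : v3 f.+1 = j by rewrite /v3 /v'' /v'; updx.
  have -> : upd (upd (upd v f (m - j.+1)) i j.+1) f.+1 j.+1 = upd v3 f.+1 (minn N (v3 f.+1).+1).
    by rewrite e3 /v3 e2 /v'' e1 /v'; updlia.
  by apply: cex_Inc; lia.
apply: (cex_seq (ts1 := conc W vb)).
  have e1 : va f.+2 = 0 by rewrite /va; updx.
  have := @cex_when i P (Inc f.+2) (conc W va) 1 (conc W (upd va f.+2 1)).
  have -> : P (tape_head (conc W va i)) = b.
    rewrite /b /conc /ztape /=; congr (P (nth _ _ _)).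
    by rewrite /va; updx.
  have -> : (if b then conc W (upd va f.+2 1) else conc W va) = conc W vb.
    by rewrite /vb; case: (b) => //=; rewrite -{1}(upd_id va f.+2) e1.
  apply; have := @cex_Inc va f.+2; rewrite e1 (minn_idPr N0); apply; lia.
apply: (cex_seq (ts1 := conc W vc)).
  apply: hB => [j hj|]; last by rewrite nzE; rewrite /vc ?upd_same //; lia.
  set v' := upd _ f.+1 _; have e1 : v' f.+1 = m - j by rewrite /v' upd_same.
  rewrite nzE ?e1 //; try lia.
  split; first by lia.
  apply: (cex_seq (T1 := 1) (T2 := 1)); first by apply: cex_MvL; rewrite e1; lia.
  set v'' := upd v' f.+1 _; have e2 : v'' i = m - j by rewrite /v'' /v'; updx.
  have -> : upd (upd vb i (m - j.+1)) f.+1 (m - j.+1) = upd v'' i (v'' i).-1.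
    by rewrite e2 /v'' e1 /v'; updlia.
  by apply: cex_MvL; rewrite e2; lia.
have e1 : vc f.+2 = b by rewrite /vc /vb; updx.
have e2 : vc f = 0 by rewrite /vc /vb /va; updx.
have -> : upd v f b = upd (upd vc f (vc f.+2 + vc f)) f.+2 0.
  by rewrite e1 e2 addn0 /vc /vb /va; updlia.
by apply: cex_MoveTo; rewrite ?e1 ?e2; try lia; case: (b).
Qed.
End World.

(** A world together with [k] numbers, addressed like de Bruijn indices: the last component is the
    innermost variable. In [fits], [es] lists the registers that hold them, innermost first. *)
Fixpoint ctx k : Type := if k is k'.+1 then (ctx k' * nat)%type else wd.

Fixpoint wof k : ctx k -> wd := if k is k'.+1 then fun g => wof (g.1 : ctx k') else id.

Fixpoint fits k : ctx k -> wd -> (nat -> nat) -> seq nat -> Prop :=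
  match k with
  | 0 => fun g W v es => g = W
  | k'.+1 => fun g W v es => if es is i :: es' then g.2 = v i /\ fits (g.1 : ctx k') W v es' else False
  end.

Lemma fits_ext k (g : ctx k) W v v' es : (forall i, i \in es -> v i = v' i) -> fits g W v es -> fits g W v' es.
Proof.
elim: k g es => //= k IH [g x] [|i es] //= h [-> hg]; split; first by rewrite h ?inE ?eqxx.
by apply: IH hg => j hj; apply: h; rewrite inE hj orbT.
Qed.

Lemma fits_wof k (g : ctx k) W v es : fits g W v es -> wof g = W.
Proof. by elim: k g es => //= k IH [g x] [|i es] //= [_ /IH]. Qed.

(** The calling convention: the heads of input and table are at home, and all registers from [f] on
    are free and zero. *)
Record safe (W : wd) (v : nat -> nat) (es : seq nat) (f : nat) : Prop := Safe {
  safe_ok : wok W;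
  safe_le : forall i, v i <= wN W;
  safe_0 : forall i, (i <= 1) || (f <= i) -> v i = 0;
  safe_es : all (fun i => 1 < i < f) es;
  safe_f : 1 < f }.

(** Computability by code that is uniform in the allocation of registers, in time polynomial in the
    capacity. The result lands in the first free register and everything else is restored; the
    clause [F g <= wN W] excludes overflow. *)
Definition comp k (F : ctx k -> nat) : Prop :=
  exists (c : seq nat -> nat -> prog I) (a : nat), forall g W v es f,
    safe W v es f -> fits g W v es ->
    F g <= wN W /\ cex (c es f) (conc W v) ((wN W).+2 ^ a) (conc W (upd v f (F g))).

Definition compb k (P : ctx k -> bool) : Prop := comp (fun g => nat_of_bool (P g)).

Lemma comp_ext k (F F' : ctx k -> nat) : F =1 F' -> comp F -> comp F'.
Proof. by move=> /functional_extensionality ->. Qed.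

Lemma safe_step W v es f x : safe W v es f -> x <= wN W -> safe W (upd v f x) (f :: es) f.+1.
Proof.
case=> h1 h2 h3 h4 h5 hx; split => //.
- by move=> i; rewrite /upd; case: eqP.
- by move=> i hi; rewrite /upd; case: eqP => [e|_]; [|apply: h3]; lia.
- rewrite /= h5 ltnSn; apply: sub_all h4 => i; lia.
- by lia.
Qed.

Lemma safe_behead W v e es f : safe W v (e :: es) f -> safe W v es f.
Proof. by case=> h1 h2 h3 /andP[_ h4] h5; split. Qed.

Lemma safe_sub W v es es' f : safe W v es f -> {subset es' <= es} -> safe W v es' f.
Proof. by case=> h1 h2 h3 /allP h4 h5 hs; split => //; apply/allP => i /hs; exact: h4. Qed.

Lemma fits_step k (g : ctx k) W v es f x : safe W v es f -> fits g W v es -> fits g W (upd v f x) es.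
Proof.
case=> _ _ _ /allP h4 _; apply: fits_ext => i /h4 hi; rewrite upd_other //; lia.
Qed.

Lemma comp_zero k : comp (fun _ : ctx k => 0).
Proof.
exists (fun _ _ => Skip), 0 => g W v es f [h1 h2 h3 h4 h5] _; split => //.
have -> : upd v f 0 = v by rewrite -{2}(upd_id v f) h3 // leqnn orbT.
exact: cex_le (cex_skip _) _.
Qed.

Lemma expn_ge N a : N.+2 <= N.+2 ^ a.+1.
Proof. by rewrite expnS leq_pmulr // expn_gt0. Qed.

Lemma comp_var k : comp (fun g : ctx k.+1 => g.2).
Proof.
exists (fun es f => Copy (head 0 es) f f.+1), 5 => g W v [|i es] f [h1 h2 h3 /= h4 h5] //= [-> _].
split; first exact: h2.
case/andP: h4 => /andP[hi hf] _.
apply: cex_le (cex_Copy h1 hi h5 _ _ _ _ _ _ _) _; try lia; try (by apply: h3; lia); try exact: h2; try (by rewrite !expnS expn0; nia).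
Qed.

Lemma comp_weak k (F : ctx k -> nat) : comp F -> comp (fun g : ctx k.+1 => F g.1).
Proof.
case=> c [a h]; exists (fun es f => c (behead es) f), a => g W v [|i es] f hs //= [_ hg].
exact: h (safe_behead hs) hg.
Qed.

Lemma comp_succ k (F : ctx k -> nat) : comp F -> comp (fun g => minn (wN (wof g)) (F g).+1).
Proof.
case=> c [a h]; exists (fun es f => Seq (c es f) (Inc f)), a.+1 => g W v es f hs hg.
rewrite (fits_wof hg); split; first by lia.
have [h1 h2] := h _ _ _ _ _ hs hg; have [k1 k2 k3 k4 k5] := hs.
have := cex_seq h2 (cex_Inc k1 (v := upd v f (F g)) k5 _); rewrite upd_same upd_upd => /(_ h1) h3.
apply: cex_le h3 _; rewrite expnS mulSn; have : 0 < (wN W).+2 ^ a by rewrite expn_gt0.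
by rewrite mulSn; lia.
Qed.

Lemma comp_top k : comp (fun g : ctx k => wN (wof g)).
Proof.
exists (fun es f => While f (fun s => s != mE) (Inc f)), 3 => g W v es f [h1 h2 h3 h4 h5] hg.
rewrite (fits_wof hg); split=> //.
have := @cex_while f (fun s => s != mE) (Inc f) (fun j => conc W (upd v f j)) (wN W) 1.
have -> : upd v f 0 = v by rewrite -{2}(upd_id v f) h3 // leqnn orbT.
move=> h; apply: cex_le (h _ _) _.
- move=> j hj; have e : upd v f j f = j by rewrite upd_same.
  have [//||_ ->] := @reg_head W h1 (upd v f j) f; first by rewrite e; lia.
  rewrite e; split; first by lia.
  have -> : upd v f j.+1 = upd (upd v f j) f (minn (wN W) (upd v f j f).+1).
    by rewrite upd_upd e; congr upd; lia.
  by apply: cex_Inc; rewrite ?e; lia.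
- have [//||_ ->] := @reg_head W h1 (upd v f (wN W)) f; first by rewrite upd_same.
  by rewrite upd_same eqxx.
- by rewrite !expnS expn0; nia.
Qed.

(** The intermediate value stays in [f] while the body computes into [f.+1]; then [f] is cleared and
    the result moved down. *)
Lemma comp_let k (F : ctx k -> nat) (H : ctx k.+1 -> nat) : comp F -> comp H -> comp (fun g : ctx k => H (g, F g)).
Proof.
case=> c [a h] [c' [a' h']].
exists (fun es f => Seq (c es f) (Seq (c' (f :: es) f.+1) (Seq (Clear f) (MoveTo f.+1 f)))), (a + a' + 4) => g W v es f hs hg.
have [h1 h2] := h _ _ _ _ _ hs hg; have [k1 k2 k3 k4 k5] := hs.
have [||h3 h4] := h' (g, F g) W (upd v f (F g)) (f :: es) f.+1.
- exact: safe_step.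
- by split; [rewrite upd_same | apply: fits_step hg].
split => //; set x := F g in h2 h3 h4 *; set y := H _ in h3 h4 *.
have vf1 : v f.+1 = 0 by rewrite k3 // leqnSn orbT.
set v2 := upd (upd v f x) f.+1 y in h4.
have hc := @cex_Clear W k1 v2 f k5; rewrite {1}/v2 upd_other ?upd_same in hc; last by lia.
have hm := @cex_MoveTo W k1 (upd v2 f 0) f.+1 f (leqW k5) k5.
have e1 : upd v2 f 0 f = 0 by rewrite upd_same.
have e2 : upd v2 f 0 f.+1 = y by rewrite /v2; updx.
rewrite e1 e2 addn0 in hm.
have := cex_seq h2 (cex_seq h4 (cex_seq (hc h1) (hm _ h3))).
have -> : upd (upd (upd v2 f 0) f y) f.+1 0 = upd v f y by rewrite /v2; updlia.
move=> hh; apply: cex_le (hh _) _; first by lia.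
rewrite !expnD; set p := _ ^ a; set q := _ ^ a'; set n := wN W.
have p0 : 0 < p by rewrite expn_gt0.
have q0 : 0 < q by rewrite expn_gt0.
have e4 : n.+2 ^ 4 = n.+2 * n.+2 ^ 3 by rewrite expnS.
have e3 : 2 ^ 3 <= n.+2 ^ 3 by rewrite leq_exp2r.
have : n.+2 * 8 <= n.+2 ^ 4 by rewrite e4 leq_mul2l e3 orbT.
set r := n.+2 ^ 4 => hr; clearbody r p q n; clear -p0 q0 hr.
have : p <= p * q by rewrite leq_pmulr.
have : q <= p * q by rewrite leq_pmull.
have : 0 < p * q by rewrite muln_gt0 p0.
set s := p * q; clearbody s => s0 hq hp.
apply: (@leq_trans (s * (n.+2 * 8))); last by rewrite leq_mul2l hr orbT.
nia.
Qed.

(** Primitive recursion, which stays polynomial because all values are at most the capacity.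
    Register [f] counts down, [f.+1] is the accumulator and [f.+2] the index; the last two are the
    innermost variables of the body. *)
Lemma comp_rec k (Fn F0 : ctx k -> nat) (Fs : ctx k.+2 -> nat) : comp Fn -> comp F0 -> comp Fs ->
  comp (fun g : ctx k => iteri (Fn g) (fun j acc => Fs (g, j, acc)) (F0 g)).
Proof.
case=> cn [an hn] [c0 [a0 h0]] [cs [as_ hs]].
pose body es f := Seq (MvL f) (Seq (cs [:: f.+1, f.+2 & es] f.+3) (Seq (Clear f.+1) (Seq (MoveTo f.+3 f.+1) (Inc f.+2)))).
exists (fun es f => Seq (cn es f) (Seq (c0 es f.+1) (Seq (While f nz (body es f)) (Seq (Clear f.+2) (MoveTo f.+1 f))))), (an + a0 + as_ + 6).
move=> g W v es f sf hg; have [k1 k2 k3 k4 k5] := sf.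
have [n1 n2] := hn _ _ _ _ _ sf hg; set m := Fn g in n1 n2 *.
have sf1 := safe_step sf n1; have hg1 := fits_step m sf hg.
have [|m1 m2] := h0 g W (upd v f m) es f.+1 _ hg1; first exact: safe_behead sf1.
set st := fun j acc => _; pose it t := iteri t st (F0 g).
pose R t := upd (upd (upd v f (m - t)) f.+1 (it t)) f.+2 t.
have vf1 : v f.+1 = 0 by rewrite k3 // leqnSn orbT.
have vf2 : v f.+2 = 0 by rewrite k3 //; lia.
have vf3 : v f.+3 = 0 by rewrite k3 //; lia.
have R1 t : R t f.+1 = it t by rewrite /R; updx.
have R2 t : R t f.+2 = t by rewrite /R upd_same.
have R0 t : R t f = m - t by rewrite /R; updx.
set n := wN W in k2 n1 n2 m1 m2 *.
have step t : it t <= n -> t < m -> it t.+1 <= n /\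
    cex (body es f) (conc W (R t)) (n.+2 ^ as_ + 7 * n + 4) (conc W (R t.+1)).
  move=> hit ht.
  pose R' := upd (R t) f (m - t.+1).
  have sR : safe W R' [:: f.+1, f.+2 & es] f.+3.
    split=> //.
    - move=> i; rewrite /R' /R /upd; case: eqP => [_|_]; first by lia.
      by case: eqP => [_|_]; [lia | case: eqP => // _; case: eqP => // _; lia].
    - move=> i hi; rewrite /R' /R /upd; case: eqP => [e|_]; first by lia.
      case: eqP => [e|_]; first by lia.
      case: eqP => [e|_]; first by lia.
      by apply: k3; lia.
    - rewrite /=; apply/andP; split; first by lia.
      apply/andP; split; first by lia.
      by apply: sub_all k4 => i; lia.
  have fR : fits ((g, t, it t) : ctx k.+2) W R' [:: f.+1, f.+2 & es].
    rewrite /=; split; first by rewrite /R' /R; updx.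
    split; first by rewrite /R' /R; updx.
    apply: fits_ext hg => i hi; have := allP k4 _ hi => hif.
    by rewrite /R' /R; updx.
  have [b1 b2] := hs _ _ _ _ _ sR fR.
  rewrite -[Fs _]/(st t (it t)) -[st t _]/(it t.+1) in b1 b2.
  split=> //; rewrite /body.
  have e1 : cex (MvL f) (conc W (R t)) 1 (conc W R').
    have -> : R' = upd (R t) f (R t f).-1 by rewrite R0 /R'; congr upd; lia.
    by apply: cex_MvL => //; rewrite R0; lia.
  set R3 := upd R' f.+3 (it t.+1) in b2.
  have e2 := @cex_Clear W k1 R3 f.+1.
  have eR31 : R3 f.+1 = it t by rewrite /R3 /R' /R; updx.
  rewrite eR31 in e2.
  have e3 := @cex_MoveTo W k1 (upd R3 f.+1 0) f.+3 f.+1.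
  have e4 : upd R3 f.+1 0 f.+3 = it t.+1 by rewrite /R3; updx.
  rewrite upd_same e4 addn0 in e3.
  set R4 := upd _ f.+3 0 in e3.
  have e5 := @cex_Inc W k1 R4 f.+2.
  have e6 : R4 f.+2 = t by rewrite /R4 /R3 /R' /R; updx.
  rewrite e6 in e5.
  have eR : upd R4 f.+2 (minn n t.+1) = R t.+1 by rewrite /R4 /R3 /R' /R; updlia.
  rewrite -/n eR in e5.
  apply: cex_le (cex_seq e1 (cex_seq b2 (cex_seq (e2 _ _) (cex_seq (e3 _ _ _ _) (e5 _ _))))) _; rewrite -?/n; try lia.
have inv t : t <= m -> it t <= n.
  by elim: t => [|t IH] ht //; case: (step t (IH (ltnW ht)) ht).
split; first exact: inv.
have hw := @cex_while f nz (body es f) (fun t => conc W (R t)) m (n.+2 ^ as_ + 7 * n + 4).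
have ew : R 0 = upd (upd v f m) f.+1 (F0 g) by rewrite /R subn0; updlia.
rewrite ew in hw.
have hw1 : cex (While f nz (body es f)) (conc W (upd (upd v f m) f.+1 (F0 g))) (m * (n.+2 ^ as_ + 7 * n + 4).+2).+1 (conc W (R m)).
  apply: hw; last by rewrite nzE // R0 ?subnn //; lia.
  move=> t ht; rewrite nzE // R0; last by lia.
  by split; [lia | case: (step t (inv t (ltnW ht)) ht)].
have e1 := @cex_Clear W k1 (R m) f.+2; rewrite R2 in e1.
have e2 := @cex_MoveTo W k1 (upd (R m) f.+2 0) f.+1 f.
have e3 : upd (R m) f.+2 0 f.+1 = it m by rewrite /R; updx.
have e4 : upd (R m) f.+2 0 f = 0 by rewrite /R; updx.
rewrite e3 e4 addn0 in e2.
have eR : upd (upd (upd (R m) f.+2 0) f (it m)) f.+1 0 = upd v f (it m) by rewrite /R subnn; updlia.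
rewrite eR in e2.
have hinv := inv m (leqnn m).
apply: cex_le (cex_seq n2 (cex_seq m2 (cex_seq hw1 (cex_seq (e1 _ _) (e2 _ _ _ _))))) _; try lia.
rewrite -/n !expnD; set p := _ ^ an; set q := _ ^ a0; set r := _ ^ as_.
have p0 : 0 < p by rewrite expn_gt0.
have q0 : 0 < q by rewrite expn_gt0.
have r0 : 0 < r by rewrite expn_gt0.
have e6 : 2 ^ 4 <= n.+2 ^ 4 by rewrite leq_exp2r.
have hE : n.+2 * (n.+2 * 16) <= n.+2 ^ 6 by rewrite !expnS -!expnS !leq_mul2l e6 !orbT.
set x := n.+2 ^ 6 in hE *; clearbody x p q r m; clearbody n; clear -p0 q0 r0 hE n1.
have hp : p <= p * q * r by rewrite -mulnA leq_pmulr // muln_gt0 q0.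
have hq : q <= p * q * r by rewrite -mulnA (leq_trans (leq_pmulr q r0)) // leq_pmull.
have hr : r <= p * q * r by rewrite leq_pmull // muln_gt0 p0.
set s := p * q * r in hp hq hr *; have s0 : 0 < s by lia.
clearbody s; apply: (@leq_trans (s * (n.+2 * (n.+2 * 16)))); last by rewrite leq_mul2l hE orbT.
have h1 : m * (r + 7 * n + 4).+2 <= n * (s + 7 * n + 6) by rewrite leq_mul //; lia.
have h2 : n * (s + 7 * n + 6) <= s * (n * (7 * n + 7)) by nia.
have h3 : 7 * n + 10 <= s * (7 * n + 10) by nia.
have h4 : n * (7 * n + 7) + (7 * n + 10) + 2 <= n.+2 * (n.+2 * 16) by nia.
have h5 : s * (n * (7 * n + 7)) + s * (7 * n + 10) + s * 2 <= s * (n.+2 * (n.+2 * 16)) by rewrite -!mulnDr leq_mul2l h4 orbT.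
lia.
Qed.

Lemma comp_probe k (i : nat) (P : sy -> bool) (F : ctx k -> nat) : i <= 1 -> comp F ->
  compb (fun g => P (nth None (cells (wof g) i) (F g))).
Proof.
move=> hi [c [a h]]; exists (fun es f => Seq (c es f) (Probe i P f)), (a + 6) => g W v es f hs hg.
rewrite (fits_wof hg); have [h1 h2] := h _ _ _ _ _ hs hg; have [k1 k2 k3 k4 k5] := hs.
split; first by case/andP: k1; case: (P _) => //; lia.
have := @cex_Probe W k1 (upd v f (F g)) i P f hi k5; rewrite upd_same !upd_other; try lia.
rewrite upd_upd => h3; apply: cex_le (cex_seq h2 (h3 _ _ _ _)) _ => //; try by (rewrite k3 //; lia).
rewrite expnD; set p := _ ^ a; set n := wN W.
have p0 : 0 < p by rewrite expn_gt0.
have e4 : 2 ^ 5 <= n.+2 ^ 5 by rewrite leq_exp2r.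
have hx : n.+2 * 32 <= n.+2 ^ 6 by rewrite [n.+2 ^ 6]expnS leq_mul2l e4 orbT.
have : p * (n.+2 * 32) <= p * n.+2 ^ 6 by rewrite leq_mul2l hx orbT.
set x := p * n.+2 ^ 6; have N0 : 0 < n by case/andP: k1.
clearbody x p n; clear -p0 N0; nia.
Qed.
End Registers.

End Registers.
Import Registers.

(** * Building a block of exponential length *)

Module Doubling.
Import all_order all_algebra finmap FunctionalExtensionality.

Section Init.
Variable I : finType.
Notation sy := (option (I + option bool)).
Notation tp := (tape sy).
Notation mM := (mM I).
Notation mF := (mF I).
Notation mE := (mE I).

Fixpoint width (p : prog I) : nat :=
  match p with
  | Skip => 0
  | Do i _ => i.+1
  | Seq p q => maxn (width p) (width q)
  | While i _ p => maxn i.+1 (width p)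
  | When i _ p => maxn i.+1 (width p)
  end.

(** The scratch tapes used for initialisation are left dirty; a program that addresses only tapes
    below [R] cannot notice. *)
Lemma exec_local R p ts n ts' : exec p ts n ts' -> width p <= R ->
  forall us, (forall i, i < R -> us i = ts i) ->
  exists2 us', exec p us n us' & forall i, i < R -> us' i = ts' i.
Proof.
elim=> {p ts n ts'} /=.
- by move=> ts _ us h; exists us => //; exact: ExecSkip.
- move=> i f ts hi us h; exists (upd us i (act f (us i))); first exact: ExecDo.
  by move=> j hj; rewrite /upd h // h.
- move=> p q ts n ts1 m ts2 _ IH1 _ IH2; rewrite geq_max => /andP[w1 w2] us h.
  have [us1 e1 h1] := IH1 w1 us h; have [us2 e2 h2] := IH2 w2 us1 h1.
  by exists us2 => //; exact: ExecSeq e1 e2.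
- move=> i g p ts hg; rewrite geq_max => /andP[hi _] us h; exists us => //.
  by apply: ExecWhileF; rewrite h.
- move=> i g p ts n ts1 m ts2 hg _ IH1 _ IH2 hw us h; have := hw; rewrite geq_max => /andP[hi w1].
  have [us1 e1 h1] := IH1 w1 us h; have [us2 e2 h2] := IH2 hw us1 h1.
  by exists us2 => //; apply: ExecWhileT e1 e2; rewrite h.
- move=> i g p ts hg; rewrite geq_max => /andP[hi _] us h; exists us => //.
  by apply: ExecWhenF; rewrite h.
- move=> i g p ts n ts1 hg _ IH; rewrite geq_max => /andP[hi w1] us h.
  have [us1 e1 h1] := IH w1 us h.
  by exists us1 => //; apply: ExecWhenT e1; rewrite h.
Qed.

Lemma while_inv i (g : sy -> bool) p (Inv : nat -> (nat -> tp) -> Prop) m T ts :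
  (forall k ts, k < m -> Inv k.+1 ts -> g (tape_head (ts i)) /\ exists2 ts', cex p ts T ts' & Inv k ts') ->
  (forall ts, Inv 0 ts -> ~~ g (tape_head (ts i))) ->
  Inv m ts -> exists2 ts', cex (While i g p) ts (m * T.+2).+1 ts' & Inv 0 ts'.
Proof.
move=> h h0; elim: m ts h => [|m IH] ts h hi.
  by exists ts => //; exists 1 => //; apply: ExecWhileF; exact: h0.
have [hg [ts1 [n hn e1] i1]] := h m ts (ltnSn m) hi.
have [ts2 [n' hn' e2] i2] := IH ts1 (fun k us hk => h k us (leqW hk)) i1.
exists ts2 => //; exists (n + n').+2; last exact: ExecWhileT e1 e2.
by rewrite mulSn; lia.
Qed.

Definition Mass (f : nat -> sy -> sy * move) (js : seq nat) : prog I :=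
  foldr (fun i p => Seq (Do i (f i)) p) Skip js.

Lemma cex_Mass f js ts : uniq js ->
  cex (Mass f js) ts (size js) (fun i => if i \in js then act (f i) (ts i) else ts i).
Proof.
elim: js ts => [|j js IH] ts /=; first by move=> _; exact: cex_skip.
case/andP => nj uj; have := cex_seq (cex_do j (f j) ts) (IH _ uj); rewrite add1n.
set us := (fun i => _); set us' := (fun i => _).
suff -> : us = us' by [].
apply: functional_extensionality => i; rewrite /us /us' inE /upd.
by case: eqP => [->|_]; rewrite ?(negbTE nj).
Qed.

Definition right (s : sy) : sy * move := (s, MoveR).
Definition left (s : sy) : sy * move := (s, MoveL).
Definition putR (x s : sy) : sy * move := (x, MoveR).
Definition putL (x s : sy) : sy * move := (x, MoveL).
Definition put (x s : sy) : sy * move := (x, Stay).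

Definition bcells a m b : seq sy := nseq a.+1 None ++ nseq m mM ++ nseq b.+1 None.

(* Tapes whose non-blank part is [M^m]; the head is on cell [k], where the cells [M] are numbered from 1. *)
Definition blockT (m k : nat) (t : tp) : Prop := exists a b, t = ztape (bcells a m b) (a + k).

Lemma size_bcells a m b : size (bcells a m b) = a + m + b + 2.
Proof. by rewrite !size_cat !size_nseq; lia. Qed.

Lemma nth_bcells a m b k : nth None (bcells a m b) (a + k) = if 0 < k <= m then mM else None.
Proof.
rewrite !nth_cat !size_nseq !nth_nseq; case: k => [|k] /=.
  by rewrite addn0 ltnSn.
have -> : (a + k.+1 < a.+1) = false by lia.
have -> : a + k.+1 - a.+1 = k by lia.
by case: (k < m) => //; case: ifP.
Qed.

Lemma block_head m k t : blockT m k t -> tape_head t = if 0 < k <= m then mM else None.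
Proof. by case=> a [b ->] /=; rewrite nth_bcells. Qed.

Lemma block_left m k t : k <= m -> blockT m k.+1 t -> blockT m k (act left t).
Proof.
move=> hk [a [b ->]]; exists a, b; rewrite addnS.
rewrite -[act _ _]/(tape_move None (ztape (bcells a m b) (a + k).+1) MoveL) ztape_left // size_bcells; lia.
Qed.

Lemma block_right m k t : k <= m -> blockT m k t -> blockT m k.+1 (act right t).
Proof.
move=> hk [a [b ->]]; exists a, b; rewrite addnS.
rewrite -[act _ _]/(tape_move None (ztape (bcells a m b) (a + k)) MoveR) ztape_right // size_bcells; lia.
Qed.

Lemma bcells_split a m b : bcells a m b = (nseq a.+1 None ++ nseq m mM) ++ nseq b.+1 None.
Proof. by rewrite /bcells catA. Qed.

Lemma bcells_splitS a m b :
  bcells a m.+1 b = rcons (nseq a.+1 None ++ nseq m mM) mM ++ nseq b.+1 None.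
Proof.
have e : nseq m.+1 mM = rcons (nseq m mM) mM by rewrite -cats1 -[m.+1]addn1 nseqD.
by rewrite /bcells e -!cats1 !catA.
Qed.

Lemma size_bpre a m : size (nseq a.+1 (None : sy) ++ nseq m mM) = a + m.+1.
Proof. by rewrite size_cat !size_nseq; lia. Qed.

Lemma block_erase m t : blockT m.+1 m.+1 t -> blockT m m (act (putL None) t).
Proof.
case=> a [b ->]; exists a, b.+1.
have e : Tape (rev (take (a + m.+1) (bcells a m.+1 b))) None (drop (a + m.+1).+1 (bcells a m.+1 b))
   = ztape (bcells a m b.+1) (a + m).+1.
  rewrite /ztape -[(a + m).+1]addnS nth_bcells ltnn andbF; congr Tape.
    by rewrite bcells_splitS bcells_split cat_rcons !take_size_cat // size_bpre.
  rewrite bcells_splitS bcells_split -[nseq b.+2 None]/(None :: nseq b.+1 None) -cat_rcons.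
  by rewrite !drop_size_cat // size_rcons size_bpre.
rewrite -[act _ _]/(tape_move None (Tape (rev (take (a + m.+1) (bcells a m.+1 b))) None (drop (a + m.+1).+1 (bcells a m.+1 b))) MoveL).
by rewrite e ztape_left // size_bcells; lia.
Qed.

Lemma block_append m t : blockT m m.+1 t -> blockT m.+1 m.+2 (act (putR mM) t).
Proof.
case=> a [b ->]; exists a, b.-1.
rewrite -[act _ _]/(tape_move None (Tape (rev (take (a + m.+1) (bcells a m b))) mM (drop (a + m.+1).+1 (bcells a m b))) MoveR).
rewrite bcells_split take_size_cat ?size_bpre // -[nseq b.+1 None]/(None :: nseq b None) -cat_rcons.
rewrite drop_size_cat ?size_rcons ?size_bpre //.
rewrite /ztape nth_bcells ltnn andbF bcells_splitS addnS take_size_cat ?size_rcons ?size_bpre // rev_rcons.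
rewrite -[nseq b.-1.+1 None]/(None :: nseq b.-1 None) -cat_rcons drop_size_cat ?size_rcons ?size_bpre //.
by case: b.
Qed.

Section Doubling.
Variables (X Y : nat).
Hypothesis nXY : X <> Y.

(** [Double] erases the block on [X] while writing two marks on [Y] for each mark, then drains [Y]
    back to [X] one for one. *)
Definition Drain (Z V : nat) (p : prog I) : prog I :=
  Seq (Do Z left) (Seq (While Z (fun s => s == mM) (Seq (Do Z (putL None)) p)) (Do Z right)).
Definition Double : prog I :=
  Seq (Drain X Y (Seq (Do Y (putR mM)) (Do Y (putR mM)))) (Drain Y X (Do X (putR mM))).

Definition only2 (ts us : nat -> tp) : Prop := forall i, i <> X -> i <> Y -> us i = ts i.

Lemma cex_Double L ts : blockT L L.+1 (ts X) -> blockT 0 1 (ts Y) ->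
  exists2 ts', cex Double ts (13 * L + 20) ts' &
    [/\ blockT (2 * L) (2 * L).+1 (ts' X), blockT 0 1 (ts' Y) & only2 ts ts'].
Proof.
move=> hX hY.
pose Inv1 k us := [/\ blockT k k (us X), blockT (2 * (L - k)) (2 * (L - k)).+1 (us Y) & only2 ts us].
pose us0 := upd ts X (act left (ts X)).
have i0 : Inv1 L us0.
  rewrite /Inv1 /us0 subnn upd_same upd_other; last by apply: nesym.
  split=> //; first exact: block_left.
  by move=> i h1 h2; rewrite upd_other.
have [||us1 e1 [x1 y1 o1]] := @while_inv X (fun s => s == mM) (Seq (Do X (putL None)) (Seq (Do Y (putR mM)) (Do Y (putR mM)))) Inv1 L 3 us0 _ _ i0.
- move=> k us hk [hx hy ho]; rewrite (block_head hx) /= ltnSn eqxx; split=> //.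
  eexists; first exact: (cex_seq (cex_do _ _ _) (cex_seq (cex_do _ _ _) (cex_do _ _ _))).
  rewrite /Inv1; split.
  + do 2 (rewrite upd_other //). rewrite upd_same. exact: block_erase.
  + rewrite upd_same upd_same upd_other; last by apply: nesym.
    have -> : 2 * (L - k) = (2 * (L - k.+1)).+2 by lia.
    by do 2 apply: block_append.
  + by move=> i h1 h2; do 3 (rewrite upd_other //); exact: ho.
- by move=> us [hx _ _]; rewrite (block_head hx).
rewrite subn0 in y1.
pose us2 := upd us1 X (act right (us1 X)).
have x2 : blockT 0 1 (us2 X) by rewrite /us2 upd_same; apply: block_right.
pose us3 := upd us2 Y (act left (us2 Y)).
pose Inv2 k us := [/\ blockT k k (us Y), blockT (2 * L - k) (2 * L - k).+1 (us X) & only2 ts us].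
have i3 : Inv2 (2 * L) us3.
  rewrite /Inv2 /us3 subnn upd_same upd_other // {1}/us2 upd_other; last by apply: nesym.
  split=> //; first exact: block_left.
  by move=> i h1 h2; rewrite /us2 !upd_other //; exact: o1.
have [||us4 e4 [x4 y4 o4]] := @while_inv Y (fun s => s == mM) (Seq (Do Y (putL None)) (Do X (putR mM))) Inv2 (2 * L) 2 us3 _ _ i3.
- move=> k us hk [hx hy ho]; rewrite (block_head hx) /= ltnSn eqxx; split=> //.
  eexists; first exact: (cex_seq (cex_do _ _ _) (cex_do _ _ _)).
  rewrite /Inv2; split.
  + rewrite upd_other; last by apply: nesym. rewrite upd_same. exact: block_erase.
  + rewrite upd_same upd_other //.
    have -> : 2 * L - k = (2 * L - k.+1).+1 by lia.
    by apply: block_append.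
  + by move=> i h1 h2; do 2 (rewrite upd_other //); exact: ho.
- by move=> us [hx _ _]; rewrite (block_head hx).
rewrite subn0 in y4.
exists (upd us4 Y (act right (us4 Y))).
  have h1 := cex_seq (cex_do X left ts) (cex_seq e1 (cex_do X right us1)).
  have h2 := cex_seq (cex_do Y left us2) (cex_seq e4 (cex_do Y right us4)).
  by apply: cex_le (cex_seq h1 h2) _; lia.
rewrite upd_same upd_other //; split=> //; first exact: block_right.
by move=> i h1 h2; rewrite upd_other //; exact: o4.
Qed.

Definition Loop z (p : prog I) : prog I :=
  Seq (Do z left) (Seq (While z (fun s => s == mM) (Seq p (Do z left)))
  (Seq (Do z right) (While z (fun s => s == mM) (Do z right)))).

(** [d] nested loops over blocks of length [m] run the body [m ^ d] times; with doubling as the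
    body, one mark grows to [2 ^ m ^ d] marks. *)
Fixpoint Nest (zs : seq nat) (p : prog I) : prog I :=
  if zs is z :: zs' then Loop z (Nest zs' p) else p.

Fixpoint nest_time d m T := if d is d'.+1 then m * (nest_time d' m T + 8) + 10 else T.

Definition doubled K (ts : nat -> tp) := blockT (2 ^ K) (2 ^ K).+1 (ts X) /\ blockT 0 1 (ts Y).

Lemma cex_Nest zs m K0 k ts : uniq zs -> X \notin zs -> Y \notin zs ->
  (forall z, z \in zs -> blockT m m.+1 (ts z)) -> doubled k ts -> k + m ^ size zs <= K0 ->
  exists2 ts', cex (Nest zs Double) ts (nest_time (size zs) m (13 * 2 ^ K0 + 20)) ts' &
    [/\ doubled (k + m ^ size zs) ts', forall z, z \in zs -> blockT m m.+1 (ts' z) &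
     forall i, i \notin zs -> i <> X -> i <> Y -> ts' i = ts i].
Proof.
elim: zs k ts => [|z zs IH] k ts /=.
  move=> _ _ _ _ [hx hy]; rewrite expn0 => hk.
  have [ts' e [x1 y1 o1]] := cex_Double hx hy.
  exists ts'; first by apply: cex_le e _; rewrite leq_add2r leq_mul2l leq_exp2l //; lia.
  by split=> //; [rewrite /doubled addn1 expnS | move=> i _; exact: o1].
case/andP => nz uz; rewrite !inE !negb_or => /andP[nXz nX] /andP[nYz nY] hz hd.
rewrite expnS; set s := m ^ size zs => hk.
set TT := nest_time _ _ _ in IH *.
pose Inv j us := [/\ blockT m j (us z), doubled (k + (m - j) * s) us,
   forall z', z' \in zs -> blockT m m.+1 (us z') & forall i, i \notin z :: zs -> i <> X -> i <> Y -> us i = ts i].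
pose us0 := upd ts z (act left (ts z)).
have zX : X <> z by apply/eqP.
have zY : Y <> z by apply/eqP.
have i0 : Inv m us0.
  rewrite /Inv /us0 upd_same subnn mul0n addn0; split.
  - by apply: block_left => //; apply: hz; rewrite inE eqxx.
  - by rewrite /doubled !upd_other.
  - move=> z' hz'; rewrite upd_other; first by apply: hz; rewrite inE hz' orbT.
    by move=> e; rewrite -e hz' in nz.
  - by move=> i; rewrite inE negb_or => /andP[/eqP h _] _ _; rewrite upd_other.
have [||us1 e1 [z1 d1 b1 o1]] := @while_inv z (fun s => s == mM) (Seq (Nest zs Double) (Do z left)) Inv m (TT + 1) us0 _ _ i0.
- move=> j us hj [hx hy hb ho]; rewrite (block_head hx) hj eqxx; split=> //.
  have hs : (m - j.+1) * s + s = (m - j) * s by rewrite addnC -mulSn; congr (_ * _); lia.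
  have hle : (m - j) * s <= m * s by rewrite leq_mul2r; apply/orP; right; lia.
  have [|us' e' [d' b' o']] := IH (k + (m - j.+1) * s) us uz nX nY hb hy; first by rewrite -/s; lia.
  exists (upd us' z (act left (us' z))); first exact: cex_seq e' (cex_do _ _ _).
  have ez : us' z = us z by apply: o' => //; exact: nesym.
  split.
  + by rewrite upd_same ez; apply: block_left => //; lia.
  + by move: d'; rewrite /doubled !upd_other // -/s -addnA hs.
  + move=> z' hz'; rewrite upd_other; first exact: b'.
    by move=> e; rewrite -e hz' in nz.
  + move=> i hi h1 h2; have := hi; rewrite inE negb_or => /andP[/eqP h h3].
    by rewrite upd_other // o' // ho.
- by move=> us [hx _ _ _]; rewrite (block_head hx).
rewrite subn0 in d1.
pose us2 := upd us1 z (act right (us1 z)).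
pose Inv2 j us := blockT m (m.+1 - j) (us z) /\ forall i, i <> z -> us i = us1 i.
have i2 : Inv2 m us2.
  rewrite /Inv2 /us2 upd_same; split; last by move=> i hi; rewrite upd_other.
  by have -> : m.+1 - m = 1 by [lia]; apply: block_right.
have [||us3 e3 [z3 o3]] := @while_inv z (fun s => s == mM) (Do z right) Inv2 m 1 us2 _ _ i2.
- move=> j us hj [hx ho]; rewrite (block_head hx); have -> : 0 < m.+1 - j.+1 <= m by lia.
  split=> //; exists (upd us z (act right (us z))); first exact: cex_do.
  rewrite /Inv2 upd_same; split; last by move=> i hi; rewrite upd_other // ho.
  have -> : m.+1 - j = (m.+1 - j.+1).+1 by lia.
  by apply: block_right => //; lia.
- by move=> us [hx _]; rewrite (block_head hx) subn0 ltnn andbF.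
exists us3.
  apply: cex_le (cex_seq (cex_do z left ts) (cex_seq e1 (cex_seq (cex_do z right us1) e3))) _.
  by rewrite !mulnDr !mulnS; lia.
rewrite subn0 in z3; split.
- by move: d1; rewrite /doubled !o3.
- move=> z'; rewrite inE => /orP[/eqP -> //|hz']; rewrite o3; first exact: b1.
  by move=> e; rewrite -e hz' in nz.
- by move=> i hi h1 h2; rewrite o3 ?o1 //; move=> e; rewrite e inE eqxx in hi.
Qed.
End Doubling.
End Init.

End Doubling.
Import Doubling.

(** * Setting up the input, the empty table and the registers *)

Module Initialisation.
Import all_order all_algebra finmap FunctionalExtensionality.

Definition pol (T : nat -> nat) := exists a, forall N, T N <= N.+2 ^ a.

Lemma pol_le T T' : (forall N, T N <= T' N) -> pol T' -> pol T.
Proof. by move=> h [a ha]; exists a => N; apply: leq_trans (h N) (ha N). Qed.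

Lemma pol_add T T' : pol T -> pol T' -> pol (fun N => T N + T' N).
Proof.
move=> [a ha] [b hb]; exists (a + b).+1 => N; rewrite expnS.
have h1 : N.+2 ^ a <= N.+2 ^ (a + b) by rewrite leq_exp2l // leq_addr.
have h2 : N.+2 ^ b <= N.+2 ^ (a + b) by rewrite leq_exp2l // leq_addl.
by have := ha N; have := hb N; rewrite !mulSn; lia.
Qed.

Lemma pol_mul T T' : pol T -> pol T' -> pol (fun N => T N * T' N).
Proof. by move=> [a ha] [b hb]; exists (a + b) => N; rewrite expnD leq_mul. Qed.

Lemma pol_cst c : pol (fun=> c).
Proof. by exists c => N; apply: leq_trans (ltnW (ltn_expl c (ltnSn 1))) _; case: c => // c; rewrite leq_exp2r. Qed.

Lemma pol_id : pol id.
Proof. by exists 1 => N; rewrite expn1; lia. Qed.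

Lemma pol_exp a : pol (fun N => N.+2 ^ a).
Proof. by exists a. Qed.

Lemma pol_nest d : pol (fun N => nest_time d N.+2 (13 * N + 20)).
Proof.
elim: d => [|d IH] /=.
  by apply: pol_add; [apply: pol_mul; [exact: pol_cst | exact: pol_id] | exact: pol_cst].
apply: pol_add; last exact: pol_cst.
apply: pol_mul; first by exists 1 => N; rewrite expn1.
by apply: pol_add => //; exact: pol_cst.
Qed.

Lemma leq_nest d m m' T : m <= m' -> nest_time d m T <= nest_time d m' T.
Proof. by move=> h; elim: d => //= d IH; rewrite leq_add2r leq_mul // leq_add2r. Qed.

Section Setup.
Variable I : finType.
Notation sy := (option (I + option bool)).
Notation tp := (tape sy).
Notation mM := (mM I).
Notation mF := (mF I).
Notation mE := (mE I).
Notation left := (@left I).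
Notation right := (@right I).

Lemma ztape_right_ext (s : seq sy) p : p.+1 = size s -> tape_move None (ztape s p) MoveR = ztape (rcons s None) p.+1.
Proof.
case/lastP: s => // s x; rewrite size_rcons => -[->].
rewrite /ztape -{1}[rcons s x]cats1 take_size_cat // nth_rcons ltnn eqxx drop_oversize ?size_rcons //=.
rewrite -[rcons (rcons s x) None]cats1 take_size_cat ?size_rcons // rev_rcons nth_cat size_rcons ltnn subnn /=.
by rewrite drop_oversize // size_cat size_rcons addn1.
Qed.

(** The head may run past the input; at least one blank is always listed, and each further move to
    the right lists one more. *)
Definition padt (s : seq sy) j : tp := ztape (s ++ nseq (maxn 1 (j.+1 - size s)) None) j.

Lemma pad_right s j : act right (padt s j) = padt s j.+1.
Proof.
rewrite -[act _ _]/(tape_move None (ztape (s ++ nseq (maxn 1 (j.+1 - size s)) None) j) MoveR) /padt.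
case: (ltnP j.+1 (size s + maxn 1 (j.+1 - size s))) => h.
  by rewrite ztape_right ?size_cat ?size_nseq //; congr (ztape (s ++ nseq _ _)); lia.
rewrite ztape_right_ext ?size_cat ?size_nseq; last by lia.
rewrite -cats1 -catA -[[:: None]]/(nseq 1 None) -nseqD; congr (ztape (s ++ nseq _ _)); lia.
Qed.

Definition rtape j : tp := Tape (nseq j.-1 mM ++ [:: mF]) None [::].

Lemma rtape_step j : 0 < j -> act (putR mM) (rtape j) = rtape j.+1.
Proof. by case: j. Qed.

Lemma rtape_end N : 0 < N -> act (put mE) (rtape N) = ztape (mF :: rcons (nseq N.-1 mM) mE) N.
Proof.
case: N => // n _; rewrite /rtape /act /ztape /=; congr Tape.
- by rewrite -cats1 take_size_cat ?size_nseq // rev_cons rev_nseq cats1.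
- by rewrite nth_rcons size_nseq ltnn eqxx.
- by rewrite drop_oversize // size_rcons size_nseq.
Qed.

Section Phases.
Variables (R d : nat).
Hypothesis R2 : 2 < R.
(** Tapes from [R] on are scratch: [X] and [Y] for doubling, [C] for a unary copy of the input
    length used to rewind tape 0, and [zs] for the loop counters of length [size w + 2]. *)
Let X := R. Let Y := R.+1. Let C := R.+2.
Let zs := iota R.+3 d.

Definition Read : prog I := While 0 (fun s => s != None) (Mass (fun i => if i == 0 then right else putR mM) [:: 0, C & zs]).
Definition Rewind : prog I := Seq (Do C left) (While C (fun s => s == mM) (Seq (Do 0 left) (Do C left))).
(** One pass writes all register tapes at once while the block on [X] is traversed backwards; tapes
    0 and 1 only move along, so that their blanks get listed as well. *)
Definition bmove (x : sy) i := if i < 2 then right else if i < R then putR x else left.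
Definition Build : prog I :=
  Seq (Do X left) (Seq (Mass (bmove mF) (iota 0 R.+1))
    (Seq (While X (fun s => s == mM) (Mass (bmove mM) (iota 0 R.+1)))
         (Mass (fun=> put mE) (iota 2 (R - 2))))).
Definition Home : prog I := While 2 (@nz I) (Mass (fun=> left) (iota 0 R)).
Definition Prepare : prog I :=
  Seq (Mass (fun=> right) (iota R (d + 3))) (Seq (Do X (putR mM))
    (Seq (Mass (fun=> putR mM) zs) (Mass (fun=> putR mM) zs))).
Definition Init : prog I :=
  Seq Prepare (Seq Read (Seq Rewind (Seq (Nest zs (Double I X Y)) (Seq Build Home)))).

Lemma pre_loops w : exists2 ts, cex Prepare (input_tapes w) (3 * d + 4) ts &
  [/\ forall i, i < R -> ts i = input_tapes w i, doubled X Y 0 ts, blockT 0 1 (ts C) & forall z, z \in zs -> blockT 2 3 (ts z)].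
Proof.
have h1 := cex_Mass (fun=> right) (input_tapes w) (iota_uniq R (d + 3)).
have hz ts := cex_Mass (fun=> putR mM) ts (iota_uniq R.+3 d).
have b0 i : R <= i -> blockT 0 1 (act right (input_tapes w i)).
  move=> hi; exists 0, 0; have z1 : (i == 0) = false by apply/eqP; lia.
  by rewrite /input_tapes z1.
eexists.
  apply: cex_le (cex_seq h1 (cex_seq (cex_do _ _ _) (cex_seq (hz _) (hz _)))) _.
  by rewrite !size_iota; lia.
have iz i : (i \in zs) = (R.+3 <= i < R.+3 + d) by rewrite mem_iota.
have ia i : (i \in iota R (d + 3)) = (R <= i < R + (d + 3)) by rewrite mem_iota.
split.
- move=> i hi; have z1 : (R.+3 <= i < R.+3 + d) = false by lia.
  have z2 : (R <= i < R + (d + 3)) = false by lia.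
  by rewrite -/zs !iz z1 upd_other ?ia ?z2 // /X; lia.
- have z1 : (R.+3 <= R < R.+3 + d) = false by lia.
  have z2 : (R <= R < R + (d + 3)) = true by lia.
  have z3 : (R.+3 <= R.+1 < R.+3 + d) = false by lia.
  have z4 : (R <= R.+1 < R + (d + 3)) = true by lia.
  rewrite /doubled -/zs !iz /X /Y z1 z3 upd_same upd_other ?ia ?z2 ?z4; last by lia.
  split; last by apply: b0; lia.
  by apply: block_append; apply: b0.
- have z3 : (R.+3 <= R.+2 < R.+3 + d) = false by lia.
  have z4 : (R <= R.+2 < R + (d + 3)) = true by lia.
  rewrite -/zs iz /C z3 upd_other ?ia ?z4; last by rewrite /X; lia.
  by apply: b0; lia.
- move=> z hz'; rewrite -/zs hz'; move: hz'; rewrite iz => hz'.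
  have z4 : (R <= z < R + (d + 3)) = true by lia.
  rewrite upd_other ?ia ?z4; last by rewrite /X; lia.
  by do 2 apply: block_append; apply: b0; lia.
Qed.

Lemma cex_Read w ts : ts 0 = input_tapes w 0 -> blockT 0 1 (ts C) -> (forall z, z \in zs -> blockT 2 3 (ts z)) ->
  exists2 ts', cex Read ts (size w * (d + 4)).+1 ts' &
  [/\ ts' 0 = padt [seq Some (inl a) | a <- w] (size w), blockT (size w) (size w).+1 (ts' C),
     forall z, z \in zs -> blockT (size w).+2 (size w).+3 (ts' z) & forall i, 0 < i < R.+2 -> ts' i = ts i].
Proof.
move=> h0 hC hz; set n := size w; set inp := [seq _ | _ <- w].
have si : size inp = n by rewrite size_map.
pose t0 j : tp := if j < n then ztape inp j else padt inp n.
pose Inv k us := [/\ us 0 = t0 (n - k), blockT (n - k) (n - k).+1 (us C),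
     forall z, z \in zs -> blockT (n - k).+2 (n - k).+3 (us z) & forall i, 0 < i < R.+2 -> us i = ts i].
have i0 : Inv n ts.
  rewrite /Inv subnn; split=> //; rewrite h0 /t0 /n /input_tapes eqxx -/inp.
  by rewrite /inp; case: (w) => [|a s] //=; rewrite /ztape /= ?take0 ?drop0.
have u0 : uniq [:: 0, C & zs].
  by rewrite /= iota_uniq inE !mem_iota /C; lia.
have iz i : (i \in zs) = (R.+3 <= i < R.+3 + d) by rewrite mem_iota.
have [||ts' e [x1 x2 x3 x4]] := @while_inv _ 0 (fun s => s != None) (Mass (fun i => if i == 0 then right else putR mM) [:: 0, C & zs]) Inv n (d + 2) ts _ _ i0.
- move=> k us hk [y1 y2 y3 y4]; split.
    rewrite y1 /t0 (_ : n - k.+1 < n); last by lia.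
    have /mapP[a _ ea] : nth None inp (n - k.+1) \in inp by rewrite mem_nth // si; lia.
    by rewrite /ztape /= ea.
  exists (fun i => if i \in [:: 0, C & zs] then act (if i == 0 then right else putR mM) (us i) else us i).
    by have := cex_Mass (fun i => if i == 0 then right else putR mM) us u0; rewrite /= size_iota addn2.
  have e1 : n - k = (n - k.+1).+1 by lia.
  split.
  + rewrite inE eqxx y1 /t0 (_ : n - k.+1 < n); last by lia.
    rewrite -[act _ _]/(tape_move None (ztape inp (n - k.+1)) MoveR) e1; case: ltnP => h.
      by rewrite ztape_right // si.
    rewrite ztape_right_ext ?si; last by lia.
    rewrite /padt si subSnn -cats1 (_ : (n - k.+1).+1 = n) //; lia.
  + by rewrite !inE eqxx orbT e1; apply: block_append.
  + move=> z hz'; have z1 : (z == 0) = false by move: hz'; rewrite iz => hz'; apply/eqP; lia.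
    by rewrite !inE hz' !orbT e1 z1; apply: block_append; exact: y3.
  + move=> i hi; have z1 : (i == 0) = false by apply/eqP; lia.
    have z2 : (i == R.+2) = false by apply/eqP; lia.
    have z3 : (R.+3 <= i < R.+3 + d) = false by lia.
    by rewrite !inE iz /C z1 z2 z3; exact: y4.
- by move=> us [y1 _ _ _]; rewrite y1 /t0 subn0 ltnn /padt /ztape /= nth_cat si ltnn subnn subSnn.
exists ts'; first by apply: cex_le e _; lia.
by move: x1; rewrite subn0 /t0 ltnn => x1; split=> //; rewrite subn0 in x2 x3.
Qed.

Lemma cex_Rewind (s : seq sy) n ts : ts 0 = ztape s n -> n < size s -> blockT n n.+1 (ts C) ->
  exists2 ts', cex Rewind ts (4 * n + 2) ts' & ts' 0 = ztape s 0 /\ forall i, 0 < i -> i <> C -> ts' i = ts i.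
Proof.
move=> h0 hn hC; have C0 : 0 <> C by rewrite /C.
pose Inv k us := [/\ us 0 = ztape s k, blockT n k (us C) & forall i, 0 < i -> i <> C -> us i = ts i].
pose us0 := upd ts C (act left (ts C)).
have i0 : Inv n us0.
  rewrite /Inv /us0 upd_same upd_other //; split=> //; first exact: block_left.
  by move=> i h1 h2; rewrite upd_other.
have [||ts' e [x1 x2 x3]] := @while_inv _ C (fun s => s == mM) (Seq (Do 0 left) (Do C left)) Inv n 2 us0 _ _ i0.
- move=> k us hk [y1 y2 y3]; rewrite (block_head y2) /= hk eqxx; split=> //.
  eexists; first exact: cex_seq (cex_do _ _ _) (cex_do _ _ _).
  split.
  + rewrite upd_other // upd_same y1 -[act _ _]/(tape_move None (ztape s k.+1) MoveL) ztape_left //; lia.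
  + rewrite upd_same upd_other; last exact: nesym.
    by apply: block_left => //; lia.
  + by move=> i h1 h2; rewrite !upd_other ?y3 //; lia.
- by move=> us [_ y2 _]; rewrite (block_head y2).
exists ts' => //; apply: cex_le (cex_seq (cex_do _ _ _) e) _; lia.
Qed.

Definition world0 N w : wd I := World N w (fun=> false).

Lemma cex_Build w N ts : 0 < N -> size w <= N ->
  ts 0 = padt [seq Some (inl a) | a <- w] 0 -> ts 1 = padt [::] 0 ->
  (forall i, 1 < i < R -> ts i = Tape [::] None [::]) -> blockT N N.+1 (ts X) ->
  exists2 ts', cex Build ts ((N + 2) * (R + 5)) ts' &
    forall i, i < R -> ts' i = ztape (cells (world0 N w) i) N.
Proof.
move=> N0 hwN h0 h1 hr hX; pose inp : seq sy := [seq Some (inl a) | a <- w].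
have mi i : (i \in iota 0 R.+1) = (i <= R) by rewrite mem_iota.
have xb x : bmove x X = left by rewrite /bmove /X ltnn; have -> : (R < 2) = false by lia.
pose us0 := upd ts X (act left (ts X)).
pose us1 := fun i => if i \in iota 0 R.+1 then act (bmove mF i) (us0 i) else us0 i.
pose Inv k us := [/\ k < N, blockT N k (us X), us 0 = padt inp (N - k), us 1 = padt [::] (N - k) &
   forall i, 1 < i < R -> us i = rtape (N - k)].
have neX i : i < R -> i <> X by rewrite /X; lia.
have i1 : Inv N.-1 us1.
  have e1 : N - N.-1 = 1 by lia.
  rewrite /Inv e1 /us1 !mi /us0; split.
  - by lia.
  - rewrite leqnn xb upd_same; apply: block_left; first by lia.
    by rewrite prednK //; exact: block_left.
  - by rewrite /= upd_other ?h0 ?pad_right //; apply: neX; lia.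
  - rewrite (_ : 1 <= R) ?upd_other ?h1 ?pad_right //; first by apply: neX; lia.
    by lia.
  - move=> i hi; rewrite mi (_ : i <= R); last by lia.
    rewrite upd_other ?hr //; last by apply: neX; lia.
    have z1 : (i < 2) = false by lia.
    have z2 : i < R by lia.
    by rewrite /bmove z1 z2.
have [||us2 e2 [_ x2 x3 x4 x5]] := @while_inv _ X (fun s => s == mM) (Mass (bmove mM) (iota 0 R.+1)) Inv N.-1 R.+1 us1 _ _ i1.
- move=> k us hk [y0 y1 y2 y3 y4]; rewrite (block_head y1) /= ltnW // eqxx; split=> //.
  exists (fun i => if i \in iota 0 R.+1 then act (bmove mM i) (us i) else us i).
    by have := cex_Mass (bmove mM) us (iota_uniq 0 R.+1); rewrite size_iota.
  have e1 : N - k = (N - k.+1).+1 by lia.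
  rewrite /Inv e1 !mi; split.
  + by lia.
  + by rewrite leqnn xb; apply: block_left => //; lia.
  + by rewrite /= y2 pad_right.
  + by rewrite (_ : 1 <= R) ?y3 ?pad_right //; lia.
  + move=> i hi; rewrite mi (_ : i <= R); last by lia.
    rewrite y4 // /bmove; have -> : (i < 2) = false by lia.
    by have -> : i < R by [lia]; rewrite rtape_step //; lia.
- by move=> us [_ y1 _ _ _]; rewrite (block_head y1).
rewrite subn0 in x3 x4 x5.
exists (fun i => if i \in iota 2 (R - 2) then act (put mE) (us2 i) else us2 i).
  have h2 := cex_Mass (bmove mF) us0 (iota_uniq 0 R.+1).
  have h3 := cex_Mass (fun=> put mE) us2 (iota_uniq 2 (R - 2)).
  apply: cex_le (cex_seq (cex_do X left ts) (cex_seq h2 (cex_seq e2 h3))) _.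
  by rewrite !size_iota; nia.
move=> i hi; rewrite mem_iota; case: (ltnP 1 i) => h /=.
  have -> : i < 2 + (R - 2) by lia.
  rewrite x5 ?h // rtape_end // /cells.
  have -> : (i == 0) = false by apply/eqP; lia.
  by have -> : (i == 1) = false by apply/eqP; lia.
case: i hi h => [|[|i]] hi h //.
  rewrite x3 /padt /cells /=; congr (ztape (_ ++ nseq _ _)); rewrite size_map; lia.
rewrite x4 /padt /cells /=; congr ztape.
have -> : maxn 1 (N.+1 - 0) = N.+1 by lia.
by apply: (@eq_from_nth _ None) => [|j]; rewrite size_nseq ?size_mkseq // => hj; rewrite nth_nseq nth_mkseq // hj.
Qed.

Lemma cex_Home W ts : wok W -> (forall i, i < R -> ts i = ztape (cells W i) (wN W)) ->
  exists2 ts', cex Home ts (wN W * (R + 2)).+1 ts' & forall i, i < R -> ts' i = conc W (fun=> 0) i.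
Proof.
move=> okW h; set N := wN W.
pose Inv k us := k <= N /\ forall i, i < R -> us i = ztape (cells W i) k.
have hd k us : Inv k us -> nz (tape_head (us 2)) = (0 < k).
  case=> hk hu; rewrite hu // -[ztape _ _]/(conc W (fun=> k) 2) nzE //.
have [|||ts' e [_ x]] := @while_inv _ 2 (@nz I) (Mass (fun=> left) (iota 0 R)) Inv N R ts.
- move=> k us hk hI; rewrite (hd _ _ hI); split=> //; case: hI => h1 h2.
  exists (fun i => if i \in iota 0 R then act left (us i) else us i).
    by have := cex_Mass (fun=> left) us (iota_uniq 0 R); rewrite size_iota.
  split; first by lia.
  move=> i hi; rewrite mem_iota /= hi h2 // -[act _ _]/(tape_move None (ztape (cells W i) k.+1) MoveL).
  by rewrite ztape_left // size_cells //; lia.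
- by move=> us /hd ->.
- by split.
by exists ts' => //; apply: cex_le e _; lia.
Qed.

(** Each doubling is linear in the final block length and the loop bounds [n.+2] are at most [N], so
    for fixed [d] the nested loops cost a polynomial in [N]. *)
Lemma cex_Init : exists2 T, pol T & forall w, let N := 2 ^ (size w).+2 ^ d in 0 < d ->
  exists2 ts, cex Init (input_tapes w) (T N) ts & forall i, i < R -> ts i = conc (world0 N w) (fun=> 0) i.
Proof.
exists (fun N => (3 * d + 4) + (N * (d + 4) + 1) + (4 * N + 2) + nest_time d N.+2 (13 * N + 20)
   + (N + 2) * (R + 5) + (N * (R + 2) + 1)).
  by repeat (first [apply: pol_add | apply: pol_mul | exact: pol_cst | exact: pol_id | exact: pol_nest]).
move=> w N d0; set n := size w; set K := n.+2 ^ d.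
have nK : n.+2 <= K by rewrite /K; case: (d) d0 => // d' _; rewrite expnS leq_pmulr // expn_gt0.
have KN : K < N by rewrite /N -/K ltn_expl.
have N0 : 0 < N by lia.
have [ts1 e1 [a1 b1 c1 d1]] := pre_loops w.
have h10 : ts1 0 = input_tapes w 0 by apply: a1; lia.
have [ts2 e2 [a2 b2 c2 d2]] := cex_Read h10 c1 d1.
have [|ts3 e3 [a3 b3]] := cex_Rewind a2 _ b2.
  by rewrite size_cat size_map size_nseq; lia.
have hXY i : i <= R.+1 -> i <> C by rewrite /C; lia.
have d3 : doubled X Y 0 ts3.
  by move: b1; rewrite /doubled !b3 ?d2 //; rewrite /X /Y /C; lia.
have z3 z : z \in zs -> blockT n.+2 n.+3 (ts3 z).
  move=> hz; rewrite b3; first exact: c2; by move: hz; rewrite mem_iota /C; lia.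
have sz : size zs = d by rewrite size_iota.
have [||||ts4 e4 [x4 y4 w4]] := @cex_Nest _ X Y _ zs n.+2 K 0 ts3 (iota_uniq _ _) _ _ z3 d3; rewrite ?mem_iota ?sz /X /Y; try lia.
rewrite sz add0n -/K in x4; rewrite sz in e4.
have s4 i : 0 < i < R -> ts4 i = input_tapes w i.
  move=> hi; rewrite w4 ?mem_iota /X /Y; try lia.
  rewrite b3; [|lia|by apply: hXY; lia].
  by rewrite d2; [apply: a1|]; lia.
have [|||||ts5 e5 h5] := @cex_Build w N ts4 N0; rewrite /X.
- by lia.
- rewrite w4 ?mem_iota /X /Y; try lia.
  by rewrite a3 /padt size_map; congr (ztape (_ ++ nseq _ _)); lia.
- by rewrite s4 //; lia.
- by move=> i hi; rewrite s4 /input_tapes; [have -> : (i == 0) = false by apply/eqP; lia | lia].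
- by case: x4.
have okW : wok (world0 N w) by rewrite /wok /= N0; lia.
have [ts6 e6 h6] := cex_Home okW h5.
exists ts6 => //.
have hn : nest_time d n.+2 (13 * 2 ^ K + 20) <= nest_time d N.+2 (13 * N + 20).
  by apply: leq_nest; lia.
have hm : n * (d + 4) <= N * (d + 4) by rewrite leq_mul2r; lia.
apply: cex_le (cex_seq e1 (cex_seq e2 (cex_seq e3 (cex_seq e4 (cex_seq e5 e6))))) _.
by rewrite -/n /=; lia.
Qed.
End Phases.

End Setup.

End Initialisation.
Import Initialisation.

(** * Iterating a table to its fixpoint, and the resulting time bound *)

Module Sweeps.
Import all_order all_algebra finmap FunctionalExtensionality.

Section Sweep.
Variable I : finType.
Notation sy := (option (I + option bool)).
Notation tp := (tape sy).
Notation mM := (mM I).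
Notation nz := (@nz I).
Notation Inc := (@Inc I).
Notation MvL := (@MvL I).
Notation MvR := (@MvR I).
Notation put := (@put I).

Lemma cex_write (W : wd I) v : wok W -> v 1 <= wN W ->
  cex (Do 1 (put mM)) (conc W v) 1 (conc (World (wN W) (ww W) (upd (wT W) (v 1) true)) v).
Proof.
move=> okW hv; have := cex_do 1 (put mM) (conc W v).
set ts := upd _ _ _; set ts' := conc (World _ _ _) v; suff -> : ts = ts' by [].
apply: functional_extensionality => i; rewrite /ts /ts' /upd; case: eqP => [->|ne]; last first.
  by rewrite /conc /cells /= (introF eqP ne).
have e1 : forall T, cells (World (wN W) (ww W) T) 1 = mkseq (fun j => if T j then mM else None) (wN W).+1 by [].
rewrite /conc e1 -[cells W 1]/(cells (World (wN W) (ww W) (wT W)) 1) e1; set c := mkseq _ _.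
rewrite -[act _ _]/(Tape (rev (take (v 1) c)) mM (drop (v 1).+1 c)) /c /ztape {c}; congr Tape.
- congr rev; apply: (@eq_from_nth _ None) => [|j]; rewrite !size_take_min !size_mkseq // => hj.
  rewrite !nth_take ?nth_mkseq //; try lia.
  have -> // : (j == v 1) = false by apply/eqP; lia.
- by rewrite nth_mkseq ?eqxx.
- apply: (@eq_from_nth _ None) => [|j]; rewrite !size_drop !size_mkseq // => hj.
  rewrite !nth_drop !nth_mkseq; try lia.
  by have -> : ((v 1).+1 + j == v 1) = false by apply/eqP; lia.
Qed.

(** Register 4 is the table index and register 5 the computed bit; entries are only ever raised, so
    a zero bit writes nothing. *)
Definition SetTab : prog I :=
  Seq (When 5 nz (Seq (Copy I 4 6 7) (Seq (While 6 nz (Seq (MvL 6) (Seq (MvR 1) (Inc 7))))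
     (Seq (Do 1 (put mM)) (While 7 nz (Seq (MvL 7) (MvL 1))))))) (Clear I 5).

Lemma cex_SetTab (W : wd I) v (b : bool) : wok W -> (forall i, v i <= wN W) -> v 1 = 0 -> v 5 = b ->
  v 6 = 0 -> v 7 = 0 ->
  cex SetTab (conc W v) (40 * wN W + 40)
    (conc (World (wN W) (ww W) (upd (wT W) (v 4) (wT W (v 4) || b))) (upd v 5 0)).
Proof.
move=> okW hv v1 v5 v6 v7; set N := wN W; set y := v 4; set W' := World _ _ _.
have okW' : wok W' by move: okW; rewrite /wok.
have hy : y <= N by exact: hv.
apply: (cex_le (T := (24 * N + 30).+1 + (3 * N).+1)); last by lia.
apply: (cex_seq (ts1 := conc W' v)); last first.
  by apply: cex_Clear => //=; exact: hv.
case: b @W' v5 okW' => W' v5 okW'; last first.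
  have -> : W' = W by rewrite /W' orbF upd_id /N; case: (W).
  exists 1; first by lia.
  by apply: ExecWhenF; rewrite nzE // v5.
suff hp : cex (Seq (Copy I 4 6 7) (Seq (While 6 nz (Seq (MvL 6) (Seq (MvR 1) (Inc 7))))
     (Seq (Do 1 (put mM)) (While 7 nz (Seq (MvL 7) (MvL 1)))))) (conc W v) (24 * N + 30) (conc W' v).
  by have := @cex_when _ 5 nz _ _ _ _ hp; rewrite nzE // v5.
have eW : W' = World (wN W) (ww W) (upd (wT W) y true) by rewrite /W' orbT.
pose S j := conc W (upd (upd (upd v 6 (y - j)) 1 j) 7 j).
have := @cex_while _ 6 nz (Seq (MvL 6) (Seq (MvR 1) (Inc 7))) S y 3; rewrite /S subn0 subnn.
have -> : upd (upd (upd v 6 y) 1 0) 7 0 = upd v 6 y by updlia.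
set va := upd (upd (upd v 6 0) 1 y) 7 y => hA.
pose S2 j := conc W' (upd (upd v 1 (y - j)) 7 (y - j)).
have := @cex_while _ 7 nz (Seq (MvL 7) (MvL 1)) S2 y 2; rewrite /S2 subn0 subnn.
have -> : upd (upd v 1 0) 7 0 = v by updlia.
have -> : upd (upd v 1 y) 7 y = va by rewrite /va; updlia.
move=> hB.
apply: (cex_le (T := (10 * N + 2) + ((y * 5).+1 + (1 + (y * 4).+1)))); last by lia.
apply: cex_seq; first by apply: cex_Copy => //; exact: hv.
apply: (cex_seq (ts1 := conc W va)).
  apply: hA => [j hj|]; last by rewrite nzE //; rewrite /va; updx.
  set v' := upd _ 7 _; have e1 : v' 6 = y - j by rewrite /v'; updx.
  rewrite nzE ?e1 //; last by rewrite -/N; lia.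
  split; first by lia.
  apply: (cex_seq (T1 := 1) (T2 := 2)); first by apply: cex_MvL => //; rewrite e1 -/N; lia.
  set v'' := upd v' 6 _; have e2 : v'' 1 = j by rewrite /v'' /v'; updx.
  apply: (cex_seq (T1 := 1) (T2 := 1)); first by apply: cex_MvR => //; rewrite e2 -/N; lia.
  set v3 := upd v'' 1 _; have e3 : v3 7 = j by rewrite /v3 /v'' /v'; updx.
  have -> : upd (upd (upd v 6 (y - j.+1)) 1 j.+1) 7 j.+1 = upd v3 7 (minn N (v3 7).+1).
    by rewrite e3 /v3 e2 /v'' e1 /v'; updlia.
  by apply: cex_Inc => //; rewrite e3 -/N; lia.
have va1 : va 1 = y by rewrite /va; updx.
apply: (cex_seq (ts1 := conc W' va)).
  by rewrite eW -va1; apply: cex_write => //; rewrite va1.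
apply: hB => [j hj|]; last by rewrite nzE // v7.
set v' := upd _ 7 _; have e1 : v' 7 = y - j by rewrite /v' upd_same.
rewrite nzE ?e1 //=; last by rewrite -/N; lia.
split; first by lia.
apply: (cex_seq (T1 := 1) (T2 := 1)); first by apply: cex_MvL => //=; rewrite e1 -/N; lia.
set v'' := upd v' 7 _; have e2 : v'' 1 = y - j by rewrite /v'' /v'; updx.
have -> : upd (upd v 1 (y - j.+1)) 7 (y - j.+1) = upd v'' 1 (v'' 1).-1.
  by rewrite e2 /v'' e1 /v'; updlia.
by apply: cex_MvL => //=; rewrite e2 -/N; lia.
Qed.

Variables (cond : wd I -> nat -> bool) (acc : wd I -> bool).
Hypothesis hcond : compb (fun g : ctx I 1 => cond g.1 g.2).
Hypothesis hacc : compb (fun g : ctx I 0 => acc g).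

Definition visit N w (y : nat) (T : nat -> bool) := upd T y (T y || cond (World N w T) y).
Definition sweep N w T := iteri N (visit N w) T.
(** [N] sweeps are enough for monotone [cond]: an increasing chain of subsets of the [N] entries
    becomes stationary after at most [N] steps. *)
Definition final N w := iter N (sweep N w) (fun=> false).

(** The registers of the main program: 2 and 3 count the sweeps and the entries still to be done, 4
    is the current entry. *)
Definition vals a b y (i : nat) := if i == 2 then a else if i == 3 then b else if i == 4 then y else 0.

Lemma vals_safe (W : wd I) a b y es f : wok W -> a <= wN W -> b <= wN W -> y <= wN W ->
  (0 < y -> 4 < f) -> (0 < b -> 3 < f) -> (0 < a -> 2 < f) -> 1 < f ->
  all (fun i => 1 < i < f) es -> safe W (vals a b y) es f.
Proof.
move=> okW ha hb hy fy fb fa f1 hes; split=> //.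
  by move=> i; rewrite /vals; do 3 case: ifP => // _.
move=> i hi; rewrite /vals; case: eqP => e2; first by case: (a) fa => // n /(_ isT); lia.
case: eqP => e3; first by case: (b) fb => // n /(_ isT); lia.
by case: eqP => e4 //; case: (y) fy => // n /(_ isT); lia.
Qed.

Lemma cex_Main : exists p, exists2 T, pol T & forall N w, 0 < N -> size w <= N ->
  exists2 ts, cex p (conc (World N w (fun=> false)) (fun=> 0)) (T N) ts &
    nz (tape_head (ts 2)) = acc (World N w (final N w)).
Proof.
have [cc [ac hc]] := hcond; have [ca [aa ha]] := hacc; have [ct [at_ ht]] := comp_top I 0.
pose body := Seq (MvL 3) (Seq (cc [:: 4] 5) (Seq SetTab (Inc 4))).
pose outer := Seq (MvL 2) (Seq (ct [::] 3) (Seq (While 3 nz body) (Clear I 4))).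
exists (Seq (ct [::] 2) (Seq (While 2 nz outer) (ca [::] 2))).
pose TB N := N.+2 ^ ac + (40 * N + 42).
pose TO N := 1 + (N.+2 ^ at_ + (N * (TB N + 2) + 1 + (3 * N + 1))).
exists (fun N => N.+2 ^ at_ + (N * (TO N + 2) + 1 + N.+2 ^ aa)).
  rewrite /TO /TB; by repeat (first [apply: pol_add | apply: pol_mul | exact: pol_cst | exact: pol_id | exact: pol_exp]).
move=> N w N0 hw; pose WT T := World N w T.
have ok T : wok (WT T) by rewrite /wok N0.
have inner a T : a <= N -> cex (While 3 nz body) (conc (WT T) (vals a N 0)) (N * (TB N).+2).+1
    (conc (WT (sweep N w T)) (vals a 0 N)).
  move=> hal; pose Tj j := iteri j (visit N w) T.
  pose S j := conc (WT (Tj j)) (vals a (N - j) j).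
  have := @cex_while _ 3 nz body S N (TB N); rewrite /S subn0 subnn; apply; last by rewrite nzE.
  move=> j hj; rewrite nzE //=; last by rewrite /vals /=; lia.
  split; first by rewrite /vals /=; lia.
  have e1 : cex (MvL 3) (conc (WT (Tj j)) (vals a (N - j) j)) 1 (conc (WT (Tj j)) (vals a (N - j.+1) j)).
    have -> : vals a (N - j.+1) j = upd (vals a (N - j) j) 3 (vals a (N - j) j 3).-1.
      by apply: functional_extensionality => i; rewrite /upd /vals /=; case: (i =P 2) => [->|_] //=; case: eqP => // _; lia.
    by apply: cex_MvL => //; rewrite /vals /=; lia.
  have [||_ e2] := hc (WT (Tj j), j) (WT (Tj j)) (vals a (N - j.+1) j) [:: 4] 5.
  - by apply: vals_safe => //=; lia.
  - by [].
  rewrite /= in e2; set b := cond _ j in e2.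
  set v5 := upd _ 5 _ in e2.
  have e3 := @cex_SetTab (WT (Tj j)) v5 b (ok _).
  have e3' : cex SetTab (conc (WT (Tj j)) v5) (40 * N + 40) (conc (WT (Tj j.+1)) (vals a (N - j.+1) j)).
    have -> : vals a (N - j.+1) j = upd v5 5 0.
      by apply: functional_extensionality => i; rewrite /v5 upd_upd /upd; case: eqP => // ->.
    apply: e3 => //; move=> i; rewrite /v5 /upd /vals; case: eqP => _ /=; first by case: (b) => //=; lia.
    by do 3 (case: eqP => _ //=; try lia).
  have e4 : cex (Inc 4) (conc (WT (Tj j.+1)) (vals a (N - j.+1) j)) 1 (conc (WT (Tj j.+1)) (vals a (N - j.+1) j.+1)).
    have -> : vals a (N - j.+1) j.+1 = upd (vals a (N - j.+1) j) 4 (minn N (vals a (N - j.+1) j 4).+1).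
      apply: functional_extensionality => i; rewrite /upd /vals /=; case: (i =P 4) => [->|_] //=.
      by lia.
    by apply: cex_Inc => //; rewrite /vals /=; lia.
  apply: cex_le (cex_seq e1 (cex_seq e2 (cex_seq e3' e4))) _.
  by rewrite /TB /=; lia.
have v0 : (fun=> 0) = vals 0 0 0 by apply: functional_extensionality => i; rewrite /vals; case: eqP => // _; case: eqP => // _; case: eqP.
have s2 : cex (ct [::] 2) (conc (WT (fun=> false)) (fun=> 0)) (N.+2 ^ at_) (conc (WT (fun=> false)) (vals N 0 0)).
  have [||_ e] := ht (WT (fun=> false)) (WT (fun=> false)) (vals 0 0 0) [::] 2 => //.
    by apply: vals_safe.
  rewrite v0; suff -> : vals N 0 0 = upd (vals 0 0 0) 2 N by [].
  by apply: functional_extensionality => i; rewrite /upd /vals; case: eqP.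
pose Tk k := iter k (sweep N w) (fun=> false).
have s3 : cex (While 2 nz outer) (conc (WT (fun=> false)) (vals N 0 0)) (N * (TO N).+2).+1 (conc (WT (final N w)) (vals 0 0 0)).
  pose S k := conc (WT (Tk k)) (vals (N - k) 0 0).
  have := @cex_while _ 2 nz outer S N (TO N); rewrite /S subn0 subnn; apply; last by rewrite nzE.
  move=> k hk; rewrite nzE //=; last by rewrite /vals /=; lia.
  split; first by rewrite /vals /=; lia.
  have e1 : cex (MvL 2) (conc (WT (Tk k)) (vals (N - k) 0 0)) 1 (conc (WT (Tk k)) (vals (N - k.+1) 0 0)).
    have -> : vals (N - k.+1) 0 0 = upd (vals (N - k) 0 0) 2 (vals (N - k) 0 0 2).-1.
      by apply: functional_extensionality => i; rewrite /upd /vals /=; case: eqP => // _; lia.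
    by apply: cex_MvL => //; rewrite /vals /=; lia.
  have [||_ e2] := ht (WT (Tk k)) (WT (Tk k)) (vals (N - k.+1) 0 0) [::] 3 => //.
    by apply: vals_safe => //=; lia.
  rewrite /= in e2.
  have ev : upd (vals (N - k.+1) 0 0) 3 N = vals (N - k.+1) N 0.
    by apply: functional_extensionality => i; rewrite /upd /vals; case: (i =P 3) => [->|].
  rewrite ev in e2.
  have e3 := inner (N - k.+1) (Tk k) (leq_subr _ _).
  have e4 : cex (Clear I 4) (conc (WT (Tk k.+1)) (vals (N - k.+1) 0 N)) (3 * N).+1 (conc (WT (Tk k.+1)) (vals (N - k.+1) 0 0)).
    have -> : vals (N - k.+1) 0 0 = upd (vals (N - k.+1) 0 N) 4 0.
      by apply: functional_extensionality => i; rewrite /upd /vals; case: (i =P 4) => [->|].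
    by apply: (@cex_Clear _ (WT (Tk k.+1))).
  apply: cex_le (cex_seq e1 (cex_seq e2 (cex_seq e3 e4))) _.
  by rewrite /TO; lia.
have [||_ e4] := ha (WT (final N w)) (WT (final N w)) (vals 0 0 0) [::] 2 => //.
  by apply: vals_safe.
exists (conc (WT (final N w)) (upd (vals 0 0 0) 2 (acc (WT (final N w))))).
  by apply: cex_le (cex_seq s2 (cex_seq s3 e4)) _; rewrite /=; lia.
by rewrite nzE ?upd_same //=; case: (acc _).
Qed.

Theorem dexptime_of_comp d : 0 < d ->
  dexptime (fun w : seq I => acc (World (2 ^ (size w).+2 ^ d) w (final (2 ^ (size w).+2 ^ d) w))).
Proof.
move=> d0; have [p [T pT hp]] := cex_Main.
pose R := maxn 3 (width p).
have R2 : 2 < R by rewrite /R; lia.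
have [T' pT' hi] := cex_Init I d R2.
have [a hT] := pol_add (pol_add pT pT') (pol_cst 2).
exists (machine (Seq (Init I R d) p) 2 nz), (a * (3 ^ d + 2 ^ d + 2)), d => w.
set n := size w; set N := 2 ^ n.+2 ^ d.
have nK : n.+2 <= n.+2 ^ d by case: (d) d0 => // d' _; rewrite expnS leq_pmulr // expn_gt0.
have KN : n.+2 ^ d < N by rewrite /N ltn_expl.
have [ts1 [m1 l1 e1] h1] := hi w d0.
have N0 : 0 < N by lia.
have hwN : size w <= N by rewrite -/n; lia.
have [ts2 [m2 l2 e2] h2] := hp N w N0 hwN.
have [|ts3 e3 h3] := @exec_local _ R _ _ _ _ e2 _ ts1 h1; first by rewrite /R; lia.
exists (acc (World N w (final N w))) => //.
have := machine_decides 2 nz (ExecSeq e1 e3); rewrite h3 ?h2 //; apply.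
have : N.+2 ^ a <= 2 ^ (a * (3 ^ d + 2 ^ d + 2) * n ^ d + a * (3 ^ d + 2 ^ d + 2)); last first.
  have l1' : m1 <= T' N by exact: l1.
  by move=> h; apply: leq_trans h; apply: leq_trans (hT N); lia.
(* The definition of [dexptime] allows only exponents [c * n ^ d + c]; [n.+2 <= 3 * n] for positive
   [n], and the summand [2 ^ d] covers [n = 0]. *)
have hK : n.+2 ^ d <= 3 ^ d * n ^ d + 2 ^ d.
  case: (n) => [|n']; first by rewrite leq_addl.
  by rewrite -expnMn; apply: leq_trans (leq_addr _ _); rewrite leq_exp2r //; lia.
have h4 : N.+2 <= 2 ^ (n.+2 ^ d + 2) by rewrite expnD -/N; lia.
apply: leq_trans (_ : (2 ^ (n.+2 ^ d + 2)) ^ a <= _).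
  by case: (a) => // a'; rewrite leq_exp2r.
rewrite -expnM leq_exp2l // mulnC -mulnA -mulnDr leq_mul2l; apply/orP; right.
have : 3 ^ d * n ^ d <= (3 ^ d + 2 ^ d + 2) * n ^ d by rewrite leq_mul2r; apply/orP; right; lia.
lia.
Qed.
End Sweep.

End Sweeps.
Import Sweeps.

(** * Local conditions on vertex labels that describe Munn trees *)

Module CayleyTrees.
Import all_order all_algebra finmap.

(** Symbols of an input in which every occurrence of [x] is expanded to a block of letters: a
    letter, an idempotent variable with the bits of its name, a filler, and the end of a word. *)
Inductive kind (A : Type) := KL of A | KV of seq bool | KS | KE.
Arguments KV {A}. Arguments KS {A}. Arguments KE {A}.

Section Labels.
Variables (A : finType) (bar : A -> A).
Hypotheses (barK : involutive bar) (bar_free : forall a : A, bar a <> a).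
Local Notation bw := (bar_word bar).
Local Notation cl := (cl barK).

Definition tree (w : seq A) (h : seq A) : bool := h \in (fim_val (psi bar w)).1.

Lemma tree_nil h : tree [::] h = (h == [::]).
Proof. by rewrite /tree inE. Qed.

Lemma treeP w h : reflect (exists i, h = reduce bar (take i w)) (tree w h).
Proof. exact: psi_fst. Qed.

Lemma tree1 w : tree w [::].
Proof. by apply/treeP; exists 0; rewrite take0. Qed.

Lemma reduced_cons_red a h : reduced bar h -> reduced bar (cons_red bar a h).
Proof. by move=> hh; have := reduced_reduce bar (a :: h); rewrite /= reduce_id. Qed.

Lemma cons_redK a h : reduced bar h -> cons_red bar a (cons_red bar (bar a) h) = h.
Proof.
case: h => [|b h] /= hh; first by rewrite eqxx.
rewrite barK; case: eqP => [eb|ne] /=; last by rewrite eqxx.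
by rewrite -eb; case: h hh => //= c h /andP[/negbTE -> _].
Qed.

Lemma tree_cons a w h : reduced bar h -> tree (a :: w) h = (h == [::]) || tree w (cons_red bar (bar a) h).
Proof.
move=> hh; apply/treeP/orP.
  case=> -[|i] ->; first by left.
  right; apply/treeP; exists i => /=.
  by rewrite -{2}(barK a) cons_redK // reduced_reduce.
case=> [/eqP ->|/treeP[i e]]; first by exists 0.
by exists i.+1; rewrite /= -e cons_redK.
Qed.

Lemma tree_cat u v h : reduce bar u = [::] -> tree (u ++ v) h = tree u h || tree v h.
Proof.
move=> hu; have hred s : reduce bar (u ++ s) = reduce bar s.
  by apply/clE; rewrite cl_cat -(cl_reduce barK u) hu mul1g.
apply/treeP/orP => [[i ->]|].
  rewrite take_cat; case: ltnP => hi; first by left; apply/treeP; exists i.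
  by right; apply/treeP; exists (i - size u); rewrite hred.
case=> /treeP[i ->]; last by exists (size u + i); rewrite takeD take_size_cat // drop_size_cat // hred.
exists (minn i (size u)); rewrite take_cat; case: ltnP => hi; first by congr reduce; rewrite /minn; case: ifP => // hh; lia.
have -> : minn i (size u) = size u by lia.
by rewrite subnn take0 cats0 take_oversize //; lia.
Qed.

Lemma tree_reduced w h : tree w h -> reduced bar h.
Proof. by case/treeP => i ->; exact: reduced_reduce. Qed.

Lemma tree_size w h : tree w h -> size h <= size w.
Proof.
case/treeP => i ->; apply: leq_trans (size_reduce _ _) _.
by rewrite size_take_min geq_minr.
Qed.

Lemma tree_there_and_back p h : reduced bar p -> tree (p ++ bw p) h = prefix h p.
Proof.
move=> rp; apply/treeP/idP.
  case=> i ->; rewrite take_cat; case: ltnP => hi.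
    by rewrite reduce_id ?reduced_take // prefix_take.
  set k := i - size p.
  have -> : take k (bw p) = bw (drop (size p - k) p).
    rewrite bar_word_drop; case: (leqP k (size p)) => hk; first by rewrite subKn.
    have -> : size p - (size p - k) = size p by lia.
    by rewrite take_oversize ?size_bar_word ?(ltnW hk) // take_oversize ?size_bar_word.
  have -> : reduce bar (p ++ bw (drop (size p - k) p)) = take (size p - k) p.
    rewrite -[RHS](reduce_id (reduced_take (size p - k) rp)); apply/clE.
    have e : cl p = (cl (take (size p - k) p) * cl (drop (size p - k) p))%g by rewrite -cl_cat cat_take_drop.
    by rewrite cl_cat cl_bw e -mulgA mulgV mulg1.
  exact: prefix_take.
case/prefixP => s e; exists (size h); rewrite {1}e -catA take_size_cat // reduce_id //.
by move: rp; rewrite e => /reduced_catl.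
Qed.

Definition spell (ps : seq (seq A)) : seq A := flatten [seq p ++ bw p | p <- ps].

Lemma reduce_tb p : reduce bar (p ++ bw p) = [::].
Proof. by rewrite -[[::]]/(reduce bar [::]); apply/clE; rewrite cl_cat cl_bw // mulgV. Qed.

Lemma reduce_spell ps : reduce bar (spell ps) = [::].
Proof.
elim: ps => //= p ps IH; rewrite /spell /= -/(spell ps) -[[::]]/(reduce bar [::]).
by apply/clE; rewrite cl_cat -(cl_reduce _ (p ++ bw p)) reduce_tb -(cl_reduce _ (spell ps)) IH mulg1.
Qed.

Lemma tree_spell ps h : all (reduced bar) ps -> tree (spell ps) h = (h == [::]) || has (prefix h) ps.
Proof.
elim: ps => [|p ps IH] /=; first by rewrite tree_nil orbF.
case/andP => rp rps; rewrite /spell /= -/(spell ps) tree_cat ?reduce_tb // tree_there_and_back // IH //.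
by rewrite orbCA.
Qed.

Lemma bw_spell ps : bw (spell ps) = spell (rev ps).
Proof.
elim: ps => //= p ps IH; rewrite /spell /= -/(spell ps) !bar_word_cat IH bar_wordK // rev_cons -cats1.
by rewrite /spell map_cat flatten_cat /= cats0.
Qed.

(** [spell ps] walks out to each [p] and back. Appending its inverse leaves the Munn tree unchanged
    and makes the word equal to its own [bar_word], as the value of a self-inverse variable must
    be. *)
Definition idword (ps : seq (seq A)) : seq A := spell ps ++ bw (spell ps).

Lemma bw_idword ps : bw (idword ps) = idword ps.
Proof. by rewrite /idword bar_word_cat bar_wordK. Qed.

Lemma reduce_idword ps : reduce bar (idword ps) = [::].
Proof. exact: reduce_tb. Qed.

Lemma tree_idword ps h : all (reduced bar) ps -> tree (idword ps) h = (h == [::]) || has (prefix h) ps.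
Proof.
move=> hp; rewrite /idword tree_cat ?reduce_spell // bw_spell !tree_spell ?all_rev // has_rev.
by rewrite orbb.
Qed.

Fixpoint xk (sb : seq bool -> seq A) (ks : seq (kind A)) : seq A :=
  match ks with
  | KL a :: ks' => a :: xk sb ks'
  | KV z :: ks' => sb z ++ xk sb ks'
  | KS :: ks' => xk sb ks'
  | _ => [::]
  end.

(* [D t], [G t] and [P z] describe the Munn tree and the end point of the word
   spelled from position [t] on, and the Munn tree of the value of [z]. *)
Definition local_ok (k : kind A) (D G D' G' : seq A -> bool) (P : seq bool -> seq A -> bool) : Prop :=
  forall h, reduced bar h ->
  match k with
  | KL a => D h = (h == [::]) || D' (cons_red bar (bar a) h) /\ G h = G' (cons_red bar (bar a) h)
  | KV z => D h = P z h || D' h /\ G h = G' h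
  | KS => D h = D' h /\ G h = G' h
  | KE => D h = (h == [::]) /\ G h = (h == [::])
  end.

Lemma labels_of_words sb k ks : (forall z, reduce bar (sb z) = [::]) ->
  local_ok k (tree (xk sb (k :: ks))) (fun h => h == reduce bar (xk sb (k :: ks)))
     (tree (xk sb ks)) (fun h => h == reduce bar (xk sb ks)) (fun z => tree (sb z)).
Proof.
move=> hsb h hh; case: k => [a|z||] /=.
- rewrite tree_cons //; split=> //; apply/eqP/eqP => [->|e].
    by rewrite -{2}(barK a) cons_redK // reduced_reduce.
  by rewrite -e cons_redK.
- rewrite tree_cat //; split=> //; congr (_ == _).
  by apply/clE; rewrite cl_cat -(cl_reduce _ (sb z)) hsb mul1g.
- by [].
- by rewrite tree_nil.
Qed.

(** The sets [P z] need not be closed under prefixes, so [D t] determines the Munn tree only up to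
    prefix closure. This is harmless, since equal labels have equal closures. The induction runs
    backwards from the end marker. *)
Lemma words_of_labels sb (f : nat -> kind A) D G (P : seq bool -> seq A -> bool) m t :
  (forall z, reduce bar (sb z) = [::]) ->
  (forall z h, reduced bar h -> tree (sb z) h <-> h = [::] \/ exists2 h', reduced bar h' & P z h' /\ prefix h h') ->
  (forall t, local_ok (f t) (D t) (G t) (D t.+1) (G t.+1) P) ->
  f (t + m) = KE ->
  (forall h, reduced bar h -> tree (xk sb (map f (iota t m.+1))) h <->
      exists2 h', reduced bar h' & D t h' /\ prefix h h') /\
  (forall h, reduced bar h -> G t h = (h == reduce bar (xk sb (map f (iota t m.+1))))) /\ D t [::].
Proof.
move=> hsb hP hl; elim: m t => [|m IH] t hE.
  rewrite addn0 in hE; have := hl t; rewrite hE /local_ok => h0 /=; rewrite hE /=.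
  have D0 h : reduced bar h -> D t h = (h == [::]) by move=> /h0 [].
  split; last by split; [move=> h /h0 [] | rewrite D0].
  move=> h hh; rewrite tree_nil; split=> [/eqP ->|[h' rh' []]].
    by exists [::] => //; rewrite D0.
  by rewrite D0 // => /eqP -> /prefixP[s]; case: (h).
have [|IH1 [IH2 IH3]] := IH t.+1; first by rewrite addSnnS.
have := hl t; rewrite /local_ok [iota _ _]/= [map _ _]/=.
case: (f t) => [a|z||] h0.
- rewrite [xk _ _]/=; set X := xk _ _ in IH1 IH2 *; split; last first.
    split; last by have [->] := h0 [::] isT; rewrite eqxx.
    move=> h hh; have [_ ->] := h0 h hh; rewrite IH2 ?reduced_cons_red //=.
    apply/eqP/eqP => [<-|->]; first by rewrite cons_redK.
    by rewrite -{2}(barK a) cons_redK // reduced_reduce.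
  move=> h hh; rewrite tree_cons //; split.
    case/orP => [/eqP ->|].
      exists [::] => //; split=> //; by have [->] := h0 [::] isT; rewrite eqxx.
    case/(IH1 _ (reduced_cons_red _ hh)) => h' rh' [dh' pre].
    have dd : D t (cons_red bar a h').
      have [-> _] := h0 _ (reduced_cons_red a rh'); apply/orP; right.
      by rewrite -{2}(barK a) cons_redK ?barK.
    (* Needed when [h'] begins with [bar a]: then [a h'] collapses and no longer extends [h], which
       can only be [[:: a]] and is its own witness. *)
    have d1 : D t [:: a].
      have [|-> _] := h0 [:: a]; first by [].
      by apply/orP; right; rewrite /= barK eqxx.
    case: h hh pre => [|b h] hh /=; first by move=> _; exists [::] => //; have [->] := h0 [::] isT.
    rewrite barK; case: eqP => [eb|nb] pre.
      rewrite eb in hh *; case: h' rh' dh' dd pre => [|c h'] rh' dh' dd pre.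
        by case: h hh pre => // _ _; exists [:: a] => //; split=> //=; rewrite eqxx.
      have ne : c != bar a \/ h = [::].
        case: h hh pre => [|b' h] hh pre; first by right.
        move: hh pre; rewrite /reduced /= => /andP[hb' _] /andP[/eqP <- _]; by left.
      case: ne => [ne|->]; last by exists [:: a] => //; split=> //=; rewrite eqxx.
      exists [:: a, c & h']; first by rewrite /reduced /= ne.
      by split; [move: dd; rewrite /= (negbTE ne) | rewrite /= eqxx].
    case: h' rh' dh' dd pre => [|c h'] rh' dh' dd //= /andP[/eqP ec pre].
    by exists h'; [exact: path_sorted rh' | move: dd; rewrite /= -ec eqxx].
  case=> h' rh' [dh' pre]; have [e1 _] := h0 h' rh'; rewrite e1 in dh'.
  case/orP: dh' => [/eqP e|dh']; first by move: pre; rewrite e; case: (h).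
  case: h hh pre => [|b h] hh pre //=.
  rewrite barK; case/prefixP: pre => s eh'; rewrite eh' in rh' dh'.
  apply/IH1; first by have := reduced_cons_red (bar a) hh; rewrite /= barK.
  exists (cons_red bar (bar a) ((b :: h) ++ s)); first exact: reduced_cons_red.
  split=> //=; rewrite barK; case: eqP => // _; first by rewrite prefix_prefix.
  by rewrite /= !eqxx prefix_prefix.
- rewrite [xk _ _]/=; set X := xk _ _ in IH1 IH2 *; split; last first.
    split; last by have [->] := h0 [::] isT; rewrite IH3 orbT.
    move=> h hh; have [_ ->] := h0 h hh; rewrite IH2 //; congr (_ == _).
    by apply/clE; rewrite cl_cat -(cl_reduce _ (sb z)) hsb mul1g.
  move=> h hh; rewrite tree_cat //; split.
    case/orP => [/(hP _ _ hh)[->|[h' r1 [r2 r3]]]|/(IH1 _ hh)[h' r1 [r2 r3]]].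
    + by exists [::] => //; have [->] := h0 [::] isT; rewrite IH3 orbT.
    + by exists h' => //; have [->] := h0 h' r1; rewrite r2.
    + by exists h' => //; have [->] := h0 h' r1; rewrite r2 orbT.
  case=> h' r1 []; have [-> _] := h0 h' r1 => /orP[] r2 r3; apply/orP.
    by left; apply/hP => //; right; exists h'.
  by right; apply/IH1 => //; exists h'.
- rewrite [xk _ _]/=; split; last first.
    split; last by have [->] := h0 [::] isT.
    by move=> h hh; have [_ ->] := h0 h hh; rewrite IH2.
  move=> h hh; rewrite IH1 //; split=> -[h' r1 [r2 r3]]; exists h' => //; have [e _] := h0 h' r1; by rewrite ?e // -e.
- rewrite [xk _ _]/=.
  have D0 h : reduced bar h -> D t h = (h == [::]) by move=> /h0 [].
  split; last by split; [move=> h /h0 [] | rewrite D0].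
  move=> h hh; rewrite tree_nil; split=> [/eqP ->|[h' rh' []]].
    by exists [::] => //; rewrite D0.
  by rewrite D0 // => /eqP -> /prefixP[s]; case: (h).
Qed.
End Labels.

End CayleyTrees.
Import CayleyTrees.

(** * Positions in an encoded system *)

Module Encoding.
Import all_order all_algebra finmap.

Definition cd (T : Type) (w : seq T) i : option T := nth None (map Some w) i.

Lemma cd_drop (T : Type) (w : seq T) i : i < size w ->
  exists2 c, cd w i = Some c & drop i w = c :: drop i.+1 w.
Proof.
elim: w i => //= x w IH [|i] hi; first by exists x; rewrite ?drop0.
exact: IH.
Qed.

Lemma cd_ge (T : Type) (w : seq T) i : size w <= i -> cd w i = None.
Proof. by move=> h; rewrite /cd nth_default // size_map. Qed.

Lemma cd_cat (T : Type) (u v : seq T) i : cd (u ++ v) i = if i < size u then cd u i else cd v (i - size u).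
Proof. by rewrite /cd map_cat nth_cat size_map. Qed.

Lemma cd_lt (T : Type) (w : seq T) i c : cd w i = Some c -> i < size w.
Proof. by case: (ltnP i (size w)) => // /cd_ge ->. Qed.

Lemma cd_mem (T : eqType) (w : seq T) i c : cd w i = Some c -> c \in w.
Proof. by move=> e; have hi := cd_lt e; move: e; rewrite /cd (nth_map c) // => -[<-]; exact: mem_nth. Qed.

Definition bits_nat (z : seq bool) : nat := foldr (fun (b : bool) n => b + n.*2) 0 z.

Lemma pos_bitsK p : bits_nat (pos_bits p) = nat_of_pos p.
Proof.
by elim: p => [p IH|p IH|] //; rewrite /bits_nat /= -/(bits_nat _) IH ?NatTrec.doubleE.
Qed.

Lemma nat_bitsK n : bits_nat (nat_bits n) = n.
Proof.
rewrite /nat_bits -{2}(bin_of_natK n); case: (bin_of_nat n) => //= p.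
exact: pos_bitsK.
Qed.

Lemma pmap_rev (T U : Type) (f : T -> option U) s : pmap f (rev s) = rev (pmap f s).
Proof.
elim: s => //= x s IH; rewrite rev_cons -cats1 pmap_cat IH /=; case: (f x) => [y|] /=.
  by rewrite rev_cons cats1.
by rewrite cats0.
Qed.

Lemma pmap_comp_map (S T U : Type) (f : T -> option U) (g : S -> T) s : pmap f (map g s) = pmap (f \o g) s.
Proof. by elim: s => //= x s ->. Qed.

Lemma pmap_omap (T U V : Type) (f : T -> option U) (g : U -> V) s : pmap (fun x => omap g (f x)) s = map g (pmap f s).
Proof. by elim: s => //= x s ->; case: (f x). Qed.

Lemma rev_iota B : rev (iota 0 B) = map (fun j => B.-1 - j) (iota 0 B).
Proof.
apply: (@eq_from_nth _ 0) => [|i]; rewrite size_rev ?size_map size_iota // => hi.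
rewrite nth_rev ?size_iota // (nth_map 0) ?size_iota // !nth_iota //; lia.
Qed.

Section Positions.
Variables (A : finType) (bar : A -> A).
Hypotheses (barK : involutive bar).
Local Notation bw := (bar_word bar).
Implicit Types (w : seq (code A)) (rl : nat -> option A).

Fixpoint run w : seq bool := if w is Bit b :: w' then b :: run w' else [::].

(** Every input symbol is given [B] positions, room for the value of [x]: position [t] is slot
    [t %% B] of symbol [t %/ B]. Occurrences of the inverse of [x] read the slots backwards with
    barred letters. *)
Definition kindf w B rl (t : nat) : kind A :=
  match cd w (t %/ B) with
  | Some (Letter a) => if t %% B == 0 then KL a else KS
  | Some (RedVar true) => if rl (t %% B) is Some a then KL a else KS
  | Some (RedVar false) => if rl (B.-1 - t %% B) is Some a then KL (bar a) else KS
  | Some IdemVar => if t %% B == 0 then KV (run (drop (t %/ B).+1 w)) else KS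
  | Some (Bit _) => KS
  | _ => KE
  end.

Fixpoint xw (sb : seq bool -> seq A) (r : seq A) w : seq A :=
  match w with
  | Letter a :: w' => a :: xw sb r w'
  | RedVar b :: w' => (if b then r else bw r) ++ xw sb r w'
  | IdemVar :: w' => sb (run w') ++ xw sb r w'
  | Bit _ :: w' => xw sb r w'
  | _ => [::]
  end.

Definition notKE (k : kind A) := if k is KE then false else true.

Lemma xk_cat sb ks1 ks2 : all notKE ks1 -> xk sb (ks1 ++ ks2) = xk sb ks1 ++ xk sb ks2.
Proof. by elim: ks1 => [|[a|z||] ks1 IH] //= h; rewrite IH ?catA. Qed.

Lemma xk_KS (sb : seq bool -> seq A) (T : Type) (s : seq T) : xk sb (map (fun=> KS) s) = [::].
Proof. by elim: s. Qed.

Lemma xk_opt sb (T : Type) (f : T -> option A) (s : seq T) :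
  xk sb (map (fun j => if f j is Some a then KL a else KS) s) = pmap f s.
Proof. by elim: s => //= x s IH; case: (f x) => [a|] /=; rewrite IH. Qed.

Section Word.
Variables (w : seq (code A)) (B : nat) (rl : nat -> option A) (sb : seq bool -> seq A).
Hypothesis B0 : 0 < B.
Let n := size w.
Let kf := kindf w B rl.
Let r := pmap rl (iota 0 B).

Lemma kf_pos i j : j < B -> kf (i * B + j) =
  match cd w i with
  | Some (Letter a) => if j == 0 then KL a else KS
  | Some (RedVar true) => if rl j is Some a then KL a else KS
  | Some (RedVar false) => if rl (B.-1 - j) is Some a then KL (bar a) else KS
  | Some IdemVar => if j == 0 then KV (run (drop i.+1 w)) else KS
  | Some (Bit _) => KS
  | _ => KE
  end.
Proof. by move=> hj; rewrite /kf /kindf divnMDl // modnMDl divn_small // modn_small // addn0. Qed.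

Lemma kf_end t : n * B <= t -> kf t = KE.
Proof. by move=> h; rewrite /kf /kindf cd_ge // leq_divRL. Qed.

Lemma xw_pos i : i <= n -> xk sb (map kf (iota (i * B) ((n - i) * B).+1)) = xw sb r (drop i w).
Proof.
move=> hi; move e: (n - i) => k; elim: k i hi e => [|k IH] i hi e.
  have -> : i = n by lia.
  by rewrite mul0n /= kf_end // drop_size.
have hin : i < n by lia.
rewrite mulSn -addnS iotaD map_cat.
have -> : i * B + B = i.+1 * B by rewrite mulSn addnC.
have {}IH := IH i.+1 hin; rewrite -[X in iota X B]addn0 iotaDl -map_comp.
have [c ec ed] := cd_drop hin; rewrite ed.
have eB : iota 0 B = 0 :: map S (iota 0 B.-1) by case: (B) B0 => // b _; rewrite /= -[1]addn0 iotaDl.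
have hfst : {in iota 0 B, (kf \o addn (i * B)) =1 fun j => kf (i * B + j)} by [].
have blk (g : nat -> kind A) : (forall j, j < B -> kf (i * B + j) = g j) ->
    [seq (kf \o addn (i * B)) j | j <- iota 0 B] = map g (iota 0 B).
  by move=> hg; apply/eq_in_map => j; rewrite mem_iota /= => hj; rewrite hg.
have first (k0 : kind A) : map (fun j => if j == 0 then k0 else KS) (iota 0 B) = k0 :: map (fun=> KS) (iota 0 B.-1).
  by rewrite eB /= -map_comp.
case: c ec {ed} => [a|[]||b||] ec.
- rewrite (blk (fun j => if j == 0 then KL a else KS)); last by move=> j hj; rewrite kf_pos // ec.
  rewrite first xk_cat; last by elim: (iota _ _).
  rewrite IH; last by lia.
  by rewrite /= xk_KS.
- rewrite (blk (fun j => if rl j is Some a then KL a else KS)); last by move=> j hj; rewrite kf_pos // ec.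
  rewrite xk_cat; last by elim: (iota _ _) => //= j s ->; case: (rl j).
  by rewrite xk_opt IH //; lia.
- rewrite (blk (fun j => if omap bar (rl (B.-1 - j)) is Some a then KL a else KS)); last first.
    by move=> j hj; rewrite kf_pos // ec; case: (rl _).
  rewrite xk_cat; last by elim: (iota _ _) => //= j s ->; case: (rl _).
  rewrite (xk_opt _ (fun j => omap bar (rl (B.-1 - j)))) IH; try lia.
  congr (_ ++ _); rewrite /bar_word /r -pmap_omap -pmap_rev rev_iota pmap_comp_map.
  by apply: eq_pmap.
- rewrite (blk (fun j => if j == 0 then KV (run (drop i.+1 w)) else KS)); last by move=> j hj; rewrite kf_pos // ec.
  rewrite first xk_cat; last by elim: (iota _ _).
  rewrite IH; last by lia.
  by rewrite /= xk_KS cats0.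
- rewrite (blk (fun=> KS)); last by move=> j hj; rewrite kf_pos // ec.
  rewrite xk_cat; last by elim: (iota _ _).
  rewrite IH; last by lia.
  by rewrite /= xk_KS.
- rewrite (blk (fun=> KE)); last by move=> j hj; rewrite kf_pos // ec.
  by rewrite eB.
- rewrite (blk (fun=> KE)); last by move=> j hj; rewrite kf_pos // ec.
  by rewrite eB.
Qed.
End Word.

Definition isq (c : code A) := (c == EqSign) || (c == EqEnd).
Lemma isq_sign : isq EqSign. Proof. by rewrite /isq eqxx. Qed.
Lemma isq_end : isq EqEnd. Proof. by rewrite /isq eqxx orbT. Qed.
Definition nobit w := if w is Bit _ :: _ then false else true.

Lemma run_bits z w : nobit w -> run (map Bit z ++ w) = z.
Proof. by move=> hw; elim: z => [|b z IH] /=; [case: w hw => [|[]] | rewrite IH]. Qed.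

Lemma xw_bits sb r z w : xw sb r (map Bit z ++ w) = xw sb r w.
Proof. by elim: z. Qed.

Lemma nobit_word U e w : isq e -> nobit (encode_word U ++ e :: w).
Proof. by case: U => [|[a|[i|b]] U] //; case: e. Qed.

Lemma encode_word_cons s U : @encode_word A (s :: U) = encode_symb s ++ encode_word U.
Proof. by []. Qed.

Lemma xw_word sb r U e w (sigma : var nat -> seq A) : isq e ->
  (forall z, sigma (inl z) = sb (nat_bits z)) -> sigma (inr true) = r -> sigma (inr false) = bw r ->
  xw sb r (encode_word U ++ e :: w) = subst_word sigma U.
Proof.
move=> he h1 h2 h3; elim: U => [|s U IH]; first by case: e he.
rewrite encode_word_cons -catA /subst_word /= -/(subst_word sigma U).
case: s => [a|[i|b]] /=.
- by rewrite IH.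
- by rewrite run_bits ?nobit_word // xw_bits IH h1.
- by rewrite IH; case: b; rewrite ?h2 ?h3.
Qed.

Lemma word_noq U : all (predC isq) (@encode_word A U).
Proof.
elim: U => [|s U IH] //; rewrite encode_word_cons all_cat IH andbT.
by case: s => [a|[i|b]] //=; elim: (nat_bits i).
Qed.

(** An equation of the encoded system located by its start [s], the position [p] of its equality
    sign and that of its end mark [e]. *)
Definition eqn w (s p e : nat) : bool :=
  [&& (s == 0) || (cd w s.-1 == Some EqEnd), cd w p == Some EqSign, cd w e == Some EqEnd, s <= p, p < e,
   all (fun i => ~~ oapp isq false (cd w i)) (iota s (p - s)) &
   all (fun i => ~~ oapp isq false (cd w i)) (iota p.+1 (e - p.+1))].

Lemma encode_cons U V S : @encode A ((U, V) :: S) = encode_word U ++ EqSign :: encode_word V ++ EqEnd :: encode S.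
Proof. by rewrite /encode /= -!catA /= -catA. Qed.

Lemma encode_cat S1 S2 : @encode A (S1 ++ S2) = encode S1 ++ encode S2.
Proof. by rewrite /encode map_cat flatten_cat. Qed.

Lemma first_isq (x1 x2 : seq (code A)) q1 q2 y1 y2 : all (predC isq) x1 -> all (predC isq) x2 -> isq q1 -> isq q2 ->
  x1 ++ q1 :: y1 = x2 ++ q2 :: y2 -> [/\ x1 = x2, q1 = q2 & y1 = y2].
Proof.
elim: x1 x2 => [|c x1 IH] [|d x2] //=.
- by move=> _ _ _ _ [-> ->].
- by move=> _ /andP[h _] h1 _ [e _]; rewrite -e h1 in h.
- by move=> /andP[h _] _ _ h2 [e _]; rewrite e h2 in h.
- by move=> /andP[_ h1] /andP[_ h2] h3 h4 [-> /(IH _ h1 h2 h3 h4)[-> -> ->]].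
Qed.

(** Encoded words contain no separators, so a cut at the beginning or right after an [EqEnd] falls
    between two equations. *)
Lemma encode_split S w1 u v w2 : encode S = w1 ++ u ++ EqSign :: v ++ EqEnd :: w2 ->
  all (predC isq) u -> all (predC isq) v -> (w1 = [::] \/ last EqSign w1 = EqEnd) ->
  exists S1 U V S2, [/\ S = S1 ++ (U, V) :: S2, w1 = encode S1, u = encode_word U & v = encode_word V].
Proof.
elim: S w1 => [|[U V] S IH] w1.
  by move/(congr1 size); rewrite !size_cat /= !size_cat /=; lia.
rewrite encode_cons => e hu hv hw1.
have [ew|nw] : w1 = [::] \/ w1 <> [::] by case: w1 {e hw1}; [left|right].
  move: e; rewrite ew /= => /(first_isq (word_noq _) hu isq_sign isq_sign)[e1 _].
  move=> /(first_isq (word_noq _) hv isq_end isq_end)[e2 _ _].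
  by exists [::], U, V, S; rewrite e1 e2.
case: hw1 => // hl.
set b := encode_word U ++ EqSign :: encode_word V.
have e' : (rcons b EqEnd) ++ encode S = w1 ++ u ++ EqSign :: v ++ EqEnd :: w2.
  by rewrite -e /b cat_rcons -catA.
have hb : EqEnd \notin b.
  rewrite /b mem_cat inE /=; apply/norP; split; first by apply/negP => /(allP (word_noq U)).
  by apply/negP => /(allP (word_noq V)).
have hsz : size b < size w1.
  rewrite ltnNge; apply/negP => hs; have et : w1 = take (size w1) b.
    have := congr1 (take (size w1)) e'; rewrite [X in _ = X]take_size_cat // => et; rewrite -[LHS]et cat_rcons take_cat.
    case: ltnP => // h; have e0 : size w1 = size b by apply/eqP; rewrite eqn_leq hs.
    by rewrite e0 subnn take0 cats0 take_size.
  case/negP: hb; rewrite -hl; case: w1 {e e' hs} nw hl et => // c w1 _ _ et.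
  have : last EqSign (c :: w1) \in take (size (c :: w1)) b by rewrite -et /= mem_last.
  exact: mem_take.
have ed : w1 = rcons b EqEnd ++ drop (size b).+1 w1.
  have := congr1 (take (size b).+1) e'; rewrite take_size_cat ?size_rcons // take_cat.
  case: ltnP => h; first by move=> ->; rewrite cat_take_drop.
  have -> : size w1 = (size b).+1 by lia.
  by rewrite subnn take0 cats0 drop_oversize ?cats0 //; lia.
have hS : encode S = drop (size b).+1 w1 ++ u ++ EqSign :: v ++ EqEnd :: w2.
  have := congr1 (drop (size b).+1) e'; rewrite drop_size_cat ?size_rcons // {1}ed -catA drop_size_cat ?size_rcons //.
have hl' : drop (size b).+1 w1 = [::] \/ last EqSign (drop (size b).+1 w1) = EqEnd.
  move: hl; rewrite {1}ed last_cat last_rcons; case: (drop _ _) => [|c s]; first by left.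
  by right.
have [S1 [U1 [V1 [S2 [e1 e2 e3 e4]]]]] := IH _ hS hu hv hl'.
exists ((U, V) :: S1), U1, V1, S2; split=> //; first by rewrite e1.
by rewrite encode_cons -e2 [LHS]ed /b cat_rcons -!catA.
Qed.

Lemma eqn_sound S s p e : eqn (encode S) s p e -> exists U V rest1 rest2, [/\ (U, V) \in S,
  drop s (encode S) = encode_word U ++ EqSign :: rest1, drop p.+1 (encode S) = encode_word V ++ EqEnd :: rest2,
  take (p - s) (drop s (encode S)) = encode_word U & take (e - p.+1) (drop p.+1 (encode S)) = encode_word V].
Proof.
set w := encode S; case/and5P => hs /eqP hp /eqP he sp /and3P[pe a1 a2].
have [c1 ec1 ed1] := cd_drop (cd_lt hp); rewrite hp in ec1; case: ec1 => ec1.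
have [c2 ec2 ed2] := cd_drop (cd_lt he); rewrite he in ec2; case: ec2 => ec2.
have noq i m : i + m <= size w -> all (fun i => ~~ oapp isq false (cd w i)) (iota i m) -> all (predC isq) (take m (drop i w)).
  elim: m i => [|m IH] i hm; first by rewrite take0.
  have [|c ec ed] := @cd_drop _ w i; first by lia.
  by rewrite ed /= ec /= => /andP[-> /IH ->] //; lia.
have hlp := cd_lt hp; have hle := cd_lt he.
have e1 : drop s w = take (p - s) (drop s w) ++ EqSign :: drop p.+1 w.
  by rewrite ec1 -ed1 -{2}(subnK sp) -drop_drop cat_take_drop.
have e2 : drop p.+1 w = take (e - p.+1) (drop p.+1 w) ++ EqEnd :: drop e.+1 w.
  by rewrite ec2 -ed2 -{2}(subnK pe) -drop_drop cat_take_drop.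
have := @encode_split S (take s w) (take (p - s) (drop s w)) (take (e - p.+1) (drop p.+1 w)) (drop e.+1 w).
case.
- by rewrite -e2 -e1 cat_take_drop.
- by apply: noq => //; rewrite subnKC // ltnW.
- by apply: noq => //; rewrite subnKC // ltnW.
- case/orP: hs => [/eqP -> |/eqP hs]; first by left; rewrite take0.
  case: s hs {e1 sp a1} => [|s] hs; first by left; rewrite take0.
  right; rewrite /= in hs; have hls := cd_lt hs; rewrite (take_nth EqSign) // last_rcons.
  by move: hs; rewrite /cd (nth_map EqSign) // => -[].
move=> S1 [U [V [S2 [eS _ eu ev]]]]; exists U, V, (drop p.+1 w), (drop e.+1 w).
split.
- by rewrite eS mem_cat inE eqxx orbT.
- by rewrite -eu.
- by rewrite -ev.
- by [].
- by [].
Qed.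

Lemma eqn_complete S1 U V S2 : let w := encode (S1 ++ (U, V) :: S2) in
  let s := size (@encode A S1) in let p := s + size (@encode_word A U) in let e := p.+1 + size (@encode_word A V) in
  [/\ eqn w s p e, e < size w, drop s w = encode_word U ++ EqSign :: encode_word V ++ EqEnd :: encode S2
    & drop p.+1 w = encode_word V ++ EqEnd :: encode S2].
Proof.
move=> w s p e.
have ew : w = encode S1 ++ encode_word U ++ EqSign :: encode_word V ++ EqEnd :: encode S2.
  by rewrite /w encode_cat encode_cons.
have ds : drop s w = encode_word U ++ EqSign :: encode_word V ++ EqEnd :: encode S2.
  by rewrite ew drop_size_cat.
have dp : drop p.+1 w = encode_word V ++ EqEnd :: encode S2.
  by rewrite /p -addnS addnC -drop_drop ds -cat_rcons drop_size_cat // size_rcons.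
have sw : size w = e.+1 + size (encode S2) by rewrite ew !size_cat /= size_cat /= /e /p /s; lia.
have cds i : cd w (s + i) = cd (drop s w) i.
  by rewrite ew drop_size_cat // cd_cat ltnNge leq_addr /= addKn.
have cdU i : i < size (@encode_word A U) -> ~~ oapp isq false (cd w (s + i)).
  move=> hi; rewrite cds ds cd_cat hi; case ec: (cd _ i) => [c|] //=.
  exact: (allP (word_noq U) _ (cd_mem ec)).
have cdV i : cd w (p.+1 + i) = cd (encode_word V ++ EqEnd :: encode S2) i.
  have -> : p.+1 + i = s + (size (@encode_word A U) + i.+1) by rewrite /p; lia.
  by rewrite cds ds cd_cat ltnNge leq_addr /= addKn.
split=> //; last by rewrite sw; lia.
apply/and5P; split.
- case: S1 @w @s @p @e ew {ds dp sw cds cdU cdV} => [|E S1] w s p e ew; first by [].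
  apply/orP; right; rewrite ew /s; set x := encode _.
  have [y ey] : exists y, x = rcons y EqEnd.
    have : E :: S1 <> [::] by [].
    rewrite /x; case/lastP: (E :: S1) => // S' [U' V'] _.
    exists (encode S' ++ encode_word U' ++ EqSign :: encode_word V').
    by rewrite -[in LHS]cats1 encode_cat encode_cons -cats1 -!catA.
  by rewrite ey size_rcons cd_cat size_rcons ltnSn /= /cd map_rcons nth_rcons size_map ltnn eqxx.
- by rewrite /p cds ds cd_cat ltnn subnn.
- by rewrite /e cdV cd_cat ltnn subnn.
- by rewrite leq_addr.
- apply/and3P; split; first by rewrite leq_addr.
    apply/allP => i; rewrite mem_iota => hi; have -> : i = s + (i - s) by lia.
    by apply: cdU; move: hi; rewrite /p; lia.
  apply/allP => i; rewrite mem_iota => hi; have -> : i = p.+1 + (i - p.+1) by lia.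
  rewrite cdV cd_cat; have -> : i - p.+1 < size (@encode_word A V) by move: hi; rewrite /e; lia.
  by case ec: (cd _ _) => [c|] //=; exact: (allP (word_noq V) _ (cd_mem ec)).
Qed.
End Positions.

End Encoding.
Import Encoding.

(** * Solutions correspond to labellings with finite support *)

Module Labellings.
Import all_order all_algebra finmap.

Section Labelling.
Variables (A : finType) (bar : A -> A).
Hypotheses (barK : involutive bar).
Local Notation bw := (bar_word bar).
Local Notation tree := (tree bar).
Local Notation kindf := (kindf bar).
Implicit Types (w : seq (code A)) (rl : nat -> option A).

(** Neighbouring slots of [x]: its letters are aligned to the left, so a free slot is followed by
    free slots only, and adjacent letters do not cancel. *)
Definition adj (x y : option A) : bool :=
  match x, y with Some a, Some b => b != bar a | None, Some _ => false | _, None => true end.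

Definition rok rl B := forall j, j.+1 < B -> adj (rl j) (rl j.+1).

Lemma rok_reduced rl B : rok rl B -> reduced bar (pmap rl (iota 0 B)).
Proof.
move=> hr; suff h m : forall j, j + m <= B -> reduced bar (pmap rl (iota j m)) /\
    (rl j = None -> pmap rl (iota j m) = [::]) by case: (h B 0 (leqnn _)).
elim: m => [|m IH] j hj //=.
have [i1 i2] := IH j.+1 ltac:(lia).
case: m IH hj i1 i2 => [|m] IH hj i1 i2 /=; first by case: (rl j).
have := hr j ltac:(lia); rewrite /adj; move: i1 i2 => /=.
case: (rl j) => [a|] /=; case: (rl j.+1) => [b|] //=.
  by rewrite /reduced /= => -> _ ->.
by move=> _ /(_ erefl) ->.
Qed.

Lemma pmap_cd (r : seq A) B : size r <= B -> pmap (cd r) (iota 0 B) = r.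
Proof.
elim: r B => [|x r IH] [|B] //= hB.
  by elim: (iota _ _) => //= j s; case: j.
by rewrite /= -[1]addn0 iotaDl pmap_comp_map -[in RHS](IH B).
Qed.

Lemma rok_cd (r : seq A) B : reduced bar r -> rok (cd r) B.
Proof.
move=> hr j _; elim: r j hr => [|x r IH] j hr; first by case: j.
case: j => [|j]; last exact: IH (path_sorted hr).
by case: r hr {IH} => [|y r] //= /andP[].
Qed.

Definition labelled w B rl (D G : nat -> seq A -> bool) P : Prop :=
  (forall t, local_ok bar (kindf w B rl t) (D t) (G t) (D t.+1) (G t.+1) P) /\
  (forall s p e, eqn w s p e -> forall h, reduced bar h -> D (s * B) h = D (p.+1 * B) h /\ G (s * B) h = G (p.+1 * B) h).

(** The labels are the Munn trees and end points of the words spelled from each position to the end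
    of its side. Only finitely many words arise, and [m] bounds their lengths. *)
Lemma labels_exist S (sigma : var nat -> seq A) B : is_solution bar S sigma -> size (sigma (inr true)) <= B -> 0 < B ->
  exists rl D G P, [/\ rok rl B, labelled (encode S) B rl D G P &
    exists m, forall h, m < size h -> (forall t, D t h = false /\ G t h = false) /\
       forall i, P (run (drop i (encode S))) h = false].
Proof.
move=> hsol hr B0; have [sbar sidem sred seqs] := hsol.
set w := encode S; set n := size w; pose r := sigma (inr true).
pose rl := cd r; pose sb z := sigma (inl (bits_nat z)).
pose X t := xk sb (map (kindf w B rl) (iota t ((n * B).+1 - t))).
have hsb z : reduce bar (sb z) = [::] by apply: (idem_reduce barK); exact: sidem.
have er : pmap rl (iota 0 B) = r by exact: pmap_cd.
exists rl, (fun t => tree (X t)), (fun t h => h == reduce bar (X t)), (fun z => tree (sb z)).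
split; first exact: rok_cd.
  split.
    move=> t; case: (leqP t (n * B)) => ht.
      have e : X t = xk sb (kindf w B rl t :: map (kindf w B rl) (iota t.+1 ((n * B).+1 - t.+1))).
        by rewrite /X (_ : (n * B).+1 - t = ((n * B).+1 - t.+1).+1) //; lia.
      by rewrite e; apply: labels_of_words.
    have e : X t = [::] by rewrite /X (_ : (n * B).+1 - t = 0) //; lia.
    rewrite kf_end //; last exact: ltnW.
    by rewrite e => h hh; rewrite tree_nil.
  have xs i : i <= n -> X (i * B) = xw bar sb r (drop i w).
    move=> hi; rewrite -er -xw_pos // /X; congr (xk _ (map _ (iota _ _))).
    by rewrite mulnBl subSn // leq_mul2r hi orbT.
  have xwU U e rest : isq e -> xw bar sb r (encode_word U ++ e :: rest) = subst_word sigma U.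
    move=> he; apply: xw_word => //; first by move=> z; rewrite /sb nat_bitsK.
    by rewrite /r -sbar.
  move=> s p e he h hh; have [U [V [r1 [r2 [hUV e1 e2 _ _]]]]] := eqn_sound he.
  have [_ /eqP hp _ hsp _] := and5P he; have hpn := cd_lt hp.
  rewrite !xs ?e1 ?e2 //; last by rewrite /n ltnW // (leq_ltn_trans hsp).
  rewrite !xwU ?isq_sign ?isq_end //; have := seqs _ _ hUV => /[dup] e3 /psi_eqP[-> _].
  by rewrite /tree e3.
pose m := \max_(t < (n * B).+1) size (X t) + \max_(i < n.+1) size (sb (run (drop i w))).
exists m => h hm; split.
  move=> t; suff hX : size (X t) < size h.
    split; first by apply/negbTE/negP => /tree_size; lia.
    by apply/negbTE/negP => /eqP eh; have := size_reduce bar (X t); rewrite -eh leqNgt hX.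
  apply: leq_ltn_trans hm; case: (ltnP t (n * B).+1) => ht.
    by apply: leq_trans (leq_addr _ _); exact: (leq_bigmax (Ordinal ht)).
  by rewrite /X (_ : (n * B).+1 - t = 0) //; lia.
move=> i; apply/negbTE/negP => /tree_size; apply/negP; rewrite -ltnNge.
apply: leq_ltn_trans hm; apply: leq_trans (leq_addl _ _).
case: (ltnP i n.+1) => hi; first exact: (leq_bigmax (F := fun i : 'I_n.+1 => size (sb (run (drop i w)))) (Ordinal hi)).
rewrite drop_oversize; last by rewrite -/n; lia.
by have := leq_bigmax (F := fun i : 'I_n.+1 => size (sb (run (drop i w)))) ord_max; rewrite /= drop_size.
Qed.

Fixpoint words m : seq (seq A) :=
  if m is m'.+1 then [::] :: [seq a :: h | a <- enum A, h <- words m'] else [:: [::]].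

Lemma mem_words m h : size h <= m -> h \in words m.
Proof.
elim: m h => [|m IH] [|a h] //= hm; rewrite inE; apply/orP; right.
by apply/allpairsP; exists (a, h); rewrite mem_enum; split=> //; exact: IH.
Qed.

Lemma psi_idem u : reduce bar u = [::] -> fim_mul (psi bar u) (psi bar u) = psi bar u.
Proof.
move=> hu; apply: val_inj; have := psi_snd bar u; have := fim_valP (psi bar u).
rewrite /= /fim_mul_val; case: (fim_val (psi bar u)) => P g /= /fim_axiomP[/= rP _ _] ->; rewrite hu.
congr (_, _); apply/fsetP => h; rewrite inE; apply/orP/idP => [[//|/imfsetP[k /= hk ->]]|]; last by left.
by rewrite /fg_mul /= reduce_id //; exact: rP.
Qed.

(** The value of a variable visits all reduced words of its label, finitely many because of [m]; its
    Munn tree is the prefix closure of the label. *)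
Lemma solution_exists S B rl D G P m : 0 < B -> rok rl B -> labelled (encode S) B rl D G P ->
  (forall z h, P z h -> size h <= m) -> solvable bar S.
Proof.
move=> B0 hrok [hl he] hP; set w := encode S in hl he; set n := size w.
pose r := pmap rl (iota 0 B).
pose ps z := [seq h <- words m | reduced bar h && P z h].
have rps z : all (reduced bar) (ps z) by apply/allP => h; rewrite mem_filter => /andP[/andP[]].
pose sb z := idword bar (ps z).
pose sigma (v : var nat) := match v with inl z => sb (nat_bits z) | inr b => if b then r else bw r end.
have hsb z : reduce bar (sb z) = [::] by exact: reduce_idword.
have hPz z h : reduced bar h -> tree (sb z) h <-> h = [::] \/ exists2 h', reduced bar h' & P z h' /\ prefix h h'.
  move=> hh; rewrite tree_idword //; split.
    case/orP => [/eqP ->|/hasP[h' hh' pre]]; first by left.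
    by right; exists h'; move: hh'; rewrite mem_filter => /andP[/andP[]].
  case=> [->|[h' rh' [ph' pre]]]; first by rewrite eqxx.
  by apply/orP; right; apply/hasP; exists h' => //; rewrite mem_filter rh' ph' mem_words // (hP z).
have key i : i <= n -> let X := xw bar sb r (drop i w) in
   (forall h, reduced bar h -> tree X h <-> exists2 h', reduced bar h' & D (i * B) h' /\ prefix h h') /\
   (forall h, reduced bar h -> G (i * B) h = (h == reduce bar X)).
  move=> hi; have hE : kindf w B rl (i * B + (n - i) * B) = KE.
    by rewrite -mulnDl subnKC // kf_end.
  have [h1 [h2 _]] := words_of_labels barK hsb hPz hl hE.
  by rewrite /= /r -xw_pos.
have xwU U e rest : isq e -> xw bar sb r (encode_word U ++ e :: rest) = subst_word sigma U.
  by move=> hq; apply: xw_word.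
exists sigma; split.
- by case=> [z|[]] /=; rewrite ?bw_idword ?bar_wordK.
- by move=> z; apply: psi_idem; exact: hsb.
- exact: rok_reduced.
move=> U V hUV; have [S1 [S2 eS]] : exists S1 S2, S = S1 ++ (U, V) :: S2.
  by case/splitPr: hUV => S1 S2; exists S1, S2.
have := eqn_complete S1 U V S2; rewrite /= -eS -/w; set s := size (encode S1); set p := s + _.
case=> hq hsz e1 e2; have hs : s <= n by rewrite /n; lia.
have hp : p.+1 <= n by rewrite /n; lia.
have [t1 g1] := key s hs; have [t2 g2] := key p.+1 hp.
rewrite /= in t1 g1 t2 g2; rewrite e1 xwU ?isq_sign // in t1 g1; rewrite e2 xwU ?isq_end // in t2 g2.
have eDG := he _ _ _ hq.
apply/psi_eqP; split.
  apply/eqP; rewrite -g2 ?reduced_reduce //; have [_ <-] := eDG _ (reduced_reduce bar (subst_word sigma U)).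
  by rewrite g1 ?reduced_reduce.
have tt h : tree (subst_word sigma U) h <-> tree (subst_word sigma V) h.
  split=> ht; have rh := tree_reduced ht; [move/(t1 _ rh): ht|move/(t2 _ rh): ht] => -[h' rh' [dh pre]].
    by apply/t2 => //; exists h' => //; have [<- _] := eDG _ rh'.
  by apply/t1 => //; exists h' => //; have [-> _] := eDG _ rh'.
by move=> h; split=> /treeP/tt/treeP.
Qed.
End Labelling.

End Labellings.
Import Labellings.

(** * Least fixpoints and finite trees of states *)

Module LeastFixpoint.
Import all_order all_algebra finmap.

Section Lfp.
Variables (I : finType) (cond : wd I -> nat -> bool) (N : nat) (w : seq I).
Hypothesis cond_mono : forall (T T' : nat -> bool) (y : 'I_N), (forall i, i < N -> T i -> T' i) ->
  cond (World N w T) y -> cond (World N w T') y.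

Definition mem_nat (X : {set 'I_N}) (i : nat) : bool := if insub i is Some y then y \in X else false.

Definition stepF (X : {set 'I_N}) : {set 'I_N} := [set y : 'I_N | cond (World N w (mem_nat X)) y].

Lemma mem_natE X (y : 'I_N) : mem_nat X y = (y \in X).
Proof. by rewrite /mem_nat valK. Qed.

Lemma stepF_mono : {homo stepF : X Y / X \subset Y}.
Proof.
move=> X Y /subsetP h; apply/subsetP => y; rewrite !inE; apply: cond_mono => i hi.
by rewrite /mem_nat; case: insubP => // u _ _ /h.
Qed.

Lemma lev_sub_fix k : iter k stepF set0 \subset fixset stepF.
Proof.
elim: k => [|k IH]; first exact: sub0set.
by rewrite -(fixsetK stepF_mono) /=; apply: stepF_mono.
Qed.

(** By monotonicity the updates in place never leave the least fixpoint, and each sweep does at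
    least one round of the simultaneous iteration, which needs [N] rounds. *)
Lemma final_fix (y : 'I_N) : final cond N w y = (y \in fixset stepF).
Proof.
pose below (T : nat -> bool) := forall i : 'I_N, T i -> i \in fixset stepF.
pose above k (T : nat -> bool) := forall i : 'I_N, i \in iter k stepF set0 -> T i.
have to_mem T : below T -> forall i, i < N -> T i -> mem_nat (fixset stepF) i.
  by move=> hT i hi; rewrite -[i]/(val (Ordinal hi)) mem_natE; exact: hT.
have bv T j : below T -> below (visit cond N w j T).
  move=> hT i; rewrite /visit /upd; case: eqP => [<-|_]; last exact: hT.
  case/orP; first exact: hT.
  by move=> hc; rewrite -(fixsetK stepF_mono) inE; apply: cond_mono hc; exact: to_mem.
have bs T : below T -> below (sweep cond N w T).
  rewrite /sweep => hT; have h m : below (iteri m (visit cond N w) T) by elim: m => //= m; exact: bv.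
  exact: h.
have bf k : below (iter k (sweep cond N w) (fun=> false)) by elim: k => //= k; exact: bs.
have grow (T : nat -> bool) m i : T i -> iteri m (visit cond N w) T i.
  by move=> hT; elim: m => //= m; rewrite {2}/visit /upd; case: eqP => // -> ->.
have vg (T : nat -> bool) j i : T i -> visit cond N w j T i by rewrite /visit /upd; case: eqP => // -> ->.
have av k T : above k T -> above k.+1 (sweep cond N w T).
  move=> hT i; rewrite iterS inE => hc.
  have : iteri i.+1 (visit cond N w) T i.
    rewrite /= {1}/visit /upd eqxx; apply/orP; right; apply: cond_mono hc => j hj.
    by rewrite -[j]/(val (Ordinal hj)) mem_natE => /hT /(grow _ i).
  move=> h1; have h2 m : iteri (i.+1 + m) (visit cond N w) T i.
    elim: m => [|m IH]; first by rewrite addn0.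
    by rewrite addnS; apply: vg.
  by have := h2 (N - i.+1); rewrite subnKC.
have af k : above k (iter k (sweep cond N w) (fun=> false)).
  by elim: k => [|k IH]; [move=> i; rewrite inE | exact: av].
apply/idP/idP; first exact: bf.
by rewrite /fixset card_ord; exact: af.
Qed.

Variables (A : finType) (bar : A -> A).
Hypothesis barK : involutive bar.
Variables (node zero : nat -> bool) (ex : nat -> A -> bool) (edge : A -> nat -> nat -> bool).
Hypothesis condE : forall T (y : 'I_N), cond (World N w T) y =
  node y && (zero y || [forall b, ex y b || [exists y' : 'I_N, T y' && edge b y y']]).
Hypothesis edge_ex : forall b y y', edge b y y' -> forall a, ex y' a = (a == bar b).

Lemma reduced_cons2 b c h : reduced bar (c :: h) -> reduced bar [:: b, c & h] = (b != bar c).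
Proof. by rewrite /reduced /= => ->; rewrite andbT -(inj_eq (inv_inj barK)) barK eq_sym. Qed.

(** A state that enters in round [k] and is not [zero] has, in every direction it does not forbid, a
    successor from an earlier round; unfolding therefore stops before depth [N]. The forbidden
    direction leads back to the parent. *)
Lemma tree_of_fix (y0 : 'I_N) : y0 \in fixset stepF -> (forall a, ex y0 a = false) ->
  exists f : seq A -> option 'I_N, [/\ f [::] = Some y0,
   forall h y, reduced bar h -> f h = Some y -> node y,
   forall b h, reduced bar (b :: h) -> match f h with
     | None => f (b :: h) = None
     | Some y => if zero y then f (b :: h) = None else exists2 y', f (b :: h) = Some y' & edge b y y'
     end &
   forall h, reduced bar h -> N <= size h -> f h = None].
Proof.
rewrite /fixset card_ord => hy0 hex; pose lev k := iter k stepF set0.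
(* Words grow at the front: the parent of [b :: h'] is [h'], because the local conditions relate a
   vertex to its left translates. *)
pose f := fix f h := if h is b :: h' then
    (if f h' is Some y then (if zero y then None else [pick y' : 'I_N | (y' \in lev (N - (size h').+1)) && edge b y y']) else None)
  else Some y0.
have levS k y : y \in lev k -> 0 < k /\ cond (World N w (mem_nat (lev k.-1))) y.
  by case: k => [|k]; rewrite /lev ?inE //= inE.
have inv h : reduced bar h -> forall y, f h = Some y -> y \in lev (N - size h) /\
    (forall b, reduced bar (b :: h) = ~~ ex y b).
  elim: h => [|c h IH] hh y.
    by case=> <-; rewrite subn0; split=> // b; rewrite hex.
  rewrite [f _]/=; have {IH} := IH (path_sorted hh); case: (f h) => [z|] // /(_ z erefl)[hz hzb].
  case: (zero z) => //; case: pickP => // y' /andP[h1 h2] [<-]; split=> // b.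
  by rewrite (edge_ex h2) reduced_cons2.
exists f; split=> //.
- by move=> h y hh /(inv _ hh)[/levS[_]]; rewrite condE => /andP[].
- move=> b h hbh; rewrite [f (b :: h)]/=; have hh := path_sorted hbh.
  have := inv h hh; case: (f h) => [y|] // /(_ y erefl)[hy hb].
  have [k0 hc] := levS _ _ hy; case hz: (zero y) => //.
  move: hc; rewrite condE hz /= => /andP[_ /forallP/(_ b)].
  rewrite -[ex y b]negbK -hb hbh /= => /existsP[y' /andP[h1 h2]].
  case: pickP => [y2 /andP[_ h3]|hn]; first by exists y2.
  by have := hn y'; rewrite h2 andbT; move: h1; rewrite mem_natE subnS => ->.
- move=> h hh hN; case ef: (f h) => [y|] //.
  by have [/levS[]] := inv h hh y ef; rewrite (eqP (_ : N - size h == 0)) // subn_eq0.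
Qed.

(** From depth [m] on all states are [zero] and enter in the first round; the others follow by
    descending induction on the depth. *)
Lemma fix_of_tree (g : seq A -> 'I_N) m : (forall h, reduced bar h -> node (g h)) ->
  (forall b h, reduced bar (b :: h) -> edge b (g h) (g (b :: h))) ->
  (forall h, reduced bar h -> m <= size h -> zero (g h)) -> g [::] \in fixset stepF.
Proof.
move=> hn he hz; suff h k : forall h, reduced bar h -> m <= size h + k -> g h \in fixset stepF by exact: (h m).
elim: k => [|k IH] h hh hk; rewrite -(fixsetK stepF_mono) inE condE hn //=.
  by rewrite hz // -(addn0 (size h)).
apply/orP; right; apply/forallP => b; case eb: (ex _ b) => //=.
have rb : reduced bar (b :: h).
  case: h hh eb {hk} => [|c h] hh eb //; rewrite reduced_cons2 //.
  by rewrite (edge_ex (he c h hh)) in eb; rewrite eb.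
apply/existsP; exists (g (b :: h)); rewrite mem_natE he // andbT.
by apply: IH => //; rewrite /= addSnnS.
Qed.
End Lfp.

End LeastFixpoint.
Import LeastFixpoint.

(** * Derived operations of the register calculus *)

Module Arithmetic.
Import all_order all_algebra finmap FunctionalExtensionality.

Section Derived.
Variable I : finType.
Notation ctx := (ctx I).
Implicit Type k : nat.

Lemma comp_eq k (F F' : ctx k -> nat) : (forall g, wok (wof g) -> F g = F' g) -> comp F -> comp F'.
Proof.
move=> e [c [a h]]; exists c, a => g W v es f hs hg.
have := h g W v es f hs hg; rewrite e // (fits_wof hg); exact: safe_ok hs.
Qed.

Lemma compb_eq k (P P' : ctx k -> bool) : (forall g, wok (wof g) -> P g = P' g) -> compb P -> compb P'.
Proof. by move=> e; apply: comp_eq => g /e ->. Qed.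

(** Code reads only the registers it is given, so a function established in the smallest context can
    be called from every larger one. *)
Lemma comp_last1 k (H : wd I -> nat -> nat) : comp (fun g : ctx 1 => H g.1 g.2) ->
  comp (fun g : ctx k.+1 => H (wof g) g.2).
Proof.
case=> c [a h]; exists (fun es f => c (take 1 es) f), a => g W v [|i es] f hs //= [e1 hg].
rewrite (fits_wof hg).
apply: (h (W, g.2)); first by apply: safe_sub hs _ => j; rewrite !inE take0 => /orP[->|].
by rewrite take0.
Qed.

Lemma comp_last2 k (H : wd I -> nat -> nat -> nat) : comp (fun g : ctx 2 => H g.1.1 g.1.2 g.2) ->
  comp (fun g : ctx k.+2 => H (wof g) g.1.2 g.2).
Proof.
case=> c [a h]; exists (fun es f => c (take 2 es) f), a => g W v es f hs; case: es hs => [|i [|j es]] hs /=; [by []|by case|case=> e1 [e2 hg]].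
rewrite (fits_wof hg).
apply: (h (W, g.1.2, g.2)); first by apply: safe_sub hs _ => l; rewrite !inE take0 => /or3P[->|->|//]; rewrite ?orbT.
by rewrite take0.
Qed.

Lemma comp_last3 k (H : wd I -> nat -> nat -> nat -> nat) : comp (fun g : ctx 3 => H g.1.1.1 g.1.1.2 g.1.2 g.2) ->
  comp (fun g : ctx k.+3 => H (wof g) g.1.1.2 g.1.2 g.2).
Proof.
case=> c [a h]; exists (fun es f => c (take 3 es) f), a => g W v es f hs; case: es hs => [|i [|j [|l es]]] hs /=; [by []|by case|by case=> _ []|case=> e1 [e2 [e3 hg]]].
rewrite (fits_wof hg).
apply: (h (W, g.1.1.2, g.1.2, g.2)); first by apply: safe_sub hs _ => m; rewrite !inE take0 => /or4P[->|->|->|//]; rewrite ?orbT.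
by rewrite take0.
Qed.

Lemma comp_call1 (H : wd I -> nat -> nat) : comp (fun g : ctx 1 => H g.1 g.2) ->
  forall k (F : ctx k -> nat), comp F -> comp (fun g => H (wof g) (F g)).
Proof. by move=> hH k F hF; exact: (comp_let hF (comp_last1 k hH)). Qed.

Lemma comp_call2 (H : wd I -> nat -> nat -> nat) : comp (fun g : ctx 2 => H g.1.1 g.1.2 g.2) ->
  forall k (F1 F2 : ctx k -> nat), comp F1 -> comp F2 -> comp (fun g => H (wof g) (F1 g) (F2 g)).
Proof. by move=> hH k F1 F2 h1 h2; exact: (comp_let h1 (comp_let (comp_weak h2) (comp_last2 k hH))). Qed.

Lemma comp_call3 (H : wd I -> nat -> nat -> nat -> nat) : comp (fun g : ctx 3 => H g.1.1.1 g.1.1.2 g.1.2 g.2) ->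
  forall k (F1 F2 F3 : ctx k -> nat), comp F1 -> comp F2 -> comp F3 -> comp (fun g => H (wof g) (F1 g) (F2 g) (F3 g)).
Proof.
move=> hH k F1 F2 F3 h1 h2 h3.
exact: (comp_let h1 (comp_let (comp_weak h2) (comp_let (comp_weak (comp_weak h3)) (comp_last3 k hH)))).
Qed.

Section Closure.
Variable k : nat.
Implicit Types (F G : ctx k -> nat) (P Q : ctx k -> bool).

Lemma compb_true : compb (fun _ : ctx k => true).
Proof. by apply: comp_eq (comp_succ (comp_zero I k)) => g /andP[h _]; rewrite (minn_idPr h). Qed.

Lemma compb_false : compb (fun _ : ctx k => false).
Proof. exact: comp_zero. Qed.

(** A conditional is a recursion of length 0 or 1 that overwrites its start value. *)
Lemma comp_if P F G : compb P -> comp F -> comp G -> comp (fun g => if P g then F g else G g).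
Proof.
move=> hP hF hG; have := comp_rec hP hG (comp_weak (comp_weak hF)).
by apply: comp_eq => g _ /=; case: (P g).
Qed.

Lemma compb_if P Q R : compb P -> compb Q -> compb R -> compb (fun g => if P g then Q g else R g).
Proof. by move=> hP hQ hR; apply: comp_eq (comp_if hP hQ hR) => g _; case: (P g). Qed.

Lemma compb_neg P : compb P -> compb (fun g => ~~ P g).
Proof. by move=> hP; apply: compb_eq (compb_if hP compb_false compb_true) => g _; case: (P g). Qed.

Lemma compb_and P Q : compb P -> compb Q -> compb (fun g => P g && Q g).
Proof. by move=> hP hQ; apply: compb_eq (compb_if hP hQ compb_false) => g _; case: (P g). Qed.

Lemma compb_or P Q : compb P -> compb Q -> compb (fun g => P g || Q g).
Proof. by move=> hP hQ; apply: compb_eq (compb_if hP compb_true hQ) => g _; case: (P g). Qed.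

Lemma compb_imp P Q : compb P -> compb Q -> compb (fun g => P g ==> Q g).
Proof. by move=> hP hQ; apply: compb_eq (compb_if hP hQ compb_true) => g _; case: (P g). Qed.

Lemma compb_eqb P Q : compb P -> compb Q -> compb (fun g => P g == Q g).
Proof. by move=> hP hQ; apply: compb_eq (compb_if hP hQ (compb_neg hQ)) => g _; case: (P g); case: (Q g). Qed.

(** The predecessor is the last index that a loop of length [F g] sees. *)
Lemma comp_pred F : comp F -> comp (fun g => (F g).-1).
Proof.
move=> hF; have := comp_rec hF (comp_zero I k) (comp_weak (comp_var I k)).
by apply: comp_eq => g _ /=; case: (F g).
Qed.

Lemma compb_eq0 F : comp F -> compb (fun g => F g == 0).
Proof.
move=> hF; have := comp_rec hF compb_true (comp_zero I k.+2).
by apply: comp_eq => g _ /=; case: (F g).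
Qed.
End Closure.

Lemma comp_sub k (F G : ctx k -> nat) : comp F -> comp G -> comp (fun g => F g - G g).
Proof.
move=> hF hG; have := comp_rec hG hF (comp_pred (comp_var I k.+1)).
by apply: comp_eq => g _ /=; elim: (G g) => [|n IH] /=; rewrite ?subn0 // IH subnS.
Qed.

Lemma compb_leq k (F G : ctx k -> nat) : comp F -> comp G -> compb (fun g => F g <= G g).
Proof. by move=> hF hG; exact: compb_eq0 (comp_sub hF hG). Qed.

Lemma compb_ltn k (F G : ctx k -> nat) : comp F -> comp G -> compb (fun g => F g < G g).
Proof. by move=> hF hG; apply: compb_eq (compb_neg (compb_leq hG hF)) => g _; rewrite -ltnNge. Qed.

Lemma compb_eqn k (F G : ctx k -> nat) : comp F -> comp G -> compb (fun g => F g == G g).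
Proof. by move=> hF hG; apply: compb_eq (compb_and (compb_leq hF hG) (compb_leq hG hF)) => g _; rewrite eqn_leq. Qed.

Lemma compb_all k (P : ctx k -> nat -> bool) (F : ctx k -> nat) : comp F ->
  compb (fun g : ctx k.+1 => P g.1 g.2) -> compb (fun g => all (P g) (iota 0 (F g))).
Proof.
move=> hF hP; have := comp_rec hF (compb_true k) (comp_if (comp_weak hP : compb (fun g : ctx k.+2 => P g.1.1 g.1.2)) (comp_var I k.+1) (comp_zero I k.+2)).
apply: comp_eq => g _; elim: (F g) => [|n IH] //; rewrite [iteri _ _ _]/= IH.
have -> : iota 0 n.+1 = iota 0 n ++ [:: n] by rewrite -addn1 iotaD.
by rewrite all_cat /= andbT; case: (P g n); rewrite ?andbT ?andbF.
Qed.

Lemma compb_has k (P : ctx k -> nat -> bool) (F : ctx k -> nat) : comp F ->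
  compb (fun g : ctx k.+1 => P g.1 g.2) -> compb (fun g => has (P g) (iota 0 (F g))).
Proof.
move=> hF hP; have := compb_neg (compb_all (P := fun g x => ~~ P g x) hF (compb_neg hP)).
by apply: compb_eq => g _; rewrite -has_predC; apply: eq_has => x /=; rewrite negbK.
Qed.

Lemma compb_alls k (T : Type) (P : T -> ctx k -> bool) (s : seq T) : (forall x, compb (P x)) ->
  compb (fun g => all (P^~ g) s).
Proof. by move=> hP; elim: s => [|x s IH]; [exact: compb_true | exact: compb_and]. Qed.

Lemma compb_forall k (T : finType) (P : T -> ctx k -> bool) : (forall x, compb (P x)) ->
  compb (fun g => [forall x, P x g]).
Proof.
move=> hP; apply: compb_eq (compb_alls (enum T) hP) => g _.
by apply/allP/forallP => h x; [apply: h; rewrite mem_enum | move=> _; exact: h].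
Qed.

Lemma compb_exists k (T : finType) (P : T -> ctx k -> bool) : (forall x, compb (P x)) ->
  compb (fun g => [exists x, P x g]).
Proof.
move=> hP; apply: compb_eq (compb_neg (compb_forall (fun x => compb_neg (hP x)))) => g _.
by rewrite negb_forall; apply: eq_existsb => x; rewrite negbK.
Qed.

Definition un_sy (s : option (I + option bool)) : option I := if s is Some (inl a) then Some a else None.

Lemma compb_inp k (Q : option I -> bool) (F : ctx k -> nat) : comp F ->
  compb (fun g => Q (cd (ww (wof g)) (F g))).
Proof.
move=> hF; apply: compb_eq (comp_probe (fun s => Q (un_sy s)) (leq0n 1) hF) => g _.
congr Q; rewrite /cells /= /cd nth_cat size_map; case: ltnP => h.
  by elim: (ww (wof g)) (F g) h => // a w IH [|i] //= h; rewrite IH.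
by rewrite nth_nseq if_same nth_default // size_map.
Qed.

Lemma compb_tab k (F : ctx k -> nat) : comp F ->
  compb (fun g => (F g <= wN (wof g)) && wT (wof g) (F g)).
Proof.
move=> hF; apply: compb_eq (comp_probe (fun s => s != None) (leqnn 1) hF) => g _.
rewrite -[cells _ 1]/(mkseq (fun j => if wT (wof g) j then mM I else None) (wN (wof g)).+1) -ltnS.
case: ltnP => h; last by rewrite nth_default ?size_mkseq.
by rewrite nth_mkseq //; case: (wT _ _).
Qed.

(** Arithmetic that saturates at the capacity, hence total; it agrees with the usual operations as
    long as the results fit. *)
Definition csucc (W : wd I) x := minn (wN W) x.+1.
Definition cadd (W : wd I) x y := iteri y (fun _ => csucc W) x.
Definition cmul (W : wd I) x y := iteri y (fun _ acc => cadd W acc x) 0.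
Definition cst (W : wd I) c := iter c (csucc W) 0.
Definition cpow (W : wd I) x d := iter d (fun acc => cmul W acc x) (cst W 1).
(** Half of [x], rounded down, is the number of odd numbers below [x]. *)
Definition chalf (W : wd I) x := iteri x (fun j acc => if odd j then csucc W acc else acc) 0.
Definition cbit (W : wd I) x i := odd (iteri i (fun _ => chalf W) x).

Lemma comp_csucc k (F : ctx k -> nat) : comp F -> comp (fun g => csucc (wof g) (F g)).
Proof. exact: comp_succ. Qed.

Lemma comp_cadd k (F G : ctx k -> nat) : comp F -> comp G -> comp (fun g => cadd (wof g) (F g) (G g)).
Proof. by move=> hF hG; exact: (comp_rec hG hF (comp_csucc (comp_var I k.+1))). Qed.

Lemma comp_cmul k (F G : ctx k -> nat) : comp F -> comp G -> comp (fun g => cmul (wof g) (F g) (G g)).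
Proof. by move=> hF hG; exact: (comp_rec hG (comp_zero I k) (comp_cadd (comp_var I k.+1) (comp_weak (comp_weak hF)))). Qed.

Lemma comp_cst k c : comp (fun g : ctx k => cst (wof g) c).
Proof. by elim: c => [|c IH]; [exact: comp_zero | exact: comp_csucc]. Qed.

Lemma comp_cpow k (F : ctx k -> nat) d : comp F -> comp (fun g => cpow (wof g) (F g) d).
Proof. by move=> hF; elim: d => [|d IH]; [exact: comp_cst | exact: comp_cmul]. Qed.

Lemma compb_odd k (F : ctx k -> nat) : comp F -> compb (fun g => odd (F g)).
Proof.
move=> hF; have := comp_rec hF (compb_false k) (compb_eq0 (comp_var I k.+1)).
by apply: comp_eq => g _ /=; elim: (F g) => //= n ->; case: (odd n).
Qed.

Lemma comp_chalf k (F : ctx k -> nat) : comp F -> comp (fun g => chalf (wof g) (F g)).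
Proof.
move=> hF; exact: (comp_rec hF (comp_zero I k) (comp_if (compb_odd (comp_weak (comp_var I k))) (comp_csucc (comp_var I k.+1)) (comp_var I k.+1))).
Qed.

Lemma compb_cbit k (F G : ctx k -> nat) : comp F -> comp G -> compb (fun g => cbit (wof g) (F g) (G g)).
Proof. by move=> hF hG; exact: (compb_odd (comp_rec hG hF (comp_chalf (comp_var I k.+1)))). Qed.

Lemma comp_count k (P : ctx k -> nat -> bool) (F : ctx k -> nat) : comp F ->
  compb (fun g : ctx k.+1 => P g.1 g.2) ->
  comp (fun g => iteri (F g) (fun j acc => if P g j then csucc (wof g) acc else acc) 0).
Proof.
move=> hF hP; exact: (comp_rec hF (comp_zero I k) (comp_if (comp_weak hP : compb (fun g : ctx k.+2 => P g.1.1 g.1.2)) (comp_csucc (comp_var I k.+1)) (comp_var I k.+1))).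
Qed.

Lemma count_iteri (W : wd I) (P : pred nat) m : m <= wN W ->
  iteri m (fun j acc => if P j then csucc W acc else acc) 0 = count P (iota 0 m).
Proof.
elim: m => [|m IH] hm //; have e : iota 0 m.+1 = iota 0 m ++ [:: m] by rewrite -addn1 iotaD.
rewrite e count_cat [iteri _ _ _]/= IH ?(ltnW hm) //= addn0 /csucc.
have : count P (iota 0 m) <= m by rewrite -{2}(size_iota 0 m) count_size.
by case: (P m) => /=; rewrite ?addn0 ?addn1 // => h; apply/minn_idPr; lia.
Qed.

Lemma comp_len k : comp (fun g : ctx k => size (ww (wof g))).
Proof.
apply: comp_eq (comp_count (P := fun g j => isSome (cd (ww (wof g)) j)) (comp_top I k) (compb_inp isSome (comp_var I k))) => g /andP[_ h].
rewrite count_iteri // -{1}(subnKC h) iotaD count_cat add0n.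
rewrite (_ : count _ (iota (size _) _) = 0) ?addn0.
  rewrite (eq_in_count (a2 := predT)) ?count_predT ?size_iota // => j; rewrite mem_iota /= => /cd_drop[c -> _] //.
by apply/eqP; rewrite -leqn0 leqNgt -has_count; apply/hasPn => j; rewrite mem_iota => /andP[/cd_ge -> _].
Qed.

Lemma caddE W x y : x + y <= wN W -> cadd W x y = x + y.
Proof. by elim: y => [|y IH] h; rewrite /cadd /= ?addn0 // -/(cadd W x y) IH ?addnS /csucc; lia. Qed.

Lemma cmulE W x y : x * y <= wN W -> cmul W x y = x * y.
Proof.
elim: y => [|y IH] h; first by rewrite muln0.
rewrite mulnS in h *; rewrite /cmul /= -/(cmul W x y) IH; last by lia.
by rewrite caddE addnC.
Qed.

Lemma cstE W c : c <= wN W -> cst W c = c.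
Proof. by elim: c => // c IH h; rewrite /cst /= -/(cst W c) IH /csucc; lia. Qed.

Lemma cpowE W x d : 0 < wN W -> 0 < x -> x ^ d <= wN W -> cpow W x d = x ^ d.
Proof.
move=> h0 hx; elim: d => [|d IH] h; first by rewrite -[cpow W x 0]/(cst W 1) cstE.
have h1 : x ^ d <= x ^ d.+1 by rewrite leq_pexp2l.
rewrite /cpow /= -/(cpow W x d) IH; last by lia.
by rewrite expnSr cmulE // -expnSr.
Qed.

Lemma chalfE W x : x <= wN W -> chalf W x = x./2.
Proof.
rewrite /chalf; elim: x => //= x IH h; rewrite IH ?(ltnW h) // uphalf_half /csucc.
by case: (odd x) => //; have := odd_double_half x; lia.
Qed.

Lemma cbitE W x i : x <= wN W -> cbit W x i = odd (iter i half x).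
Proof.
move=> h; rewrite /cbit; congr odd.
suff : iteri i (fun _ => chalf W) x = iter i half x /\ iter i half x <= wN W by case.
elim: i => //= i [-> hi]; rewrite chalfE //; split=> //.
by apply: leq_trans hi; rewrite -{2}[iter i half x]odd_double_half -addnn; lia.
Qed.
End Derived.

End Arithmetic.
Import Arithmetic.

(** * The tree automaton of an encoded system *)

Module TreeAutomaton.
Import all_order all_algebra finmap ClassicalEpsilon.

Lemma all_iota0 (P : pred nat) m : reflect (forall i, i < m -> P i) (all P (iota 0 m)).
Proof. by apply: (iffP allP) => h i; [move=> hi; apply: h; rewrite mem_iota | rewrite mem_iota => hi; apply: h]. Qed.

Section Automaton.
Variables (A : finType) (bar : A -> A).
Hypotheses (barK : involutive bar) (bar_free : forall a : A, bar a <> a).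
Implicit Types (b : A) (y i j t : nat).

Definition isE (c : option (code A)) : bool :=
  match c with Some EqSign | Some EqEnd | None => true | _ => false end.

(* [L y i j q] is the label of kind [q] (0 for D, 1 for G, 2 for P) of state [y] at position [i * B + j],
   [Ln] the one at the next position; [R y j a] says that letter [j] of x is [a], and [X y] is the set
   of forbidden directions. *)
Section Def.
Variables (w : seq (code A)) (n B : nat) (sc : nat -> nat).
Variables (rho : nat -> bool) (X : nat -> A -> bool) (R : nat -> nat -> A -> bool).
Variables (L Ln : nat -> nat -> nat -> nat -> bool) (same : nat -> nat -> bool) (eqq : nat -> nat -> nat -> bool).

Definition gkl y i j a : bool :=
  [|| (cd w i == Some (Letter a)) && (j == 0), (cd w i == Some (RedVar true)) && R y j a
    | (cd w i == Some (RedVar false)) && R y (B.-1 - j) (bar a)].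

(** Conditions inside one vertex; [rho y] stands for [h == [::]]. A letter relates the labels of two
    neighbouring vertices, so its positions are left to [gedge1]. *)
Definition gnode1 y i j : bool :=
  if isE (cd w i) then (L y i j 0 == rho y) && (L y i j 1 == rho y)
  else if (cd w i == Some IdemVar) && (j == 0) then
    (L y i j 0 == L y i j 2 || Ln y i j 0) && (L y i j 1 == Ln y i j 1)
  else [exists a, gkl y i j a] || (L y i j 0 == Ln y i j 0) && (L y i j 1 == Ln y i j 1).

(** Every state stores a whole copy of [x], and [gedge] makes neighbours store the same one. Here
    the copy is checked to be single-valued, aligned to the left and reduced. *)
Definition gr y j : bool :=
  [forall a, forall b, (R y j a && R y j b ==> (a == b)) &&
    ((sc j < B) && R y (sc j) b ==> [exists a', R y j a'] && (R y j a ==> (b != bar a)))].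

(** The label of a variable is stored once per occurrence, so occurrences with the same name must
    agree. *)
Definition gvar y i i' : bool :=
  [&& cd w i == Some IdemVar, cd w i' == Some IdemVar & same i i'] ==> (L y i 0 2 == L y i' 0 2).

Definition geqn y s p e : bool :=
  eqq s p e ==> (L y s 0 0 == L y (sc p) 0 0) && (L y s 0 1 == L y (sc p) 0 1).

Definition gnode y : bool :=
  [&& all (fun i => all (gnode1 y i) (iota 0 B)) (iota 0 (sc n)),
      all (fun i => all (gvar y i) (iota 0 n)) (iota 0 n),
      all (fun s => all (fun p => all (geqn y s p) (iota 0 n)) (iota 0 n)) (iota 0 n)
    & all (gr y) (iota 0 B)].

(** A state outside the root with empty labels: the tree may stop here, all further vertices being
    empty as well. *)
Definition gzero y : bool :=
  ~~ rho y && all (fun i => all (fun j => [forall q : 'I_3, ~~ L y i j q]) (iota 0 B)) (iota 0 (sc n)).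

(** With [y] at [h] and [y'] at [b h], reading the letter [b] leads from [b h] to [h], and reading
    [bar b] from [h] to [b h]. Only in the second case can the starting vertex be the root. *)
Definition gedge1 b y y' i j : bool :=
  (gkl y i j b ==> (L y' i j 0 == Ln y i j 0) && (L y' i j 1 == Ln y i j 1)) &&
  (gkl y i j (bar b) ==> (L y i j 0 == rho y || Ln y' i j 0) && (L y i j 1 == Ln y' i j 1)).

Definition gedge b y y' : bool :=
  [&& ~~ rho y', [forall a, X y' a == (a == bar b)], all (fun j => [forall a, R y j a == R y' j a]) (iota 0 B)
    & all (fun i => all (gedge1 b y y' i) (iota 0 B)) (iota 0 (sc n))].
End Def.

Variables (S : seq (equation A nat)) (N B : nat).
Let w := encode S.
Let n := size w.
Hypothesis B0 : 0 < B.
Variables (sc : nat -> nat) (rho : nat -> bool) (X : nat -> A -> bool) (R : nat -> nat -> A -> bool).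
Variables (L Ln : nat -> nat -> nat -> nat -> bool) (Lt : nat -> nat -> nat -> bool).
Variables (same : nat -> nat -> bool) (eqq : nat -> nat -> nat -> bool).
Hypothesis hsc : forall i, i <= n \/ i < B -> sc i = i.+1.
Hypothesis hL : forall y i j q, y < N -> i <= n -> j < B -> q < 3 -> L y i j q = Lt y (i * B + j) q.
Hypothesis hLn : forall y i j q, y < N -> i <= n -> j < B -> q < 3 -> Ln y i j q = Lt y (i * B + j).+1 q.
Hypothesis hsame : forall i i', i < n -> i' < n -> same i i' = (run (drop i.+1 w) == run (drop i'.+1 w)).
Hypothesis heqq : forall s p e, s < n -> p < n -> e < n -> eqq s p e = eqn w s p e.
Hypothesis hmk : forall (rho0 : bool) (X0 : A -> bool) (R0 : nat -> A -> bool) (L0 : nat -> nat -> bool),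
  exists2 y : 'I_N, rho y = rho0 & [/\ forall a, X y a = X0 a, forall j a, j < B -> R y j a = R0 j a
    & forall t q, t <= n.+1 * B -> q < 3 -> Lt y t q = L0 t q].
Local Notation node := (gnode w n B sc rho R L Ln same eqq).
Local Notation zero := (gzero n B sc rho L).
Local Notation edge := (gedge w n B sc rho X R L Ln).
Local Notation kl := (gkl w B R).
Variable cond : wd (code A) -> nat -> bool.
Hypothesis condE : forall T (y : 'I_N), cond (World N w T) y =
  node y && (zero y || [forall b, X y b || [exists y' : 'I_N, T y' && edge b y y']]).

Lemma cond_mono (T T' : nat -> bool) (y : 'I_N) : (forall i, i < N -> T i -> T' i) ->
  cond (World N w T) y -> cond (World N w T') y.
Proof.
move=> hT; rewrite !condE => /andP[-> /orP[->|/forallP h]] //=; apply/orP; right.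
apply/forallP => b; case/orP: (h b) => [->//|/existsP[y' /andP[h1 h2]]]; apply/orP; right.
by apply/existsP; exists y'; rewrite hT.
Qed.

Lemma edge_forbids b y y' : edge b y y' -> forall a, X y' a = (a == bar b).
Proof. by case/and4P => _ /forallP h _ _ a; apply/eqP. Qed.

Lemma klE rl y i j a : (forall j a, j < B -> R y j a = (rl j == Some a)) -> j < B ->
  kl y i j a <-> kindf bar w B rl (i * B + j) = KL a.
Proof.
move=> hR hj; have hj' : B.-1 - j < B by lia.
rewrite kf_pos // /gkl !hR //; case: (cd w i) => [[c|[]||b||]|] //=; rewrite ?orbF.
- case: (j =P 0) => _; rewrite ?andbT ?andbF //; split=> [/eqP[->]|[->]] //.
- case: (rl j) => [c|] //=; split=> [/eqP[->]|[->]] //.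
- case: (rl _) => [c|] //=; split=> [/eqP[->]|[<-]] //; first by rewrite barK.
  by rewrite barK.
- by case: (j == 0).
Qed.

Lemma posB i j : i <= n -> j < B -> i * B + j < n.+1 * B.
Proof. by move=> hi hj; rewrite -ltn_divLR // divnMDl // divn_small // addn0. Qed.

(** The state at [h] packs the values at [h] of all labels, the copy of [x] and the direction
    towards the parent; beyond depth [m] the labels are empty and [gzero] holds. *)
Theorem fix_of_solution sigma : is_solution bar S sigma -> size (sigma (inr true)) <= B ->
  exists2 y0 : 'I_N, y0 \in fixset (stepF cond w) & rho y0 && [forall a, ~~ X y0 a].
Proof.
move=> hsol hsz; have [rl [D [G [P [hrok [hloc heq] [m hm]]]]]] := labels_exist barK hsol hsz B0.
rewrite -/w in hloc heq hm.
pose lab h t q := if q == 0 then D t h else if q == 1 then G t h else P (run (drop (t %/ B).+1 w)) h.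
pose good h (y : 'I_N) := [/\ rho y = (h == [::]), forall a, X y a = (if h is c :: _ then a == bar c else false),
  forall j a, j < B -> R y j a = (rl j == Some a) & forall t q, t <= n.+1 * B -> q < 3 -> Lt y t q = lab h t q].
have ex (h : seq A) : exists y : 'I_N, good h y.
  by have [y h1 [h2 h3 h4]] := hmk (h == [::]) (fun a => if h is c :: _ then a == bar c else false) (fun j a => rl j == Some a) (lab h); exists y.
pose g h : 'I_N := proj1_sig (constructive_indefinite_description _ (ex h)).
have gP h : good h (g h) by exact: proj2_sig (constructive_indefinite_description _ (ex h)).
have gL h i j q : i <= n -> j < B -> q < 3 -> L (g h) i j q = lab h (i * B + j) q.
  move=> hi hj hq; have [_ _ _ h4] := gP h; rewrite hL // h4 // ltnW // posB //.
have gLn h i j q : i <= n -> j < B -> q < 3 -> Ln (g h) i j q = lab h (i * B + j).+1 q.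
  by move=> hi hj hq; have [_ _ _ h4] := gP h; rewrite hLn // h4 // posB.
have scn : sc n = n.+1 by rewrite hsc //; left.
have kl_of h i j a : j < B -> kl (g h) i j a <-> kindf bar w B rl (i * B + j) = KL a.
  by move=> hj; have [_ _ h3 _] := gP h; exact: klE.
exists (g [::]); last first.
  by have [-> h2 _ _] := gP [::]; apply/forallP => a; rewrite h2.
apply: (fix_of_tree cond_mono barK condE edge_forbids (m := m.+1)) => [h hh|b h hbh|h hh hsm].
- have [hrho _ hR _] := gP h; apply/and4P; split.
  + apply/all_iota0 => i; rewrite scn ltnS => hi; apply/all_iota0 => j hj.
    rewrite /gnode1 !gL // !gLn // hrho /lab /=.
    have hl := hloc (i * B + j) h hh; rewrite kf_pos // in hl.
    have hkl a := kl_of h i j a hj; rewrite kf_pos // in hkl.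
    case ec: (cd w i) hl hkl => [[a|[]||c||]|] /= hl hkl; try by case: hl => -> ->; rewrite ?eqxx ?orbT.
    * case: (j =P 0) hl hkl => [ej|_] hl hkl; last by case: hl => -> ->; rewrite !eqxx orbT.
      by apply/orP; left; apply/existsP; exists a; apply/hkl.
    * case: (rl j) hl hkl => [a|] hl hkl; last by case: hl => -> ->; rewrite !eqxx orbT.
      by apply/orP; left; apply/existsP; exists a; apply/hkl.
    * case: (rl _) hl hkl => [a|] hl hkl; last by case: hl => -> ->; rewrite !eqxx orbT.
      by apply/orP; left; apply/existsP; exists (bar a); apply/hkl.
    * case: (j =P 0) hl hkl => [ej|_] hl hkl; last by case: hl => -> ->; rewrite !eqxx orbT.
      by case: hl => -> ->; rewrite ej addn0 mulnK // !eqxx.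
  + apply/all_iota0 => i hi; apply/all_iota0 => i' hi'; rewrite /gvar hsame //.
    apply/implyP => /and3P[_ _ /eqP e]; rewrite !gL ?(ltnW hi) ?(ltnW hi') //.
    by rewrite /lab /= !addn0 !mulnK // e.
  + apply/all_iota0 => s hs; apply/all_iota0 => p hp; apply/all_iota0 => e he.
    rewrite /geqn heqq // hsc; last by left; exact: ltnW.
    apply/implyP => /heq/(_ h hh)[e1 e2]; rewrite !gL ?(ltnW hs) //.
    by rewrite /lab /= !addn0 e1 e2 !eqxx.
  + apply/all_iota0 => j hj; apply/forallP => a; apply/forallP => b; rewrite hsc; last by right.
    apply/andP; split; first by rewrite !hR //; apply/implyP => /andP[/eqP -> /eqP[->]].
    apply/implyP => /andP[hj1 hb]; rewrite hR // in hb; move/eqP: hb => eb.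
    have := hrok j hj1; rewrite eb; case ea: (rl j) => [c|] //= hc; apply/andP; split.
      by apply/existsP; exists c; rewrite hR // ea.
    by rewrite hR // ea; apply/implyP => /eqP[<-].
- have [_ _ hR _] := gP h; have [h1 h2 hR' _] := gP (b :: h); have hh := path_sorted hbh.
  apply/and4P; split.
  + by rewrite h1.
  + by apply/forallP => a; rewrite h2.
  + by apply/all_iota0 => j hj; apply/forallP => a; rewrite hR // hR'.
  + apply/all_iota0 => i; rewrite scn ltnS => hi; apply/all_iota0 => j hj.
    have [hrho _ _ _] := gP h.
    rewrite /gedge1 !gL // !gLn // hrho /lab /=; apply/andP; split; apply/implyP => /(kl_of h _ _ _ hj) ek.
      have := hloc (i * B + j) (b :: h) hbh; rewrite ek /= barK eqxx => -[-> ->].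
      by rewrite !eqxx.
    have := hloc (i * B + j) h hh; rewrite ek /= barK => -[-> ->].
    have -> : cons_red bar b h = b :: h by rewrite -[RHS](reduce_id hbh) /= reduce_id.
    by rewrite !eqxx.
- have [h1 _ _ _] := gP h; have [hD hPP] := hm h hsm.
  apply/andP; split; first by rewrite h1; case: (h) hsm.
  apply/all_iota0 => i; rewrite scn ltnS => hi; apply/all_iota0 => j hj; apply/forallP => q.
  rewrite gL // /lab; have [-> ->] := hD (i * B + j); rewrite hPP.
  by case: ifP => // _; case: ifP.
Qed.

Theorem solution_of_fix (y0 : 'I_N) : y0 \in fixset (stepF cond w) -> rho y0 -> (forall a, ~~ X y0 a) ->
  solvable bar S.
Proof.
move=> hy0 hrho hX.
have [f [f0 fnode fedge fbig]] := tree_of_fix barK condE edge_forbids hy0 (fun a => negbTE (hX a)).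
have scn : sc n = n.+1 by rewrite hsc //; left.
pose rl j := [pick a | R y0 j a].
have node0 := fnode [::] y0 isT f0; case/and4P: node0 => _ _ _ /all_iota0 hgr.
have hR0 j a : j < B -> R y0 j a = (rl j == Some a).
  move=> hj; rewrite /rl; case: pickP => [c hc|hn]; last by rewrite hn.
  apply/idP/eqP => [ha|[<-]] //; have /forallP/(_ c)/forallP/(_ a)/andP[/implyP h _] := hgr j hj.
  by congr Some; apply/eqP/h; rewrite hc ha.
have hR h (y : 'I_N) : reduced bar h -> f h = Some y -> forall j a, j < B -> R y j a = (rl j == Some a).
  elim: h y => [|b h IH] y hh; first by rewrite f0 => -[<-].
  move=> e; have := fedge b h hh; case eh: (f h) => [z|]; last by rewrite e.
  case: ifP => _; first by rewrite e.
  case=> z' ez he j a hj; have ezy : z' = y by move: ez; rewrite e => -[].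
  case/and4P: he => _ _ /all_iota0/(_ j hj)/forallP/(_ a)/eqP; rewrite ezy => <- _.
  exact: IH (path_sorted hh) eh _ _ hj.
have hrho' h (y : 'I_N) : reduced bar h -> f h = Some y -> rho y = (h == [::]).
  case: h => [|b h] hh; first by rewrite f0 => -[<-].
  move=> e; have := fedge b h hh; case eh: (f h) => [z|]; last by rewrite e.
  case: ifP => _; first by rewrite e.
  by case=> z'; rewrite e => -[<-] /and4P[/negbTE].
pose lab t q h := if f h is Some y then Lt y t q else false.
(* States cover the blocks 0 to [n], the last one lying behind the input; from there on the label is
   the one that [KE] prescribes. Vertices without a state have empty labels. *)
pose D t h := if t < n.+1 * B then lab t 0 h else h == [::].
pose G t h := if t < n.+1 * B then lab t 1 h else h == [::].
pose P z h := [exists i : 'I_n, [&& cd w i == Some IdemVar, run (drop i.+1 w) == z & lab (i * B) 2 h]] && reduced bar h.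
have zero0 h (y : 'I_N) t q : reduced bar h -> f h = Some y -> zero y -> t < n.+1 * B -> q < 3 -> lab t q h = false.
  move=> hh e /andP[_ /all_iota0 hz] ht hq; rewrite /lab e.
  have hi : t %/ B < n.+1 by rewrite ltn_divLR.
  have hj : t %% B < B by rewrite ltn_mod.
  have := hz (t %/ B); rewrite scn => /(_ hi)/all_iota0/(_ _ hj)/forallP/(_ (Ordinal hq)).
  by rewrite hL //= -divn_eq => /negbTE.
apply: (@solution_exists A bar barK S B rl D G P N B0).
- move=> j hj1; have hj : j < B by lia.
  have /forallP hg := hgr j hj; rewrite /adj.
  case eb: (rl j.+1) => [b|]; last by case: (rl j).
  have hb : R y0 j.+1 b by rewrite hR0 // eb.
  have hsj : sc j = j.+1 by rewrite hsc //; right.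
  case ea: (rl j) => [a|].
    have /forallP/(_ b)/andP[_] := hg a; rewrite hsj hj1 hb /= => /andP[_ /implyP]; apply.
    by rewrite hR0 // ea.
  have /forallP/(_ b)/andP[_] := hg b; rewrite hsj hj1 hb /= => /andP[/existsP[a]].
  by rewrite hR0 // ea.
- split.
    move=> t h hh; case: (ltnP t (n * B)) => htn; last first.
      rewrite kf_end //; rewrite /D /G; case: ltnP => // ht.
      have hi : t %/ B = n by apply/eqP; rewrite eqn_leq -ltnS ltn_divLR // ht leq_divRL.
      have hj : t %% B < B by rewrite ltn_mod.
      have et : n * B + t %% B = t by rewrite -{1}hi -divn_eq.
      rewrite /lab; case ef: (f h) => [y|]; last first.
        by case: (h) ef => [|b h'] //; rewrite f0.
      case/and4P: (fnode h y hh ef) => /all_iota0/(_ n); rewrite scn => /(_ (ltnSn n))/all_iota0/(_ _ hj).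
      rewrite /gnode1 cd_ge // !hL // et (hrho' h) //= => /andP[/eqP -> /eqP ->] _ _ _.
      by split.
    set i := t %/ B; set j := t %% B.
    have hi : i < n by rewrite ltn_divLR.
    have hj : j < B by rewrite ltn_mod.
    have et : t = i * B + j by rewrite -divn_eq.
    have ht : t < n.+1 * B by rewrite mulSn; lia.
    have ht1 : t.+1 < n.+1 * B by rewrite mulSn; lia.
    rewrite /D /G ht ht1.
    have n1 (y : 'I_N) : f h = Some y -> gnode1 w B rho R L Ln y i j.
      move=> ef; case/and4P: (fnode h y hh ef) => /all_iota0/(_ i); rewrite scn => /(_ (ltnW hi))/all_iota0/(_ j hj) //.
    have kly (y : 'I_N) h' : reduced bar h' -> f h' = Some y -> forall a, kl y i j a <-> kindf bar w B rl t = KL a.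
      by move=> rh' e a; have := @klE rl y i j a (hR h' y rh' e) hj; rewrite -et.
    have edge1 b y y' : edge b y y' -> gedge1 w B rho R L Ln b y y' i j.
      by case/and4P => _ _ _ /all_iota0/(_ i); rewrite scn => /(_ (ltnW hi))/all_iota0/(_ j hj).
    have LtE (y : 'I_N) q : q < 3 -> L y i j q = Lt y t q by move=> hq; rewrite hL ?(ltnW hi) // -et.
    have LnE (y : 'I_N) q : q < 3 -> Ln y i j q = Lt y t.+1 q by move=> hq; rewrite hLn ?(ltnW hi) // -et.
    case ek: (kindf bar w B rl t) => [a|z||].
    + have [b hb] : exists b, a = bar b by exists (bar a); rewrite barK.
      (* Reading [a] at [h] leads to [a^-1 h]: this is the parent of [h] if [h] begins with [a], and
         the child in direction [bar a] otherwise. *)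
      have [[h' eh]|[ec rc]] : (exists h', h = a :: h') \/ (cons_red bar (bar a) h = bar a :: h /\ reduced bar (bar a :: h)).
        case: (h) hh => [|c h'] hc; first by right.
        rewrite /= barK; case: eqP => [->|/eqP nc]; first by left; exists h'.
        by right; split=> //; rewrite /reduced /= barK nc.
      * rewrite eh /= barK eqxx; rewrite eh in hh; have rh' := path_sorted hh.
        have := fedge a h' hh; rewrite /lab; case eh' : (f h') => [y|]; last by move=> ->.
        case hz: (zero y).
          move=> ->; have z0 := zero0 _ _ t.+1 0 rh' eh' hz ht1 isT; have z1 := zero0 _ _ t.+1 1 rh' eh' hz ht1 isT.
          by move: z0 z1; rewrite /lab eh' => -> ->.
        case=> y' ey' he; rewrite ey'; have /andP[/implyP hk _] := edge1 _ _ _ he.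
        have := hk; rewrite !LtE // !LnE // => /(_ (iffRL (kly y h' rh' eh' a) ek))/andP[/eqP -> /eqP ->] //.
      * rewrite ec; have := fedge (bar a) h rc; rewrite /lab; case eh: (f h) => [y|]; last first.
          move=> ->; split=> //; by case: (h) eh => //; rewrite f0.
        case hz: (zero y).
          move=> ->; have z0 := zero0 _ _ t 0 hh eh hz ht isT; have z1 := zero0 _ _ t 1 hh eh hz ht isT.
          move: z0 z1; rewrite /lab eh => -> ->; split=> //.
          by rewrite orbF -(hrho' h y hh eh); case/andP: hz => /negbTE ->.
        case=> y' ey' he; rewrite ey'; have /andP[_ /implyP hk] := edge1 _ _ _ he.
        have := hk; rewrite barK !LtE // !LnE // (hrho' h y hh eh) => /(_ (iffRL (kly y h hh eh a) ek))/andP[/eqP -> /eqP ->] //.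
    + have [ec [ej ez]] : cd w i = Some IdemVar /\ j = 0 /\ z = run (drop i.+1 w).
        move: ek; rewrite {1}et kf_pos //; case: (cd w i) => [[c|[]||b||]|] //; try by case: (j == 0).
        * by case: (rl _).
        * by case: (rl _).
        * by case: (j =P 0) => // -> [<-].
      have eP : P z h = lab t 2 h.
        rewrite /P hh andbT; apply/existsP/idP.
          case=> i' /and3P[/eqP ec' /eqP ez']; rewrite /lab; case ef: (f h) => [y|] //.
          case/and4P: (fnode h y hh ef) => _ /all_iota0/(_ i' (ltn_ord i'))/all_iota0/(_ i hi) + _ _.
          rewrite /gvar ec' ec hsame // ez' ez !eqxx /= !hL ?(ltnW hi) ?(ltnW (ltn_ord i')) // !addn0 => /eqP ->.
          by rewrite et ej addn0.
        by move=> hl; exists (Ordinal hi); rewrite /= ec ez !eqxx /=; move: hl; rewrite et ej addn0.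
      rewrite eP /lab; case ef: (f h) => [y|] //.
      have ej0 : (j == 0) = true by rewrite ej.
      by have := n1 y ef; rewrite /gnode1 ec eqxx ej0 /= !LtE // !LnE // => /andP[/eqP -> /eqP ->].
    + rewrite /lab; case ef: (f h) => [y|] //; have := n1 y ef; rewrite /gnode1 !LtE // !LnE //.
      have nE : isE (cd w i) = false.
        by move: ek; rewrite {1}et kf_pos //; case: (cd w i) => [[]|].
      have nV : (cd w i == Some IdemVar) && (j == 0) = false.
        by move: ek; rewrite {1}et kf_pos //; case: (cd w i =P _) => [->|] //=; case: (j == 0).
      rewrite nE nV => /orP[/existsP[a /(kly y h hh ef)]|/andP[/eqP -> /eqP ->]] //.
      by rewrite ek.
    + have nE : isE (cd w i).
        move: ek; rewrite {1}et kf_pos //; case: (cd w i) => [[c|[]||b||]|] //; try by case: (j == 0).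
        * by case: (rl _).
        * by case: (rl _).
      rewrite /lab; case ef: (f h) => [y|]; last by case: (h) ef => //; rewrite f0.
      by have := n1 y ef; rewrite /gnode1 nE !LtE // (hrho' h y hh ef) => /andP[/eqP -> /eqP ->].
  move=> s p e he h hh; have [_ /eqP hp /eqP he' hsp /and3P[hpe _ _]] := and5P he.
  have hp' := cd_lt hp; have he'' := cd_lt he'; have hs : s < n by rewrite /n; apply: leq_ltn_trans hsp _.
  have hsB : s * B < n.+1 * B by rewrite ltn_mul2r B0; lia.
  have hpB : p.+1 * B < n.+1 * B by rewrite ltn_mul2r B0.
  rewrite /D /G hsB hpB /lab; case ef: (f h) => [y|] //.
  case/and4P: (fnode h y hh ef) => _ _ /all_iota0/(_ s hs)/all_iota0/(_ p hp')/all_iota0/(_ e he'') + _.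
  have hscp : sc p = p.+1 by apply: hsc; left; exact: ltnW hp'.
  rewrite /geqn heqq // he hscp.
  by rewrite !hL ?(ltnW hs) // !addn0 /= => /andP[/eqP -> /eqP ->].
- move=> z h /andP[/existsP[i /and3P[_ _]]]; rewrite /lab; case ef: (f h) => [y|] // _ hh.
  by rewrite leqNgt; apply/negP => hN; rewrite fbig // ltnW in ef.
Qed.
End Automaton.

End TreeAutomaton.
Import TreeAutomaton.

(** * States as numbers, and computability of the automaton *)

Module Tables.
Import all_order all_algebra finmap.

Fixpoint mkn (K : nat) (f : nat -> bool) : nat := if K is K'.+1 then f 0 + (mkn K' (fun i => f i.+1)).*2 else 0.

Lemma mkn_lt K f : mkn K f < 2 ^ K.
Proof. by elim: K f => //= K IH f; rewrite expnS mul2n; have := IH (fun i => f i.+1); case: (f 0) => /=; rewrite -!addnn; lia. Qed.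

Lemma mkn_bit K f i : i < K -> odd (iter i half (mkn K f)) = f i.
Proof.
elim: K f i => // K IH f [|i] hi /=; first by rewrite oddD odd_double addbF; case: (f 0).
by rewrite -[_./2]/(iter i.+1 half _) iterSr half_bit_double IH.
Qed.

Section Accessors.
Variables (A : finType) (bar : A -> A).
Notation wd := (wd (code A)).
Notation ctx := (ctx (code A)).
Implicit Types (W : wd) (a b : A).

Definition rk a : nat := enum_rank a.
Let c := #|A|.

(** The number of slots for [x]. The exponent is [10 + 7 + 4]: the factors 600 and 100 of [xbound]
    are below [2 ^ 10] and [2 ^ 7], and its degree is 4. *)
Definition BW W := cpow W (csucc W (csucc W (size (ww W)))) 21.
Definition posW W i j := cadd W (cmul W i (BW W)) j.
(** The bits of a state, from the lowest: one for the root flag, [c] for the forbidden directions,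
    [B * c] for the letters of [x], and three per position for the labels. *)
Definition rhoW W y := cbit W y (cst W 0).
Definition XW W y a := cbit W y (cst W (rk a).+1).
Definition RW W y j a := cbit W y (cadd W (cst W (1 + c + rk a)) (cmul W j (cst W c))).
Definition LiW W t q := cadd W (cst W (1 + c + q)) (cadd W (cmul W (BW W) (cst W c)) (cmul W t (cst W 3))).
Definition LtW W y t q := cbit W y (LiW W t q).
Definition LW W y i j q := LtW W y (posW W i j) q.
Definition LnW W y i j q := LtW W y (csucc W (posW W i j)) q.
Definition isb (x : bool) (o : option (code A)) := o == Some (Bit x).
(** Compares two names bit by bit; the first disjunct switches the comparison off once a symbol
    other than a bit has been passed. *)
Definition sameW W i i' : bool :=
  all (fun k => has (fun k' => ~~ (isb true (cd (ww W) (cadd W (csucc W i) k')) || isb false (cd (ww W) (cadd W (csucc W i) k')))) (iota 0 k)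
    || ((isb true (cd (ww W) (cadd W (csucc W i) k)) == isb true (cd (ww W) (cadd W (csucc W i') k)))
    && (isb false (cd (ww W) (cadd W (csucc W i) k)) == isb false (cd (ww W) (cadd W (csucc W i') k)))))
   (iota 0 (csucc W (size (ww W)))).
Definition isqo (o : option (code A)) := oapp (@isq A) false o.
(** The test [eqn] with its intervals rewritten as guarded ranges from 0, the form that [compb_all]
    accepts. *)
Definition eqnW W s p e : bool :=
  [&& (s == 0) || (cd (ww W) s.-1 == Some EqEnd), cd (ww W) p == Some EqSign, cd (ww W) e == Some EqEnd, s <= p, p < e,
   all (fun i => (s <= i) ==> ~~ isqo (cd (ww W) i)) (iota 0 p) &
   all (fun i => (p < i) ==> ~~ isqo (cd (ww W) i)) (iota 0 e)].

Notation nodeW W := (gnode bar (ww W) (size (ww W)) (BW W) (csucc W) (rhoW W) (RW W) (LW W) (LnW W) (sameW W) (eqnW W)).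
Notation zeroW W := (gzero (size (ww W)) (BW W) (csucc W) (rhoW W) (LW W)).
Notation edgeW W := (gedge bar (ww W) (size (ww W)) (BW W) (csucc W) (rhoW W) (XW W) (RW W) (LW W) (LnW W)).

Definition condW W y : bool :=
  nodeW W y && (zeroW W y || [forall b, XW W y b ||
    has (fun y' => ((y' <= wN W) && wT W y') && edgeW W b y y') (iota 0 (wN W))]).
Definition rootW W : bool :=
  has (fun y => ((y <= wN W) && wT W y) && (rhoW W y && [forall a, ~~ XW W y a])) (iota 0 (wN W)).

Section Leaves.
Variable k : nat.
Implicit Types (F G H : ctx k -> nat).

Lemma comp_BW : comp (fun g : ctx k => BW (wof g)).
Proof. by apply: comp_cpow; do 2 apply: comp_csucc; exact: comp_len. Qed.

Lemma comp_posW F G : comp F -> comp G -> comp (fun g => posW (wof g) (F g) (G g)).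
Proof. by move=> hF hG; apply: comp_cadd => //; apply: comp_cmul => //; exact: comp_BW. Qed.

Lemma compb_rhoW F : comp F -> compb (fun g => rhoW (wof g) (F g)).
Proof. by move=> hF; apply: compb_cbit => //; exact: comp_cst. Qed.

Lemma compb_XW F a : comp F -> compb (fun g => XW (wof g) (F g) a).
Proof. by move=> hF; apply: compb_cbit => //; exact: comp_cst. Qed.

Lemma compb_RW F G a : comp F -> comp G -> compb (fun g => RW (wof g) (F g) (G g) a).
Proof. by move=> hF hG; apply: compb_cbit => //; apply: comp_cadd; [exact: comp_cst | apply: comp_cmul => //; exact: comp_cst]. Qed.

Lemma compb_LtW F G q : comp F -> comp G -> compb (fun g => LtW (wof g) (F g) (G g) q).
Proof.
move=> hF hG; apply: compb_cbit => //; apply: comp_cadd; first exact: comp_cst.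
apply: comp_cadd; first by apply: comp_cmul; [exact: comp_BW | exact: comp_cst].
by apply: comp_cmul => //; exact: comp_cst.
Qed.

Lemma compb_LW F G H q : comp F -> comp G -> comp H -> compb (fun g => LW (wof g) (F g) (G g) (H g) q).
Proof. by move=> hF hG hH; apply: compb_LtW => //; exact: comp_posW. Qed.

Lemma compb_LnW F G H q : comp F -> comp G -> comp H -> compb (fun g => LnW (wof g) (F g) (G g) (H g) q).
Proof. by move=> hF hG hH; apply: compb_LtW => //; apply: comp_csucc; exact: comp_posW. Qed.

Lemma compb_cdx F x : comp F -> compb (fun g => cd (ww (wof g)) (F g) == Some x).
Proof. by move=> hF; exact: (compb_inp (fun o => o == Some x) hF). Qed.

Lemma compb_gkl F G H a : comp F -> comp G -> comp H ->
  compb (fun g => gkl bar (ww (wof g)) (BW (wof g)) (RW (wof g)) (F g) (G g) (H g) a).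
Proof.
move=> hF hG hH; apply: compb_or; first by apply: compb_and; [exact: compb_cdx | exact: compb_eq0].
apply: compb_or; first by apply: compb_and; [exact: compb_cdx | exact: compb_RW].
apply: compb_and; first exact: compb_cdx.
by apply: compb_RW => //; apply: comp_sub => //; apply: comp_pred; exact: comp_BW.
Qed.

Lemma compb_gnode1 F G H : comp F -> comp G -> comp H ->
  compb (fun g => gnode1 bar (ww (wof g)) (BW (wof g)) (rhoW (wof g)) (RW (wof g)) (LW (wof g)) (LnW (wof g)) (F g) (G g) (H g)).
Proof.
move=> hF hG hH; have l q := compb_LW q hF hG hH; have ln q := compb_LnW q hF hG hH; have r := compb_rhoW hF.
apply: compb_if; first exact: (compb_inp (@isE A) hG).
  by apply: compb_and; apply: compb_eqb.
apply: compb_if; first by apply: compb_and; [exact: compb_cdx | exact: compb_eq0].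
  by apply: compb_and; apply: compb_eqb => //; exact: compb_or.
apply: compb_or; first by apply: compb_exists => a; exact: compb_gkl.
by apply: compb_and; apply: compb_eqb.
Qed.

Lemma compb_gr F G : comp F -> comp G ->
  compb (fun g => gr bar (BW (wof g)) (csucc (wof g)) (RW (wof g)) (F g) (G g)).
Proof.
move=> hF hG; apply: compb_forall => a; apply: compb_forall => b.
apply: compb_and; first by apply: compb_imp; [apply: compb_and; exact: compb_RW | case: (a == b); [exact: compb_true | exact: compb_false]].
apply: compb_imp.
  apply: compb_and; first by apply: compb_ltn; [exact: comp_csucc | exact: comp_BW].
  by apply: compb_RW => //; exact: comp_csucc.
apply: compb_and; first by apply: compb_exists => a'; exact: compb_RW.
by apply: compb_imp; [exact: compb_RW | case: (b != bar a); [exact: compb_true | exact: compb_false]].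
Qed.

Lemma compb_gedge1 F F' G H b : comp F -> comp F' -> comp G -> comp H ->
  compb (fun g => gedge1 bar (ww (wof g)) (BW (wof g)) (rhoW (wof g)) (RW (wof g)) (LW (wof g)) (LnW (wof g)) b (F g) (F' g) (G g) (H g)).
Proof.
move=> hF hF' hG hH; apply: compb_and; (apply: compb_imp; first exact: compb_gkl); apply: compb_and; apply: compb_eqb;
  try (by apply: compb_LW); try (by apply: compb_LnW).
by apply: compb_or; [exact: compb_rhoW | exact: compb_LnW].
Qed.
End Leaves.

Lemma comp_v1 k : comp (fun g : ctx k.+2 => g.1.2).
Proof. exact: comp_weak (comp_var _ k). Qed.
Lemma comp_v2 k : comp (fun g : ctx k.+3 => g.1.1.2).
Proof. exact: comp_weak (comp_v1 k). Qed.
Lemma comp_v3 k : comp (fun g : ctx k.+4 => g.1.1.1.2).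
Proof. exact: comp_weak (comp_v2 k). Qed.
Lemma comp_v4 k : comp (fun g : ctx k.+4.+1 => g.1.1.1.1.2).
Proof. exact: comp_weak (comp_v3 k). Qed.
Hint Resolve comp_var comp_v1 comp_v2 comp_v3 comp_v4 comp_BW comp_len : core.

Lemma compb_sameW k (F G : ctx k -> nat) : comp F -> comp G -> compb (fun g => sameW (wof g) (F g) (G g)).
Proof.
move=> hF hG; apply: (comp_call2 (H := fun W i i' => nat_of_bool (sameW W i i')) _ hF hG).
have hp (x : bool) m (H K : ctx m -> nat) : comp H -> comp K -> compb (fun g => isb x (cd (ww (wof g)) (cadd (wof g) (csucc (wof g) (H g)) (K g)))).
  by move=> hH hK; apply: (compb_inp (isb x)); apply: comp_cadd => //; exact: comp_csucc.
apply: (compb_all (k := 2) (P := fun g x => _)); first by apply: (comp_csucc (k := 2)); exact: comp_len.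
apply: compb_or.
  apply: (compb_has (k := 3) (P := fun g x => _)); first exact: comp_var.
  by apply: compb_neg; apply: compb_or; [apply: (hp true 4) | apply: (hp false 4)].
by apply: compb_and; apply: compb_eqb; first [apply: (hp true 3) | apply: (hp false 3)].
Qed.

Lemma compb_eqnW k (F1 F2 F3 : ctx k -> nat) : comp F1 -> comp F2 -> comp F3 -> compb (fun g => eqnW (wof g) (F1 g) (F2 g) (F3 g)).
Proof.
move=> h1 h2 h3; apply: (comp_call3 (H := fun W s p e => nat_of_bool (eqnW W s p e)) _ h1 h2 h3).
apply: compb_and; first by apply: compb_or; [apply: compb_eq0 | apply: (compb_cdx (k := 3)); apply: comp_pred].
apply: compb_and; first exact: (compb_cdx (k := 3)).
apply: compb_and; first exact: (compb_cdx (k := 3)).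
apply: compb_and; first exact: compb_leq.
apply: compb_and; first exact: compb_ltn.
apply: compb_and.
  apply: (compb_all (k := 3) (P := fun g x => _)); first exact: comp_v1.
  apply: compb_imp; first exact: (compb_leq (comp_v3 0) (comp_var _ 3)).
  by apply: compb_neg; apply: (compb_inp isqo (k := 4)); exact: comp_var.
apply: (compb_all (k := 3) (P := fun g x => _)); first exact: comp_var.
apply: compb_imp; first exact: (compb_ltn (comp_v2 1) (comp_var _ 3)).
by apply: compb_neg; apply: (compb_inp isqo (k := 4)); exact: comp_var.
Qed.

Lemma compb_nodeW : compb (fun g : ctx 1 => nodeW g.1 g.2).
Proof.
apply: compb_and.
  apply: (compb_all (k := 1) (P := fun g x => _)); first by apply: (comp_csucc (k := 1)); exact: comp_len.
  apply: (compb_all (k := 2) (P := fun g x => _)); first exact: (comp_BW 2).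
  exact: (compb_gnode1 (comp_v2 0) (comp_v1 1) (comp_var _ 2)).
apply: compb_and.
  apply: (compb_all (k := 1) (P := fun g x => _)); first exact: (comp_len _ 1).
  apply: (compb_all (k := 2) (P := fun g x => _)); first exact: (comp_len _ 2).
  apply: compb_imp.
    apply: compb_and; first exact: (compb_cdx _ (comp_v1 1)).
    by apply: compb_and; [exact: (compb_cdx _ (comp_var _ 2)) | exact: (compb_sameW (comp_v1 1) (comp_var _ 2))].
  by apply: compb_eqb; [exact: (compb_LW 2 (comp_v2 0) (comp_v1 1) (comp_zero _ 3)) | exact: (compb_LW 2 (comp_v2 0) (comp_var _ 2) (comp_zero _ 3))].
apply: compb_and.
  apply: (compb_all (k := 1) (P := fun g x => _)); first exact: (comp_len _ 1).
  apply: (compb_all (k := 2) (P := fun g x => _)); first exact: (comp_len _ 2).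
  apply: (compb_all (k := 3) (P := fun g x => _)); first exact: (comp_len _ 3).
  apply: compb_imp; first exact: (compb_eqnW (comp_v2 1) (comp_v1 2) (comp_var _ 3)).
  have hs := comp_csucc (comp_v1 2 : comp (fun g : ctx 4 => g.1.2)).
  apply: compb_and; apply: compb_eqb.
  - exact: (compb_LW 0 (comp_v3 0) (comp_v2 1) (comp_zero _ 4)).
  - exact: (compb_LW 0 (comp_v3 0) hs (comp_zero _ 4)).
  - exact: (compb_LW 1 (comp_v3 0) (comp_v2 1) (comp_zero _ 4)).
  - exact: (compb_LW 1 (comp_v3 0) hs (comp_zero _ 4)).
apply: (compb_all (k := 1) (P := fun g x => _)); first exact: (comp_BW 1).
exact: (compb_gr (comp_v1 0) (comp_var _ 1)).
Qed.

Lemma compb_zeroW : compb (fun g : ctx 1 => zeroW g.1 g.2).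
Proof.
apply: compb_and; first by apply: compb_neg; exact: (compb_rhoW (comp_var _ 0)).
apply: (compb_all (k := 1) (P := fun g x => _)); first by apply: (comp_csucc (k := 1)); exact: comp_len.
apply: (compb_all (k := 2) (P := fun g x => _)); first exact: (comp_BW 2).
apply: compb_forall => q; apply: compb_neg; exact: (compb_LW q (comp_v2 0) (comp_v1 1) (comp_var _ 2)).
Qed.

Lemma compb_edgeW b : compb (fun g : ctx 2 => edgeW g.1.1 b g.1.2 g.2).
Proof.
apply: compb_and; first by apply: compb_neg; exact: (compb_rhoW (comp_var _ 1)).
apply: compb_and.
  apply: compb_forall => a; apply: compb_eqb; first exact: (compb_XW a (comp_var _ 1)).
  by case: (a == bar b); [exact: compb_true | exact: compb_false].
apply: compb_and.
  apply: (compb_all (k := 2) (P := fun g x => _)); first exact: (comp_BW 2).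
  apply: compb_forall => a; apply: compb_eqb; [exact: (compb_RW a (comp_v2 0) (comp_var _ 2)) | exact: (compb_RW a (comp_v1 1) (comp_var _ 2))].
apply: (compb_all (k := 2) (P := fun g x => _)); first by apply: (comp_csucc (k := 2)); exact: comp_len.
apply: (compb_all (k := 3) (P := fun g x => _)); first exact: (comp_BW 3).
exact: (compb_gedge1 b (comp_v3 0) (comp_v2 1) (comp_v1 2) (comp_var _ 3)).
Qed.

Lemma compb_condW : compb (fun g : ctx 1 => condW g.1 g.2).
Proof.
apply: compb_and; first exact: compb_nodeW.
apply: compb_or; first exact: compb_zeroW.
apply: compb_forall => b; apply: compb_or; first exact: (compb_XW b (comp_var _ 0)).
apply: (compb_has (k := 1) (P := fun g x => _)); first exact: (comp_top _ 1).
by apply: compb_and; [exact: (compb_tab (comp_var _ 1)) | exact: compb_edgeW].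
Qed.

Lemma compb_rootW : compb (fun g : ctx 0 => rootW g).
Proof.
apply: (compb_has (k := 0) (P := fun g x => _)); first exact: (comp_top _ 0).
apply: compb_and; first exact: (compb_tab (comp_var _ 0)).
apply: compb_and; first exact: (compb_rhoW (comp_var _ 0)).
apply: compb_forall => a; apply: compb_neg; exact: (compb_XW a (comp_var _ 0)).
Qed.
End Accessors.

End Tables.
Import Tables.

(** * Recognising encodings, and prefixes of encoded words *)

Module Grammar.
Import all_order all_algebra finmap.
Import Order.TTheory GRing.Theory Num.Theory.

Section Grammar.
Variable A : finType.
Implicit Types (w : seq (code A)).

(* 0: before an equation, 1/2/3: in a left-hand side, 4/5/6: in a right-hand side; 2 and 5 follow
   a variable name that may be complete, 3 and 6 one that ends with 0. *)
Definition dstep (q : nat) (c : code A) : nat :=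
  match c with
  | Letter _ | RedVar _ => if q <= 2 then 1 else if (q == 4) || (q == 5) then 4 else 7
  | IdemVar => if q <= 2 then 2 else if (q == 4) || (q == 5) then 5 else 7
  | Bit b => if (q == 2) || (q == 3) then (if b then 2 else 3)
             else if (q == 5) || (q == 6) then (if b then 5 else 6) else 7
  | EqSign => if q <= 2 then 4 else 7
  | EqEnd => if (q == 4) || (q == 5) then 0 else 7
  end.

Lemma last_nat_bits i : last true (nat_bits i).
Proof.
rewrite /nat_bits; case: (bin_of_nat i) => //= p.
have h b : last b (pos_bits p) by elim: p b => [p IH|p IH|] b //=.
exact: h.
Qed.

Lemma nat_bits_onto z : last true z -> exists i, z = nat_bits i.
Proof.
case: z => [|b z] hz; first by exists 0.
have [p ->] : exists p, b :: z = pos_bits p.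
  elim: z b hz => [|b' z IH] b /=; first by case: b => // _; exists xH.
  by move=> /IH[p ->]; case: b; [exists (xI p) | exists (xO p)].
exists (nat_of_pos p); have := nat_of_binK (Npos p); rewrite /= => e.
by rewrite /nat_bits e.
Qed.

(** These are the languages of accepted continuations. In [bitsL b L] the bits of a name are still
    being read and [b] is the last one so far; [last b z] keeps a finished name from ending in 0. *)
Let LV w := exists V S, w = encode_word V ++ EqEnd :: @encode A S.
Let LU w := exists U w', LV w' /\ w = encode_word U ++ EqSign :: w'.
Let L0 w := exists S, w = @encode A S.
Let bitsL (b : bool) (L : seq (code A) -> Prop) w := exists z w', [/\ last b z, L w' & w = map Bit z ++ w'].

Lemma LU_cons s w : LU w -> LU (encode_symb s ++ w).
Proof. by case=> U [w' [h ->]]; exists (s :: U), w'; rewrite encode_word_cons catA. Qed.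

Lemma LV_cons s w : LV w -> LV (encode_symb s ++ w).
Proof. by case=> V [S ->]; exists (s :: V), S; rewrite encode_word_cons catA. Qed.

Lemma LU_var w : bitsL true LU w -> LU (IdemVar :: w).
Proof. by case=> z [w' [hz hw ->]]; have [i ->] := nat_bits_onto hz; exact: (LU_cons (inr (inl i)) hw). Qed.

Lemma LV_var w : bitsL true LV w -> LV (IdemVar :: w).
Proof. by case=> z [w' [hz hw ->]]; have [i ->] := nat_bits_onto hz; exact: (LV_cons (inr (inl i)) hw). Qed.

Lemma L0_of_LU w : LU w -> L0 w.
Proof. by case=> U [w' [[V [S ->]] ->]]; exists ((U, V) :: S); rewrite encode_cons. Qed.

(** One clause per live state, proved together by induction on [w]; state 7 is a sink. *)
Lemma dfa_sound w :
  (foldl dstep 0 w = 0 -> L0 w) /\ (foldl dstep 1 w = 0 -> LU w) /\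
  (foldl dstep 2 w = 0 -> bitsL true LU w) /\ (foldl dstep 3 w = 0 -> bitsL false LU w) /\
  (foldl dstep 4 w = 0 -> LV w) /\ (foldl dstep 5 w = 0 -> bitsL true LV w) /\
  (foldl dstep 6 w = 0 -> bitsL false LV w).
Proof.
have sink w' : foldl dstep 7 w' = 0 -> False.
  by elim: w' => [|c w' IH] //=; have -> : dstep 7 c = 7 by case: c.
have nb (L : seq (code A) -> Prop) w' : L w' -> bitsL true L w' by move=> h; exists [::], w'.
have cb b b' (L : seq (code A) -> Prop) w' : bitsL b L w' -> bitsL b' L (Bit b :: w').
  by case=> z [w2 [h1 h2 ->]]; exists (b :: z), w2.
elim: w => [|c w [I0 [I1 [I2 [I3 [I4 [I5 I6]]]]]]] /=.
  by do !split=> //; move=> _; exists [::].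
case: c => [a|b||b||] /=.
- have hU := LU_cons (inl a); have hV := LV_cons (inl a).
  by do !split=> //; move=> h; try (by case: (sink _ h));
    [apply: L0_of_LU; apply: hU; auto | apply: hU; auto | apply: nb; apply: hU; auto | apply: hV; auto | apply: nb; apply: hV; auto].
- have hU := LU_cons (inr (inr b)); have hV := LV_cons (inr (inr b)).
  by do !split=> //; move=> h; try (by case: (sink _ h));
    [apply: L0_of_LU; apply: hU; auto | apply: hU; auto | apply: nb; apply: hU; auto | apply: hV; auto | apply: nb; apply: hV; auto].
- by do !split=> //; move=> h; try (by case: (sink _ h));
    [apply: L0_of_LU; apply: LU_var; auto | apply: LU_var; auto | apply: nb; apply: LU_var; auto | apply: LV_var; auto | apply: nb; apply: LV_var; auto].
- by case: b; do !split=> //; move=> h; try (by case: (sink _ h)); apply: cb; auto.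
- have hU : foldl dstep 4 w = 0 -> LU (EqSign :: w) by move=> h; exists [::], w; split; auto.
  by do !split=> //; move=> h; first [by case: (sink _ h) | by apply: L0_of_LU; auto | by apply: nb; auto | by auto].
- have hV : foldl dstep 0 w = 0 -> LV (EqEnd :: w) by move=> h; have [S ->] := I0 h; exists [::], S.
  by do !split=> //; move=> h; first [by case: (sink _ h) | by apply: nb; auto | by auto].
Qed.

Lemma dfa_bits q b z : (q == 2) || (q == 5) ->
  foldl dstep (if b then q else q.+1) (map Bit z) = if last b z then q else q.+1.
Proof.
move=> hq; elim: z b => //= c z IH b; rewrite -IH; congr foldl.
by case/orP: hq => /eqP ->; case: b; case: c.
Qed.

Lemma dfa_U U q : q <= 2 -> foldl dstep q (encode_word U) <= 2.
Proof.
elim: U q => [|s U IH] q hq //; rewrite encode_word_cons foldl_cat; apply: IH.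
case: s => [a|[i|b]] /=; rewrite ?hq //.
by have := @dfa_bits 2 true (nat_bits i) isT; rewrite last_nat_bits => ->.
Qed.

Lemma dfa_V V q : (q == 4) || (q == 5) -> let q' := foldl dstep q (encode_word V) in (q' == 4) || (q' == 5).
Proof.
elim: V q => [|s V IH] q hq //; rewrite encode_word_cons /= foldl_cat; apply: IH.
have h2 : (q <= 2) = false by case/orP: hq => /eqP ->.
case: s => [a|[i|b]] /=; rewrite ?h2 ?hq //.
by have := @dfa_bits 5 true (nat_bits i) isT; rewrite last_nat_bits => ->.
Qed.

Lemma dfaP w : foldl dstep 0 w = 0 <-> exists S, w = @encode A S.
Proof.
split; first by case: (dfa_sound w).
case=> S ->; elim: S => [|[U V] S IH] //; rewrite encode_cons foldl_cat /= foldl_cat /=.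
rewrite (dfa_U U (leq0n 2)); have := @dfa_V V 4 isT; rewrite /= => ->.
exact: IH.
Qed.
End Grammar.

Section Prefixes.
Variable A : finType.
Implicit Types (U V : seq (symb A nat)).
Notation ew := (@encode_word A).

Lemma count_word b U : count_mem (RedVar b) (ew U) = count_mem (rvar A nat b) U.
Proof.
elim: U => [|s U IH] //; rewrite encode_word_cons count_cat IH /=; congr (_ + _).
case: s => [a|[i|c]] //=; first by elim: (nat_bits i).
by rewrite addn0; congr nat_of_bool; apply/eqP/eqP => [[->]|[->]].
Qed.

(** A cut inside the name of a variable counts the same occurrences of [x] as the cut in front of
    that variable. *)
Lemma prefix_of_pos U k : exists2 U', prefix U' U & forall b, count_mem (RedVar b) (take k (ew U)) = count_mem (rvar A nat b) U'.
Proof.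
elim: U k => [|s U IH] k; first by exists [::].
rewrite encode_word_cons take_cat; case: ltnP => hk; last first.
  have [U' h1 h2] := IH (k - size (encode_symb s)).
  exists (s :: U'); first by rewrite /= eqxx.
  by move=> b; rewrite count_cat h2 -[count_mem _ (encode_symb s)]addn0 -[X in _ + X + _](count_word b [::]) -count_cat -[encode_symb s ++ _]/(ew [:: s]) count_word /= addn0.
exists [::] => // b; case: s hk => [a|[i|c]] /=; case: k => //= k.
by move=> _; rewrite -map_take; elim: (take _ _).
Qed.

Lemma pos_of_prefix U' U Z rest : nobit rest -> prefix (U' ++ [:: idem A Z]) U ->
  let k := size (ew U') in [/\ k < size (ew U), cd (ew U) k = Some IdemVar, take k (ew U) = ew U'
    & run (drop k.+1 (ew U ++ rest)) = nat_bits Z].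
Proof.
move=> hr /prefixP[U2 ->] k.
have e : ew ((U' ++ [:: idem A Z]) ++ U2) = ew U' ++ IdemVar :: map Bit (nat_bits Z) ++ ew U2.
  by rewrite /encode_word !map_cat !flatten_cat /= cats0 -catA.
rewrite e; split.
- by rewrite size_cat /=; lia.
- by rewrite cd_cat ltnn subnn.
- by rewrite take_size_cat.
- rewrite -catA /= -cat_rcons drop_size_cat ?size_rcons // -catA run_bits //.
  by case: U2 {e} => [|[a|[i|b]] U2].
Qed.

Lemma pos_of_prefix0 U' U : prefix U' U -> size (ew U') <= size (ew U) /\ take (size (ew U')) (ew U) = ew U'.
Proof.
case/prefixP => U2 ->; rewrite /encode_word map_cat flatten_cat size_cat take_size_cat //.
by rewrite leq_addr.
Qed.

Lemma idem_of_pos U k : cd (ew U) k = Some IdemVar -> exists U' Z, prefix (U' ++ [:: idem A Z]) U /\ k = size (ew U').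
Proof.
elim: U k => [|s U IH] k; first by case: k.
rewrite encode_word_cons cd_cat; case: ltnP => hk; last first.
  move=> /IH[U' [Z [h1 h2]]]; exists (s :: U'), Z; rewrite /= eqxx h1; split=> //.
  by rewrite encode_word_cons size_cat -h2; lia.
case: s hk => [a|[i|b]] /=; case: k => //= k; last first.
  by move=> hk e; exfalso; move: e; rewrite /cd /=; elim: (nat_bits i) k {hk} => [|x z IHz] [|k] //=; exact: IHz.
by move=> *; exists [::], i; rewrite /= /idem eqxx prefix0s.
Qed.
End Prefixes.

End Grammar.
Import Grammar.

(** * Deciding validity and strong unbalancedness of the input *)

Module InputChecks.
Import all_order all_algebra finmap.
Import Order.TTheory GRing.Theory Num.Theory.

Local Arguments cst : simpl never.

Section Check.
Variables (A : finType) (bar : A -> A).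
Hypothesis barK : involutive bar.
Notation wd := (wd (code A)).
Notation ctx := (ctx (code A)).
Implicit Types (W : wd).

Definition er (c : code A) : option (A + bool) :=
  match c with Letter a => Some (inl a) | RedVar b => Some (inr b) | _ => None end.
(** Digits start at 1, so that the number 0 codes only the empty word. *)
Definition lcx (x : A + bool) : nat := (enum_rank x).+1.
(** The base [QQ] exceeds every digit, and as a power of two it allows division by repeated
    halving. *)
Definition s0 := #|A|.+3.
Definition QQ := 2 ^ s0.

Definition shrW W x := iter s0 (chalf W) x.
(** A reduced word is kept as a stack written in base [QQ] with its first letter as lowest digit;
    pushing a letter pops instead if the top is its inverse, which is [cons_red]. *)
Definition pushW W (x : A + bool) acc :=
  if acc - cmul W (shrW W acc) (cst W QQ) == cst W (lcx (barx bar x)) then shrW W acc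
  else cadd W (cst W (lcx x)) (cmul W acc (cst W QQ)).
Definition stepW W (o : option (code A)) acc :=
  foldr (fun x r => if obind er o == Some x then pushW W x acc else r) acc (enum {: A + bool}).
(** The segment is read from right to left because [reduce] is a right fold. *)
Definition piW W lo hi := iteri (hi - lo) (fun j acc => stepW W (cd (ww W) (hi.-1 - j)) acc) 0.
Definition cntW W b lo hi :=
  iteri hi (fun j acc => if (lo <= j) && (cd (ww W) j == Some (RedVar b)) then csucc W acc else acc) 0.
(** The inequality between two values of [delta], with the negative terms moved across so that only
    natural numbers occur. *)
Definition gtW W b s q p' q' :=
  cadd W (cntW W b p' q') (cntW W (~~ b) s q) < cadd W (cntW W b s q) (cntW W (~~ b) p' q').
(** Dominance with positions of the code in place of prefixes: the first clause is the case without
    a variable, the second runs over occurrences of variables with equal names. *)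
Definition domW W b s p e : bool :=
  all (fun q' => (p < q') ==> has (fun q => (s <= q) && gtW W b s q (csucc W p) q') (iota 0 (csucc W p))) (iota 0 (csucc W e)) &&
  all (fun q' => (p < q') && (cd (ww W) q' == Some IdemVar) ==>
     has (fun q => [&& s <= q, cd (ww W) q == Some IdemVar, sameW W q q' & gtW W b s q (csucc W p) q']) (iota 0 p)) (iota 0 e).
Definition suW W s p e : bool :=
  [&& eqnW W s p e, piW W s p != piW W (csucc W p) e &
    [|| cadd W (cntW W true s p) (cntW W false (csucc W p) e) != cadd W (cntW W true (csucc W p) e) (cntW W false s p),
        domW W true s p e | domW W false s p e]].
Definition existsSU W : bool :=
  has (fun s => has (fun p => has (suW W s p) (iota 0 (size (ww W)))) (iota 0 (size (ww W)))) (iota 0 (size (ww W))).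

(** The finite transition table is unrolled into comparisons with constants, one level for the state
    and one for its successor. *)
Definition dW1 W q0 (o : option (code A)) : nat :=
  foldr (fun v r => if oapp (@dstep A q0) 7 o == v then cst W v else r) (cst W 7) (iota 0 7).
Definition dW W q (o : option (code A)) : nat :=
  foldr (fun q0 r => if q == cst W q0 then dW1 W q0 o else r) (cst W 7) (iota 0 7).
Definition validW W : bool := iteri (size (ww W)) (fun j acc => dW W acc (cd (ww W) j)) 0 == 0.

Section Comp.
Variable k : nat.
Implicit Types (F G H : ctx k -> nat).

Lemma comp_shrW F : comp F -> comp (fun g => shrW (wof g) (F g)).
Proof. by move=> hF; rewrite /shrW; elim: s0 => [|s IH] //; exact: comp_chalf. Qed.

Lemma comp_pushW x F : comp F -> comp (fun g => pushW (wof g) x (F g)).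
Proof.
move=> hF; apply: comp_if.
- apply: compb_eqn; last exact: comp_cst.
  by apply: comp_sub => //; apply: comp_cmul; [exact: comp_shrW | exact: comp_cst].
- exact: comp_shrW.
- by apply: comp_cadd; [exact: comp_cst | apply: comp_cmul => //; exact: comp_cst].
Qed.

Lemma comp_stepW F G : comp F -> comp G -> comp (fun g => stepW (wof g) (cd (ww (wof g)) (F g)) (G g)).
Proof.
move=> hF hG; rewrite /stepW; elim: (enum _) => [|x s IH] //=.
apply: comp_if => //; first exact: (compb_inp (fun o => obind er o == Some x) hF).
exact: comp_pushW.
Qed.

Lemma comp_dW F G : comp F -> comp G -> comp (fun g => dW (wof g) (F g) (cd (ww (wof g)) (G g))).
Proof.
move=> hF hG; rewrite /dW; elim: (iota 0 7) => [|q s IH]; first exact: comp_cst.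
apply: comp_if => //; first by apply: compb_eqn => //; exact: comp_cst.
rewrite /dW1; elim: (iota 0 7) => [|v s' IH']; first exact: comp_cst.
apply: comp_if => //; first exact: (compb_inp (fun o => oapp (@dstep A q) 7 o == v) hG).
exact: comp_cst.
Qed.
End Comp.

Hint Resolve comp_var comp_v1 comp_v2 comp_v3 comp_v4 comp_len : core.

Lemma comp_piW k (F G : ctx k -> nat) : comp F -> comp G -> comp (fun g => piW (wof g) (F g) (G g)).
Proof.
move=> hF hG; apply: (comp_call2 (H := piW) _ hF hG).
apply: (comp_rec (k := 2) (Fs := fun g => stepW (wof g) (cd (ww (wof g)) (g.1.1.2.-1 - g.1.2)) g.2)).
- exact: comp_sub.
- exact: comp_zero.
- by apply: (comp_stepW (k := 4)) => //; apply: comp_sub => //; apply: comp_pred; exact: (comp_v2 _ 1).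
Qed.

Lemma comp_cntW b k (F G : ctx k -> nat) : comp F -> comp G -> comp (fun g => cntW (wof g) b (F g) (G g)).
Proof.
move=> hF hG; apply: (comp_call2 (H := fun W => cntW W b) _ hF hG).
apply: (comp_count (k := 2) (P := fun g j => (g.1.2 <= j) && (cd (ww (wof g)) j == Some (RedVar b)))); first exact: comp_var.
apply: compb_and; first by apply: compb_leq; [exact: (comp_v2 _ 0) | exact: comp_var].
exact: (compb_cdx (k := 3) _ (comp_var _ 2)).
Qed.

Lemma compb_gtW b k (F1 F2 F3 F4 : ctx k -> nat) : comp F1 -> comp F2 -> comp F3 -> comp F4 ->
  compb (fun g => gtW (wof g) b (F1 g) (F2 g) (F3 g) (F4 g)).
Proof. by move=> h1 h2 h3 h4; apply: compb_ltn; apply: comp_cadd; exact: comp_cntW. Qed.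

Lemma compb_domW b k (F1 F2 F3 : ctx k -> nat) : comp F1 -> comp F2 -> comp F3 ->
  compb (fun g => domW (wof g) b (F1 g) (F2 g) (F3 g)).
Proof.
move=> h1 h2 h3; apply: (comp_call3 (H := fun W s p e => nat_of_bool (domW W b s p e)) _ h1 h2 h3).
have v3 : comp (fun g : ctx 4 => g.1.1.1.2) := comp_v3 _ 0.
have v2 : comp (fun g : ctx 4 => g.1.1.2) := comp_v2 _ 1.
have w4 : comp (fun g : ctx 5 => g.1.1.1.1.2) := comp_v4 _ 0.
have w3 : comp (fun g : ctx 5 => g.1.1.1.2) := comp_v3 _ 1.
have w1 : comp (fun g : ctx 5 => g.1.2) := comp_v1 _ 3.
have w0 : comp (fun g : ctx 5 => g.2) := comp_var _ 4.
have ws := comp_csucc w3.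
have gt := compb_gtW b w4 w0 ws w1.
apply: compb_and.
  apply: (compb_all (k := 3) (P := fun g x => _)); first exact: (comp_csucc (k := 3) (comp_var _ 2)).
  apply: compb_imp; first exact: (compb_ltn v2 (comp_var _ 3)).
  apply: (compb_has (k := 4) (P := fun g x => _)); first exact: (comp_csucc v2).
  by apply: compb_and; [exact: (compb_leq w4 w0) | exact: gt].
apply: (compb_all (k := 3) (P := fun g x => _)); first exact: comp_var.
apply: compb_imp; first by apply: compb_and; [exact: (compb_ltn v2 (comp_var _ 3)) | exact: (compb_cdx (k := 4) _ (comp_var _ 3))].
apply: (compb_has (k := 4) (P := fun g x => _)); first exact: v2.
apply: compb_and; first exact: (compb_leq w4 w0).
apply: compb_and; first exact: (compb_cdx (k := 5) _ w0).
by apply: compb_and; [exact: (compb_sameW w0 w1) | exact: gt].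
Qed.

Lemma compb_suW : compb (fun g : ctx 3 => suW g.1.1.1 g.1.1.2 g.1.2 g.2).
Proof.
have v2 : comp (fun g : ctx 3 => g.1.1.2) := comp_v2 _ 0.
have v1 : comp (fun g : ctx 3 => g.1.2) := comp_v1 _ 1.
have v0 : comp (fun g : ctx 3 => g.2) := comp_var _ 2.
have vs := comp_csucc v1.
apply: compb_and; first exact: (compb_eqnW v2 v1 v0).
apply: compb_and; first by apply: compb_neg; exact: (compb_eqn (comp_piW v2 v1) (comp_piW vs v0)).
apply: compb_or; last by apply: compb_or; exact: (compb_domW _ v2 v1 v0).
apply: compb_neg; exact: (compb_eqn (comp_cadd (comp_cntW _ v2 v1) (comp_cntW _ vs v0)) (comp_cadd (comp_cntW _ vs v0) (comp_cntW _ v2 v1))).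
Qed.

Lemma compb_existsSU : compb (fun g : ctx 0 => existsSU g).
Proof.
apply: (compb_has (k := 0) (P := fun g x => _)); first exact: (comp_len _ 0).
apply: (compb_has (k := 1) (P := fun g x => _)); first exact: (comp_len _ 1).
apply: (compb_has (k := 2) (P := fun g x => _)); first exact: (comp_len _ 2).
exact: compb_suW.
Qed.

Lemma compb_validW : compb (fun g : ctx 0 => validW g).
Proof.
apply: compb_eq0; apply: (comp_rec (k := 0) (Fs := fun g => dW (wof g) g.2 (cd (ww (wof g)) g.1.2))).
- exact: (comp_len _ 0).
- exact: comp_zero.
- exact: (comp_dW (k := 2) (comp_var _ 1) (comp_v1 _ 0)).
Qed.

Section Spec.
Variable W : wd.
Let N := wN W.
Let w := ww W.
Let n := size w.
(** Room for a stack of [n] letters, one more multiplication by [QQ], sums of two counters, and the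
    small constants. *)
Hypothesis big : QQ ^ n.+2 + 2 * n + 10 <= N.

Lemma iter_half s x : iter s half x = x %/ 2 ^ s.
Proof. by elim: s => [|s IH]; rewrite ?divn1 // iterS IH -divn2 -divnMA expnSr. Qed.

Lemma shrE x : x <= N -> shrW W x = x %/ QQ.
Proof.
move=> hx; rewrite /shrW /QQ -iter_half; suff : iter s0 (chalf W) x = iter s0 half x /\ iter s0 half x <= N by case.
elim: s0 => //= s [-> h]; rewrite chalfE //; split=> //; apply: leq_trans h.
by rewrite -divn2 leq_div.
Qed.

Lemma lcx_lt x : lcx x < QQ.
Proof.
rewrite /lcx /QQ; apply: leq_ltn_trans (ltn_ord (enum_rank x)) _.
by rewrite card_sum card_bool; apply: leq_trans (ltn_expl _ (ltnSn 1)); rewrite /s0; lia.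
Qed.

Lemma lcx_inj : injective lcx.
Proof. by move=> x y [e]; apply: enum_rank_inj; apply: val_inj. Qed.

Definition encx (u : seq (A + bool)) := foldr (fun x m => lcx x + m * QQ) 0 u.

Lemma encx_lt u : encx u < QQ ^ size u.
Proof.
elim: u => //= x u IH; rewrite expnSr; have := lcx_lt x.
have : (encx u).+1 * QQ <= QQ ^ size u * QQ by rewrite leq_mul2r IH orbT.
by rewrite mulSn; lia.
Qed.

Lemma encx_inj : injective encx.
Proof.
elim=> [|x u IH] [|y v] //= e.
have h1 : x = y by apply: lcx_inj; have := congr1 (fun m => m %% QQ) e; rewrite addnC modnMDl [lcx y + _]addnC modnMDl !modn_small ?lcx_lt.
congr (_ :: _) => //; apply: IH; have Q0 : 0 < QQ by rewrite /QQ expn_gt0.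
have := congr1 (fun m => m %/ QQ) e; rewrite addnC divnMDl // [lcx y + _]addnC divnMDl //.
by rewrite !(divn_small (lcx_lt _)) !addn0.
Qed.

Lemma pushE x u : size u < n -> pushW W x (encx u) = encx (cons_red (barx bar) x u).
Proof.
move=> hu; have Q0 : 0 < QQ by rewrite /QQ expn_gt0.
have QQn : QQ <= QQ ^ n.+2 by rewrite expnS leq_pmulr // expn_gt0 Q0.
have hlx y : cst W (lcx y) = lcx y by apply: cstE; have := lcx_lt y; rewrite -/N; lia.
have hq : cst W QQ = QQ by apply: cstE; rewrite -/N; lia.
have hb : encx u * QQ + QQ <= QQ ^ n.+2.
  rewrite addnC -mulSn expnSr leq_mul2r; apply/orP; right; apply: leq_trans (encx_lt u) _.
  by rewrite leq_exp2l ?(leq_trans (ltnW hu)) // /QQ -[1]/(2 ^ 0) ltn_exp2l.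
have hle : encx u <= encx u * QQ by rewrite leq_pmulr.
rewrite /pushW hq !hlx shrE; last by rewrite -/N; lia.
have hdm : encx u %/ QQ * QQ <= encx u by rewrite leq_trunc_div.
rewrite !cmulE -/N; try lia; rewrite caddE -/N; last by have := lcx_lt x; lia.
case: u hu hb hle hdm => [|y u] hu hb hle hdm /=; first by [].
have -> : (lcx y + encx u * QQ) %/ QQ = encx u.
  by rewrite addnC divnMDl // divn_small ?lcx_lt // addn0.
by rewrite addnK (inj_eq lcx_inj); case: eqP.
Qed.

Lemma stepE o u : size u < n -> stepW W o (encx u) = encx (if obind er o is Some x then cons_red (barx bar) x u else u).
Proof.
move=> hu; rewrite /stepW; case eo: (obind er o) => [x|]; last by elim: (enum _) => //= y s ->.
have : x \in enum {: A + bool} by rewrite mem_enum.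
elim: (enum _) => //= y s IH; rewrite inE; case: (x =P y) => [->|ne] /=; first by rewrite eqxx => _; exact: pushE.
by case: (Some x =P Some y) => [[e]|_]; [case: (ne e) | exact: IH].
Qed.

Lemma piE lo hi : lo <= hi -> hi <= n -> piW W lo hi = encx (reduce (barx bar) (pmap er (take (hi - lo) (drop lo w)))).
Proof.
move=> h1 h2; rewrite /piW; move e: (hi - lo) => m.
have : m <= hi by lia.
have -> : lo = hi - m by lia.
elim: m {e} => [|m IH] hm; first by rewrite take0.
rewrite [iteri _ _ _]/= IH; last by lia.
have hlt : hi - m.+1 < size w by rewrite -/n; lia.
have [c ec ed] := cd_drop hlt; rewrite -/w.
have -> : hi.-1 - m = hi - m.+1 by lia.
rewrite ec ed; have -> : (hi - m.+1).+1 = hi - m by lia.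
rewrite stepE /=.
  by case: (er c).
apply: leq_ltn_trans (size_reduce _ _) _; rewrite size_pmap.
apply: leq_ltn_trans (count_size _ _) _; rewrite size_take_min; lia.
Qed.

Lemma cntE b lo hi : lo <= hi -> hi <= n -> cntW W b lo hi = count_mem (RedVar b) (take (hi - lo) (drop lo w)).
Proof.
move=> h1 h2; rewrite /cntW (count_iteri (W := W) (fun j => (lo <= j) && (cd w j == Some (RedVar b)))); last by rewrite -/N; lia.
rewrite -{1}(subnKC h1) iotaD count_cat add0n (_ : count _ (iota 0 lo) = 0) ?add0n; last first.
  by apply/eqP; rewrite -leqn0 leqNgt -has_count; apply/hasPn => j; rewrite mem_iota /= => hj; rewrite leqNgt hj.
have gen m l : lo <= l -> l + m <= size w ->
    count (fun j => (lo <= j) && (cd w j == Some (RedVar b))) (iota l m) = count_mem (RedVar b) (take m (drop l w)).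
  elim: m l => [|m IH] l hl hm; first by rewrite take0.
  have [|c ec ed] := @cd_drop _ w l; first by lia.
  have -> : drop l w = c :: drop l.+1 w by [].
  rewrite [iota _ _]/= [take _ _]/= [count _ (_ :: _)]/= [count _ (c :: _)]/= hl ec IH //; lia.
by apply: gen; rewrite -/n; lia.
Qed.

Lemma cnt_le b lo hi : hi <= n -> cntW W b lo hi <= n.
Proof.
move=> h; rewrite /cntW (count_iteri (W := W) (fun j => (lo <= j) && (cd w j == Some (RedVar b)))); last by rewrite -/N; lia.
by apply: leq_trans (count_size _ _) _; rewrite size_iota.
Qed.

Lemma sameE i i' : i < n -> i' < n -> sameW W i i' = (run (drop i.+1 w) == run (drop i'.+1 w)).
Proof.
move=> hi hi'; pose bcl (o : option (code A)) := if o is Some (Bit x) then Some x else None.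
have bclE (o o' : option (code A)) : (isb true o == isb true o') && (isb false o == isb false o') = (bcl o == bcl o').
  by case: o => [[a|b||[]||]|]; case: o' => [[a'|b'||[]||]|].
have bclN (o : option (code A)) : ~~ (isb true o || isb false o) = (bcl o == None).
  by case: o => [[a|b||[]||]|].
have cdD j m : cd w (j + m) = cd (drop j w) m.
  by rewrite /cd map_drop nth_drop.
have key (u v : seq (code A)) m : size u <= m -> (forall k, k <= m -> has (fun k' => bcl (cd u k') == None) (iota 0 k) \/ bcl (cd u k) = bcl (cd v k)) <-> run u = run v.
  elim: u v m => [|c u IH] v m hm.
    split=> [/(_ 0 isT)[]//|]; first by case: v => [|[]] //=.
    move=> e k hk; case: k hk => [|k] hk; last by left.
    by right; case: v e => [|[]] //=.
  case: m hm => // m hm.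
  have [[b ec]|ec] : (exists b, c = Bit b) \/ bcl (Some c) = None by case: (c) => [a|b||b||]; [right|right|right|left; exists b|right|right].
    rewrite ec /=; split.
      move=> h; have [//|e0] := h 0 isT; case: v e0 h => [|[a'|b'||b'||] v] //= [e0] h.
      congr (_ :: _) => //; apply/(IH v m) => // k hk; have [h1|h1] := h k.+1 hk; [left|by right].
      by move: h1; rewrite /= -[1]addn0 iotaDl has_map.
    case: v => [|[a'|b'||b'||] v] //= [-> /(IH v m hm) h] [|k] hk; first by right.
    by have [h1|h1] := h k hk; [left | by right]; rewrite /= -[1]addn0 iotaDl has_map.
  have ru : run (c :: u) = [::] by case: (c) ec.
  rewrite ru; split=> [h|e].
    have [//|e0] := h 0 isT; have : bcl (cd v 0) = None by rewrite -e0; exact: ec.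
      by case: (v) => [|[]].
  case=> [|k] hk; last by left; apply/hasP; exists 0; [rewrite mem_iota | apply/eqP; exact: ec].
  right; have -> : bcl (cd (c :: u) 0) = None by exact: ec.
  by case: v e => [|[]].
have csE j : j < n -> csucc W j = j.+1 by rewrite /csucc => hj; apply/minn_idPr; rewrite -/N; lia.
have csn : csucc W n = n.+1 by apply/minn_idPr; rewrite -/N; lia.
have hadd j m : j < n -> m <= n -> cadd W (csucc W j) m = j.+1 + m by move=> hj hm; rewrite csE // caddE // -/N; lia.
rewrite /sameW -/w -/n csn; apply/idP/eqP.
  move=> /all_iota0 h; apply/(key _ _ n); first by rewrite size_drop leq_subr.
  move=> k hk; have := h k hk; rewrite !hadd // !cdD bclE => /orP[|/eqP]; last by right.
  move=> hh; left; apply/hasP; case/hasP: hh => k'; rewrite mem_iota /= => hk'.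
  by rewrite hadd ?cdD ?bclN => [hb||]; [exists k'; rewrite ?mem_iota | | lia].
move/(key _ _ n) => h; have {}h := h ltac:(by rewrite size_drop leq_subr).
apply/all_iota0 => k hk; rewrite !hadd // !cdD bclE; apply/orP.
have [/hasP[k']|->] := h k hk; last by right.
rewrite mem_iota /= => hk' hb; left; apply/hasP; exists k'; rewrite ?mem_iota //.
by rewrite hadd ?cdD ?bclN //; lia.
Qed.

Lemma eqnWE s p e : eqnW W s p e = eqn w s p e.
Proof.
rewrite /eqnW /eqn -/w; do 3 congr (_ && _); case hsp: (s <= p) => //=; case hpe: (p < e) => //=.
congr (_ && _); apply/all_iota0/allP => h i.
- by rewrite mem_iota => hi; have /implyP := h i ltac:(lia); apply; lia.
- by move=> hi; apply/implyP => hs; apply: h; rewrite mem_iota; lia.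
- by rewrite mem_iota => hi; have /implyP := h i ltac:(lia); apply; lia.
- by move=> hi; apply/implyP => hs; apply: h; rewrite mem_iota; lia.
Qed.

Lemma validE : validW W = (foldl (@dstep A) 0 w == 0).
Proof.
have hc v : v <= 7 -> cst W v = v by move=> hv; apply: cstE; rewrite -/N; lia.
have dE q o : q <= 7 -> dW W q o = if q < 7 then oapp (dstep q) 7 o else 7.
  move=> hq; have hd q0 : oapp (@dstep A q0) 7 o <= 7.
    case: o => [c|] //=; case: c => [a|b||b||] /=; repeat case: ifP => // _.
  have hin q0 : dW1 W q0 o = oapp (@dstep A q0) 7 o.
    rewrite /dW1 /= !hc //; have := hd q0; move: (oapp _ _ _) => x.
    by do 8 (case: x => [|x] //).
  by rewrite /dW /= !hc // !hin; case: q hq => [|[|[|[|[|[|[|[|q]]]]]]]].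
suff h m : m <= n -> iteri m (fun j acc => dW W acc (cd w j)) 0 = foldl (@dstep A) 0 (take m w) /\ foldl (@dstep A) 0 (take m w) <= 7.
  by rewrite /validW -/w -/n (h n (leqnn n)).1 take_size.
elim: m => [|m IH] hm; first by rewrite take0.
have [e hle] := IH (ltnW hm); have [c ec ed] := cd_drop (hm : m < size w).
have et : take m.+1 w = rcons (take m w) c.
  by rewrite -[X in take m.+1 X](cat_take_drop m w) ed take_cat size_take_min (minn_idPl (ltnW hm)) ltnNge leqnSn /= subSnn /= take0 cats1.
rewrite [iteri _ _ _]/= e ec et -cats1 foldl_cat /= dE //.
move: (foldl _ _ _) hle => q hq; case: (ltnP q 7) => h7 /=.
  by split=> //; case: c {ec ed et} => [a|b||b||] /=; repeat case: ifP => // _.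
have -> : q = 7 by lia.
by case: c {ec ed et}.
Qed.
End Spec.
End Check.

End InputChecks.
Import InputChecks.

(** * Sizes of the numbers, and correctness of the tests *)

Module Correctness.
Import all_order all_algebra finmap.
Import Order.TTheory GRing.Theory Num.Theory.

Local Arguments cst : simpl never.

Lemma has_iota_ord (P : pred nat) m : has P (iota 0 m) = [exists y : 'I_m, P y].
Proof.
apply/hasP/existsP => [[y]|[y h]]; last by exists (y : nat); rewrite ?mem_iota //=.
by rewrite mem_iota /= => hy h; exists (Ordinal hy).
Qed.

Ltac forget_bodies :=
  repeat match goal with
  | x := #|?T0| |- _ => try (change #|T0| with x in * ); clearbody x
  | x := World ?N0 ?w0 _ |- _ => try (change (wN x) with N0 in * ); try (change (ww x) with w0 in * ); clearbody x
  | x := size ?w0 |- _ => try (change (size w0) with x in * ); clearbody x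
  | H : _ = _ ^ _ |- _ => clear H
  end.
Ltac slia := forget_bodies; lia.
Ltac snia := forget_bodies; nia.

Section Final.
Variables (A : finType) (bar : A -> A).
Hypotheses (barK : involutive bar) (bar_free : forall a : A, bar a <> a).
Let c := #|A|.

Section Numbers.
Variables (w : seq (code A)) (T : nat -> bool) (N M B : nat).
Let n := size w.
(** A state needs about [B * c + 3 * n.+1 * B] bits, which [B * n.+2 ^ (c + 5)] exceeds comfortably;
    hence the exponent [26 + c = 21 + (c + 5)]. *)
Hypotheses (BE : B = n.+2 ^ 21) (ME : M = n.+2 ^ (26 + c)) (NE : N = 2 ^ M).
Let W := World N w T.

Lemma powc k : k <= 7 -> c + k <= 2 ^ (c + 3).
Proof.
move=> hk; elim: c => [|m IH]; first by apply: leq_trans hk _.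
by rewrite addSn [m.+1 + 3]addSn expnS; slia.
Qed.

Lemma n2pow : 2 * (n.+2 * (c + 7)) <= n.+2 ^ (c + 5).
Proof.
have -> : c + 5 = (c + 3).+2 by slia.
rewrite !expnS leq_mul // leq_mul //; apply: leq_trans (powc (leqnn 7)) _.
by rewrite leq_exp2r ?addn3.
Qed.

Lemma ME_B : M = B * n.+2 ^ (c + 5).
Proof. by rewrite ME BE -expnD; congr (_ ^ _); slia. Qed.

Lemma B0 : 0 < B.
Proof. by rewrite BE expn_gt0. Qed.

Lemma M_bound : 2 * c + 14 + B * c + 3 * (n.+1 * B) <= M.
Proof.
rewrite ME_B; apply: (@leq_trans (B * (2 * (n.+2 * (c + 7))))); last by rewrite leq_mul2l n2pow orbT.
have -> : 3 * (n.+1 * B) = B * (3 * n.+1) by rewrite mulnA mulnC.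
have h : 2 * c + 14 <= B * (2 * c + 14) by rewrite leq_pmull // B0.
apply: (@leq_trans (B * (2 * c + 14) + B * c + B * (3 * n.+1))); first by slia.
rewrite -!mulnDr leq_mul2l; apply/orP; right.
rewrite -[n.+2]addn2 [(n + 2) * _]mulnDl; have : n * 7 <= n * (c + 7) by rewrite leq_mul2l leq_addl orbT.
by slia.
Qed.

Lemma MN : M < N.
Proof. by rewrite NE ltn_expl. Qed.

Lemma nB : n.+2 <= B.
Proof. by rewrite BE expnS leq_pmulr // expn_gt0. Qed.

Lemma BM : B + n + 20 <= M.
Proof.
have := M_bound; have := B0; have := nB; have -> : 3 * (n.+1 * B) = 3 * B + 3 * (n * B) by rewrite -mulnDr -[B + _]mulSn.
have : 2 ^ 21 <= B by rewrite BE leq_exp2r.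
have : 2 ^ 4 <= 2 ^ 21 by rewrite leq_exp2l.
by move: (2 ^ 21) => x; slia.
Qed.

Lemma big : QQ A ^ n.+2 + 2 * n + 10 <= N.
Proof.
have hx : c.+3 * n.+2 + (n + 4) <= M.
  rewrite ME_B; apply: leq_trans (leq_pmull _ B0); apply: leq_trans n2pow.
  by snia.
apply: (@leq_trans (2 ^ (c.+3 * n.+2 + (n + 4)))); last by rewrite NE leq_exp2l.
rewrite /QQ /s0 -/c -expnM expnD; set x := 2 ^ (c.+3 * n.+2).
have h1 : 2 <= x by rewrite /x -{1}(expn1 2) leq_exp2l // muln_gt0.
have h2 : 2 * n + 10 <= 2 ^ (n + 4).
  rewrite expnD; have := ltn_expl n (ltnSn 1); move: (2 ^ n) => z; rewrite !expnS expn0; slia.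
move: (2 ^ (n + 4)) h2 => y h2; clearbody x; clear -h1 h2; nia.
Qed.

Lemma bigW : QQ A ^ (size (ww W)).+2 + 2 * size (ww W) + 10 <= wN W.
Proof. exact: big. Qed.

Lemma csuccE x : x < N -> csucc W x = x.+1.
Proof. by rewrite /csucc => h; apply/minn_idPr. Qed.

Lemma BWE : BW W = B.
Proof.
have h1 := BM; have h2 := MN.
rewrite /BW -[size (ww W)]/n !csuccE; try slia.
by rewrite BE; apply: cpowE => /=; rewrite -?BE; slia.
Qed.

Lemma posWE i j : i <= n -> j < B -> posW W i j = i * B + j /\ i * B + j < n.+1 * B.
Proof.
move=> hi hj; have h : i * B + j < n.+1 * B by rewrite -ltn_divLR ?B0 // divnMDl ?B0 // divn_small // addn0.
have h1 := M_bound; have h2 := MN; split=> //.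
by rewrite /posW BWE cmulE ?caddE //=; slia.
Qed.

Lemma rk_lt (a : A) : rk a < c.
Proof. exact: ltn_ord. Qed.

Lemma rhoWE y : y < N -> rhoW W y = odd y.
Proof. by move=> hy; rewrite /rhoW cbitE //= ?cstE //=; slia. Qed.

Lemma XWE y a : y < N -> XW W y a = odd (iter (rk a).+1 half y).
Proof.
move=> hy; have h1 := M_bound; have h2 := MN; have h3 := rk_lt a.
by rewrite /XW cstE ?cbitE //=; slia.
Qed.

Lemma RWE y j a : y < N -> j < B -> RW W y j a = odd (iter (1 + c + rk a + j * c) half y).
Proof.
move=> hy hj; have h1 := M_bound; have h2 := MN; have h3 := rk_lt a.
have h4 : j * c <= B * c by rewrite leq_mul2r (ltnW hj) orbT.
by rewrite /RW -/c cstE ?(cstE (c := c)) ?cmulE ?caddE ?cbitE //=; slia.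
Qed.

Lemma LtWE y t q : y < N -> t <= n.+1 * B -> q < 3 -> LtW W y t q = odd (iter (1 + c + q + (B * c + t * 3)) half y).
Proof.
move=> hy ht hq; have h1 := M_bound; have h2 := MN.
by rewrite /LtW /LiW BWE -/c !cstE ?cmulE ?caddE ?cbitE //=; slia.
Qed.

(** The bit layout read backwards: comparison with the section borders, then division with
    remainder, recovers from a bit index which label it stores. *)
Lemma mkW (rho0 : bool) (X0 : A -> bool) (R0 : nat -> A -> bool) (L0 : nat -> nat -> bool) :
  exists2 y : 'I_N, rhoW W y = rho0 & [/\ forall a, XW W y a = X0 a, forall j a, j < B -> RW W y j a = R0 j a
    & forall t q, t <= n.+1 * B -> q < 3 -> LtW W y t q = L0 t q].
Proof.
pose base := 1 + c + B * c.
pose f i := if i == 0 then rho0 else if i < c.+1 then [exists a, (rk a == i.-1) && X0 a]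
  else if i < base then [exists a, (rk a == (i - c.+1) %% c) && R0 ((i - c.+1) %/ c) a]
  else L0 ((i - base) %/ 3) ((i - base) %% 3).
have h1 := M_bound.
have hy : mkn M f < N by rewrite NE; exact: mkn_lt.
have exrk (P : A -> bool) a : [exists a', (rk a' == rk a) && P a'] = P a.
  apply/existsP/idP => [[a' /andP[/eqP e]]|h]; last by exists a; rewrite eqxx.
  by have -> : a' = a by apply: enum_rank_inj; apply: val_inj.
exists (Ordinal hy); first by rewrite (_ : rhoW W (Ordinal hy) = odd (mkn M f)); [exact: (@mkn_bit M f 0 ltac:(slia)) | exact: rhoWE].
split=> [a|j a hj|t q ht hq].
- have h3 := rk_lt a; have -> : XW W (Ordinal hy) a = odd (iter (rk a).+1 half (mkn M f)) by exact: XWE.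
  rewrite mkn_bit; last by slia.
  by rewrite /f /= ltnS h3 exrk.
- have h3 := rk_lt a; have h4 : j.+1 * c <= B * c by rewrite leq_mul2r hj orbT.
  rewrite mulSn in h4; have -> : RW W (Ordinal hy) j a = odd (iter (1 + c + rk a + j * c) half (mkn M f)) by exact: RWE.
  rewrite mkn_bit; last by slia.
  rewrite /f; have -> : (1 + c + rk a + j * c == 0) = false by [].
  have -> : (1 + c + rk a + j * c < c.+1) = false by slia.
  have -> : 1 + c + rk a + j * c < base by rewrite /base; slia.
  have -> : 1 + c + rk a + j * c - c.+1 = j * c + rk a by slia.
  by rewrite modnMDl divnMDl ?modn_small ?divn_small // ?addn0 ?exrk //; slia.
- have -> : LtW W (Ordinal hy) t q = odd (iter (1 + c + q + (B * c + t * 3)) half (mkn M f)) by exact: LtWE.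
  rewrite mkn_bit; last by slia.
  rewrite /f; have -> : (1 + c + q + (B * c + t * 3) == 0) = false by [].
  have -> : (1 + c + q + (B * c + t * 3) < c.+1) = false by slia.
  have -> : (1 + c + q + (B * c + t * 3) < base) = false by rewrite /base; slia.
  have -> : 1 + c + q + (B * c + t * 3) - base = t * 3 + q by rewrite /base; slia.
  by rewrite modnMDl divnMDl // modn_small // divn_small // addn0.
Qed.

Lemma hscW i : i <= n \/ i < B -> csucc W i = i.+1.
Proof. by have h1 := BM; have h2 := MN => h; apply: csuccE; slia. Qed.

Lemma hLW y i j q : y < N -> i <= n -> j < B -> q < 3 -> LW W y i j q = LtW W y (i * B + j) q.
Proof. by move=> hy hi hj hq; rewrite /LW (posWE hi hj).1. Qed.

Lemma hLnW y i j q : y < N -> i <= n -> j < B -> q < 3 -> LnW W y i j q = LtW W y (i * B + j).+1 q.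
Proof.
move=> hy hi hj hq; have [e h] := posWE hi hj; have h1 := M_bound; have h2 := MN.
by rewrite /LnW e csuccE //; slia.
Qed.

Lemma condWE (y : nat) : condW bar W y =
  gnode bar w n B (csucc W) (rhoW W) (RW W) (LW W) (LnW W) (sameW W) (eqnW W) y &&
  (gzero n B (csucc W) (rhoW W) (LW W) y || [forall b, XW W y b || [exists y' : 'I_N, T y' &&
     gedge bar w n B (csucc W) (rhoW W) (XW W) (RW W) (LW W) (LnW W) b y y']]).
Proof.
rewrite /condW BWE; congr (_ && (_ || _)); apply: eq_forallb => b; congr (_ || _).
rewrite -[wN W]/N has_iota_ord; apply: eq_existsb => y'.
by rewrite (ltnW (ltn_ord y')).
Qed.

Lemma rootWE : rootW W = [exists y : 'I_N, T y && (rhoW W y && [forall a, ~~ XW W y a])].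
Proof.
rewrite /rootW -[wN W]/N has_iota_ord; apply: eq_existsb => y'.
by rewrite (ltnW (ltn_ord y')).
Qed.
End Numbers.

Section Unbalanced.
Variables (S : seq (equation A nat)) (T : nat -> bool) (N : nat).
Let w := encode S.
Let n := size w.
Let W := World N w T.
Hypothesis hbig : QQ A ^ n.+2 + 2 * n + 10 <= N.
Variables (s p e : nat) (U V : seq (symb A nat)) (r1 r2 : seq (code A)).
Hypotheses (he : eqn w s p e) (dU : drop s w = encode_word U ++ EqSign :: r1)
  (dV : drop p.+1 w = encode_word V ++ EqEnd :: r2)
  (tU : take (p - s) (drop s w) = encode_word U) (tV : take (e - p.+1) (drop p.+1 w) = encode_word V).
Notation ew := (@encode_word A).

Lemma hbigW : QQ A ^ (size (ww W)).+2 + 2 * size (ww W) + 10 <= wN W.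
Proof. exact: hbig. Qed.

Lemma positions : [/\ s <= p, p < e, e < n, size (ew U) = p - s & size (ew V) = e - p.+1].
Proof.
have [_ _ /eqP h0 h2 /and3P[h3 _ _]] := and5P he; have h1 := cd_lt h0; split=> //.
  by rewrite -tU size_takel // size_drop; exact: leq_sub2r (ltnW (ltn_trans h3 h1)).
by rewrite -tV size_takel // size_drop; exact: leq_sub2r (ltnW h1).
Qed.

Lemma cntU b q : s <= q <= p -> cntW W b s q = count_mem (RedVar b) (take (q - s) (ew U)).
Proof.
move=> /andP[h1 h2]; have [a1 a2 a3 _ _] := positions.
by rewrite (cntE (hbigW)) //=; [rewrite -tU take_takel //; slia | rewrite -/n; slia].
Qed.

Lemma cntV b q : p < q <= e -> cntW W b p.+1 q = count_mem (RedVar b) (take (q - p.+1) (ew V)).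
Proof.
move=> /andP[h1 h2]; have [a1 a2 a3 _ _] := positions.
by rewrite (cntE (hbigW)) //=; [rewrite -tV take_takel //; slia | rewrite -/n; slia].
Qed.

Lemma scp : csucc W p = p.+1 /\ csucc W e = e.+1.
Proof.
have [a1 a2 a3 _ _] := positions; have h := hbig.
by split; rewrite /csucc; apply/minn_idPr => /=; rewrite -/N; slia.
Qed.

Lemma cnt_sum b b' lo hi lo' hi' : hi <= n -> hi' <= n ->
  cadd W (cntW W b lo hi) (cntW W b' lo' hi') = cntW W b lo hi + cntW W b' lo' hi'.
Proof.
move=> h1 h2; apply: caddE => /=; have := hbig.
by have := cnt_le (hbigW) b lo h1; have := cnt_le (hbigW) b' lo' h2; rewrite -/n -/W; slia.
Qed.

Lemma gtP b q q' U' V' : s <= q <= p -> p < q' <= e ->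
  (forall x, count_mem (RedVar x) (take (q - s) (ew U)) = count_mem (rvar A nat x) U') ->
  (forall x, count_mem (RedVar x) (take (q' - p.+1) (ew V)) = count_mem (rvar A nat x) V') ->
  gtW W b s q p.+1 q' <-> (delta b V' < delta b U')%R.
Proof.
move=> h1 h2 hU hV; have [a1 a2 a3 _ _] := positions; rewrite /gtW !cnt_sum; try slia.
rewrite !cntU // !cntV // !hU !hV /delta.
by move: (count_mem _ U') (count_mem _ U') (count_mem _ V') (count_mem _ V') => x1 x2 y1 y2; split; slia.
Qed.

Lemma cdwU k : k < size (ew U) -> cd w (s + k) = cd (ew U) k.
Proof. by move=> h; rewrite -{1}(addn0 k) /cd -nth_drop -map_drop dU map_cat nth_cat size_map addn0 h. Qed.

Lemma cdwV k : k < size (ew V) -> cd w (p.+1 + k) = cd (ew V) k.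
Proof. by move=> h; rewrite -{1}(addn0 k) /cd -nth_drop -map_drop dV map_cat nth_cat size_map addn0 h. Qed.

Lemma runU U' Z : prefix (U' ++ [:: idem A Z]) U -> run (drop (s + size (ew U')).+1 w) = nat_bits Z.
Proof.
move=> h; have [_ _ _ <-] := @pos_of_prefix A U' U Z (EqSign :: r1) isT h.
by rewrite -dU drop_drop addSn addnC.
Qed.

Lemma runV V' Z : prefix (V' ++ [:: idem A Z]) V -> run (drop (p.+1 + size (ew V')).+1 w) = nat_bits Z.
Proof.
move=> h; have [_ _ _ <-] := @pos_of_prefix A V' V Z (EqEnd :: r2) isT h.
by rewrite -dV drop_drop; congr (run (drop _ _)); lia.
Qed.

(** Positions and prefixes give the same inequalities by [prefix_of_pos]. A variable is found at the
    position of its marker [IdemVar], and injectivity of [nat_bits] turns equal names into equal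
    variables. *)
Lemma domP b : domW W b s p e <-> delta_dominates b U V.
Proof.
have [a1 a2 a3 sU sV] := positions; have [cp ce] := scp; rewrite /domW cp ce.
split.
  case/andP => /all_iota0 h1 /all_iota0 h2 [Z|] V' hpre /=.
    have [k1 k2 k3 _] := @pos_of_prefix A V' V Z (EqEnd :: r2) isT hpre.
    set k := size _ in k1 k2 k3.
    have /implyP := h2 (p.+1 + k) ltac:(slia); rewrite -/w cdwV // k2 eqxx andbT => /(_ ltac:(slia))/hasP[q].
    rewrite mem_iota => hq /and4P[hsq /eqP hcd hsame hgt].
    have hqU : q - s < size (ew U) by slia.
    have [U' [Z2 [hpU eq]]] : exists U' Z2, prefix (U' ++ [:: idem A Z2]) U /\ q - s = size (ew U').
      by apply: idem_of_pos; rewrite -cdwU // subnKC.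
    have [k1' k2' k3' _] := @pos_of_prefix A U' U Z2 (EqSign :: r1) isT hpU.
    have eZ : Z2 = Z.
      move: hsame; rewrite (sameE (hbigW)) //=; try (rewrite -/n; slia).
      rewrite (runV hpre) (_ : q = s + size (ew U')) ?(runU hpU); last by slia.
      by move/eqP/nat_bits_inj.
    exists U'; first by rewrite -eZ.
    apply/(@gtP b q (p.+1 + k)) => //; try slia.
      by move=> x; rewrite eq k3' count_word.
    by move=> x; rewrite addKn k3 count_word.
  rewrite cats0 in hpre; have [k1 k3] := pos_of_prefix0 hpre; set k := size _ in k1 k3.
  have /implyP := h1 (p.+1 + k) ltac:(slia); move=> /(_ ltac:(slia))/hasP[q].
  rewrite mem_iota => hq /andP[hsq hgt].
  have [U' hpU hc] := prefix_of_pos U (q - s).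
  exists U'; first by rewrite cats0.
  apply/(@gtP b q (p.+1 + k)) => //; try slia.
  by move=> x; rewrite addKn k3 count_word.
move=> hdom; apply/andP; split; apply/all_iota0 => q' hq'; apply/implyP.
  move=> hpq; have [V' hpV hc] := prefix_of_pos V (q' - p.+1).
  have [|U' hpU hlt] := hdom None V'; first by rewrite cats0.
  rewrite cats0 in hpU; have [k1 k3] := pos_of_prefix0 hpU.
  apply/hasP; exists (s + size (ew U')); first by rewrite mem_iota; slia.
  rewrite leq_addr; apply/(@gtP b _ q' U' V') => //; try slia.
  by move=> x; rewrite addKn k3 count_word.
case/andP => hpq /eqP hcd.
have [V' [Z [hpV eq]]] : exists V' Z, prefix (V' ++ [:: idem A Z]) V /\ q' - p.+1 = size (ew V').
  by apply: idem_of_pos; rewrite -cdwV ?subnKC //; slia.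
have [k1' k2' k3' _] := @pos_of_prefix A V' V Z (EqEnd :: r2) isT hpV.
have [U' hpU hlt] := hdom (Some Z) V' hpV.
have [k1 k2 k3 _] := @pos_of_prefix A U' U Z (EqSign :: r1) isT hpU.
apply/hasP; exists (s + size (ew U')); first by rewrite mem_iota; slia.
rewrite leq_addr -[ww W]/w cdwU // k2 eqxx !andTb; apply/andP; split.
  rewrite (sameE (hbigW)) //=; try (rewrite -/n; slia).
  by rewrite (runU hpU) (_ : q' = p.+1 + size (ew V')) ?(runV hpV) //; slia.
apply/(@gtP b _ q' U' V') => //; try slia.
  by move=> x; rewrite addKn k3 count_word.
by move=> x; rewrite eq k3' count_word.
Qed.

Lemma pmap_er X : pmap (@er A) (ew X) = pmap (@erase_idem A nat) X.
Proof.
elim: X => [|x X IH] //; rewrite encode_word_cons pmap_cat IH.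
by case: x => [a|[i|b]] //=; elim: (nat_bits i).
Qed.

Lemma suP : suW bar W s p e <-> strongly_unbalanced bar (U, V).
Proof.
have [a1 a2 a3 sU sV] := positions; have [cp ce] := scp.
rewrite /suW cp (eqnWE hbigW) he andTb.
rewrite !(piE bar hbigW); try (rewrite /= -/n; slia).
rewrite -[ww W]/w.
have hinj x y : (encx x == encx y) = (x == y :> seq (A + bool)).
  by apply/eqP/eqP => [h|->] //; exact: (encx_inj hbigW h).
rewrite tU tV !pmap_er hinj -/(pi_A_Gamma bar U) -/(pi_A_Gamma bar V).
have hU x : cntW W x s p = count_mem (rvar A nat x) U.
  by rewrite cntU ?a1 ?leqnn // -sU take_size count_word.
have hV x : cntW W x p.+1 e = count_mem (rvar A nat x) V.
  by rewrite cntV ?a2 ?leqnn // -sV take_size count_word.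
rewrite !cnt_sum ?hU ?hV; try (rewrite -/n; slia).
have hd : (count_mem (rvar A nat true) U + count_mem (rvar A nat false) V != count_mem (rvar A nat true) V + count_mem (rvar A nat false) U)
    <-> delta true U <> delta true V.
  rewrite /delta /=; move: (count_mem _ U) (count_mem _ U) (count_mem _ V) (count_mem _ V) => x1 x2 y1 y2.
  by split=> [/eqP h h'|h]; [slia | apply/eqP => h'; apply: h; slia].
split.
  case/andP => /eqP h1 /or3P h2; split=> //; case: h2 => [/hd|/domP|/domP] h2; [exact: Or31 | exact: Or32 | exact: Or33].
case=> /eqP -> /= h2; apply/or3P; case: h2 => [/hd|/domP|/domP] h2; [exact: Or31 | exact: Or32 | exact: Or33].
Qed.
End Unbalanced.
End Final.

End Correctness.
Import Correctness.

(** * The decision procedure *)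

Module Decision.
Import all_order all_algebra finmap FunctionalExtensionality.

Lemma dexptime_ext (I : finType) (L L' : seq I -> Prop) :
  (forall w, L w <-> L' w) -> dexptime L -> dexptime L'.
Proof.
move=> h [M [c [d hM]]]; exists M, c, d => w; have [b hb e] := hM w.
by exists b => //; split=> [/e/h|/h/e].
Qed.

Lemma xbound_le m n : m <= n -> xbound m <= n.+2 ^ 21.
Proof.
move=> h; rewrite /xbound mulnA.
apply: (@leq_trans (n.+2 ^ (10 + 7) * n.+2 ^ 4)); last by rewrite -expnD; exact: leqnn.
apply: leq_mul; last by rewrite leq_exp2r //; lia.
apply: (@leq_trans (2 ^ 10 * 2 ^ 7)); first exact: leq_mul.
by rewrite -expnD leq_exp2r.
Qed.

Lemma size_encode_word (A : finType) U : size U <= size (@encode_word A U).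
Proof.
elim: U => [|x U IH] //; rewrite encode_word_cons size_cat.
by case: x => [a|[i|b]] /=; lia.
Qed.

Section Decision.
Variables (A : finType) (bar : A -> A).
Hypotheses (barK : involutive bar) (bar_free : forall a : A, bar a <> a).
Local Notation T0 := (fun _ : nat => false).

(** The table enters [condW] only in the search for successors; all other parts can be evaluated
    with the empty table, as the fixpoint argument requires. *)
Lemma condW_world w N M B (BE : B = (size w).+2 ^ 21) (ME : M = (size w).+2 ^ (26 + #|A|)) (NE : N = 2 ^ M)
    T (y : 'I_N) : let W := World N w T0 in condW bar (World N w T) y =
  gnode bar w (size w) B (csucc W) (rhoW W) (RW W) (LW W) (LnW W) (sameW W) (eqnW W) y &&
  (gzero (size w) B (csucc W) (rhoW W) (LW W) y || [forall b, XW W y b || [exists y' : 'I_N, T y' &&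
     gedge bar w (size w) B (csucc W) (rhoW W) (XW W) (RW W) (LW W) (LnW W) b y y']]).
Proof.
move=> W; rewrite (condWE bar T BE ME NE).
have -> : csucc (World N w T) = csucc W by [].
have -> : rhoW (World N w T) = rhoW W by [].
have -> : XW (World N w T) = XW W by [].
have -> : RW (World N w T) = RW W by [].
have -> : sameW (World N w T) = sameW W by [].
have -> : eqnW (World N w T) = eqnW W by [].
have eL : LW (World N w T) = LW W.
  do 4 (apply: functional_extensionality => ?).
  by rewrite /LW /posW /LtW /LiW !(BWE _ BE ME NE).
have -> : LnW (World N w T) = LnW W.
  do 4 (apply: functional_extensionality => ?).
  by rewrite /LnW /posW /LtW /LiW !(BWE _ BE ME NE).
by rewrite eL.
Qed.

Definition accept (W : wd (code A)) := [&& validW W, existsSU bar W & rootW W].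

(** The length bound enters in the direction from a solution to acceptance, where the value of [x]
    has to fit into [B] slots. *)
Lemma acceptP w N M B (BE : B = (size w).+2 ^ 21) (ME : M = (size w).+2 ^ (26 + #|A|)) (NE : N = 2 ^ M) :
  accept (World N w (final (condW bar) N w)) <->
  exists S : seq (equation A nat), [/\ w = encode S,
    exists2 E : equation A nat, E \in S & strongly_unbalanced bar E & solvable bar S].
Proof.
have hbig := big BE ME NE.
have hbigW T : QQ A ^ (size (ww (World N w T))).+2 + 2 * size (ww (World N w T)) + 10 <= wN (World N w T) by exact: hbig.
have hcond := condW_world BE ME NE.
have finE (y : 'I_N) : final (condW bar) N w y = (y \in fixset (stepF (condW bar) w)).
  apply: final_fix => T T' y' hT; rewrite !hcond => /andP[-> /orP[->|/forallP h]] //=; apply/orP; right.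
  apply/forallP => b; case/orP: (h b) => [->//|/existsP[z /andP[h1 h2]]]; apply/orP; right.
  by apply/existsP; exists z; rewrite hT.
have h0 := @B0 A w B BE.
have h1 := @hscW A w T0 N M B BE ME NE.
have h2 := @hLW A w T0 N M B BE ME NE.
have h3 := @hLnW A w T0 N M B BE ME NE.
have h4 := sameE (hbigW T0).
have h5 s p e := fun (_ : s < size w) (_ : p < size w) (_ : e < size w) => eqnWE (hbigW T0) s p e.
have h6 := @mkW A w T0 N M B BE ME NE.
have hvalid : validW (World N w (final (condW bar) N w)) = (foldl (@dstep A) 0 w == 0) by exact: (validE (hbigW _)).
have hroot : rootW (World N w (final (condW bar) N w)) = [exists y : 'I_N, final (condW bar) N w y &&
  (rhoW (World N w T0) y && [forall a, ~~ XW (World N w T0) y a])] by exact: rootWE.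
have heqn s p e : eqnW (World N w (final (condW bar) N w)) s p e = eqn w s p e by exact: (eqnWE (hbigW _)).
rewrite /accept hvalid hroot; have BE' := BE; clear hvalid hroot BE ME NE.
split.
  case/and3P => /eqP/dfaP[S eS] hex /existsP[y /and3P[hT hrho /forallP hX]].
  rewrite finE in hT; subst w; exists S; split=> //.
    case/hasP: hex => s hs /hasP[p hp /hasP[e he hsu]].
    have heq : eqn (encode S) s p e by rewrite -heqn; case/andP: hsu.
    have [U [V [r1 [r2 [hin dU dV tU tV]]]]] := eqn_sound heq.
    have hsuP : suW bar (World N (encode S) (final (condW bar) N (encode S))) s p e <-> strongly_unbalanced bar (U, V).
      by eapply suP; eassumption.
    by exists (U, V) => //; apply/hsuP.
  exact: (solution_of_fix barK h0 h1 h2 h3 h4 h5 hcond hT hrho hX).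
case=> S [eS [[U V] hin hsu] [sigma hsol]]; subst w.
have [S1 [S2 eS]] : exists S1 S2, S = S1 ++ (U, V) :: S2 by case/splitPr: (hin) => S1 S2; exists S1, S2.
have [heq he dU dV] := eqn_complete S1 U V S2; rewrite -eS in heq he dU dV.
set s := size (encode S1) in heq he dU dV; set p := s + size (encode_word U) in heq he dU dV.
set e := p.+1 + size (encode_word V) in heq he.
have tU : take (p - s) (drop s (encode S)) = encode_word U by rewrite dU /p addKn take_size_cat.
have tV : take (e - p.+1) (drop p.+1 (encode S)) = encode_word V by rewrite dV /e addKn take_size_cat.
have hs : s <= p by rewrite /p leq_addr.
have hp : p < e by rewrite /e leq_addr.
apply/and3P; split.
- by apply/eqP/dfaP; exists S.
- apply/hasP; exists s; first by rewrite mem_iota leq0n add0n; exact: (leq_ltn_trans hs (ltn_trans hp he)).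
  apply/hasP; exists p; first by rewrite mem_iota leq0n add0n; exact: (ltn_trans hp he).
  apply/hasP; exists e; first by rewrite mem_iota leq0n add0n; exact: he.
  have hsuP : suW bar (World N (encode S) (final (condW bar) N (encode S))) s p e <-> strongly_unbalanced bar (U, V).
    by eapply suP; eassumption.
  by apply/hsuP.
have hsize : size (sigma (inr true)) <= B.
  have [sb si sr _] := hsol; rewrite BE'.
  apply: leq_trans (solution_bound barK bar_free sb _ sr hsol hin hsu) _.
    by move=> Z; exact: (idem_reduce barK (si Z)).
  apply: xbound_le; have hU := size_encode_word (A := A) U; have hV := size_encode_word (A := A) V.
  apply: leq_trans (ltnW he); rewrite /e /p; apply: (leq_trans (leq_add hU hV)).
  by rewrite leq_add2r -addSn; apply: leq_trans (leq_addl s.+1 _) _; rewrite addSn.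
have [y hy hr] := fix_of_solution barK h0 h1 h2 h3 h4 h5 h6 hcond hsol hsize.
by apply/existsP; exists y; rewrite finE hy.
Qed.
End Decision.

End Decision.
Import Decision.

Theorem theorem6p8 (A : finType) (bar : A -> A)
    (barK : involutive bar) (bar_free : forall a : A, bar a <> a) :
  dexptime (fun w : seq (code A) =>
    exists S : seq (equation A nat),
      [/\ w = encode S,
          exists2 E : equation A nat, E \in S & strongly_unbalanced bar E
        & solvable bar S]).
Proof.
(* The three [erefl] fix [B], [M] and [N] as functions of the input size; the exponent [26 + #|A|]
   becomes the degree [d], constant because the alphabet is fixed. *)
apply: dexptime_ext (fun w => acceptP barK bar_free (w := w) (erefl _) (erefl _) (erefl _)) _.
apply: (dexptime_of_comp (cond := condW bar) (acc := @accept A bar)) => //.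
  exact: compb_condW.
apply: compb_and; first exact: compb_validW.
by apply: compb_and; [exact: compb_existsSU | exact: compb_rootW].
Qed.
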